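(* Let $m>0$. There exists $\beta_*>0$ such that for every $\beta$ with $2-\beta_*<\beta<2$ there exist a locally unique wave speed $c=c(\beta)$ and a locally unique (up to translation in $\xi$) homoclinic solution $q^*_\beta:\mathbb{R}\to\mathbb{R}$ of the forward-backward delay equation $$0=-c\,Q'(\xi)+2Q(\xi-1)Q(\xi+1)-Q(\xi)\big(Q(\xi-2)+Q(\xi+2)\big)+\beta\big(Q(\xi+1)^2-Q(\xi)^2\big),\qquad \xi\in\mathbb{R},$$ with $\lim_{|\xi|\to\infty}q^*_\beta(\xi)=m$, and therefore a (locally) unique traveling-wave spike solution $P_n(t)=q^*_\beta(n+c(\beta)t)$, $n\in\mathbb{Z}$, of the lattice equation $$\frac{dP_n}{dt}=2P_{n+1}P_{n-1}-P_n(P_{n+2}+P_{n-2})+\beta(P_{n+1}^2-P_n^2),\qquad n\in\mathbb{Z}.$$ Furthermore, as $\beta\nearrow 2$ (for a suitable choice of translate), $$q^*_\beta(\xi)=m\left(1+\frac{7(2-\beta)}{10}\operatorname{sech}^2\!\left(\sqrt{\frac{7(2-\beta)}{20}}\,\xi\right)\right)+\mathcal{O}\big((2-\beta)^{3/2}\big)$$ uniformly in $\xi\in\mathbb{R}$, and $$c(\beta)=m\left(4-\frac{16}{15}(2-\beta)\right)+\mathcal{O}\big((2-\beta)^{3/2}\big).$$ In particular, $q^*_\beta(\xi)>m$ for all $\xi\in\mathbb{R}$, and $c(\beta)>2m\beta$.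
   Context: A homoclinic solution is a nonconstant solution with the same limit $m$ as $\xi\to+\infty$ and $\xi\to-\infty$. ''Locally unique'' means that the pair $(q^*_\beta,c(\beta))$ is isolated modulo translation: there is a neighborhood of $(q^*_\beta-m,c(\beta))$ in $H^2(\mathbb{R})\times\mathbb{R}$ such that any pair $(Q-m,c)$ in it for which $Q$ solves the delay equation with speed $c$ and $Q(\xi)\to m$ as $|\xi|\to\infty$ satisfies $c=c(\beta)$ and $Q=q^*_\beta(\cdot+\tau)$ for some $\tau\in\mathbb{R}$. *)

(* Defs.v *)
From HB Require Import structures.
From mathcomp Require Import all_boot all_order all_algebra.
From mathcomp Require Import all_classical all_reals all_analysis.

Set Implicit Arguments.
Unset Strict Implicit.
Unset Printing Implicit Defensive.

Import Order.TTheory GRing.Theory Num.Theory.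
Import numFieldNormedType.Exports.

Local Open Scope classical_set_scope.
Local Open Scope ring_scope.

Definition sech (R : realType) (x : R) : R := 2 / (expR x + expR (- x)).

Definition test_function (R : realType) (phi : R -> R) : Prop :=
  (forall (k : nat) (x : R), derivable (derive1n k phi) x 1) /\
  compact (closure [set x | phi x != 0]).

(** Only used for [u] and [v] in L^2, where both integrals converge. *)
Definition weak_derivative (R : realType) (u v : R -> R) : Prop :=
  forall phi : R -> R, test_function phi ->
    \int[lebesgue_measure]_x (u x * derive1 phi x) =
    - \int[lebesgue_measure]_x (v x * phi x).

Definition L2 (R : realType) (u : R -> R) : Prop :=
  u \in Lfun lebesgue_measure 2%:E.

Definition L2norm (R : realType) (u : R -> R) : R :=
  fine ('N[lebesgue_measure]_2%:E[EFin \o u])%E.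

(** [u] belongs to H^2(R), with weak derivatives [u1] and [u2] of orders 1
    and 2; these are determined by [u] up to a null set. *)
Definition H2_jet (R : realType) (u u1 u2 : R -> R) : Prop :=
  [/\ L2 u, L2 u1, L2 u2, weak_derivative u u1 & weak_derivative u1 u2].

Definition H2 (R : realType) (u : R -> R) : Prop :=
  exists u1 u2, H2_jet u u1 u2.

Definition H2_ball (R : realType) (u : R -> R) (delta : R) (v : R -> R) : Prop :=
  exists w1 w2, H2_jet (v \- u) w1 w2 /\
    Num.sqrt (L2norm (v \- u) ^+ 2 + L2norm w1 ^+ 2 + L2norm w2 ^+ 2) < delta.

Definition delay_solution (R : realType) (beta : R) (Q : R -> R) (c : R) : Prop :=
  (forall xi, derivable Q xi 1) /\
  forall xi,
    0 = - c * derive1 Q xi + 2 * Q (xi - 1) * Q (xi + 1)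
        - Q xi * (Q (xi - 2) + Q (xi + 2))
        + beta * (Q (xi + 1) ^+ 2 - Q xi ^+ 2).

Definition limit_at_infinity (R : realType) (Q : R -> R) (m : R) : Prop :=
  (Q xi @[xi --> +oo] --> m) /\ (Q xi @[xi --> -oo] --> m).

Definition homoclinic_solution (R : realType) (beta m : R) (Q : R -> R) (c : R)
    : Prop :=
  [/\ delay_solution beta Q c,
      exists xi1 xi2, Q xi1 != Q xi2
    & limit_at_infinity Q m].

Definition lattice_solution (R : realType) (beta : R) (P : int -> R -> R) : Prop :=
  forall (n : int) (t : R),
    is_derive t 1 (P n)
      (2 * P (n + 1) t * P (n - 1) t - P n t * (P (n + 2) t + P (n - 2) t)
       + beta * (P (n + 1) t ^+ 2 - P n t ^+ 2)).

Definition traveling_wave (R : realType) (Q : R -> R) (c : R) : int -> R -> R :=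
  fun n t => Q (n%:~R + c * t).

(** [(q, c)] is isolated modulo translation, for the topology of
    (m + H^2(R)) x R, among the pairs satisfying [sol] and tending to [m]. *)
Definition locally_unique (R : realType) (sol : (R -> R) -> R -> Prop)
    (m : R) (q : R -> R) (c : R) : Prop :=
  H2 (fun xi => q xi - m) /\
  exists2 delta : R, 0 < delta &
    forall (Q : R -> R) (c' : R),
      H2 (fun xi => Q xi - m) ->
      H2_ball (fun xi => q xi - m) delta (fun xi => Q xi - m) ->
      `|c' - c| < delta ->
      sol Q c' -> limit_at_infinity Q m ->
      c' = c /\ exists tau : R, forall xi, Q xi = q (xi + tau).

(* Main.v *)
(** Write [Q = m (1 + u)] and [beta = 2 - 20/7 e^2].  Integrated once, the delay
    equation becomes an identity between window integrals of [u] and of its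
    translates ([int_res = 0]), in which no derivative occurs.  Put
    [u xi = e^2 U (e xi)] and [U = P - e^2/2 P''].  The second difference acting on
    [U] then becomes [- e^2/2 B P''], where [B = 4/3 + O(e)] is a combination of
    averages of translates, and the equation reads [B P'' = 2 F(U)] ([profile]);
    at [e = 0] it is the stationary KdV equation of the profile [2 s^2 sech^2 (s x)],
    with speed [c = 4 + e^2 (8/3 s^2 - 40/7)].

    [B] is not a small perturbation of its limit on all of the functions at hand,
    but it is invertible with a bound independent of [e]: its even part is coercive,
    its odd part skew, so an exponentially weighted L^2 estimate bounds solutions,
    and the method of continuity produces them.  The bound passes to weights that
    vary slowly at the scale [e].  Applying [B^-1], the correction to the soliton and
    the deviation of [s] from 1 satisfy a fixed point equation of Lyapunov-Schmidt
    type.  The linearisation [V'' - 4 V + 12 sech^2 V] is inverted by an explicit Green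
    kernel normalised by [V' 0 = 0]; its solvability condition, orthogonality to the
    derivative of the soliton, determines [s], and its first order part vanishes at
    [s = 1], which is where the constants 7/10, 7/20 and 16/15 come from.  The map is
    [O(e)]-Lipschitz, both in the weight [exp (- |x|)], which gives existence and decay, and
    in the sup norm, which gives uniqueness among bounded solutions close to the wave.

    A second solution close to the wave has [P] close as well, and is translated so
    that [P' 0 = 0]; closeness in H^2 implies uniform closeness through the
    integrated equation.  Positivity of [u] near 0 follows from that of the soliton;
    on the tails, [P'' = 4 P + o(1)] on the scale of the local supremum lets it
    propagate by steps of length 1. *)
Require Import Defs.
From HB Require Import structures.
From mathcomp Require Import all_boot all_order all_algebra.
From mathcomp Require Import all_classical all_reals all_analysis.
From mathcomp Require Import ring lra measurable_realfun.

Set Implicit Arguments.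
Unset Strict Implicit.
Unset Printing Implicit Defensive.

Import Order.TTheory GRing.Theory Num.Theory.
Import numFieldNormedType.Exports.

Local Open Scope classical_set_scope.
Local Open Scope ring_scope.

(* [lra] slows down sharply with the number of hypotheses in the context, and
   most goals follow from their premises and the last few hypotheses. *)
Ltac hide_hyps := repeat match goal with
  | H : ?T |- _ => lazymatch T with hide _ => fail | _ =>
      lazymatch type of T with Prop => change (hide T) in H end end end.
Ltac unhide_last := match goal with H : hide ?T |- _ => change T in H end.
Ltac lra_recent := first
  [ solve [hide_hyps; lra]
  | solve [hide_hyps; do 4 try unhide_last; lra]
  | solve [hide_hyps; do 10 try unhide_last; lra]
  | lra ].
(* [clear] is not usable together with [lra] inside a section with variables. *)
Ltac lra_local := first [solve [clear; lra] | lra_recent].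

(** * Differential calculus *)

Section Calculus.
Context {R : realType}.
Implicit Types (f g h F G : R -> R) (a b c x y t : R).

(** The nonlinearity [2 Q(x-1) Q(x+1) - Q(x) (Q(x-2) + Q(x+2))] is minus the second difference of
    [Q(x-1) Q(x+1)], which is why the equation can be integrated. The preconditioner exists because
    the linear part so obtained has a symbol that vanishes to order two at low frequency and tends
    to 4 at high frequency; divided by [(e^2 k^2 / 2) / (1 + e^2 k^2 / 2)] it becomes [B], of order
    zero, tending to 4/3 at low and to 4 at high frequency. The equation is not invariant under
    reflection: [B] contains [- 2 e d/dx] at first order. Hence the wave cannot be sought among even
    functions, where the linearisation would be invertible, and the speed, through [s], has to pay
    for the kernel. The factor 20/7 in the scaling of [beta] is the quotient of the integrals of
    [P''^2] and [P'^2] for [P = 2 sech^2]. The unknown attached to [s] is [sg = (s - 1) / e]. Its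
    solvability condition is an [O(e)] integral divided by [e], so it depends on the correction with
    a Lipschitz constant of order one; the contraction survives because this scalar is measured with
    a large weight. *)

Definition deriv F f := forall x, is_derive x 1 F (f x).

Lemma deriv_eq F f g : deriv F f -> f =1 g -> deriv F g.
Proof. by move=> Ff fg x; rewrite -fg. Qed.

Lemma deriv_ext F G f : F =1 G -> deriv F f -> deriv G f.
Proof. by move=> /funext <-. Qed.

Lemma deriv_cst a : deriv (fun=> a) (fun=> 0).
Proof. by move=> x; exact: is_derive_cst. Qed.

Lemma deriv_id : deriv (fun x => x) (fun=> 1).
Proof. by move=> x; exact: is_derive_id. Qed.

Lemma derivD F G f g : deriv F f -> deriv G g ->
  deriv (fun x => F x + G x) (fun x => f x + g x).
Proof. by move=> Ff Gg x; exact: (is_deriveD (Ff x) (Gg x)). Qed.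

Lemma derivB F G f g : deriv F f -> deriv G g ->
  deriv (fun x => F x - G x) (fun x => f x - g x).
Proof. by move=> Ff Gg x; exact: (is_deriveB (Ff x) (Gg x)). Qed.

Lemma derivN F f : deriv F f -> deriv (fun x => - F x) (fun x => - f x).
Proof. by move=> Ff x; exact: (is_deriveN (Ff x)). Qed.

Lemma derivZ a F f : deriv F f -> deriv (fun x => a * F x) (fun x => a * f x).
Proof. by move=> Ff x; exact: (is_deriveZ a (Ff x)). Qed.

Lemma derivM F G f g : deriv F f -> deriv G g ->
  deriv (fun x => F x * G x) (fun x => f x * G x + F x * g x).
Proof.
move=> Ff Gg x; apply: is_derive_eq; first exact: (is_deriveM (Ff x) (Gg x)).
by rewrite /GRing.scale /= addrC mulrC.
Qed.

Lemma deriv_comp F G f g : deriv F f -> deriv G g ->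
  deriv (fun x => F (G x)) (fun x => f (G x) * g x).
Proof.
move=> Ff Gg x; have Fx := Ff (G x).
apply: is_derive_eq; first exact: (@is_derive1_comp _ _ _ _ _ _ Fx (Gg x)).
by [].
Qed.

Lemma deriv_aff a b F f : deriv F f ->
  deriv (fun x => F (a + b * x)) (fun x => b * f (a + b * x)).
Proof.
move=> Ff; have h : deriv (fun x => a + b * x) (fun x => 0 + b * 1).
  by apply: derivD (deriv_cst a) (derivZ _ deriv_id).
apply: deriv_eq (deriv_comp Ff h) _ => x /=; ring.
Qed.

Lemma deriv_cont F f : deriv F f -> continuous F.
Proof.
move=> Ff x; apply: differentiable_continuous.
by apply/derivable1_diffP; case: (Ff x).
Qed.

Lemma deriv_within F f a b : deriv F f -> {within `[a, b], continuous F}.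
Proof. by move=> /deriv_cont cF; exact: continuous_subspaceT. Qed.

Lemma deriv_le F G f g a b : deriv F f -> deriv G g -> a <= b ->
  (forall x, a <= x <= b -> f x <= g x) -> F b - F a <= G b - G a.
Proof.
move=> Ff Gg ab fg.
have D := derivB Gg Ff.
have [c cab E] := MVT_segment ab (fun x _ => D x) (deriv_within (a:=a) (b:=b) D).
have : 0 <= (g c - f c) * (b - a).
  by rewrite mulr_ge0 // subr_ge0 // fg // -(itvP cab).
rewrite -E; lra.
Qed.

Lemma deriv_uniq F G f a b : deriv F f -> deriv G f -> F b - F a = G b - G a.
Proof.
wlog ab : a b / a <= b => [H|] Ff Gf.
  have [/H->//|ba] := leP a b.
  have := H b a (ltW ba) Ff Gf; lra.
by apply/eqP; rewrite eq_le; apply/andP; split; exact: (deriv_le Ff Gf) || exact: (deriv_le Gf Ff).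
Qed.

Lemma deriv0_cst F : deriv F (fun=> 0) -> forall x y, F x = F y.
Proof. by move=> F0 x y; have := deriv_uniq y x F0 (deriv_cst 0); lra. Qed.

(** The bound is asked on the ball of radius [|b - a|] around [a], so that [a <= b] and [b < a]
    share one statement. *)
Lemma deriv_abs_le F f M a b : deriv F f ->
  (forall x, `|x - a| <= `|b - a| -> `|f x| <= M) -> `|F b - F a| <= M * `|b - a|.
Proof.
move=> Ff fM; have DM := derivZ M deriv_id.
have DN := derivN DM.
have [ab|ba] := leP a b.
  have fM' x : a <= x <= b -> `|f x| <= M.
    by move=> /andP[ax xb]; apply: fM; rewrite !ger0_norm; lra.
  have := deriv_le Ff DM ab; have := deriv_le DN Ff ab.
  rewrite (ger0_norm (_ : 0 <= b - a)); last lra.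
  move=> H1 H2; rewrite ler_norml; apply/andP; split.
    suff : - (M * b) - - (M * a) <= F b - F a by lra.
    by apply: H1 => x /fM'; rewrite ler_norml => /andP[]; lra.
  suff : F b - F a <= M * b - M * a by lra.
  by apply: H2 => x /fM'; rewrite ler_norml => /andP[]; lra.
have fM' x : b <= x <= a -> `|f x| <= M.
  by move=> /andP[ax xb]; apply: fM; rewrite !ler0_norm; lra.
have := deriv_le Ff DM (ltW ba); have := deriv_le DN Ff (ltW ba).
rewrite (ltr0_norm (_ : b - a < 0)); last lra.
move=> H1 H2; rewrite ler_norml; apply/andP; split.
  suff : F a - F b <= M * a - M * b by lra.
  by apply: H2 => x /fM'; rewrite ler_norml => /andP[]; lra.
suff : - (M * a) - - (M * b) <= F a - F b by lra.
by apply: H1 => x /fM'; rewrite ler_norml => /andP[]; lra.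
Qed.

Lemma is_derive_bound F x d :
  (forall e, 0 < e -> exists2 r, 0 < r & forall y, `|y - x| < r ->
    `|F y - F x - d * (y - x)| <= e * `|y - x|) -> is_derive x 1 F d.
Proof.
move=> H; have key : h^-1 *: (F (h *: 1 + x) - F x) @[h --> 0^'] --> d.
  apply/cvgrPdist_le => e e0; have [r r0 Hr] := H e e0.
  exists r => //= h; rewrite /= sub0r normrN => hr h0.
  have hn : 0 < `|h| by rewrite normr_gt0.
  have := Hr (h + x); rewrite addrK => /(_ hr) hh.
  rewrite [h *: 1]mulr1 -(ler_pM2r hn) -normrM.
  rewrite [_ * h](_ : _ = - (F (h + x) - F x - d * h)) ?normrN //.
  by rewrite /GRing.scale /=; field.
split; first by apply/cvg_ex; exists d.
by rewrite /derive; apply: cvg_lim.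
Qed.

End Calculus.

(** * Continuity and existence of primitives *)

Section Continuity.
Context {R : realType}.
Implicit Types (f g h F G : R -> R) (a b c x y t : R).

Lemma contP f x : {for x, continuous f} <->
  forall e, 0 < e -> exists2 r, 0 < r & forall y, `|y - x| < r -> `|f y - f x| <= e.
Proof.
split=> [cf e e0|H].
  move/cvgrPdist_le: cf => /(_ e e0) [r /= r0 Hr].
  exists r => // y yx; have := Hr y; rewrite /= distrC => /(_ yx).
  by rewrite distrC.
apply/cvgrPdist_le => e e0; have [r r0 Hr] := H e e0.
by exists r => //= y /= xy; rewrite distrC; apply: Hr; rewrite distrC.
Qed.

Lemma contD f g : continuous f -> continuous g -> continuous (fun x => f x + g x).
Proof. by move=> cf cg x; apply: cvgD; [exact: cf|exact: cg]. Qed.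

Lemma contB f g : continuous f -> continuous g -> continuous (fun x => f x - g x).
Proof. by move=> cf cg x; apply: cvgB; [exact: cf|exact: cg]. Qed.

Lemma contN f : continuous f -> continuous (fun x => - f x).
Proof. by move=> cf x; apply: cvgN; exact: cf. Qed.

Lemma contM f g : continuous f -> continuous g -> continuous (fun x => f x * g x).
Proof. by move=> cf cg x; apply: cvgM; [exact: cf|exact: cg]. Qed.

Lemma cont_cst a : continuous (fun _ : R => a).
Proof. by move=> x; exact: cvg_cst. Qed.

Lemma cont_id : continuous (fun x : R => x).
Proof. by move=> x; exact: cvg_id. Qed.

Lemma contZ a f : continuous f -> continuous (fun x => a * f x).
Proof. by move=> cf; apply: contM => //; exact: cont_cst. Qed.

Lemma cont_comp f g : continuous f -> continuous g -> continuous (fun x => f (g x)).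
Proof. by move=> cf cg x; apply: (continuous_comp (cg x) (cf _)). Qed.

Lemma cont_aff a b f : continuous f -> continuous (fun x => f (a + b * x)).
Proof.
move=> cf; apply: cont_comp => //; apply: contD; first exact: cont_cst.
exact: contZ cont_id.
Qed.

Lemma continuous_prim_right f a : continuous f ->
  exists F, forall x, a < x -> is_derive x 1 F (f x).
Proof.
move=> cf; exists (fun x => \int[lebesgue_measure]_(t in `[a, x]) f t) => x ax.
have xx : x < x + 1 by lra.
have fi : lebesgue_measure.-integrable `[a, x + 1] (EFin \o f).
  by apply: continuous_compact_integrable; [exact: segment_compact|exact: continuous_subspaceT].
have [d1 d2] := continuous_FTC1_closed xx fi ax (cf x).
by apply: DeriveDef; [exact: d1|rewrite -derive1E; exact: d2].
Qed.

(** A base point [a] yields a primitive on []a, +oo[] only. Increments do not depend on the base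
    point, so those taken from a base point to the left of each argument glue to a primitive on the
    whole line. *)
Lemma continuous_prim f : continuous f -> exists F, deriv F f.
Proof.
move=> cf; pose Fa a := xget (fun=> 0) [set F | forall x, a < x -> is_derive x 1 F (f x)].
have FaP a x : a < x -> is_derive x 1 (Fa a) (f x).
  move: x; have [F HF] := continuous_prim_right a cf.
  by rewrite /Fa; case: xgetP => [F0 -> //|/(_ F)] /(_ HF).
have indep a a' x y : a < x -> a < y -> a' < x -> a' < y -> Fa a y - Fa a x = Fa a' y - Fa a' x.
  wlog xy : x y / x <= y => [W|].
    have [xy|yx] := leP x y; first exact: W.
    move=> ax ay a'x a'y; have := W _ _ (ltW yx) ay ax a'y a'x; lra.
  move=> ax ay a'x a'y.
  have D z : z \in `]x, y[%R -> is_derive z 1 (Fa a - Fa a') (f z - f z).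
    by rewrite in_itv /= => /andP[xz _]; apply: is_deriveB; apply: FaP; lra.
  have C : {within `[x, y], continuous (Fa a - Fa a')}.
    apply: derivable_within_continuous => z; rewrite in_itv /= => /andP[xz _].
    have az : a < z by lra.
    have a'z : a' < z by lra.
    by have [d1 _] := FaP _ _ az; have [d2 _] := FaP _ _ a'z; exact: (derivableB d1 d2).
  have [c _ E] := MVT_segment xy D C.
  by move: E; rewrite subrr mul0r /= !fctE; lra.
(* The base point lies to the left of both [x] and 0 and moves with [x]; around a given [x] it is
   traded for the fixed [a], one unit further left. *)
pose A x := - `|x| - 1.
exists (fun x => Fa (A x) x - Fa (A x) 0) => x.
pose a := - `|x| - 2.
have A0 z : A z < 0 by rewrite /A; have := normr_ge0 z; lra.
have Az z : A z < z by rewrite /A; have := ler_norm (- z); rewrite normrN; lra.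
have a0 : a < 0 by rewrite /a; have := normr_ge0 x; lra.
have ax : a < x by rewrite /a; have := ler_norm (- x); rewrite normrN; lra.
have D : is_derive x 1 (fun y => Fa a y - Fa a 0) (f x).
  have := is_deriveB (FaP _ _ ax) (is_derive_cst (Fa a 0) x 1).
  by rewrite subr0.
apply: near_eq_is_derive D.
exists 1 => //= y /= xy; apply: indep => //.
by rewrite /a; have := ler_norm (- x); move: xy; rewrite ltr_norml normrN; lra.
Qed.

End Continuity.

(** * Integrals of continuous functions *)

Section Integral.
Context {R : realType}.
Implicit Types (f g h F G : R -> R) (a b c x y t : R).

(** Integrals are increments of a chosen primitive rather than Lebesgue integrals: cutting an
    interval and exchanging its ends then require no hypothesis at all. Where no primitive exists
    the choice falls back to 0. *)
Definition prim f : R -> R := xget (fun=> 0) [set F | deriv F f].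

Lemma primP F f : deriv F f -> deriv (prim f) f.
Proof. by move=> Ff; rewrite /prim; case: xgetP => [G _ //|/(_ F)] /(_ Ff). Qed.

Lemma prim_cont f : continuous f -> deriv (prim f) f.
Proof. by move=> /continuous_prim [F]; exact: primP. Qed.

Definition itg f a b := prim f b - prim f a.

Lemma itgE F f a b : deriv F f -> itg f a b = F b - F a.
Proof. by move=> Ff; apply: (deriv_uniq _ _ (primP Ff) Ff). Qed.

Lemma eq_itg f g a b : f =1 g -> itg f a b = itg g a b.
Proof. by move=> /funext ->. Qed.

Lemma itg_cat f a b c : itg f a b + itg f b c = itg f a c.
Proof. by rewrite /itg; ring. Qed.

Lemma itg_xx f a : itg f a a = 0.
Proof. by rewrite /itg subrr. Qed.

Lemma itg_swap f a b : itg f a b = - itg f b a.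
Proof. by rewrite /itg; ring. Qed.

Lemma itg_cst k a b : itg (fun=> k) a b = k * (b - a).
Proof.
rewrite (itgE _ _ (F := fun x => k * x)); first by ring.
apply: deriv_eq (derivZ k deriv_id) _ => x; exact: mulr1.
Qed.

Lemma itgD f g a b : continuous f -> continuous g ->
  itg (fun x => f x + g x) a b = itg f a b + itg g a b.
Proof.
move=> /prim_cont Ff /prim_cont Gg.
by rewrite (itgE _ _ (derivD Ff Gg)) (itgE _ _ Ff) (itgE _ _ Gg); ring.
Qed.

Lemma itgB f g a b : continuous f -> continuous g ->
  itg (fun x => f x - g x) a b = itg f a b - itg g a b.
Proof.
move=> /prim_cont Ff /prim_cont Gg.
by rewrite (itgE _ _ (derivB Ff Gg)) (itgE _ _ Ff) (itgE _ _ Gg); ring.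
Qed.

Lemma itgZ k f a b : continuous f -> itg (fun x => k * f x) a b = k * itg f a b.
Proof.
move=> /prim_cont Ff.
by rewrite (itgE _ _ (derivZ k Ff)) (itgE _ _ Ff); ring.
Qed.

Lemma itgZr k f a b : continuous f -> itg (fun x => f x * k) a b = itg f a b * k.
Proof.
by move=> cf; rewrite mulrC -itgZ //; apply: eq_itg => x; exact: mulrC.
Qed.

Lemma itgN f a b : continuous f -> itg (fun x => - f x) a b = - itg f a b.
Proof.
move=> /prim_cont Ff; rewrite (itgE _ _ (derivN Ff)) (itgE _ _ Ff); ring.
Qed.

Lemma itg_le f g a b : continuous f -> continuous g -> a <= b ->
  (forall x, a <= x <= b -> f x <= g x) -> itg f a b <= itg g a b.
Proof. by move=> /prim_cont Ff /prim_cont Gg; exact: deriv_le Ff Gg. Qed.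

Lemma itg_ge0 f a b : continuous f -> a <= b ->
  (forall x, a <= x <= b -> 0 <= f x) -> 0 <= itg f a b.
Proof.
move=> cf ab f0; have := itg_le (@cont_cst _ 0) cf ab f0.
by rewrite itg_cst mul0r.
Qed.

Lemma itg_abs_le f g a b : continuous f -> continuous g -> a <= b ->
  (forall x, a <= x <= b -> `|f x| <= g x) -> `|itg f a b| <= itg g a b.
Proof.
move=> cf cg ab fg; rewrite ler_norml; apply/andP; split.
  rewrite -itgN //; apply: itg_le => //; first exact: contN.
  by move=> x /fg; rewrite ler_norml => /andP[].
by apply: itg_le => // x /fg; rewrite ler_norml => /andP[].
Qed.

Lemma itg_bound f M a b : continuous f -> a <= b ->
  (forall x, a <= x <= b -> `|f x| <= M) -> `|itg f a b| <= M * (b - a).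
Proof.
move=> cf ab fM; rewrite -itg_cst; apply: itg_abs_le => //; exact: cont_cst.
Qed.

Lemma itg01_bound f M : continuous f ->
  (forall x, 0 <= x <= 1 -> `|f x| <= M) -> `|itg f 0 1| <= M.
Proof. by move=> cf fM; have := itg_bound cf ler01 fM; rewrite subr0 mulr1. Qed.

Lemma itg_deriv f a : continuous f -> deriv (fun x => itg f a x) f.
Proof.
move=> /prim_cont Ff; rewrite /itg; apply: deriv_eq (derivB Ff (deriv_cst _)) _ => x.
exact: subr0.
Qed.

Lemma itg_aff f t k a b : continuous f ->
  itg (fun x => f (t + k * x)) a b * k = itg f (t + k * a) (t + k * b).
Proof.
move=> cf; have Ff := prim_cont cf.
rewrite mulrC -itgZ; last exact: cont_aff.
by rewrite (itgE _ _ (deriv_aff t k Ff)) (itgE _ _ Ff).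
Qed.

Lemma itg_shift f t a b : continuous f ->
  itg (fun x => f (x + t)) a b = itg f (a + t) (b + t).
Proof.
move=> cf; have := itg_aff t 1 a b cf; rewrite mulr1 !mul1r ![t + _]addrC => <-.
by apply: eq_itg => x; rewrite mul1r addrC.
Qed.

Lemma itg_subset f a b c d : continuous f -> a <= c -> c <= d -> d <= b ->
  (forall x, a <= x <= b -> 0 <= f x) -> itg f c d <= itg f a b.
Proof.
move=> cf ac cd db f0; rewrite -(itg_cat f a c b) -(itg_cat f c d b).
have : 0 <= itg f a c by apply: itg_ge0 => // x xx; apply: f0; lra.
have : 0 <= itg f d b by apply: itg_ge0 => // x xx; apply: f0; lra.
lra.
Qed.

Lemma itg_cont_param (g : R -> R -> R) a b x : a <= b ->
  (forall y, continuous (g y)) ->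
  (forall e, 0 < e -> exists2 r, 0 < r & forall y s, `|y - x| < r -> a <= s <= b ->
    `|g y s - g x s| <= e) ->
  {for x, continuous (fun y => itg (g y) a b)}.
Proof.
move=> ab cg H; apply/contP => e e0.
have ba : 0 < b - a + 1 by lra.
have [r r0 Hr] := H (e / (b - a + 1)) (divr_gt0 e0 ba).
exists r => // y yx; rewrite -itgB //.
apply: le_trans (itg_bound _ ab (fun s hs => Hr y s yx hs)) _.
  exact: contB.
rewrite mulrAC ler_pdivrMr // ler_pM2l //; lra.
Qed.

(** Fubini for continuous integrands, with joint continuity replaced by the two
    uniform statements that hold for bounded uniformly continuous data. *)
Lemma itg_fubini (g : R -> R -> R) a b c d : a <= b -> c <= d ->
  (forall x, continuous (g x)) -> (forall s, continuous (g^~ s)) ->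
  (forall x e, 0 < e -> exists2 r, 0 < r & forall y s, `|y - x| < r -> c <= s <= d ->
    `|g y s - g x s| <= e) ->
  (forall s e, 0 < e -> exists2 r, 0 < r & forall t x, `|t - s| < r ->
    `|g x t - g x s| <= e) ->
  itg (fun x => itg (g x) c d) a b = itg (fun s => itg (g^~ s) a b) c d.
Proof.
move=> ab cd c1 c2 u1 u2.
have cJ y : continuous (fun s => itg (g^~ s) a y).
  have H z1 z2 : z1 <= z2 -> continuous (fun s => itg (g^~ s) z1 z2).
    move=> z12 s; apply: itg_cont_param => // e e0.
    by have [r r0 Hr] := u2 s e e0; exists r => // t x ts _; exact: Hr.
  have [|/ltW] := leP a y; first exact: H.
  move=> /H hc; rewrite (_ : (fun s => _) = (fun s => - itg (g^~ s) y a)); first exact: contN.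
  by apply/funext => s; exact: itg_swap.
(* Both sides vanish at [b = a], so it suffices to differentiate the right-hand side in the upper
   limit of its inner integral. *)
have D : deriv (fun y => itg (fun s => itg (g^~ s) a y) c d) (fun x => itg (g x) c d).
  move=> x; apply: is_derive_bound => e e0.
  have dc : 0 < d - c + 1 by lra.
  have [r r0 Hr] := u1 x _ (divr_gt0 e0 dc); exists r => // y yx.
  rewrite mulrC -itgZ; last exact: c1.
  rewrite -itgB // -itgB //; first last.
  - by apply: contZ; exact: c1.
  - exact: contB.
  have -> : e * `|y - x| = e * `|y - x| / (d - c + 1) * (d - c + 1) by field; lra_local.
  have HB s : c <= s <= d -> `|itg (g^~ s) a y - itg (g^~ s) a x - (y - x) * g x s|
      <= e * `|y - x| / (d - c + 1).
    move=> hs.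
    have D1 := derivB (itg_deriv a (c2 s)) (derivZ (g x s) deriv_id).
    have := @deriv_abs_le _ _ _ (e / (d - c + 1)) x y D1.
    rewrite (_ : _ - _ - (_ - _) = itg (g^~ s) a y - itg (g^~ s) a x - (y - x) * g x s); last ring.
    rewrite mulrAC; apply => z zx; rewrite mulr1; apply: Hr => //.
    exact: le_lt_trans zx yx.
  apply: le_trans (itg_bound _ cd HB) _.
    by apply: contB; [exact: contB|apply: contZ; exact: c1].
  rewrite ler_wpM2l //; last lra_local.
  by rewrite divr_ge0 ?mulr_ge0 //; lra_local.
rewrite (itgE _ _ D) [X in _ - X](_ : _ = 0) ?subr0 //.
rewrite (eq_itg _ _ (g := fun=> 0)) ?itg_cst ?mul0r // => s; exact: itg_xx.
Qed.

End Integral.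

(** * Bounded and uniformly continuous functions *)

Section UniformContinuity.
Context {R : realType}.
Implicit Types (f g h z p : R -> R) (a b c d e x y t s M : R).

Definition bnd M f := forall x, `|f x| <= M.

Definition ucont f := forall e, 0 < e ->
  exists2 r, 0 < r & forall x y, `|x - y| < r -> `|f x - f y| <= e.

Lemma ucont_cont f : ucont f -> continuous f.
Proof.
by move=> uf x; apply/contP => e e0; have [r r0 Hr] := uf e e0; exists r => // y /Hr.
Qed.

Lemma bnd_ge0 M f : bnd M f -> 0 <= M.
Proof. by move=> /(_ 0); apply: le_trans. Qed.

Lemma ucont_lip L f : (forall x y, `|f x - f y| <= L * `|x - y|) -> ucont f.
Proof.
move=> lf e e0; have L0 : 0 < `|L| + 1 by have := normr_ge0 L; lra.
exists (e / (`|L| + 1)) => [|x y xy]; first exact: divr_gt0.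
apply: le_trans (lf x y) _.
apply: le_trans (_ : (`|L| + 1) * `|x - y| <= _).
  by rewrite ler_wpM2r // ltW // (le_lt_trans (ler_norm L)) //; lra.
by rewrite mulrC -ler_pdivlMr // ltW.
Qed.

Lemma deriv_lip M f g : deriv f g -> bnd M g -> forall x y, `|f x - f y| <= M * `|x - y|.
Proof. by move=> fg gM x y; apply: deriv_abs_le fg _. Qed.

Lemma deriv_ucont M f g : deriv f g -> bnd M g -> ucont f.
Proof. by move=> fg gM; apply: ucont_lip (deriv_lip fg gM). Qed.

Lemma ucont_cst a : ucont (fun=> a).
Proof. by move=> e e0; exists 1 => // x y _; rewrite subrr normr0 ltW. Qed.

Lemma ucontD f g : ucont f -> ucont g -> ucont (fun x => f x + g x).
Proof.
move=> uf ug e e0; have e2 : 0 < e / 2 by lra.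
have [r r0 Hr] := uf _ e2; have [q q0 Hq] := ug _ e2.
exists (Num.min r q); first by rewrite lt_min r0.
move=> x y; rewrite lt_min => /andP[/Hr h1 /Hq h2].
rewrite (_ : _ - _ = (f x - f y) + (g x - g y)); last ring.
by apply: le_trans (ler_normD _ _) _; lra.
Qed.

Lemma ucontM M N f g : bnd M f -> bnd N g -> ucont f -> ucont g ->
  ucont (fun x => f x * g x).
Proof.
move=> fM gN uf ug e e0.
have M0 := bnd_ge0 fM; have N0 := bnd_ge0 gN.
have MN : 0 < M + N + 1 by lra.
have [r r0 Hr] := uf _ (divr_gt0 e0 MN); have [q q0 Hq] := ug _ (divr_gt0 e0 MN).
exists (Num.min r q); first by rewrite lt_min r0.
move=> x y; rewrite lt_min => /andP[/Hr h1 /Hq h2].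
rewrite (_ : _ - _ = (f x - f y) * g x + f y * (g x - g y)); last ring.
apply: le_trans (ler_normD _ _) _; rewrite !normrM.
apply: le_trans (_ : (e / (M + N + 1)) * N + M * (e / (M + N + 1)) <= _).
  by apply: lerD; apply: ler_pM.
rewrite [M * _]mulrC -mulrDr mulrAC ler_pdivrMr // ler_pM2l //; lra.
Qed.

Lemma ucontZ k f : ucont f -> ucont (fun x => k * f x).
Proof.
move=> uf e e0; have k0 : 0 < `|k| + 1 by have := normr_ge0 k; lra.
have [r r0 Hr] := uf _ (divr_gt0 e0 k0); exists r => // x y /Hr h.
rewrite -mulrBr normrM; apply: le_trans (_ : `|k| * (e / (`|k| + 1)) <= _).
  by rewrite ler_wpM2l.
rewrite mulrA ler_pdivrMr // mulrC ler_pM2l //; lra.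
Qed.

Lemma ucontB f g : ucont f -> ucont g -> ucont (fun x => f x - g x).
Proof.
move=> uf ug; rewrite (_ : (fun _ => _) = (fun x => f x + (-1) * g x)).
  by apply: ucontD => //; exact: ucontZ.
by apply/funext => x; ring.
Qed.

Lemma ucont_comp f g : ucont f -> ucont g -> ucont (fun x => f (g x)).
Proof.
move=> uf ug e e0; have [r r0 Hr] := uf e e0; have [q q0 Hq] := ug (r / 2) (divr_gt0 r0 (ltr0Sn _ 1)).
exists q => // x y /Hq h; apply: Hr; lra.
Qed.

Lemma ucont_aff a b f : ucont f -> ucont (fun x => f (a + b * x)).
Proof.
move=> uf; apply: ucont_comp => //; apply: (@ucont_lip `|b|) => x y.
by rewrite (_ : _ - _ = b * (x - y)) ?normrM //; ring.
Qed.

Lemma ucont_abs : ucont (fun x : R => `|x|).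
Proof. by apply: (@ucont_lip 1) => x y; rewrite mul1r ler_dist_dist. Qed.

Lemma ucont_lim f (u : nat -> R -> R) : (forall n, ucont (u n)) ->
  (forall e, 0 < e -> exists n, forall x, `|u n x - f x| <= e) -> ucont f.
Proof.
move=> uu H e e0; have e3 : 0 < e / 3 by lra.
have [n Hn] := H _ e3; have [r r0 Hr] := uu n _ e3.
exists r => // x y /Hr; have := Hn x; have := Hn y.
by rewrite !ler_norml => /andP[? ?] /andP[? ?] /andP[? ?]; apply/andP; split; lra_local.
Qed.

Lemma itg_ucont (k : R -> R) M f e d a b : a <= b -> continuous k ->
  (forall s, a <= s <= b -> `|k s| <= M) -> ucont f ->
  ucont (fun x => itg (fun s => k s * f (x + (d + e * s))) a b).
Proof.
move=> ab ck kM uf eps eps0.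
have cint x : continuous (fun s => k s * f (x + (d + e * s))).
  apply: contM => //; rewrite (_ : (fun _ => _) = (fun s => f ((x + d) + e * s))).
    by apply: cont_aff; exact: ucont_cont.
  by apply/funext => s; rewrite addrA.
have M0 : 0 <= M by apply: le_trans (kM a _) => //; rewrite lexx.
have D0 : 0 < M * (b - a) + 1.
  by apply: lt_le_trans (_ : 1 <= _) => //; rewrite lerDr mulr_ge0 //; lra.
have [r r0 Hr] := uf _ (divr_gt0 eps0 D0); exists r => // x y xy.
rewrite -itgB //.
apply: le_trans (_ : (M * (eps / (M * (b - a) + 1))) * (b - a) <= _).
  apply: itg_bound => // [|s hs]; first exact: contB.
  rewrite -mulrBr normrM ler_pM ?kM //; apply: Hr.
  by rewrite (_ : _ - _ = x - y) //; ring.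
rewrite (_ : _ * _ * _ = (eps * (M * (b - a))) / (M * (b - a) + 1)).
  by rewrite ler_pdivrMr // ler_pM2l //; lra.
by field; rewrite gt_eqF.
Qed.

(** This exchange turns the pairing of [p] with an average of translates of [z] into an average of
    correlations. The two uniformity conditions of [itg_fubini] come from the uniform continuity of
    [p] and [z] and from the continuity of [k] at a point. *)
Lemma itg_fubini_term (k : R -> R) M A N p z c d a b : a <= b -> continuous k ->
  (forall s, 0 <= s <= 1 -> `|k s| <= M) -> bnd A p -> bnd N z -> ucont p -> ucont z ->
  itg (fun x => p x * itg (fun s => k s * z (x + (d + c * s))) 0 1) a b =
  itg (fun s => k s * itg (fun x => p x * z (x + (d + c * s))) a b) 0 1.
Proof.
move=> ab ck kM pA zN up uz.
have cz := ucont_cont uz; have cp := ucont_cont up.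
have cz1 x : continuous (fun s => z (x + (d + c * s))).
  rewrite (_ : (fun _ => _) = (fun s => z ((x + d) + c * s))); first exact: cont_aff.
  by apply/funext => s; rewrite addrA.
have cz2 t : continuous (fun x => z (x + t)).
  rewrite (_ : (fun _ => _) = (fun x => z (t + 1 * x))); first exact: cont_aff.
  by apply/funext => x; rewrite mul1r addrC.
transitivity (itg (fun x => itg (fun s => k s * (p x * z (x + (d + c * s)))) 0 1) a b).
  apply: eq_itg => x; rewrite -itgZ; last exact: contM.
  by apply: eq_itg => s; ring.
rewrite (itg_fubini (g := fun x s => k s * (p x * z (x + (d + c * s))))) //.
- apply: eq_itg => s; rewrite -itgZ //; exact: contM.
- by move=> x; apply: contM => //; exact: contZ.
- by move=> s; apply: contZ; exact: contM.
- move=> x e e0.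
  have M0 : 0 <= M by apply: le_trans (kM 0 _) => //; rewrite lexx ler01.
  have M1 : 0 < M + 1 by lra.
  have A0 := bnd_ge0 pA; have N0 := bnd_ge0 zN.
  have e1 : 0 < e / (M + 1) by exact: divr_gt0.
  have AN : 0 < A + N + 1 by lra.
  have [r r0 Hr] := up _ (divr_gt0 e1 AN); have [q q0 Hq] := uz _ (divr_gt0 e1 AN).
  exists (Num.min r q); first by rewrite lt_min r0.
  move=> y s; rewrite lt_min => /andP[/Hr h1 yq] hs.
  have /Hq h2 : `|(y + (d + c * s)) - (x + (d + c * s))| < q by rewrite (_ : _ - _ = y - x) //; ring.
  rewrite -mulrBr normrM; apply: le_trans (_ : M * (e / (M + 1)) <= _); last first.
    by rewrite mulrA ler_pdivrMr // mulrC ler_pM2l //; lra_local.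
  apply: ler_pM => //; first exact: kM.
  rewrite (_ : _ - _ = (p y - p x) * z (y + (d + c * s)) +
    p x * (z (y + (d + c * s)) - z (x + (d + c * s)))); last ring.
  apply: le_trans (ler_normD _ _) _; rewrite !normrM.
  apply: le_trans (_ : (e / (M + 1) / (A + N + 1)) * N + A * (e / (M + 1) / (A + N + 1)) <= _).
    by apply: lerD; apply: ler_pM.
  rewrite [A * _]mulrC -mulrDr mulrAC ler_pdivrMr // ler_pM2l //; lra_local.
- move=> s e e0.
  have A0 := bnd_ge0 pA; have N0 := bnd_ge0 zN.
  have K0 := normr_ge0 (k s).
  have T0 : 0 < A * N + (`|k s| + 1) * A + 1.
    have : 0 <= A * N by exact: mulr_ge0.
    have : 0 <= (`|k s| + 1) * A by rewrite mulr_ge0 //; lra.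
    lra.
  have [r r0 Hr] := (contP k s).1 (ck s) _ (divr_gt0 e0 T0).
  have [q q0 Hq] := ucont_aff 0 c uz (divr_gt0 e0 T0).
  exists (Num.min r q); first by rewrite lt_min r0.
  move=> t x; rewrite lt_min => /andP[/Hr h1 yq].
  have /Hq h2 : `|((x + d) / c + t) - ((x + d) / c + s)| < q by rewrite (_ : _ - _ = t - s) //; ring.
  have h3 : `|z (x + (d + c * t)) - z (x + (d + c * s))| <= e / (A * N + (`|k s| + 1) * A + 1).
    (* The translate has been written through [(x + d) / c]; for [c = 0] that point is meaningless,
       but [z (x + (d + c * s))] is then constant in [s]. *)
    have [c0|c0] := eqVneq c 0.
      by rewrite c0 !mul0r subrr normr0 ltW // divr_gt0.
    move: h2; rewrite !add0r !mulrDr mulrCA divff // mulr1.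
    by rewrite !addrA.
  rewrite (_ : _ - _ = (k t - k s) * (p x * z (x + (d + c * t))) +
    k s * (p x * (z (x + (d + c * t)) - z (x + (d + c * s))))); last ring.
  apply: le_trans (ler_normD _ _) _; rewrite !normrM.
  set E := e / _ in h1 h3 *.
  apply: le_trans (_ : E * (A * N) + (`|k s| + 1) * (A * E) <= _).
    apply: lerD; first by apply: ler_pM => //; apply: ler_pM.
    by apply: ler_pM => //; [lra_local|apply: ler_pM].
  rewrite (_ : _ + _ = E * (A * N + (`|k s| + 1) * A)); last ring.
  rewrite /E mulrAC ler_pdivrMr // ler_pM2l //; lra_local.
Qed.

End UniformContinuity.

(** * Averages of translates and their weighted energy *)

Section Averages.
Context {R : realType}.
Implicit Types (f g h z k : R -> R) (c d e x y t s M N : R).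

(** All the nonlocal operators are combinations of averages of translates. *)
Definition Tk k d c f x := itg (fun s => k s * f (x + (d + c * s))) 0 1.

Lemma cont_transl f x d c : continuous f -> continuous (fun s => f (x + (d + c * s))).
Proof.
move=> cf; rewrite (_ : (fun _ => _) = (fun s => f ((x + d) + c * s))).
  exact: cont_aff.
by apply/funext => s; rewrite addrA.
Qed.

Lemma TkD k d c f g x : continuous k -> continuous f -> continuous g ->
  Tk k d c (fun y => f y + g y) x = Tk k d c f x + Tk k d c g x.
Proof.
move=> ck cf cg; rewrite /Tk -itgD; try by apply: contM => //; exact: cont_transl.
by apply: eq_itg => s; rewrite mulrDr.
Qed.

Lemma TkB k d c f g x : continuous k -> continuous f -> continuous g ->
  Tk k d c (fun y => f y - g y) x = Tk k d c f x - Tk k d c g x.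
Proof.
move=> ck cf cg; rewrite /Tk -itgB; try by apply: contM => //; exact: cont_transl.
by apply: eq_itg => s; rewrite mulrBr.
Qed.

Lemma TkZ k d c a f x : continuous k -> continuous f ->
  Tk k d c (fun y => a * f y) x = a * Tk k d c f x.
Proof.
move=> ck cf; rewrite /Tk -itgZ; try by apply: contM => //; exact: cont_transl.
by apply: eq_itg => s; rewrite mulrCA.
Qed.

Lemma Tk_ucont k d c f M : continuous k -> (forall s, 0 <= s <= 1 -> `|k s| <= M) ->
  ucont f -> ucont (Tk k d c f).
Proof. by move=> ck kM uf; apply: (itg_ucont (M := M)). Qed.

Lemma Tk_le k d c f M B x : continuous k -> (forall s, 0 <= s <= 1 -> `|k s| <= M) ->
  continuous f -> (forall s, 0 <= s <= 1 -> `|f (x + (d + c * s))| <= B) ->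
  `|Tk k d c f x| <= M * B.
Proof.
move=> ck kM cf fB; apply: itg01_bound; first by apply: contM => //; exact: cont_transl.
by move=> s hs; rewrite normrM ler_pM ?kM ?fB.
Qed.

(** The kernels left by two integrations by parts in the second difference [Mop], see [Mop_precond],
    one polynomial per unit cell of [-2, 2]: [kb] on [-1, 0], [ka] on [0, 1], [kc] on the two outer
    cells. There it appears with opposite signs, so that the outer cells contribute to the odd part
    only. *)
Definition ka : R -> R := fun s => - 3 - 8 * s + 5 * (s * s).
Definition kb : R -> R := fun s => 3 - s * s.
Definition kc : R -> R := fun s => 2 * s - s * s.

Lemma cont_sq : continuous (fun s : R => s * s).
Proof. exact: contM cont_id cont_id. Qed.

Lemma cont_ka : continuous ka.
Proof.
apply: contD; last exact: contZ cont_sq.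
by apply: contB; [exact: cont_cst|exact: contZ cont_id].
Qed.

Lemma cont_kb : continuous kb.
Proof. by apply: contB; [exact: cont_cst|exact: cont_sq]. Qed.

Lemma cont_kc : continuous kc.
Proof. by apply: contB; [exact: contZ cont_id|exact: cont_sq]. Qed.

Lemma ka_le s : 0 <= s <= 1 -> `|ka s| <= 8.
Proof. by move=> /andP[s0 s1]; rewrite ler_norml /ka; apply/andP; split; nra. Qed.

Lemma kb_le s : 0 <= s <= 1 -> `|kb s| <= 3.
Proof. by move=> /andP[s0 s1]; rewrite ler_norml /kb; apply/andP; split; nra. Qed.

Lemma kc_le s : 0 <= s <= 1 -> `|kc s| <= 1.
Proof. by move=> /andP[s0 s1]; rewrite ler_norml /kc; apply/andP; split; nra. Qed.

Definition Kop e z x :=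
  Tk ka 0 e z x + Tk kb 0 (- e) z x + Tk kc e e z x - Tk kc (- e) (- e) z x.

Definition Bt t e z x := 4 * z x + t * Kop e z x.
Definition Bop e z x := 4 * z x + Kop e z x.

Lemma Bt1 e z : Bt 1 e z = Bop e z.
Proof. by apply/funext => x; rewrite /Bt mul1r. Qed.

Lemma Kop_ucont e z : ucont z -> ucont (Kop e z).
Proof.
move=> uz; apply: ucontB; first (apply: ucontD; first apply: ucontD).
- exact: Tk_ucont cont_ka ka_le uz.
- exact: Tk_ucont cont_kb kb_le uz.
- exact: Tk_ucont cont_kc kc_le uz.
- exact: Tk_ucont cont_kc kc_le uz.
Qed.

(** Here 13 = 8 + 3 + 1 + 1 adds up the bounds of the four kernels, and no translate reaches further
    than [2 |e|]. *)
Lemma Kop_le e z x B : continuous z ->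
  (forall y, `|y - x| <= 2 * `|e| -> `|z y| <= B) -> `|Kop e z x| <= 13 * B.
Proof.
move=> cz zB.
have H d c s : `|d| <= `|e| -> `|c| <= `|e| -> 0 <= s <= 1 -> `|z (x + (d + c * s))| <= B.
  move=> hd hc /andP[s0 s1]; apply: zB; rewrite addrAC subrr add0r.
  apply: le_trans (ler_normD _ _) _; rewrite normrM (ger0_norm s0).
  by have := ler_pM (normr_ge0 c) s0 hc s1; lra.
have e0 := normr_ge0 e.
have L0 : `|0 : R| <= `|e| by rewrite normr0.
have LN : `|- e| <= `|e| by rewrite normrN.
have h1 := Tk_le cont_ka ka_le cz (fun s => H 0 e s L0 (lexx _)).
have h2 := Tk_le cont_kb kb_le cz (fun s => H 0 (-e) s L0 LN).
have h3 := Tk_le cont_kc kc_le cz (fun s => H e e s (lexx _) (lexx _)).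
have h4 := Tk_le cont_kc kc_le cz (fun s => H (-e) (-e) s LN LN).
rewrite /Kop; apply: le_trans (ler_normB _ _) _.
apply: le_trans (lerD (ler_normD _ _) (lexx _)) _.
apply: le_trans (lerD (lerD (ler_normD _ _) (lexx _)) (lexx _)) _.
lra.
Qed.

Lemma KopD e f g x : continuous f -> continuous g ->
  Kop e (fun y => f y + g y) x = Kop e f x + Kop e g x.
Proof.
move=> cf cg; rewrite /Kop !TkD //; first ring.
all: try exact: cont_ka. all: try exact: cont_kb. all: exact: cont_kc.
Qed.

Lemma KopZ e a f x : continuous f -> Kop e (fun y => a * f y) x = a * Kop e f x.
Proof.
move=> cf; rewrite /Kop !TkZ //; first ring.
all: try exact: cont_ka. all: try exact: cont_kb. all: exact: cont_kc.
Qed.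

Lemma KopB e f g x : continuous f -> continuous g ->
  Kop e (fun y => f y - g y) x = Kop e f x - Kop e g x.
Proof.
move=> cf cg; rewrite /Kop !TkB //; first ring.
all: try exact: cont_ka. all: try exact: cont_kb. all: exact: cont_kc.
Qed.

(** Scaling the variable changes [e], which is how all estimates for the inverse are reduced to
    [e = 1]. *)
Lemma Kop_aff e z a b x : Kop e (fun y => z (a + b * y)) x = Kop (b * e) z (a + b * x).
Proof.
have E k d c : Tk k d c (fun y => z (a + b * y)) x = Tk k (b * d) (b * c) z (a + b * x).
  by apply: eq_itg => s; congr (k s * z _); ring.
by rewrite /Kop !E mulr0 mulrN.
Qed.

Lemma BopD e f g x : continuous f -> continuous g ->
  Bop e (fun y => f y + g y) x = Bop e f x + Bop e g x.
Proof. by move=> cf cg; rewrite /Bop KopD //; ring. Qed.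

Lemma BopB e f g x : continuous f -> continuous g ->
  Bop e (fun y => f y - g y) x = Bop e f x - Bop e g x.
Proof. by move=> cf cg; rewrite /Bop KopB //; ring. Qed.

Lemma BopZ e a f x : continuous f -> Bop e (fun y => a * f y) x = a * Bop e f x.
Proof. by move=> cf; rewrite /Bop KopZ //; ring. Qed.

End Averages.

(** * A weighted energy estimate at scale 1 *)

Section Energy.
Context {R : realType}.
Implicit Types (f g h : R -> R) (x y s : R).

(** The kernels reach as far as 2. The rate 1/70 is so slow that over this distance the weight
    changes by a factor at most 35/34, little enough to preserve the coercivity of the even part. *)
Let w x : R := expR (- (`|x| / 70)).

Let w_gt0 x : 0 < w x. Proof. exact: expR_gt0. Qed.

Let w_ge0 x : 0 <= w x. Proof. exact: ltW. Qed.

Let w_le1 x : w x <= 1.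
Proof. by rewrite /w expR_le1 oppr_le0 divr_ge0. Qed.

Let w_shift x y : `|x - y| <= 2 -> w x <= 35 / 34 * w y.
Proof.
move=> xy; rewrite /w.
have e1 : expR (1 / 35 : R) <= 35 / 34.
  have := expR_ge1Dx (- (1 / 35 : R)); rewrite expRN => h.
  have p := expR_gt0 (1 / 35 : R).
  rewrite -[expR _]invrK -[35 / 34]invrK lef_pV2 ?posrE ?invr_gt0 //; lra.
apply: le_trans (_ : expR (1 / 35 - `|y| / 70) <= _).
  rewrite ler_expR; have := ler_normD (y - x) x; rewrite subrK [`|y - x|]distrC; lra.
by rewrite expRD ler_wpM2r // expR_ge0.
Qed.

Let w_ucont : ucont w.
Proof.
apply: (@ucont_lip _ 1) => x y.
wlog xy : x y / `|x| <= `|y| => [W|].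
  by have [/W//|/ltW/W] := leP `|x| `|y|; rewrite distrC [`|y - x|]distrC.
have h0 := normr_ge0 (`|y| - `|x|).
have -> : w y = w x * expR (- ((`|y| - `|x|) / 70)).
  by rewrite /w -expRD; congr expR; ring.
rewrite -{1}[w x]mulr1 -mulrBr normrM ger0_norm ?w_ge0 // ger0_norm; last first.
  by rewrite subr_ge0 expR_le1 oppr_le0 divr_ge0 // subr_ge0.
apply: ler_pM; rewrite ?w_ge0 //.
  by rewrite subr_ge0 expR_le1 oppr_le0 divr_ge0 // subr_ge0.
have := expR_ge1Dx (- ((`|y| - `|x|) / 70)).
have := ler_normD (y - x) x; rewrite subrK [`|y - x|]distrC.
have := normr_ge0 (x - y); lra.
Qed.

Let w_cont : continuous w. Proof. exact: ucont_cont. Qed.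

Variables (z : R -> R) (Z : R).
Hypotheses (zZ : bnd Z z) (uz : ucont z).
(** All integrals are truncated to [-N, N], and [mu] bounds the weight beyond [N - 2]. Boundary
    terms are then multiples of [mu * (Z * Z)], made arbitrarily small in [mass_estimate]. *)
Variables (N mu : R).
Hypotheses (N2 : 2 <= N) (mu0 : 0 <= mu).
Hypothesis wmu : forall x, N - 2 <= `|x| -> w x <= mu.

Let z_cont : continuous z. Proof. exact: ucont_cont. Qed.

Let NN : - N <= N. Proof. by move: N2; lra. Qed.

Let W x := w x * (z x * z x).

Let W_cont : continuous W.
Proof. by apply: contM => //; apply: contM. Qed.

Let W_ge0 x : 0 <= W x.
Proof. by rewrite /W mulr_ge0 ?w_ge0 // -expr2 sqr_ge0. Qed.

Let J := itg W (- N) N.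

Let J_ge0 : 0 <= J. Proof. by apply: itg_ge0. Qed.

Let zz x y : `|z x * z y| <= Z * Z.
Proof. by rewrite normrM ler_pM. Qed.

Let Z0 : 0 <= Z. Proof. exact: bnd_ge0 zZ. Qed.
Let ZZ0 : 0 <= Z * Z. Proof. exact: mulr_ge0. Qed.
Let mZ0 : 0 <= mu * (Z * Z). Proof. exact: mulr_ge0. Qed.

Let W_tail x : N - 2 <= `|x| -> `|W x| <= mu * (Z * Z).
Proof.
by move=> hx; rewrite /W normrM (ger0_norm (ltW (w_gt0 x))); apply: ler_pM; rewrite ?w_ge0 ?wmu.
Qed.

Let cont_sh f t : continuous f -> continuous (fun x => f (x + t)).
Proof.
move=> cf; rewrite (_ : (fun _ => _) = (fun x => f (t + 1 * x))); first exact: cont_aff.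
by apply/funext => x; rewrite mul1r addrC.
Qed.

Let J_shift t : `|t| <= 2 ->
  itg (fun x => w x * (z (x + t) * z (x + t))) (- N) N <= 35 / 34 * (J + 2 * (mu * (Z * Z))).
Proof.
have [nn [m0 j0]] := (N2, (mZ0, J_ge0)).
move=> t2; apply: (@le_trans _ _ (itg (fun x => 35 / 34 * W (x + t)) (- N) N)).
  apply: itg_le => //.
  - by apply: contM => //; apply: contM; exact: cont_sh.
  - by apply: contZ; exact: cont_sh.
  move=> x _; rewrite /W [35 / 34 * _]mulrA ler_wpM2r -?expr2 ?sqr_ge0 //.
  by apply: w_shift; rewrite opprD addrA subrr sub0r normrN.
rewrite itgZ; last exact: cont_sh.
rewrite ler_pM2l; last lra.
rewrite itg_shift // -(itg_cat _ (- N + t) (- N) (N + t)) -(itg_cat _ (- N) N (N + t)) -/J.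
have [t0|t0] := leP 0 t.
  have h1 : 0 <= itg W (- N) (- N + t) by apply: itg_ge0 => //; lra.
  rewrite [itg W (- N + t) _]itg_swap.
  have h2 : `|itg W N (N + t)| <= mu * (Z * Z) * (N + t - N).
    apply: itg_bound => //; first lra.
    by move=> x /andP[hx _]; apply: W_tail; rewrite ger0_norm; lra.
  have h3 := ler_norm (itg W N (N + t)).
  have h4 : mu * (Z * Z) * (N + t - N) <= mu * (Z * Z) * 2.
    by rewrite ler_wpM2l //; move: t2; rewrite ger0_norm; lra.
  lra.
have h1 : 0 <= itg W (N + t) N by apply: itg_ge0 => //; lra.
rewrite [itg W N _]itg_swap.
have h2 : `|itg W (- N + t) (- N)| <= mu * (Z * Z) * (- N - (- N + t)).
  apply: itg_bound => //; first lra.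
  by move=> x /andP[_ hx]; apply: W_tail; rewrite ler0_norm; lra.
have h3 := ler_norm (itg W (- N + t) (- N)).
have h4 : mu * (Z * Z) * (- N - (- N + t)) <= mu * (Z * Z) * 2.
  by rewrite ler_wpM2l //; move: t2; rewrite ltr0_norm; lra_recent.
lra.
Qed.

(** The weighted autocorrelation of [z]: by [pairing], the energy form of every average is an
    integral of [q] against its kernel. *)
Let q t := itg (fun x => (w x * z x) * z (x + t)) (- N) N.

Let q_abs t : `|t| <= 2 ->
  itg (fun x => w x * `|z x * z (x + t)|) (- N) N <= 35 / 34 * J + 2 * (mu * (Z * Z)).
Proof.
have [nn [m0 j0]] := (N2, (mZ0, J_ge0)).
move=> t2; have := J_shift t2.
have c1 : continuous (fun x => w x * (z (x + t) * z (x + t))).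
  by apply: contM => //; apply: contM; exact: cont_sh.
suff : itg (fun x => w x * `|z x * z (x + t)|) (- N) N <=
    itg (fun x => 1 / 2 * (W x + w x * (z (x + t) * z (x + t)))) (- N) N.
  rewrite itgZ; last by apply: contD.
  rewrite itgD // -/J; lra.
apply: itg_le => //.
- apply: contM => //; apply: cont_comp; last by apply: contM => //; exact: cont_sh.
  exact: ucont_cont ucont_abs.
- by apply: contZ; apply: contD.
move=> x _; rewrite /W -mulrDr mulrCA ler_wpM2l ?w_ge0 //.
have := sqr_ge0 (z x - z (x + t)); have := sqr_ge0 (z x + z (x + t)).
by rewrite ler_norml !expr2 => h1 h2; apply/andP; split; lra.
Qed.

Let q_le t : `|t| <= 2 -> `|q t| <= 35 / 34 * J + 2 * (mu * (Z * Z)).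
Proof.
move=> t2; apply: le_trans (q_abs t2).
apply: itg_abs_le => //.
- by apply: contM; [exact: contM|exact: cont_sh].
- apply: contM => //; apply: cont_comp; last by apply: contM => //; exact: cont_sh.
  exact: ucont_cont ucont_abs.
by move=> x _; rewrite -mulrA normrM (ger0_norm (ltW (w_gt0 x))).
Qed.

(** An unweighted autocorrelation would be even up to the boundary. The change of variable [x + t]
    leaves the difference [w x - w (x + t)], at most 1/34 of the weight, and two end pieces of
    length [t]. *)
Let q_skew t : 0 <= t <= 2 -> `|q t - q (- t)| <= 2 / 34 * J + 6 * (mu * (Z * Z)).
Proof.
have [nn [m0 j0]] := (N2, (mZ0, J_ge0)).
move=> /andP[t0 t2]; have at2 : `|t| <= 2 by rewrite ger0_norm.
pose h x := w (x + t) * z (x + t) * z x.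
have ch : continuous h by apply: contM => //; apply: contM; exact: cont_sh.
have -> : q (- t) = itg h (- N - t) (N - t).
  pose f0 y := w y * z y * z (y + - t).
  rewrite /q -/f0 (_ : h = fun x => f0 (x + t)); last first.
    by apply/funext => x; rewrite /h /f0 addrK.
  rewrite (@itg_shift _ f0 t); last by apply: contM; [exact: contM|exact: cont_sh].
  by rewrite !subrK.
pose d x := (w x - w (x + t)) * (z x * z (x + t)).
have cd : continuous d.
  apply: contM; first by apply: contB => //; exact: cont_sh.
  by apply: contM => //; exact: cont_sh.
have -> : q t - itg h (- N - t) (N - t) =
    itg d (- N) N + (itg h (N - t) N - itg h (- N - t) (- N)).
  have -> : itg h (N - t) N - itg h (- N - t) (- N) = itg h (- N) N - itg h (- N - t) (N - t).
    by rewrite /itg; ring.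
  rewrite addrA -itgD //; congr (_ - _); apply: eq_itg => x; rewrite /d /h; ring.
have h1 : `|itg d (- N) N| <= 1 / 34 * (35 / 34 * J + 2 * (mu * (Z * Z))).
  apply: le_trans (_ : itg (fun x => 1 / 34 * (w x * `|z x * z (x + t)|)) (- N) N <= _).
    have c1 : continuous (fun x => w x * `|z x * z (x + t)|).
      apply: contM => //; apply: cont_comp; last by apply: contM => //; exact: cont_sh.
      exact: ucont_cont ucont_abs.
    apply: itg_abs_le => //; first exact: contZ.
    move=> x _; rewrite /d normrM mulrA ler_wpM2r //.
    have a1 : w x <= 35 / 34 * w (x + t).
      by apply: w_shift; rewrite opprD addrA subrr sub0r normrN.
    have a2 : w (x + t) <= 35 / 34 * w x by apply: w_shift; rewrite addrAC subrr add0r.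
    by have := w_gt0 x; rewrite ler_norml => ?; apply/andP; split; lra_recent.
  rewrite itgZ; last first.
    apply: contM => //; apply: cont_comp; last by apply: contM => //; exact: cont_sh.
    exact: ucont_cont ucont_abs.
  by rewrite ler_pM2l; [exact: q_abs|lra].
have hb y : N - 2 <= `|y + t| -> `|h y| <= mu * (Z * Z).
  move=> hy; rewrite /h -mulrA normrM (ger0_norm (ltW (w_gt0 _))).
  by apply: ler_pM; rewrite ?w_ge0 ?wmu.
have h4 : mu * (Z * Z) * t <= mu * (Z * Z) * 2 by rewrite ler_wpM2l.
have h2 : `|itg h (N - t) N| <= mu * (Z * Z) * (N - (N - t)).
  apply: itg_bound => //; first lra.
  by move=> x /andP[hx _]; apply: hb; rewrite ger0_norm; lra_recent.
have h3 : `|itg h (- N - t) (- N)| <= mu * (Z * Z) * (- N - (- N - t)).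
  apply: itg_bound => //; first lra.
  by move=> x /andP[_ hx]; apply: hb; rewrite ler0_norm; lra_recent.
apply: le_trans (ler_normD _ _) _.
have := ler_normB (itg h (N - t) N) (itg h (- N - t) (- N)).
by have := J_ge0; lra_recent.
Qed.

Let q_cont : continuous q.
Proof.
move=> t; apply: itg_cont_param => //.
  by move=> y; apply: contM; [exact: contM|exact: cont_sh].
move=> e e0; have z0 := Z0; have Z1 : 0 < Z + 1 by lra.
have [r r0 Hr] := uz (divr_gt0 e0 Z1); exists r => // y s yt _.
have /Hr hh : `|s + y - (s + t)| < r by rewrite (_ : _ - _ = y - t) //; ring.
rewrite -mulrBr normrM normrM (ger0_norm (ltW (w_gt0 s))).
apply: le_trans (_ : 1 * Z * (e / (Z + 1)) <= _).
  apply: ler_pM => //; first by rewrite mulr_ge0 // w_ge0.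
  by apply: ler_pM; rewrite ?w_ge0.
rewrite mul1r mulrA ler_pdivrMr // mulrC ler_pM2l //; lra.
Qed.

Let pairing (k : R -> R) M d c : continuous k -> (forall s, 0 <= s <= 1 -> `|k s| <= M) ->
  itg (fun x => (w x * z x) * Tk k d c z x) (- N) N = itg (fun s => k s * q (d + c * s)) 0 1.
Proof.
move=> ck kM; have wz : bnd (1 * Z) (fun x => w x * z x).
  by move=> x; rewrite normrM ler_pM // ger0_norm ?w_ge0.
have uwz : ucont (fun x => w x * z x).
  apply: ucontM w_ucont uz => //; first by move=> x; rewrite ger0_norm ?w_ge0.
exact: (itg_fubini_term c d NN ck kM wz zZ uwz uz).
Qed.

Let q_aff d c : continuous (fun s => q (d + c * s)).
Proof. exact: cont_aff. Qed.

(** The even part of the kernel of [Bop] is [4 - 4 |s| (2 - |s|)] on [-1, 1],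
    whose negative part has mass [8/3 < 4]; the odd part is skew up to the slow
    variation of the weight. *)
Let energy_K :
  - (8 / 3 * (35 / 34 * J + 2 * (mu * (Z * Z)))) - 4 * (2 / 34 * J + 6 * (mu * (Z * Z)))
  <= itg (fun x => (w x * z x) * Kop 1 z x) (- N) N.
Proof.
have [nn [m0 j0]] := (N2, (mZ0, J_ge0)).
set A := 35 / 34 * J + _; set B := 2 / 34 * J + _.
have cT (k : R -> R) M d c : continuous k -> (forall s, 0 <= s <= 1 -> `|k s| <= M) ->
    continuous (fun x => (w x * z x) * Tk k d c z x).
  move=> ck kM; apply: contM; first exact: contM.
  exact: ucont_cont (Tk_ucont d c ck kM uz).
have ca := cT ka 8 0 1 cont_ka ka_le.
have cb := cT kb 3 0 (-1) cont_kb kb_le.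
have cc := cT kc 1 1 1 cont_kc kc_le.
have cd := cT kc 1 (-1) (-1) cont_kc kc_le.
rewrite (eq_itg (g := fun x => w x * z x * Tk ka 0 1 z x + w x * z x * Tk kb 0 (-1) z x
   + w x * z x * Tk kc 1 1 z x - w x * z x * Tk kc (-1) (-1) z x)); last first.
  by move=> x; rewrite /Kop; ring.
rewrite itgB //; last by apply: contD => //; exact: contD.
rewrite itgD //; last exact: contD.
rewrite itgD // (pairing _ _ cont_ka ka_le) (pairing _ _ cont_kb kb_le).
rewrite !(pairing _ _ cont_kc kc_le).
have ck (k : R -> R) d c : continuous k -> continuous (fun s => k s * q (d + c * s)).
  by move=> hk; apply: contM.
have [ea [eb [ec ed]]] := (ck ka 0 1 cont_ka, (ck kb 0 (-1) cont_kb, (ck kc 1 1 cont_kc, ck kc (-1) (-1) cont_kc))).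
rewrite -itgD // -itgD //; last exact: contD.
rewrite -itgB //; last by apply: contD => //; exact: contD.
(* The integral of [8 s - 4 s^2] over [0, 1] is 8/3; the factor 4 of [B] is the sum of the bounds 3
   of [kb] and 1 of [kc]. *)
have -> : - (8 / 3 * A) - 4 * B = itg (fun s => - A * (8 * s - 4 * (s * s)) - 4 * B) 0 1.
  have D : deriv (fun s : R => - A * (4 * (s * s) - 4 / 3 * (s * s * s)) - 4 * B * s)
                 (fun s => - A * (8 * s - 4 * (s * s)) - 4 * B).
    apply: deriv_eq (derivB (derivZ (- A) (derivB (derivZ 4 (derivM deriv_id deriv_id))
      (derivZ (4 / 3) (derivM (derivM deriv_id deriv_id) deriv_id))))
      (derivZ (4 * B) deriv_id)) _ => s /=; by field.
  by rewrite (itgE _ _ D); field.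
apply: itg_le => //.
- apply: contB; last exact: cont_cst.
  apply: contZ; apply: contB; [exact: contZ cont_id|exact: contZ cont_sq].
- by apply: contB => //; apply: contD => //; apply: contD.
move=> s /andP[s0 s1].
(* Since [ka + kb = 4 s^2 - 8 s], the sum splits into a multiple of [q s] and multiples of skew
   differences of [q]. *)
have E : ka s * q (0 + 1 * s) + kb s * q (0 + (-1) * s) + kc s * q (1 + 1 * s)
   - kc s * q (- 1 + (-1) * s) =
   (4 * (s * s) - 8 * s) * q s - kb s * (q s - q (- s)) + kc s * (q (1 + s) - q (- (1 + s))).
  rewrite !add0r !mul1r !mulN1r -opprD /ka /kb; ring.
rewrite E.
have h1 : `|q s| <= A by apply: q_le; rewrite ger0_norm; lra_recent.
have h2 : `|q s - q (- s)| <= B by apply: q_skew; lra_recent.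
have h3 : `|q (1 + s) - q (- (1 + s))| <= B by apply: q_skew; lra_recent.
have b0 : `|kb s * (q s - q (- s))| <= 3 * B.
  by rewrite normrM ler_pM // kb_le // s0.
have c0 : `|kc s * (q (1 + s) - q (- (1 + s)))| <= 1 * B.
  by rewrite normrM ler_pM // kc_le // s0.
have a0 : `|(8 * s - 4 * (s * s)) * q s| <= (8 * s - 4 * (s * s)) * A.
  have p : 0 <= 8 * s - 4 * (s * s) by nra.
  by rewrite normrM (ger0_norm p) ler_wpM2l.
move: a0 b0 c0; rewrite !ler_norml => /andP[? ?] /andP[? ?] /andP[? ?]; lra_recent.
Qed.

Let w140 x : R := expR (- (`|x| / 140)).

(** The gap [4 - 8/3 * 35/34 - 8/34] exceeds 1, and Young's inequality spends 1/2 of it. The data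
    may grow at the rate 1/280: its square grows at the rate 1/140, half the decay of [w], and
    leaves [w140]. Uniformity in [t] holds because [t] only multiplies a negative lower bound. *)
Lemma energy_estimate t L : 0 <= t <= 1 ->
  (forall x, `|Bt t 1 z x| <= L * expR (`|x| / 280)) ->
  J <= 2 * (L * L * itg w140 (- N) N) + 100 * (mu * (Z * Z)).
Proof.
have [nn [m0 j0]] := (N2, (mZ0, J_ge0)).
move=> /andP[t0 t1] BL.
have cK : continuous (Kop 1 z) by exact: ucont_cont (Kop_ucont _ uz).
have cwz : continuous (fun x => w x * z x) by exact: contM.
have cB : continuous (Bt t 1 z) by apply: contD; apply: contZ.
have c140 : continuous w140.
  apply: (@cont_comp _ expR (fun x : R => - (`|x| / 140))); first exact: continuous_expR.
  apply: contN; apply: contM; last exact: cont_cst.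
  exact: ucont_cont ucont_abs.
have h1 : itg (fun x => (w x * z x) * Bt t 1 z x) (- N) N =
   4 * J + t * itg (fun x => (w x * z x) * Kop 1 z x) (- N) N.
  rewrite -!itgZ //; last exact: contM.
  rewrite -itgD; [|exact: contZ|by apply: contZ; exact: contM].
  by apply: eq_itg => x; rewrite /Bt /W; ring.
have h2 : itg (fun x => (w x * z x) * Bt t 1 z x) (- N) N <=
   1 / 2 * J + 1 / 2 * (L * L * itg w140 (- N) N).
  rewrite -!itgZ // -?itgD //; try exact: contZ; last by apply: contZ; exact: contZ.
  apply: itg_le => //; first exact: contM.
    by apply: contD; apply: contZ => //; exact: contZ.
  move=> x _; rewrite /W.
  have E : w140 x = w x * (expR (`|x| / 280) * expR (`|x| / 280)).
    by rewrite /w140 /w -!expRD; congr expR; field.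
  have : z x * Bt t 1 z x <= 1 / 2 * (z x * z x) +
      1 / 2 * (L * L * (expR (`|x| / 280) * expR (`|x| / 280))).
    have := sqr_ge0 (z x - Bt t 1 z x); rewrite expr2.
    have : Bt t 1 z x * Bt t 1 z x <= (L * expR (`|x| / 280)) * (L * expR (`|x| / 280)).
      have := BL x; rewrite ler_norml => /andP[b1 b2].
      by have := mulr_ge0 (_ : 0 <= L * expR (`|x| / 280) - Bt t 1 z x)
        (_ : 0 <= L * expR (`|x| / 280) + Bt t 1 z x); lra_recent.
    lra_recent.
  by move=> /(ler_wpM2l (w_ge0 x)); rewrite E; lra_recent.
have h3 := energy_K.
have h4 : t * (- (8 / 3 * (35 / 34 * J + 2 * (mu * (Z * Z)))) - 4 * (2 / 34 * J + 6 * (mu * (Z * Z))))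
   <= t * itg (fun x => w x * z x * Kop 1 z x) (- N) N by rewrite ler_wpM2l.
have h5 : 1 * (- (8 / 3 * (35 / 34 * J + 2 * (mu * (Z * Z)))) - 4 * (2 / 34 * J + 6 * (mu * (Z * Z)))) <=
  t * (- (8 / 3 * (35 / 34 * J + 2 * (mu * (Z * Z)))) - 4 * (2 / 34 * J + 6 * (mu * (Z * Z)))).
  by rewrite ler_wnM2r //; lra_recent.
have WN : 0 <= L * L * itg w140 (- N) N.
  by rewrite mulr_ge0 -?expr2 ?sqr_ge0 //; apply: itg_ge0 => // x _; rewrite expR_ge0.
lra_recent.
Qed.

Lemma local_mass a b : - 2 <= a -> a <= b -> b <= 2 ->
  itg (fun x => z x * z x) a b <= 35 / 34 * J.
Proof.
have [nn [m0 j0]] := (N2, (mZ0, J_ge0)).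
move=> a2 ab b2; apply: (@le_trans _ _ (itg (fun x => 35 / 34 * W x) a b)).
  apply: itg_le => //; [exact: contM|exact: contZ|].
  move=> x hx; rewrite /W [35 / 34 * _]mulrA -{1}[z x * z x]mul1r ler_wpM2r -?expr2 ?sqr_ge0 //.
  have := @w_shift 0 x; rewrite sub0r normrN /w normr0 mul0r oppr0 expR0; apply.
  by rewrite ler_norml; lra.
rewrite itgZ // ler_pM2l; last lra.
by apply: itg_subset => //; lra.
Qed.

End Energy.

(** * A contraction principle for weighted sup distances *)

Section FixedPoint.
Context {R : realType}.

(** The domain [X] is arbitrary so that a function and a scalar can be packed into one function on
    [option R]. The class [S] has to be closed under limits uniform relative to the weight. *)
Lemma contraction_fixpoint (X : Type) (w : X -> R) (Phi : (X -> R) -> X -> R)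
    (S : (X -> R) -> Prop) (f0 : X -> R) (theta D0 : R) :
  0 <= theta < 1 -> (forall x, 0 <= w x) -> S f0 -> (forall f, S f -> S (Phi f)) ->
  (forall f g D, S f -> S g -> 0 <= D -> (forall x, `|f x - g x| <= D * w x) ->
    forall x, `|Phi f x - Phi g x| <= theta * D * w x) ->
  0 <= D0 -> (forall x, `|Phi f0 x - f0 x| <= D0 * w x) ->
  (forall u f, (forall n : nat, S (u n)) ->
    (forall e, 0 < e -> exists n, forall x, `|u n x - f x| <= e * w x) -> S f) ->
  exists2 f, S f & Phi f =1 f.
Proof.
move=> /andP[th0 th1] w0 S0 SPhi PhiL D00 HD0 Scl.
pose u n := iter n Phi f0.
have Su n : S (u n) by elim: n => //= n; exact: SPhi.
have du n x : `|u n.+1 x - u n x| <= theta ^+ n * D0 * w x.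
  elim: n x => [|n IH] x; first by rewrite expr0 mul1r; exact: HD0.
  rewrite (_ : theta ^+ n.+1 * D0 * w x = theta * (theta ^+ n * D0) * w x); last first.
    by rewrite exprS; ring.
  by apply: (PhiL _ _ _ (Su n.+1) (Su n)) => //; rewrite mulr_ge0 // exprn_ge0.
have th1' : 0 < 1 - theta by lra.
pose K := D0 / (1 - theta).
have K0 : 0 <= K by rewrite divr_ge0 // ltW.
have KE : D0 = K * (1 - theta) by rewrite /K divfK // gt_eqF.
have dun n m x : `|u (n + m)%N x - u n x| <= theta ^+ n * (1 - theta ^+ m) * K * w x.
  elim: m => [|m IH]; first by rewrite addn0 subrr normr0 expr0 subrr mulr0 !mul0r.
  rewrite addnS; have := du (n + m)%N x; rewrite exprD KE.
  have := ler_distD (u (n + m)%N x) (u (n + m).+1 x) (u n x).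
  by rewrite exprS; lra.
have thK n x : 0 <= theta ^+ n * K * w x by rewrite mulr_ge0 // mulr_ge0 // exprn_ge0.
have dunm n m x : (n <= m)%N -> `|u m x - u n x| <= theta ^+ n * K * w x.
  move=> /subnKC <-; apply: le_trans (dun _ _ _) _.
  rewrite mulrBr mulr1 -exprD !mulrBl lerBlDr lerDl; exact: thK.
(* The limit is taken pointwise, as the supremum of the left ends of the intervals of radius
   [theta ^+ n * K * w x] around [u n x]; [key] says that every left end lies below every right
   end. *)
pose f x := sup [set u n x - theta ^+ n * K * w x | n in [set: nat]].
have key n m x : u m x - theta ^+ m * K * w x <= u n x + theta ^+ n * K * w x.
  have [nm|/ltnW mn] := leqP n m.
    by have := dunm _ _ x nm; have := thK m x; rewrite ler_norml => ? /andP[? ?]; lra_local.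
  by have := dunm _ _ x mn; have := thK n x; rewrite ler_norml => ? /andP[? ?]; lra_local.
have fu n x : `|u n x - f x| <= theta ^+ n * K * w x.
  have hs : has_ubound [set u n x - theta ^+ n * K * w x | n in [set: nat]].
    by exists (u n x + theta ^+ n * K * w x) => _ [m _ <-]; exact: key.
  have h1 : u n x - theta ^+ n * K * w x <= f x by apply: ub_le_sup => //; exists n.
  have h2 : f x <= u n x + theta ^+ n * K * w x.
    apply: ge_sup; first by exists (u 0%N x - theta ^+ 0 * K * w x); exists 0%N.
    by move=> _ [m _ <-]; exact: key.
  by rewrite ler_norml; apply/andP; split; lra_local.
have small e : 0 < e -> exists n, theta ^+ n * K <= e.
  move=> e0; have K1 : 0 < K + 1 by lra_local.
  have : theta ^+ n @[n --> \oo] --> (0 : R) by apply: cvg_expr; rewrite ger0_norm.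
  move=> /cvgrPdist_le /(_ _ (divr_gt0 e0 K1)) [n _ /(_ n (leqnn n))] /=.
  rewrite sub0r normrN ger0_norm ?exprn_ge0 // => h; exists n.
  apply: le_trans (ler_wpM2r K0 h) _.
  by rewrite mulrAC ler_pdivrMr // ler_pM2l //; lra_local.
have Sf : S f.
  apply: (Scl u) => // e /small[n hn]; exists n => x.
  by apply: le_trans (fu n x) _; rewrite ler_wpM2r.
exists f => // x; apply/eqP; rewrite -subr_eq0 -normr_le0.
apply/ler_addgt0Pr => e e0; rewrite add0r.
have w1 : 0 < 2 * (w x + 1) by have := w0 x; lra_local.
have [n hn] := small _ (divr_gt0 e0 w1).
have h1 := fu n.+1 x.
have h2 := PhiL _ _ (theta ^+ n * K) Sf (Su n) (mulr_ge0 (exprn_ge0 _ th0) K0) _ x.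
have {h2} : `|Phi f x - Phi (u n) x| <= theta * (theta ^+ n * K) * w x.
  by apply: h2 => y; rewrite distrC; exact: fu.
have := ler_distD (u n.+1 x) (Phi f x) (f x).
have h3 : theta * (theta ^+ n * K) * w x <= theta ^+ n * K * w x.
  by rewrite -mulrA -[X in _ <= X]mul1r ler_wpM2r // ltW.
have {}h1 : `|Phi (u n) x - f x| <= theta * (theta ^+ n * K) * w x.
  by rewrite (_ : _ * _ * _ = theta ^+ n.+1 * K * w x) // exprS; ring.
have h4 : theta ^+ n * K * w x <= e / 2.
  apply: le_trans (ler_wpM2r (w0 x) hn) _.
  rewrite invfM mulrA mulrAC ler_pdivrMr; last by have := w0 x; lra_local.
  by rewrite ler_wpM2l //; have := w0 x; lra_local.
move: h1 h3 h4; rewrite /u /=; lra_local.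
Qed.

End FixedPoint.

(** * Inversion of the averaging operator *)

Section Inverse.
Context {R : realType}.
Implicit Types (f g h z w : R -> R) (c d e x y t s k L M N : R).

(** Bounded uniformly continuous functions: the class is stable under products, translates, averages
    and uniform limits, and it is the class on which the averaging operator is inverted. *)
Definition bu f := ucont f /\ exists M, bnd M f.

Lemma bu_cont f : bu f -> continuous f.
Proof. by move=> [/ucont_cont]. Qed.

Lemma buD f g : bu f -> bu g -> bu (fun x => f x + g x).
Proof.
move=> [uf [M fM]] [ug [N gN]]; split; first exact: ucontD.
by exists (M + N) => x; apply: le_trans (ler_normD _ _) _; apply: lerD.
Qed.

Lemma buM f g : bu f -> bu g -> bu (fun x => f x * g x).
Proof.
move=> [uf [M fM]] [ug [N gN]]; split; first exact: ucontM fM gN _ _.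
by exists (M * N) => x; rewrite normrM; apply: ler_pM.
Qed.

Lemma bu_cst a : bu (fun=> a).
Proof. by split; [exact: ucont_cst|exists `|a| => x]. Qed.

Lemma buZ a f : bu f -> bu (fun x => a * f x).
Proof. by apply: buM; exact: bu_cst. Qed.

Lemma buB f g : bu f -> bu g -> bu (fun x => f x - g x).
Proof.
move=> bf bg; rewrite (_ : (fun _ => _) = (fun x => f x + (-1) * g x)).
  by apply: buD => //; exact: buZ.
by apply/funext => x; ring.
Qed.

Lemma bu_aff a b f : bu f -> bu (fun x => f (a + b * x)).
Proof. by move=> [uf [M fM]]; split; [exact: ucont_aff|exists M => x]. Qed.

Lemma bu_Kop e f : bu f -> bu (Kop e f).
Proof.
move=> [uf [M fM]]; split; first exact: Kop_ucont.
by exists (13 * M) => x; apply: Kop_le => //; exact: ucont_cont.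
Qed.

Lemma bu_Bop e f : bu f -> bu (Bop e f).
Proof. by move=> bf; apply: buD; [exact: buZ|exact: bu_Kop]. Qed.

Lemma itg_exp_abs k N : 0 < k -> 0 <= N ->
  itg (fun x : R => expR (- (`|x| / k))) (- N) N <= 2 * k.
Proof.
move=> k0 N0; have kn : k != 0 by rewrite gt_eqF.
have cE a : continuous (fun x : R => expR (a * x)).
  by apply: (@cont_comp _ expR); [exact: continuous_expR|exact: contZ cont_id].
have cA : continuous (fun x : R => expR (- (`|x| / k))).
  apply: (@cont_comp _ expR (fun x : R => - (`|x| / k))); first exact: continuous_expR.
  apply: contN; apply: contM; last exact: cont_cst.
  exact: ucont_cont ucont_abs.
have D a : deriv (fun x : R => expR (a * x)) (fun x => a * expR (a * x)).
  apply: deriv_eq (deriv_comp (fun x => is_derive_expR x) (derivZ a deriv_id)) _ => x.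
  by rewrite mulr1 mulrC.
have I a x y : a != 0 -> itg (fun x : R => expR (a * x)) x y = a^-1 * (expR (a * y) - expR (a * x)).
  move=> a0; rewrite mulrBr; apply: (@itgE _ (fun x => a^-1 * expR (a * x))).
  by apply: deriv_eq (derivZ _ (D a)) _ => u; rewrite mulrA mulVf // mul1r.
rewrite -(itg_cat _ _ 0).
have h1 : itg (fun x : R => expR (- (`|x| / k))) (- N) 0 <= k.
  apply: le_trans (_ : itg (fun x : R => expR (k^-1 * x)) (- N) 0 <= _).
    apply: itg_le => //; first lra.
    by move=> x /andP[_ x0]; rewrite ler0_norm // mulNr opprK mulrC.
  rewrite I ?invr_neq0 // invrK mulr0 expR0.
  rewrite -[X in _ <= X]mulr1; apply: ler_wpM2l; first exact: ltW.
  by have := expR_ge0 (k^-1 * - N); lra.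
have h2 : itg (fun x : R => expR (- (`|x| / k))) 0 N <= k.
  apply: le_trans (_ : itg (fun x : R => expR ((- k^-1) * x)) 0 N <= _).
    by apply: itg_le => // x /andP[x0 _]; rewrite ger0_norm // mulNr mulrC.
  rewrite I ?oppr_eq0 ?invr_neq0 // invrN invrK mulr0 expR0 mulNr -mulrN.
  rewrite -[X in _ <= X]mulr1; apply: ler_wpM2l; first exact: ltW.
  by have := expR_ge0 (- k^-1 * N); lra.
lra.
Qed.

(** The truncation is removed by letting [mu] tend to 0; what remains is [2 * 280 * 35/34], below
    600. *)
Lemma mass_estimate t z L a b : 0 <= t <= 1 -> bu z ->
  (forall x, `|Bt t 1 z x| <= L * expR (`|x| / 280)) ->
  - 2 <= a -> a <= b -> b <= 2 ->
  itg (fun x => z x * z x) a b <= 600 * (L * L).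
Proof.
move=> t01 [uz [Z zZ]] BL a2 ab b2.
have Z0 := bnd_ge0 zZ.
have ZZ : 0 <= Z * Z by rewrite mulr_ge0.
have LL : 0 <= L * L by rewrite -expr2 sqr_ge0.
apply/ler_addgt0Pr => e e0.
have T0 : 0 < 1000 * (Z * Z + 1) by lra.
pose mu := e / (1000 * (Z * Z + 1)).
have mu0 : 0 < mu by exact: divr_gt0.
have muE : mu * (1000 * (Z * Z + 1)) = e := divfK (lt0r_neq0 T0) e.
(* Chosen by [1 + x <= exp x], which makes [exp (- |x| / 70) <= mu] for [|x| >= 70 / mu]. *)
pose N := 2 + 70 / mu.
have N2 : 2 <= N by rewrite /N lerDl divr_ge0 // ltW.
have wmu x : N - 2 <= `|x| -> expR (- (`|x| / 70)) <= mu.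
  rewrite /N addrAC subrr add0r => hx.
  have h : mu^-1 <= expR (`|x| / 70).
    apply: le_trans (expR_ge1Dx _).
    suff : 70 * mu^-1 <= `|x| by lra_local.
    exact: hx.
  by rewrite expRN -[mu]invrK lef_pV2 ?posrE ?invr_gt0 // expR_gt0.
have h1 := energy_estimate zZ uz N2 (ltW mu0) wmu t01 BL.
have h2 := local_mass zZ uz N2 (ltW mu0) a2 ab b2.
have h3 : itg (fun x : R => expR (- (`|x| / 140))) (- N) N <= 2 * 140.
  by apply: itg_exp_abs => //; lra_local.
have h4 := ler_wpM2l LL h3.
have h5 : 0 <= mu * (Z * Z) by rewrite mulr_ge0 // ltW.
move: h1 h2; set J := itg _ (- N) N; set I := itg _ a b => h1 h2.
move: h1 h2 h3 h4 h5 mu0 LL; lra_local.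
Qed.

(** The equation itself converts local mass into a pointwise bound: [4 z 0] is the datum minus
    averages of [z], and the averages are controlled by the mass on [-2, 2]. Numerically
    [(1 + 13 * 301) / 4 <= 1000]. *)
Lemma Bt_apriori0 t z L : 0 <= t <= 1 -> bu z -> 0 < L ->
  (forall x, `|Bt t 1 z x| <= L * expR (`|x| / 280)) -> `|z 0| <= 1000 * L.
Proof.
move=> /[dup] t01 /andP[t0 t1] bz L0 BL; have cz := bu_cont bz.
have mass := mass_estimate t01 bz BL.
have Tle (k : R -> R) M d c : continuous k -> (forall s : R, 0 <= s <= 1 -> `|k s| <= M) ->
    (c = 1 /\ -2 <= d <= 1) \/ (c = -1 /\ -1 <= d <= 2) ->
    `|Tk k d c z 0| <= M * (301 * L).
  move=> ck kM dc.
  have M0 : 0 <= M by apply: le_trans (kM 0 _) => //; rewrite lexx ler01.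
  have cz1 : continuous (fun s => z (d + c * s)) by exact: cont_aff.
  have m : itg (fun s => z (d + c * s) * z (d + c * s)) 0 1 <= 600 * (L * L).
    have E := @itg_aff _ (fun x => z x * z x) d c 0 1 (contM cz cz).
    set X := itg _ 0 1 in E *; set Y := itg _ _ _ in E.
    case: dc => [[hc hd]|[hc hd]].
      have -> : X = Y by rewrite -E [c in _ * c]hc mulr1.
      rewrite /Y hc; apply: mass; lra_local.
    have -> : X = - Y by rewrite -E [c in _ * c]hc mulrN1 opprK.
    rewrite /Y hc -itg_swap; apply: mass; lra_local.
  (* The inequality [|v| <= v^2 / (2 L) + L / 2] plays the part of Cauchy-Schwarz; its two terms
     contribute [300 L] and [L / 2]. *)
  rewrite /Tk; apply: le_trans (_ : itg (fun s => M * (1 / (2 * L) * (z (d + c * s) * z (d + c * s)) + L / 2)) 0 1 <= _).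
    apply: itg_abs_le => //.
    - by apply: contM => //; exact: cont_transl.
    - apply: contZ; apply: contD; last exact: cont_cst.
      by apply: contZ; exact: contM.
    move=> s hs; rewrite add0r normrM; apply: ler_pM => //; first exact: kM.
    set v := z _.
    have -> : 1 / (2 * L) * (v * v) + L / 2 = (v * v + L * L) / (2 * L) by field; rewrite gt_eqF.
    rewrite ler_pdivlMr; last lra_local.
    have := sqr_ge0 (v - L); have := sqr_ge0 (v + L); rewrite !expr2 => p1 p2.
    by rewrite mulrC; have [q|q] := leP 0 v; [rewrite ger0_norm|rewrite ltr0_norm]; lra_local.
  rewrite itgZ; last first.
    apply: contD; last exact: cont_cst.
    by apply: contZ; exact: contM.
  rewrite ler_wpM2l // itgD ?itg_cst ?itgZ //; last exact: cont_cst.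
  - have h : 1 / (2 * L) * itg (fun s => z (d + c * s) * z (d + c * s)) 0 1 <= 300 * L.
      have -> : 300 * L = 1 / (2 * L) * (600 * (L * L)) by field; rewrite gt_eqF.
      by rewrite ler_wpM2l // divr_ge0 //; lra_local.
    lra_local.
  - exact: contM.
  - by apply: contZ; exact: contM.
have l1 : `|Tk ka 0 1 z 0| <= 8 * (301 * L) by apply: Tle cont_ka ka_le _; left; split; lra_local.
have l2 : `|Tk kb 0 (-1) z 0| <= 3 * (301 * L) by apply: Tle cont_kb kb_le _; right; split; lra_local.
have l3 : `|Tk kc 1 1 z 0| <= 1 * (301 * L) by apply: Tle cont_kc kc_le _; left; split; lra_local.
have l4 : `|Tk kc (-1) (-1) z 0| <= 1 * (301 * L) by apply: Tle cont_kc kc_le _; right; split; lra_local.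
have := BL 0; rewrite normr0 mul0r expR0 mulr1 /Bt => hB.
have hK : `|t * Kop 1 z 0| <= 1 * (13 * (301 * L)).
  rewrite normrM (ger0_norm t0); apply: ler_pM => //.
  move: l1 l2 l3 l4; rewrite /Kop !ler_norml => /andP[d1 u1] /andP[d2 u2] /andP[d3 u3] /andP[d4 u4].
  by apply/andP; split; move: d1 d2 d3 d4 u1 u2 u3 u4; clear; lra.
move: hB hK; rewrite !ler_norml => /andP[b1 b2] /andP[k1 k2].
by apply/andP; split; move: b1 b2 k1 k2 L0; clear; lra.
Qed.

Lemma Bt_aff t e z a b x : Bt t e (fun y => z (a + b * y)) x = Bt t (b * e) z (a + b * x).
Proof. by rewrite /Bt Kop_aff. Qed.

(** Translation to [x0] and scaling by [e] reduce to [Bt_apriori0]. The growth allowed away from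
    [x0] becomes [1 / (280 e)], which for small [e] exceeds that of any weight varying on the scale
    1. *)
Lemma Bt_apriori t e z L x0 : 0 <= t <= 1 -> 0 < e -> bu z -> 0 < L ->
  (forall x, `|Bt t e z x| <= L * expR (`|x - x0| / (280 * e))) -> `|z x0| <= 1000 * L.
Proof.
move=> t01 e0 bz L0 BL.
have := @Bt_apriori0 t (fun y => z (x0 + e * y)) L t01 (bu_aff _ _ bz) L0.
rewrite mulr0 addr0; apply => x; rewrite Bt_aff mulr1.
apply: le_trans (BL _) _; rewrite addrAC subrr add0r normrM (gtr0_norm e0).
by rewrite (_ : e * `|x| / (280 * e) = `|x| / 280) //; field; rewrite gt_eqF.
Qed.

Lemma Bt_bound t z L : 0 <= t <= 1 -> bu z -> bnd L (Bt t 1 z) -> bnd (1000 * L) z.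
Proof.
move=> t01 bz BL x; have L0 := bnd_ge0 BL.
apply/ler_addgt0Pr => e e0.
have -> : 1000 * L + e = 1000 * (L + e / 1000) by field.
apply: (Bt_apriori t01 ltr01 bz); first lra.
move=> y; apply: le_trans (BL y) _; apply: le_trans (_ : (L + e / 1000) * 1 <= _); first lra.
apply: ler_wpM2l; first lra.
by rewrite -[X in X <= _]expR0 ler_expR; apply: divr_ge0; [exact: normr_ge0|lra].
Qed.

Lemma Bt_inj t z1 z2 : 0 <= t <= 1 -> bu z1 -> bu z2 -> Bt t 1 z1 =1 Bt t 1 z2 -> z1 =1 z2.
Proof.
move=> t01 b1 b2 E x.
have : bnd (1000 * 0) (fun x => z1 x - z2 x).
  apply: (Bt_bound t01); first exact: buB.
  move=> y; have := E y; rewrite /Bt KopB; [|exact: bu_cont|exact: bu_cont] => Ey.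
  by rewrite (_ : _ + _ = 0) ?normr0 //; lra.
by move=> /(_ x); rewrite mulr0 normr_le0 subr_eq0 => /eqP.
Qed.

(** Method of continuity along [Bt t], starting from [Bt 0 = 4]. *)
Lemma Bt_step t (h : R) : 0 <= t -> 0 <= h -> t + h <= 1 -> h * (1000 * 26) <= 1 ->
  (forall f, bu f -> exists2 z, bu z & Bt t 1 z =1 f) ->
  (forall f, bu f -> exists2 z, bu z & Bt (t + h) 1 z =1 f).
Proof.
move=> t0 h0 th1 hs solve f bf.
have t01 : 0 <= t <= 1 by lra.
pose S f := xget (fun=> 0) [set z | bu z /\ Bt t 1 z =1 f].
have SP g : bu g -> bu (S g) /\ Bt t 1 (S g) =1 g.
  move=> bg; rewrite /S; case: xgetP => [z -> //|nz].
  by have [z bz Bz] := solve g bg; case: (nz z).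
(* The equation at [t + h] is the equation at [t] with [h * Kop] moved to the right; the bounds 1000
   of the inverse and 13 of [Kop] give the ratio 1/2 as soon as [26000 h <= 1]. *)
pose Phi z := S (fun x => f x - h * Kop 1 z x).
have bg z : bu z -> bu (fun x => f x - h * Kop 1 z x).
  by move=> bz; apply: buB => //; apply: buZ; exact: bu_Kop.
have bPhi z : bu z -> bu (Phi z) by move=> bz; have [] := SP _ (bg z bz).
have [M0 HM0] : exists M, bnd M (fun x => Phi (fun=> 0) x - 0).
  by have [_ [M hM]] := buB (bPhi _ (bu_cst 0)) (bu_cst 0); exists M.
have := @contraction_fixpoint R R (fun=> 1) Phi bu (fun=> 0) (1 / 2) M0.
case.
- lra.
- by [].
- exact: bu_cst.
- exact: bPhi.
- move=> z1 z2 D b1 b2 D0 HD x; rewrite mulr1.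
  have : bnd (1000 * (h * (13 * D))) (fun x => Phi z1 x - Phi z2 x).
    apply: (Bt_bound t01); first by apply: buB; exact: bPhi.
    move=> y.
    have -> : Bt t 1 (fun x => Phi z1 x - Phi z2 x) y = h * Kop 1 (fun x => z2 x - z1 x) y.
      have E z : bu z -> Bt t 1 (Phi z) y = f y - h * Kop 1 z y.
        by move=> bz; have [_ ->] := SP _ (bg z bz).
      move: (E z1 b1) (E z2 b2); rewrite /Bt !KopB; try (by apply: bu_cont; exact: bPhi); try exact: bu_cont.
      lra_local.
    rewrite normrM (ger0_norm h0) ler_wpM2l // Kop_le //.
      by apply: contB; exact: bu_cont.
    by move=> u _; rewrite distrC; have := HD u; rewrite mulr1.
  move=> /(_ x) /le_trans; apply.
  by have := ler_wpM2r D0 hs; lra.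
- exact: bnd_ge0 HM0.
- by move=> x; rewrite mulr1; exact: HM0.
- move=> u g bu_u H; split.
    by apply: (@ucont_lim _ _ u) => [n|e e0]; [case: (bu_u n)|have [n Hn] := H e e0; exists n => x; have := Hn x; rewrite mulr1].
  have [n Hn] := H 1 ltr01; have [_ [M hM]] := bu_u n.
  exists (M + 1) => x; have := Hn x; have := hM x; rewrite mulr1 !ler_norml.
  by move=> /andP[? ?] /andP[? ?]; apply/andP; split; lra_local.
move=> z bz Pz; exists z => // x.
have [_ /(_ x)] := SP _ (bg z bz).
rewrite -/(Phi z) (_ : Phi z = z); last exact/funext.
rewrite /Bt; lra.
Qed.

Lemma nat_ge (X : R) : exists n : nat, X <= n%:R.
Proof.
exists (Num.bound `|X|); apply: le_trans (ler_norm X) _.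
by rewrite ltW // archi_boundP.
Qed.

Lemma Bop_solve1 f : bu f -> exists2 z, bu z & Bop 1 z =1 f.
Proof.
(* The admissible step does not depend on [t], so [n] steps of length [1 / n] lead from 0 to 1. *)
have [n hn] := nat_ge (1000 * 26).
have n0 : 0 < n%:R :> R by lra.
have H m : (m <= n)%N -> forall f, bu f -> exists2 z, bu z & Bt (m%:R / n%:R) 1 z =1 f.
  elim: m => [_ g bg|m IH mn].
    exists (fun x => 4^-1 * g x); first exact: buZ.
    by move=> x; rewrite /Bt !mul0r addr0 mulrA divff ?mul1r.
  have -> : m.+1%:R / n%:R = m%:R / n%:R + 1 / n%:R :> R by rewrite -mulrDl natr1.
  apply: Bt_step; last by apply: IH; exact: ltnW.
  - by rewrite divr_ge0 // ler0n.
  - by rewrite divr_ge0.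
  - by rewrite -mulrDl natr1 ler_pdivrMr // mul1r ler_nat.
  - by rewrite mulrAC mul1r ler_pdivrMr // mul1r.
move=> bf; have [z bz Bz] := H n (leqnn n) f bf.
by exists z => // x; rewrite -Bz divff ?gt_eqF // Bt1.
Qed.

Lemma Bop_solve e f : 0 < e -> bu f -> exists2 z, bu z & Bop e z =1 f.
Proof.
move=> e0 bf; have [z bz Bz] := Bop_solve1 (bu_aff 0 e bf).
exists (fun x => z (0 + e^-1 * x)); first exact: bu_aff.
move=> x; rewrite -Bt1 Bt_aff mulVf ?gt_eqF // Bt1 Bz !add0r mulrA divff ?gt_eqF // mul1r //.
Qed.

Lemma Bop_inj e z1 z2 : 0 < e -> bu z1 -> bu z2 -> Bop e z1 =1 Bop e z2 -> z1 =1 z2.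
Proof.
move=> e0 b1 b2 E x.
have t01 : 0 <= (1 : R) <= 1 by rewrite ler01 lexx.
have H := Bt_inj t01 (bu_aff 0 e b1) (bu_aff 0 e b2).
have := H _ (e^-1 * x); rewrite add0r mulrA divff ?gt_eqF // mul1r; apply=> y.
by rewrite !Bt_aff mulr1 !Bt1 E.
Qed.

(** [Bop_inj] makes the solution unique within [bu], so membership is part of the choice. *)
Definition Bi e f := xget (fun=> 0) [set z | bu z /\ Bop e z =1 f].

Lemma Bi_spec e f : 0 < e -> bu f -> bu (Bi e f) /\ Bop e (Bi e f) =1 f.
Proof.
move=> e0 bf; rewrite /Bi; case: xgetP => [z -> //|nz].
by have [z bz Bz] := Bop_solve e0 bf; case: (nz z).
Qed.

Lemma bu_Bi e f : 0 < e -> bu f -> bu (Bi e f).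
Proof. by move=> e0 /(Bi_spec e0)[]. Qed.

Lemma BiK e f : 0 < e -> bu f -> Bop e (Bi e f) =1 f.
Proof. by move=> e0 /(Bi_spec e0)[]. Qed.

Lemma BopK e z : 0 < e -> bu z -> Bi e (Bop e z) =1 z.
Proof.
move=> e0 bz; have bB := bu_Bop e bz.
by apply: (Bop_inj e0 _ bz) => //; [exact: bu_Bi|exact: BiK].
Qed.

Lemma BiB e f g x : 0 < e -> bu f -> bu g -> Bi e (fun y => f y - g y) x = Bi e f x - Bi e g x.
Proof.
move=> e0 bf bg; apply: (Bop_inj e0 _ (buB (bu_Bi e0 bf) (bu_Bi e0 bg))).
  exact: bu_Bi (buB _ _).
move=> y; rewrite BiK //; last exact: buB.
by rewrite BopB ?BiK //; apply: bu_cont; exact: bu_Bi.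
Qed.

(** The logarithm of the weight is [k]-Lipschitz. *)
Definition slow k w := (forall x, 0 < w x) /\ forall x y, w y <= expR (k * `|y - x|) * w x.

(** Seen from [x0], a slow weight is at most [w x0 * exp (k |x - x0|)], within the growth that
    [Bt_apriori] tolerates. Thus the inverse is bounded uniformly in [e] for every such weight at
    once. The additional [r] serves to make the constant positive. *)
Lemma Bi_slow e k w f L : 0 < e -> 280 * e * k <= 1 -> slow k w -> bu f ->
  0 <= L -> (forall x, `|f x| <= L * w x) -> forall x, `|Bi e f x| <= 1000 * L * w x.
Proof.
move=> e0 ek [w0 wk] bf L0 fL x0; have bB := bu_Bi e0 bf.
apply/ler_addgt0Pr => r r0.
have wx := w0 x0.
have -> : 1000 * L * w x0 + r = 1000 * (L * w x0 + r / 1000) by field.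
have p : 0 <= L * w x0 by rewrite mulr_ge0 // ltW.
have t01 : 0 <= (1 : R) <= 1 by rewrite ler01 lexx.
apply: (Bt_apriori t01 e0 bB); first lra.
move=> x; rewrite Bt1 BiK //; apply: le_trans (fL x) _.
apply: le_trans (ler_wpM2l L0 (wk x0 x)) _.
have h : expR (k * `|x - x0|) <= expR (`|x - x0| / (280 * e)).
  rewrite ler_expR ler_pdivlMr; last by lra.
  have := normr_ge0 (x - x0); nra.
have := ler_wpM2l p h.
have : 0 <= r / 1000 * expR (`|x - x0| / (280 * e)).
  by apply: mulr_ge0; [lra|exact: expR_ge0].
lra.
Qed.

End Inverse.

(** * The soliton and the Green kernel of its linearisation *)

Section HyperbolicFunctions.
Context {R : realType}.
Implicit Types (x y s : R).

Definition Ech x : R := expR x + expR (- x).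
Definition th x : R := (expR x - expR (- x)) / Ech x.
Definition sq x : R := sech x ^+ 2.

Lemma Ech_gt0 x : 0 < Ech x.
Proof. by rewrite addr_gt0 // expR_gt0. Qed.

Lemma deriv_expN : deriv (fun x : R => expR (- x)) (fun x => - expR (- x)).
Proof.
apply: deriv_eq (deriv_comp (fun x => is_derive_expR x) (derivN deriv_id)) _ => x.
by rewrite mulrN1.
Qed.

Lemma deriv_exp : deriv (@expR R) expR.
Proof. by move=> x; exact: is_derive_expR. Qed.

Lemma derivV F f : (forall x : R, F x != 0) -> deriv F f ->
  deriv (fun x => (F x)^-1) (fun x => - f x / F x ^+ 2).
Proof.
move=> F0 Ff x; apply: is_derive_eq; first exact: (is_deriveV (F0 x) (Ff x)).
by rewrite /GRing.scale /=; field.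
Qed.

Lemma sqE x : sq x = 4 / Ech x ^+ 2.
Proof. by rewrite /sq /sech -/(Ech x) expr_div_n -natrX. Qed.

Lemma sq_gt0 x : 0 < sq x.
Proof. by rewrite sqE divr_gt0 // exprn_gt0 // Ech_gt0. Qed.

Lemma th2 x : th x ^+ 2 = 1 - sq x.
Proof.
rewrite sqE /th; have e0 := Ech_gt0 x; have := expRxMexpNx_1 x; move: e0.
rewrite /Ech; set a := expR x; set b := expR (- x) => e0 ab.
apply: (@mulIf _ ((a + b) ^+ 2)); first by rewrite expf_neq0 // gt_eqF.
rewrite expr_div_n divfK; last by rewrite expf_neq0 // gt_eqF.
rewrite mulrBl divfK; last by rewrite expf_neq0 // gt_eqF.
by rewrite mul1r; lra.
Qed.

Lemma deriv_th : deriv th sq.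
Proof.
have E0 x : Ech x != 0 by rewrite gt_eqF // Ech_gt0.
have D := derivM (derivB deriv_exp deriv_expN) (derivV E0 (derivD deriv_exp deriv_expN)).
apply: deriv_eq D _ => x; rewrite sqE.
have := expRxMexpNx_1 x; move: (E0 x); rewrite /Ech.
set a := expR x; set b := expR (- x) => e0 ab.
have e4 : 4 = 4 * (a * b) by rewrite ab mulr1.
by rewrite [X in _ = X / _]e4; field.
Qed.

Lemma deriv_sq : deriv sq (fun x => - 2 * sq x * th x).
Proof.
have D := derivB (deriv_cst 1) (derivM deriv_th deriv_th).
apply: (deriv_ext (F := fun x => 1 - th x * th x)).
  by move=> x; rewrite -expr2 th2; ring.
by apply: deriv_eq D _ => x; ring.
Qed.

Lemma cont_sqch : continuous sq. Proof. exact: deriv_cont deriv_sq. Qed.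
Lemma th_le1 x : `|th x| <= 1.
Proof.
have := th2 x; have := sq_gt0 x => s0 t2.
rewrite -(@ler_pXn2r _ 2) ?nnegrE // expr1n -normrX ger0_norm ?sqr_ge0 // t2; lra.
Qed.

Lemma sq_le1 x : sq x <= 1.
Proof. by have := th2 x; have := sqr_ge0 (th x); lra. Qed.

Lemma thN x : th (- x) = - th x.
Proof. by rewrite /th (_ : Ech (- x) = Ech x) ?opprK -?mulNr ?opprB // /Ech opprK addrC. Qed.

Lemma sqN x : sq (- x) = sq x.
Proof. by rewrite !sqE /Ech opprK [expR (- x) + _]addrC. Qed.

Lemma th0 : th 0 = 0 :> R.
Proof. by rewrite /th oppr0 subrr mul0r. Qed.

Lemma sq0 : sq 0 = 1 :> R.
Proof. by have := th2 0; rewrite th0; lra. Qed.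

Lemma sq_bounds x : expR (- (2 * `|x|)) <= sq x <= 4 * expR (- (2 * `|x|)).
Proof.
wlog x0 : x / 0 <= x => [H|].
  have [/H//|/ltW xl] := leP 0 x; have := H (- x); rewrite sqN normrN; apply.
  by rewrite oppr_ge0.
rewrite ger0_norm // sqE mulr2n [2 * x]mulrDl mul1r opprD expRD.
have := expRxMexpNx_1 x; have e0 := Ech_gt0 x; move: e0; rewrite /Ech.
have b0 := expR_gt0 (- x); have a0 := expR_gt0 x.
have ba : expR (- x) <= expR x by rewrite ler_expR; lra.
move: b0 a0 ba; set a := expR x; set b := expR (- x) => b0 a0 ba e0 ab.
have e2 : 0 < (a + b) ^+ 2 by rewrite exprn_gt0.
rewrite ler_pdivlMr // ler_pdivrMr //.
apply/andP; split.
  have -> : b * b * (a + b) ^+ 2 = (a * b + b * b) ^+ 2 by ring.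
  have h : b * b <= 1 by rewrite -ab ler_pM2r.
  rewrite ab -[X in _ <= X](_ : 2 ^+ 2 = 4); last by rewrite -natrX.
  rewrite ler_pXn2r ?nnegrE //; first lra.
  by rewrite addr_ge0 // mulr_ge0 // ltW.
have -> : 4 * (b * b) * (a + b) ^+ 2 = 4 * (a * b + b * b) ^+ 2 by ring.
rewrite ab -[X in X <= _]mulr1 ler_pM2l // -[X in X <= _](expr1n _ 2) ler_pXn2r ?nnegrE //.
  by rewrite lerDl mulr_ge0 // ltW.
by rewrite addr_ge0 // mulr_ge0 // ltW.
Qed.

(** [phi] and [psi] span the solutions of [V'' = (4 - 12 sech^2) V]: [phi] is [- 1/2] times the
    derivative of [sech^2], odd and decaying; [psi] is even and grows like [cosh^2]. [phi1] and
    [psi1] are their derivatives. *)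
Definition phi x := sq x * th x.
Definition phi1 x := sq x * (1 - 3 * th x ^+ 2).
Definition psi x := (sq x)^-1 + 5 / 2 - 15 / 2 * sq x + 15 / 2 * (x * phi x).
Definition psi1 x := 2 * th x / sq x + 45 / 2 * phi x + 15 / 2 * (x * phi1 x).

Lemma deriv_phi : deriv phi phi1.
Proof.
apply: deriv_eq (derivM deriv_sq deriv_th) _ => x.
have := th2 x; rewrite /phi1 => t2.
have -> : sq x * sq x = sq x * (1 - th x ^+ 2) by rewrite t2; ring.
by ring.
Qed.

Lemma deriv_phi1 : deriv phi1 (fun x => (4 - 12 * sq x) * phi x).
Proof.
have D := derivM deriv_sq (derivB (deriv_cst 1) (derivZ 3 (derivM deriv_th deriv_th))).
apply: (deriv_ext (F := fun x => sq x * (1 - 3 * (th x * th x)))) => //.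
apply: deriv_eq D _ => x; have := th2 x; rewrite /phi => t2.
have -> : sq x * (0 - 3 * (sq x * th x + th x * sq x)) = - 6 * sq x * th x * (1 - th x ^+ 2).
  by rewrite t2; ring.
have -> : (4 - 12 * sq x) = 4 - 12 * (1 - th x ^+ 2) by rewrite t2; ring.
by ring.
Qed.

Let sqn0 x : sq x != 0. Proof. by rewrite gt_eqF // sq_gt0. Qed.

Lemma deriv_psi : deriv psi psi1.
Proof.
have D := derivD (derivB (derivD (derivV sqn0 deriv_sq) (deriv_cst (5 / 2)))
  (derivZ (15 / 2) deriv_sq)) (derivZ (15 / 2) (derivM deriv_id deriv_phi)).
apply: deriv_eq D _ => x; rewrite /psi1 /phi.
by field.
Qed.

Lemma deriv_psi1 : deriv psi1 (fun x => (4 - 12 * sq x) * psi x).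
Proof.
have D := derivD (derivD (derivM (derivZ 2 deriv_th) (derivV sqn0 deriv_sq))
  (derivZ (45 / 2) deriv_phi)) (derivZ (15 / 2) (derivM deriv_id deriv_phi1)).
apply: deriv_eq D _ => x; have := th2 x; rewrite /psi /phi1 => t2.
rewrite t2.
have -> : 2 * th x * (- (- 2 * sq x * th x) / sq x ^+ 2) = 4 * (1 - sq x) / sq x.
  by rewrite -t2; field.
by field.
Qed.

Lemma wronskian x : phi x * psi1 x - phi1 x * psi x = 4.
Proof.
have := th2 x; rewrite /psi /psi1 /phi1 => t2.
have -> : phi x * (2 * th x / sq x + 45 / 2 * phi x + 15 / 2 * (x * (sq x * (1 - 3 * th x ^+ 2)))) =
  2 * th x ^+ 2 + 45 / 2 * (sq x ^+ 2 * th x ^+ 2) + 15 / 2 * (x * phi x * (sq x * (1 - 3 * th x ^+ 2))).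
  by rewrite /phi; field.
rewrite t2; by field.
Qed.

Lemma xexp_le1 x : 0 <= x -> x * expR (- x) <= 1.
Proof.
move=> x0; rewrite expRN ler_pdivrMr ?expR_gt0 // mul1r.
by have := expR_ge1Dx x; lra.
Qed.

Lemma phi_le x : `|phi x| <= 4 * expR (- (2 * `|x|)).
Proof.
have /andP[_ h] := sq_bounds x; rewrite /phi normrM (gtr0_norm (sq_gt0 x)).
by rewrite -[X in _ <= X]mulr1 ler_pM ?th_le1 // ltW // sq_gt0.
Qed.

Lemma phi1_le x : `|phi1 x| <= 8 * expR (- (2 * `|x|)).
Proof.
have /andP[_ h] := sq_bounds x; rewrite /phi1 normrM (gtr0_norm (sq_gt0 x)).
apply: le_trans (_ : (4 * expR (- (2 * `|x|))) * 2 <= _); last lra.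
apply: ler_pM => //; first by rewrite ltW // sq_gt0.
have := th2 x; have := sq_gt0 x; have := sq_le1 x; have := sqr_ge0 (th x).
by rewrite ler_norml => *; apply/andP; split; lra.
Qed.

Let e2 x : expR (- (2 * `|x|)) * expR (2 * `|x|) = 1.
Proof. by rewrite -expRD addNr expR0. Qed.

Let e2_ge1 x : 1 <= expR (2 * `|x|).
Proof. by rewrite -[X in X <= _]expR0 ler_expR mulr_ge0. Qed.

Let xphi_le x c f : 0 <= c -> `|f| <= c * expR (- (2 * `|x|)) -> `|x * f| <= c * expR (2 * `|x|).
Proof.
move=> c0 hf; have := xexp_le1 (mulr_ge0 (ler0n _ 2) (normr_ge0 x)) => h.
rewrite normrM; apply: le_trans (ler_wpM2l (normr_ge0 x) hf) _.
have := ler_wpM2l c0 h; have := ler_wpM2l c0 (e2_ge1 x).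
have := mulr_ge0 c0 (mulr_ge0 (normr_ge0 x) (expR_ge0 (- (2 * `|x|)))); lra.
Qed.

Let isq_le x : (sq x)^-1 <= expR (2 * `|x|).
Proof.
have /andP[h _] := sq_bounds x.
rewrite -[expR _]invrK -expRN lef_pV2 ?posrE ?expR_gt0 //; exact: sq_gt0.
Qed.

Let isq_ge0 x : 0 <= (sq x)^-1. Proof. by rewrite invr_ge0 ltW // sq_gt0. Qed.

Lemma psi_le x : `|psi x| <= 41 * expR (2 * `|x|).
Proof.
have := xphi_le (ler0n _ 4) (phi_le x); have := isq_le x; have := isq_ge0 x.
have := e2_ge1 x; have := sq_le1 x; have := sq_gt0 x.
rewrite /psi !ler_norml => ? ? ? ? ? /andP[? ?]; apply/andP; split; lra_recent.
Qed.

Lemma psi1_le x : `|psi1 x| <= 85 * expR (2 * `|x|).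
Proof.
have := xphi_le (ler0n _ 8) (phi1_le x); have := isq_le x; have := isq_ge0 x.
have := e2_ge1 x.
have hp : `|phi x| <= 1.
  rewrite normrM -[X in _ <= X]mulr1 ler_pM ?th_le1 //.
  by rewrite (gtr0_norm (sq_gt0 x)) sq_le1.
have ht : `|th x / sq x| <= (sq x)^-1.
  rewrite normrM (ger0_norm (isq_ge0 x)) -[X in _ <= X]mul1r ler_wpM2r ?th_le1 //.
move: hp ht; rewrite /psi1 !ler_norml => /andP[? ?] /andP[? ?] ? ? ? /andP[? ?].
by apply/andP; split; lra_recent.
Qed.

Lemma phiN x : phi (- x) = - phi x.
Proof. by rewrite /phi sqN thN mulrN. Qed.

Lemma psiN x : psi (- x) = psi x.
Proof. by rewrite /psi sqN phiN mulrNN. Qed.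

Lemma phi1N x : phi1 (- x) = phi1 x.
Proof. by rewrite /phi1 sqN thN sqrrN. Qed.

Lemma psi1N x : psi1 (- x) = - psi1 x.
Proof. by rewrite /psi1 sqN phiN phi1N thN; ring. Qed.

Lemma psi1_0 : psi1 0 = 0.
Proof. by rewrite /psi1 /phi sq0 th0; ring. Qed.

Lemma phi_0 : phi 0 = 0.
Proof. by rewrite /phi th0 mulr0. Qed.

Lemma phi1_0 : phi1 0 = 1.
Proof. by rewrite /phi1 th0 sq0; ring. Qed.

Lemma cont_phi : continuous phi. Proof. exact: deriv_cont deriv_phi. Qed.
Lemma cont_psi : continuous psi. Proof. exact: deriv_cont deriv_psi. Qed.

End HyperbolicFunctions.

(** * Improper integrals of exponentially decaying functions *)

Section TotalIntegral.
Context {R : realType}.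
Implicit Types (f g h F G : R -> R) (a b c x y t l C L : R).

Definition dec a C g := continuous g /\ forall x, `|g x| <= C * expR (- (a * `|x|)).

Lemma dec_ge0 a C g : dec a C g -> 0 <= C.
Proof.
by move=> [_ /(_ 0)]; rewrite normr0 mulr0 oppr0 expR0 mulr1; apply: le_trans.
Qed.

Lemma exp_small a C e : 0 < a -> 0 < e ->
  exists2 X, 0 <= X & forall x, X <= x -> C * expR (- (a * x)) <= e.
Proof.
move=> a0 e0; exists (`|C| / (a * e)).
  by rewrite divr_ge0 // mulr_ge0 // ltW.
move=> x hx; apply: le_trans (ler_wpM2r (expR_ge0 _) (ler_norm C)) _.
rewrite expRN ler_pdivrMr ?expR_gt0 //.
move: hx; rewrite ler_pdivrMr ?mulr_gt0 // => hx.
apply: le_trans hx _; rewrite mulrA mulrC ler_wpM2l ?ltW //.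
by have := expR_gt1Dx; have := expR_ge1Dx (a * x); lra.
Qed.

Lemma deriv_expZ a : deriv (fun x : R => expR (a * x)) (fun x => a * expR (a * x)).
Proof.
apply: deriv_eq (deriv_comp (@deriv_exp R) (derivZ a deriv_id)) _ => x.
by rewrite mulr1 mulrC.
Qed.

(** By [key] the intervals of radius [C / a * exp (- a x)] around [itg g 0 x] are nested, and the
    limit is the supremum of their left ends. The rate of convergence comes for free. *)
Lemma prim_limit g a C : 0 < a -> continuous g ->
  (forall x, 0 <= x -> `|g x| <= C * expR (- (a * x))) ->
  exists l, forall x, 0 <= x -> `|itg g 0 x - l| <= C / a * expR (- (a * x)).
Proof.
move=> a0 cg gC; have Dg := itg_deriv 0 cg.
have De := derivZ (C / a) (deriv_expZ (- a)).
have key x y : 0 <= x -> x <= y ->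
   `|itg g 0 y - itg g 0 x| <= C / a * expR (- (a * x)) - C / a * expR (- (a * y)).
  move=> x0 xy.
  have h1 := deriv_le Dg (derivN De) xy _; have h2 := deriv_le De Dg xy _.
  have E t : C / a * (- a * expR (- a * t)) = - (C * expR (- (a * t))).
    have -> : expR (- a * t) = expR (- (a * t)) by rewrite mulNr.
    by field; rewrite gt_eqF.
  rewrite ler_norml -!mulNr; apply/andP; split; last first.
    suff : itg g 0 y - itg g 0 x <= - (C / a * expR (- a * y)) - - (C / a * expR (- a * x)) by lra.
    apply: h1 => t /andP[xt ty]; rewrite E opprK.
    by have := gC t; rewrite ler_norml => /(_ _)/andP[]//; lra.
  suff : C / a * expR (- a * y) - C / a * expR (- a * x) <= itg g 0 y - itg g 0 x by lra.
  apply: h2 => t /andP[xt ty]; rewrite E.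
  by have := gC t; rewrite ler_norml => /(_ _)/andP[]//; lra.
have C0 : 0 <= C.
  by have := gC 0 (lexx 0); rewrite mulr0 oppr0 expR0 mulr1; apply: le_trans.
have Ca : 0 <= C / a by rewrite divr_ge0 // ltW.
pose A := [set itg g 0 x - C / a * expR (- (a * x)) | x in [set x | 0 <= x]].
have ub x y : 0 <= x -> 0 <= y ->
    itg g 0 y - C / a * expR (- (a * y)) <= itg g 0 x + C / a * expR (- (a * x)).
  move=> x0 y0; have px := mulr_ge0 Ca (expR_ge0 (- (a * x))).
  have py := mulr_ge0 Ca (expR_ge0 (- (a * y))).
  have [xy|/ltW yx] := leP x y.
    by have := key x y x0 xy; rewrite ler_norml => /andP[? ?]; lra_local.
  by have := key y x y0 yx; rewrite ler_norml => /andP[? ?]; lra_local.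
exists (sup A) => x x0.
have h1 : itg g 0 x - C / a * expR (- (a * x)) <= sup A.
  apply: ub_le_sup; last by exists x.
  by exists (itg g 0 0 + C / a * expR (- (a * 0))) => _ [y y0 <-]; exact: ub.
have h2 : sup A <= itg g 0 x + C / a * expR (- (a * x)).
  apply: ge_sup; first by exists (itg g 0 x - C / a * expR (- (a * x))); exists x.
  by move=> _ [y y0 <-]; exact: ub.
by rewrite ler_norml; apply/andP; split; lra_local.
Qed.

(** A limit at [+oo] only. Limits at [-oo] are taken for the reflected function, and [Tint] is the
    sum of two half-line integrals. *)
Definition tends F l := forall e, 0 < e -> exists X, forall x, X <= x -> `|F x - l| <= e.

Lemma tends_uniq F l l' : tends F l -> tends F l' -> l = l'.
Proof.
move=> h h'; apply/eqP; rewrite -subr_eq0 -normr_le0; apply/ler_addgt0Pr => e e0.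
rewrite add0r; have e2 : 0 < e / 2 by lra.
have [X HX] := h _ e2; have [Y HY] := h' _ e2.
have := HX (Num.max X Y); have := HY (Num.max X Y); rewrite !le_max !lexx orbT /=.
move=> /(_ isT) h1 /(_ isT) h2; have := ler_distD (F (Num.max X Y)) l l'.
by rewrite [`|l - F _|]distrC; lra.
Qed.

Lemma tends_eq F G l : (forall x, 0 <= x -> F x = G x) -> tends F l -> tends G l.
Proof.
move=> FG h e e0; have [X HX] := h e e0; exists (Num.max 0 X) => x.
by rewrite ge_max => /andP[x0 /HX]; rewrite FG.
Qed.

Lemma tendsD F G l l' : tends F l -> tends G l' -> tends (fun x => F x + G x) (l + l').
Proof.
move=> h h' e e0; have e2 : 0 < e / 2 by lra.
have [X HX] := h _ e2; have [Y HY] := h' _ e2; exists (Num.max X Y) => x.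
rewrite ge_max => /andP[/HX h1 /HY h2].
rewrite (_ : _ - _ = (F x - l) + (G x - l')); last ring.
by apply: le_trans (ler_normD _ _) _; lra.
Qed.

Lemma tends_cst c : tends (fun=> c) c.
Proof. by move=> e e0; exists 0 => x _; rewrite subrr normr0 ltW. Qed.

Lemma tendsZ c F l : tends F l -> tends (fun x => c * F x) (c * l).
Proof.
move=> h e e0; have c1 : 0 < `|c| + 1 by have := normr_ge0 c; lra.
have [X HX] := h _ (divr_gt0 e0 c1); exists X => x /HX h1.
rewrite -mulrBr normrM; apply: le_trans (ler_wpM2l (normr_ge0 c) h1) _.
by rewrite mulrA ler_pdivrMr // mulrC ler_pM2l //; lra.
Qed.

Lemma tendsB F G l l' : tends F l -> tends G l' -> tends (fun x => F x - G x) (l - l').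
Proof.
move=> h /(tendsZ (-1)) h'; have := tendsD h h'; rewrite mulN1r.
by apply: tends_eq => x _; rewrite mulN1r.
Qed.

Lemma tends_dom F l a C : 0 < a -> (forall x, 0 <= x -> `|F x - l| <= C * expR (- (a * x))) ->
  tends F l.
Proof.
move=> a0 h e e0; have [X X0 HX] := exp_small C a0 e0; exists X => x Xx.
by apply: le_trans (h x _) (HX x Xx); exact: le_trans Xx.
Qed.

Definition rlim F := xget 0 [set l | tends F l].

Lemma rlimE F l : tends F l -> rlim F = l.
Proof.
by move=> h; rewrite /rlim; case: xgetP => [l' -> h'|/(_ l)//]; exact: tends_uniq h' h.
Qed.

Definition Ip g := rlim (itg g 0).
Definition Tint g := Ip g + Ip (fun x => g (- x)).

Lemma Ip_le g a C : 0 < a -> continuous g ->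
  (forall x, 0 <= x -> `|g x| <= C * expR (- (a * x))) ->
  forall x, 0 <= x -> `|itg g 0 x - Ip g| <= C / a * expR (- (a * x)).
Proof.
move=> a0 cg gC; have [l Hl] := prim_limit a0 cg gC.
by rewrite /Ip (rlimE (tends_dom a0 Hl)).
Qed.

Lemma itg_tends g a C : 0 < a -> dec a C g -> tends (itg g 0) (Ip g).
Proof.
move=> a0 [cg gC]; apply: (@tends_dom _ _ a (C / a) a0) => x x0; apply: Ip_le a0 cg _ x x0 => y y0.
by have := gC y; rewrite (ger0_norm y0).
Qed.

Lemma dec_opp g a C : dec a C g -> dec a C (fun x => g (- x)).
Proof.
move=> [cg gC]; split=> [|x]; last by have := gC (- x); rewrite normrN.
by apply: cont_comp => //; exact: contN cont_id.
Qed.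

Lemma itg_opp g x : continuous g -> itg g 0 (- x) = - itg (fun y => g (- y)) 0 x.
Proof.
move=> cg; have := itg_aff 0 (-1) 0 x cg; rewrite mulr0 addr0 mulN1r add0r => <-.
rewrite mulrN1; congr (- _); apply: eq_itg => y; by rewrite mulN1r add0r.
Qed.

Lemma Tint_uniq g l l' : tends (itg g 0) l -> tends (itg (fun x => g (- x)) 0) l' ->
  Tint g = l + l'.
Proof. by move=> h h'; rewrite /Tint /Ip (rlimE h) (rlimE h'). Qed.

Lemma TintD f g a C C' : 0 < a -> dec a C f -> dec a C' g ->
  Tint (fun x => f x + g x) = Tint f + Tint g.
Proof.
move=> a0 df dg; have df' := dec_opp df; have dg' := dec_opp dg.
rewrite (Tint_uniq (l := Ip f + Ip g) (l' := Ip (fun x => f (- x)) + Ip (fun x => g (- x)))).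
- by rewrite /Tint; ring.
- apply: tends_eq (tendsD (itg_tends a0 df) (itg_tends a0 dg)) => x _.
  by rewrite itgD //; [case: df|case: dg].
- apply: tends_eq (tendsD (itg_tends a0 df') (itg_tends a0 dg')) => x _.
  by rewrite itgD //; [case: df'|case: dg'].
Qed.

Lemma TintZ c f a C : 0 < a -> dec a C f -> Tint (fun x => c * f x) = c * Tint f.
Proof.
move=> a0 df; have df' := dec_opp df.
rewrite (Tint_uniq (l := c * Ip f) (l' := c * Ip (fun x => f (- x)))).
- by rewrite /Tint; ring.
- apply: tends_eq (tendsZ c (itg_tends a0 df)) => x _.
  by rewrite itgZ //; case: df.
- apply: tends_eq (tendsZ c (itg_tends a0 df')) => x _.
  by rewrite itgZ //; case: df'.
Qed.

Lemma decD f g a C C' : dec a C f -> dec a C' g -> dec a (C + C') (fun x => f x + g x).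
Proof.
move=> [cf hf] [cg hg]; split; first exact: contD.
by move=> x; apply: le_trans (ler_normD _ _) _; rewrite mulrDl lerD.
Qed.

Lemma decZ c f a C : dec a C f -> dec a (`|c| * C) (fun x => c * f x).
Proof.
move=> [cf hf]; split; first exact: contZ.
by move=> x; rewrite normrM -mulrA ler_wpM2l.
Qed.

Lemma TintB f g a C C' : 0 < a -> dec a C f -> dec a C' g ->
  Tint (fun x => f x - g x) = Tint f - Tint g.
Proof.
move=> a0 df dg; rewrite -[X in _ = _ + X]mulN1r -(TintZ _ a0 dg) -(TintD a0 df (decZ _ dg)).
by congr Tint; apply/funext => x; rewrite mulN1r.
Qed.

Lemma Ip_abs_le g a C : 0 < a -> dec a C g -> `|Ip g| <= C / a.
Proof.
move=> a0 [cg gC].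
have := @Ip_le g a C a0 cg _ 0 (lexx 0); rewrite itg_xx sub0r normrN mulr0 oppr0 expR0 mulr1.
by apply=> x x0; have := gC x; rewrite (ger0_norm x0).
Qed.

Lemma Tint_le g a C : 0 < a -> dec a C g -> `|Tint g| <= 2 * C / a.
Proof.
move=> a0 dg; apply: le_trans (ler_normD _ _) _.
have := Ip_abs_le a0 dg; have := Ip_abs_le a0 (dec_opp dg); lra.
Qed.

Lemma Tint_deriv G g l l' : deriv G g -> continuous g -> tends G l ->
  tends (fun x => G (- x)) l' -> Tint g = l - l'.
Proof.
move=> Gg cg h h'.
rewrite (Tint_uniq (l := l - G 0) (l' := G 0 - l')); first ring.
  by apply: tends_eq (tendsB h (tends_cst (G 0))) => x _; rewrite (itgE _ _ Gg).
apply: tends_eq (tendsB (tends_cst (G 0)) h') => x _.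
have := itg_opp x cg; rewrite (itgE _ _ Gg) => /(congr1 -%R); rewrite opprK => <-; ring.
Qed.

End TotalIntegral.

(** * The Green kernel of the linearised operator *)

Section Green.
Context {R : realType}.
Implicit Types (f g h F G : R -> R) (a b c k x y t l C L : R).

(** Variation of constants with Wronskian 4. Subtracting [Gc h], the integral of [phi h] over the
    positive half-line, makes the coefficient of the growing [psi] decay at [+oo]; at [-oo] the same
    constant works exactly when the total integral of [phi h] vanishes. Starting the [psi] integral
    at 0 gives [Gr1 h 0 = 0]. *)
Definition Gc h := Ip (fun x => phi x * h x).
Definition Gr h x := 1 / 4 * (psi x * (itg (fun t => phi t * h t) 0 x - Gc h)
   - phi x * itg (fun t => psi t * h t) 0 x).
Definition Gr1 h x := 1 / 4 * (psi1 x * (itg (fun t => phi t * h t) 0 x - Gc h)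
   - phi1 x * itg (fun t => psi t * h t) 0 x).
Definition Gr2 h x := h x + (4 - 12 * sq x) * Gr h x.

Lemma deriv_Gr h : continuous h -> deriv (Gr h) (Gr1 h).
Proof.
move=> ch; have D1 := itg_deriv 0 (contM (@cont_phi R) ch).
have D2 := itg_deriv 0 (contM (@cont_psi R) ch).
have D := derivZ (1 / 4) (derivB (derivM (@deriv_psi R) (derivB D1 (deriv_cst (Gc h))))
  (derivM (@deriv_phi R) D2)).
by apply: deriv_eq D _ => x; rewrite /Gr1; ring.
Qed.

Lemma deriv_Gr1 h : continuous h -> deriv (Gr1 h) (Gr2 h).
Proof.
move=> ch; have D1 := itg_deriv 0 (contM (@cont_phi R) ch).
have D2 := itg_deriv 0 (contM (@cont_psi R) ch).
have D := derivZ (1 / 4) (derivB (derivM (@deriv_psi1 R) (derivB D1 (deriv_cst (Gc h))))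
  (derivM (@deriv_phi1 R) D2)).
apply: deriv_eq D _ => x; rewrite /Gr2 /Gr.
have := wronskian x; set A := itg _ 0 x; set B := itg _ 0 x => W.
have : (phi x * psi1 x - phi1 x * psi x) * h x = 4 * h x by rewrite W.
by lra.
Qed.

Lemma Gr1_0 h : Gr1 h 0 = 0.
Proof. by rewrite /Gr1 !itg_xx psi1_0; ring. Qed.

Lemma phi_h_dec h k L : 0 <= k -> dec k L h -> dec (2 + k) (4 * L) (fun x => phi x * h x).
Proof.
move=> k0 [ch hL]; split; first exact: contM (@cont_phi R) ch.
move=> x; rewrite normrM.
apply: le_trans (ler_pM _ _ (phi_le x) (hL x)) _ => //.
by rewrite mulrACA -expRD ler_wpM2l ?mulr_ge0 ?(dec_ge0 (conj ch hL)) // ler_expR; lra.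
Qed.

Lemma psi_h_itg h k L x : 0 <= k <= 1 -> dec k L h -> 0 <= x ->
  `|itg (fun t => psi t * h t) 0 x| <= 41 * L * expR ((2 - k) * x).
Proof.
move=> /andP[k0 k1] dh x0; have [ch hL] := dh; have L0 := dec_ge0 dh.
have cE : continuous (fun t : R => 41 * L * ((2 - k) * expR ((2 - k) * t))).
  by apply: contZ; apply: contZ; exact: deriv_cont (deriv_expZ _).
apply: le_trans (_ : itg (fun t : R => 41 * L * ((2 - k) * expR ((2 - k) * t))) 0 x <= _).
  apply: itg_abs_le => //; first exact: contM (@cont_psi R) ch.
  move=> t /andP[t0 tx]; rewrite normrM; apply: le_trans (ler_pM _ _ (psi_le t) (hL t)) _ => //.
  rewrite (ger0_norm t0) mulrACA -expRD (_ : 2 * t + - (k * t) = (2 - k) * t); last ring.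
  rewrite ler_wpM2l //; first by rewrite mulr_ge0.
  by rewrite -[X in X <= _]mul1r ler_wpM2r ?expR_ge0 //; lra.
rewrite (itgE _ _ (derivZ (41 * L) (deriv_expZ (2 - k)))) mulr0 expR0.
by have : 0 <= 41 * L by [rewrite mulr_ge0]; lra.
Qed.

Let half h k L x : 0 <= k <= 1 -> dec k L h -> 0 <= x ->
  `|itg (fun t => phi t * h t) 0 x - Gc h| <= 2 * L * expR (- ((2 + k) * x)) /\
  `|itg (fun t => psi t * h t) 0 x| <= 41 * L * expR ((2 - k) * x).
Proof.
move=> /[dup] k01 /andP[k0 k1] dh x0; have L0 := dec_ge0 dh; split; last exact: psi_h_itg.
have a0 : 0 < 2 + k by lra.
have [cp hp] := phi_h_dec k0 dh.
have := @Ip_le _ (fun t => phi t * h t) (2 + k) (4 * L) a0 cp.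
move=> /(_ _ x x0) H; apply: le_trans (H _) _.
  by move=> t t0; have := hp t; rewrite (ger0_norm t0).
rewrite ler_wpM2r ?expR_ge0 // ler_pdivrMr //.
by have := mulr_ge0 L0 k0; lra.
Qed.

Let half_bound A B a b k L x : 0 <= x -> 0 <= L -> 0 <= a -> 0 <= b ->
  forall p q, `|p| <= a * expR (2 * x) -> `|q| <= b * expR (- (2 * x)) ->
  `|A| <= 2 * L * expR (- ((2 + k) * x)) -> `|B| <= 41 * L * expR ((2 - k) * x) ->
  `|1 / 4 * (p * A - q * B)| <= (a / 2 + 41 / 4 * b) * L * expR (- (k * x)).
Proof.
move=> x0 L0 a0 b0 p q hp hq hA hB.
have h1 : `|p * A| <= a * (2 * L) * expR (- (k * x)).
  rewrite normrM; apply: le_trans (ler_pM _ _ hp hA) _ => //.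
  by rewrite mulrACA -expRD (_ : 2 * x - (2 + k) * x = - (k * x)) //; ring.
have h2 : `|q * B| <= b * (41 * L) * expR (- (k * x)).
  rewrite normrM; apply: le_trans (ler_pM _ _ hq hB) _ => //.
  by rewrite mulrACA -expRD (_ : - (2 * x) + (2 - k) * x = - (k * x)) //; ring.
rewrite normrM ger0_norm; last lra.
have := ler_normB (p * A) (q * B); lra.
Qed.

(** This is where orthogonality to [phi] enters: it makes the half-line constants of [h] and of its
    reflection agree, so that negative arguments reduce to positive ones. *)
Lemma Gc_opp h C a : 0 < a -> dec a C (fun x => phi x * h x) -> Tint (fun x => phi x * h x) = 0 ->
  Gc (fun x => h (- x)) = Gc h.
Proof.
move=> a0 dh; rewrite /Tint -/(Gc h) => H.
have [c1 _] := dec_opp dh; have := itg_tends a0 (dec_opp dh); set l := Ip _ in H * => hl.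
have -> : Gc h = - l by lra.
rewrite /Gc /Ip; apply: rlimE; rewrite -mulN1r.
apply: tends_eq (tendsZ (-1) hl) => x x0.
rewrite -itgZ //; apply: eq_itg => y; by rewrite phiN; ring.
Qed.

Lemma Gr_opp h k C x : 0 <= k -> dec k C h -> Tint (fun x => phi x * h x) = 0 ->
  Gr h (- x) = Gr (fun y => h (- y)) x /\ Gr1 h (- x) = - Gr1 (fun y => h (- y)) x.
Proof.
move=> k0 dh ht; have [ch _] := dh.
have a0 : 0 < 2 + k by lra.
have E := Gc_opp a0 (phi_h_dec k0 dh) ht.
have [ch' _] := dec_opp dh.
have E1 : itg (fun t => phi t * h t) 0 (- x) = itg (fun t => phi t * h (- t)) 0 x.
  rewrite itg_opp; last exact: contM (@cont_phi R) ch.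
  rewrite -mulN1r -itgZ; last first.
    by case: (dec_opp (phi_h_dec k0 dh)).
  by apply: eq_itg => t; rewrite phiN; ring.
have E2 : itg (fun t => psi t * h t) 0 (- x) = - itg (fun t => psi t * h (- t)) 0 x.
  rewrite itg_opp; last exact: contM (@cont_psi R) ch.
  by congr (- _); apply: eq_itg => t; rewrite psiN.
by rewrite /Gr /Gr1 E E1 E2 psiN phiN psi1N phi1N; split; ring.
Qed.

(** The rate [k] of the data is kept because it is below the rate 2 of [phi] and [psi]. The value
    [k = 0] is included: bounded data give a bounded solution, as uniqueness in the sup norm
    requires. *)
Lemma Gr_bounds h k L : 0 <= k <= 1 -> dec k L h -> Tint (fun x => phi x * h x) = 0 ->
  [/\ dec k (1000 * L) (Gr h), dec k (1000 * L) (Gr1 h) & dec k (20000 * L) (Gr2 h)].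
Proof.
move=> /[dup] k01 /andP[k0 k1] dh ht; have [ch hL] := dh; have L0 := dec_ge0 dh.
have pos g x : dec k L g -> 0 <= x ->
    `|Gr g x| <= 1000 * L * expR (- (k * `|x|)) /\ `|Gr1 g x| <= 1000 * L * expR (- (k * `|x|)).
  move=> dg x0; have [hA hB] := half k01 dg x0; rewrite (ger0_norm x0).
  have p1 := psi_le x; have p2 := psi1_le x; have q1 := phi_le x; have q2 := phi1_le x.
  rewrite (ger0_norm x0) in p1 p2 q1 q2.
  have h41 : 0 <= (41 : R) by lra_recent. have h85 : 0 <= (85 : R) by lra_recent.
  have h4 : 0 <= (4 : R) by lra_recent. have h8 : 0 <= (8 : R) by lra_recent.
  have Le : 0 <= L * expR (- (k * x)) by rewrite mulr_ge0 ?expR_ge0.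
  have := half_bound x0 L0 h41 h4 p1 q1 hA hB.
  have := half_bound x0 L0 h85 h8 p2 q2 hA hB.
  rewrite -/(Gr g x) -/(Gr1 g x) => b2 b1; split; lra_recent.
have all x : `|Gr h x| <= 1000 * L * expR (- (k * `|x|)) /\
    `|Gr1 h x| <= 1000 * L * expR (- (k * `|x|)).
  have [x0|/ltW x0] := leP 0 x; first exact: pos _ _ dh x0.
  have := Gr_opp (- x) k0 dh ht; rewrite opprK => -[-> ->].
  have x0' : 0 <= - x by lra_recent.
  by have := pos _ _ (dec_opp dh) x0'; rewrite (normrN x) (normrN (Gr1 _ _)).
have D1 := deriv_Gr ch; have D2 := deriv_Gr1 ch.
have cG2 : continuous (Gr2 h).
  apply: contD => //; apply: contM; last exact: deriv_cont D1.
  apply: contB; [exact: cont_cst|exact: contZ (@cont_sqch R)].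
split; split.
- exact: deriv_cont D1.
- by move=> x; case: (all x).
- exact: deriv_cont D2.
- by move=> x; case: (all x).
- exact: cG2.
move=> x; have [h1 _] := all x; have h2 := hL x.
rewrite /Gr2; apply: le_trans (ler_normD _ _) _; rewrite normrM.
have h3 : `|4 - 12 * sq x| <= 8.
  by rewrite ler_norml; apply/andP; split; move: (sq_gt0 x) (sq_le1 x); lra_recent.
have := ler_pM (normr_ge0 _) (normr_ge0 _) h3 h1.
have : 0 <= L * expR (- (k * `|x|)) by rewrite mulr_ge0 ?expR_ge0.
lra_recent.
Qed.

End Green.

(** * Consistency of the averages *)

Section Consistency.
Context {R : realType}.
Implicit Types (f g h z w k : R -> R) (a b c d e x y t s L M N : R).

Definition wb w L f := forall x, `|f x| <= L * w x.

Lemma bnd_wb L f : bnd L f -> wb (fun=> 1) L f.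
Proof. by move=> h x; rewrite mulr1. Qed.

Lemma wb_ge0 w L f : (forall x, 0 < w x) -> wb w L f -> 0 <= L.
Proof. by move=> w0 /(_ 0) h; rewrite -(pmulr_lge0 _ (w0 0)); apply: le_trans h. Qed.

Lemma wbW w L L' f : (forall x, 0 < w x) -> L <= L' -> wb w L f -> wb w L' f.
Proof. by move=> w0 LL h x; apply: le_trans (h x) _; rewrite ler_wpM2r // ltW. Qed.

Lemma wbD w L L' f g : wb w L f -> wb w L' g -> wb w (L + L') (fun x => f x + g x).
Proof.
by move=> h h' x; apply: le_trans (ler_normD _ _) _; rewrite mulrDl lerD.
Qed.

Lemma wbB w L L' f g : wb w L f -> wb w L' g -> wb w (L + L') (fun x => f x - g x).
Proof.
by move=> h h' x; apply: le_trans (ler_normB _ _) _; rewrite mulrDl lerD.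
Qed.

Lemma wbM w L M f g : bnd M f -> wb w L g -> wb w (M * L) (fun x => f x * g x).
Proof. by move=> h h' x; rewrite normrM -mulrA ler_pM. Qed.

Lemma wbMr w L M f g : wb w L f -> bnd M g -> wb w (L * M) (fun x => f x * g x).
Proof. by move=> h h' x; rewrite normrM mulrAC ler_pM. Qed.

Lemma wbZ w L c f : wb w L f -> wb w (`|c| * L) (fun x => c * f x).
Proof. by move=> h; apply: wbM => // x. Qed.

Lemma slow_cst (k : R) : 0 <= k -> slow k (fun=> 1 : R).
Proof.
move=> k0; split=> // x y; rewrite mulr1 -[X in X <= _]expR0 ler_expR mulr_ge0 //.
Qed.

Lemma slow_exp (k : R) : `|k| <= 3 -> slow 3 (fun x => expR (k * `|x|)).
Proof.
move=> k3; split=> [x|x y]; first exact: expR_gt0.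
rewrite -expRD ler_expR -lerBlDr -mulrBr.
apply: le_trans (ler_norm _) _; rewrite normrM; apply: ler_pM => //.
by rewrite ler_dist_dist.
Qed.

Section Fixed.
Variables (e : R) (w : R -> R).
Hypotheses (e0 : 0 < e) (e1 : e <= 1 / 100) (sw : slow 3 w).

Let w0 x : 0 < w x. Proof. by case: sw. Qed.
Let w0' x : 0 <= w x. Proof. exact: ltW. Qed.

(** A translation by at most [4 e] costs a factor [exp (12 e) <= exp (1 / 2) <= 2], which is how
    averages act on weighted bounds. *)
Lemma slow2 x t : `|t| <= 4 * e -> w (x + t) <= 2 * w x.
Proof.
move=> te; have [_ /(_ x (x + t)) h] := sw; apply: le_trans h _.
rewrite ler_wpM2r ?w0' // addrAC subrr add0r.
apply: le_trans (_ : expR (1 / 2) <= _).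
  by rewrite ler_expR; move: e1 te; lra.
have := expR_ge1Dx (- (1 / 2 : R)); rewrite expRN => h.
have p := expR_gt0 (1 / 2 : R).
rewrite -[expR _]invrK -[X in _ <= X]invrK lef_pV2 ?posrE ?invr_gt0 //; lra.
Qed.

Lemma wb_transl L f t : `|t| <= 4 * e -> wb w L f -> wb w (2 * L) (fun x => f (x + t)).
Proof.
move=> te h x; have L0 := wb_ge0 w0 h.
apply: le_trans (h _) _; rewrite [2 * L]mulrC -mulrA ler_wpM2l //; exact: slow2.
Qed.

Lemma diff1 L f f1 x t : `|t| <= 4 * e -> deriv f f1 -> wb w L f1 ->
  `|f (x + t) - f x| <= 2 * L * `|t| * w x.
Proof.
move=> te Df hL; have L0 := wb_ge0 w0 hL.
have := @deriv_abs_le _ f f1 (2 * L * w x) x (x + t) Df.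
rewrite (_ : x + t - x = t); last ring.
move=> H; rewrite mulrAC; apply: H => y yt.
apply: le_trans (hL y) _; rewrite -[y](subrK x) addrC.
rewrite [2 * L]mulrC -mulrA ler_wpM2l // slow2 //.
exact: le_trans yt te.
Qed.

Lemma diff2 L f f1 f2 x t : `|t| <= 4 * e -> deriv f f1 -> deriv f1 f2 -> wb w L f2 ->
  `|f (x + t) - f x - t * f1 x| <= 2 * L * t ^+ 2 * w x.
Proof.
move=> te Df Df1 hL; have L0 := wb_ge0 w0 hL.
have D := derivB Df (derivZ (f1 x) deriv_id).
have := @deriv_abs_le _ _ _ (2 * L * `|t| * w x) x (x + t) D.
rewrite (_ : x + t - x = t); last ring.
rewrite (_ : _ - _ - _ = f (x + t) - f x - t * f1 x); last ring.
rewrite (_ : 2 * L * `|t| * w x * `|t| = 2 * L * (`|t| ^+ 2) * w x); last ring.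
rewrite real_normK ?num_real //; apply => y yt; rewrite mulr1.
have := @diff1 L f1 f2 x (y - x) _ Df1 hL; rewrite (_ : x + (y - x) = y); last ring.
move=> H.
apply: le_trans (H _) _; first exact: le_trans te.
by rewrite ler_wpM2r ?w0' // ler_wpM2l // mulr_ge0.
Qed.

Let dc_le d c s : `|d| <= e -> `|c| <= e -> 0 <= s <= 1 -> `|d + c * s| <= 2 * e.
Proof.
move=> hd hc /andP[s0 s1]; apply: le_trans (ler_normD _ _) _.
rewrite normrM (ger0_norm s0).
by have := ler_pM (normr_ge0 c) s0 hc s1; lra.
Qed.

Let dc_le4 d c s : `|d| <= e -> `|c| <= e -> 0 <= s <= 1 -> `|d + c * s| <= 4 * e.
Proof. by move=> hd hc hs; have := dc_le hd hc hs; move: e0; lra. Qed.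

Section Tk.
Variables (k : R -> R) (M d c : R).
Hypotheses (ck : continuous k) (kM : forall s, 0 <= s <= 1 -> `|k s| <= M).
Hypotheses (hd : `|d| <= e) (hc : `|c| <= e).

Let M0 : 0 <= M. Proof. by apply: le_trans (kM (s := 0) _) => //; rewrite lexx ler01. Qed.

Lemma Tk_wb L f : continuous f -> wb w L f -> wb w (M * (2 * L)) (Tk k d c f).
Proof.
move=> cf hL x; rewrite -mulrA; apply: Tk_le => // s hs.
by apply: (wb_transl (t := d + c * s)) => //; exact: dc_le4.
Qed.

Lemma Tk_diff1 L f f1 x : deriv f f1 -> wb w L f1 ->
  `|Tk k d c f x - itg k 0 1 * f x| <= M * (4 * e * L * w x).
Proof.
move=> Df hL; have L0 := wb_ge0 w0 hL; have cf := deriv_cont Df.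
have -> : Tk k d c f x - itg k 0 1 * f x = itg (fun s => k s * (f (x + (d + c * s)) - f x)) 0 1.
  rewrite /Tk -itgZr // -itgB //.
  - by apply: eq_itg => s; ring.
  - by apply: contM => //; exact: cont_transl.
  - by apply: contM => //; exact: cont_cst.
apply: itg01_bound.
  by apply: contM => //; apply: contB; [exact: cont_transl|exact: cont_cst].
move=> s hs; rewrite normrM ler_pM ?kM //.
apply: le_trans (diff1 x (dc_le4 hd hc hs) Df hL) _.
rewrite ler_wpM2r ?w0' // -mulrA [L * _]mulrC mulrA ler_wpM2r //.
by have := dc_le hd hc hs; lra.
Qed.

Lemma Tk_diff2 L f f1 f2 x : deriv f f1 -> deriv f1 f2 -> wb w L f2 ->
  `|Tk k d c f x - itg k 0 1 * f x - (d * itg k 0 1 + c * itg (fun s => k s * s) 0 1) * f1 x|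
   <= M * (8 * e ^+ 2 * L * w x).
Proof.
move=> Df Df1 hL; have L0 := wb_ge0 w0 hL; have cf := deriv_cont Df.
have cks : continuous (fun s => k s * s) by apply: contM => //; exact: cont_id.
have -> : Tk k d c f x - itg k 0 1 * f x - (d * itg k 0 1 + c * itg (fun s => k s * s) 0 1) * f1 x
  = itg (fun s => k s * (f (x + (d + c * s)) - f x - (d + c * s) * f1 x)) 0 1.
  rewrite [RHS](eq_itg (g := fun s => k s * f (x + (d + c * s)) - (k s * (f x + d * f1 x)
     + (k s * s) * (c * f1 x)))); last by move=> s; ring.
  have c1 : continuous (fun s => k s * (f x + d * f1 x)).
    by apply: contM => //; exact: cont_cst.
  have c2 : continuous (fun s => k s * s * (c * f1 x)).
    by apply: contM => //; exact: cont_cst.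
  rewrite [RHS]itgB; [|by apply: contM => //; exact: cont_transl|exact: contD].
  rewrite (itgD _ _ c1 c2) (itgZr _ _ _ ck) (itgZr _ _ _ cks) /Tk; ring.
apply: itg01_bound.
  apply: contM => //; apply: contB; first by apply: contB; [exact: cont_transl|exact: cont_cst].
  apply: contM; last exact: cont_cst.
  by apply: contD; [exact: cont_cst|exact: contZ cont_id].
move=> s hs; rewrite normrM ler_pM ?kM //.
apply: le_trans (diff2 x (dc_le4 hd hc hs) Df Df1 hL) _.
rewrite ler_wpM2r ?w0' //.
have h := dc_le hd hc hs.
have h2 : (d + c * s) ^+ 2 <= 4 * e ^+ 2.
  rewrite -[(d + c * s) ^+ 2]real_normK ?num_real // (_ : 4 * e ^+ 2 = (2 * e) ^+ 2); last ring.
  by rewrite ler_pXn2r ?nnegrE // mulr_ge0 // ltW.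
have := ler_wpM2l L0 h2; lra.
Qed.

End Tk.

Let poly_itg a0 a1 a2 a3 : itg (fun s : R => a0 + a1 * s + a2 * (s * s) + a3 * (s * s * s)) 0 1
  = a0 + a1 / 2 + a2 / 3 + a3 / 4.
Proof.
have D := derivD (derivD (derivD (derivZ a0 deriv_id) (derivZ (a1 / 2) (derivM deriv_id deriv_id)))
  (derivZ (a2 / 3) (derivM (derivM deriv_id deriv_id) deriv_id)))
  (derivZ (a3 / 4) (derivM (derivM (derivM deriv_id deriv_id) deriv_id) (@deriv_id R))).
have D' : deriv (fun s : R => a0 * s + a1 / 2 * (s * s) + a2 / 3 * (s * s * s) + a3 / 4 * (s * s * s * s))
  (fun s => a0 + a1 * s + a2 * (s * s) + a3 * (s * s * s)).
  by apply: deriv_eq D _ => s; field.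
by rewrite (itgE _ _ D'); field.
Qed.

Let poly_eq k a0 a1 a2 a3 : (forall s, k s = a0 + a1 * s + a2 * (s * s) + a3 * (s * s * s)) ->
  itg k 0 1 = a0 + a1 / 2 + a2 / 3 + a3 / 4.
Proof. by move=> /funext ->; exact: poly_itg. Qed.

Let ka_m0 : itg (@ka R) 0 1 = - (16 / 3).
Proof. rewrite (@poly_eq _ (-3) (-8) 5 0) => [|s]; [by field|by rewrite /ka; ring]. Qed.
Let ka_m1 : itg (fun s => @ka R s * s) 0 1 = - (35 / 12).
Proof. rewrite (@poly_eq _ 0 (-3) (-8) 5) => [|s]; [by field|by rewrite /ka; ring]. Qed.
Let kb_m0 : itg (@kb R) 0 1 = 8 / 3.
Proof. rewrite (@poly_eq _ 3 0 (-1) 0) => [|s]; [by field|by rewrite /kb; ring]. Qed.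
Let kb_m1 : itg (fun s => @kb R s * s) 0 1 = 5 / 4.
Proof. rewrite (@poly_eq _ 0 3 0 (-1)) => [|s]; [by field|by rewrite /kb; ring]. Qed.
Let kc_m0 : itg (@kc R) 0 1 = 2 / 3.
Proof. rewrite (@poly_eq _ 0 2 (-1) 0) => [|s]; [by field|by rewrite /kc; ring]. Qed.
Let kc_m1 : itg (fun s => @kc R s * s) 0 1 = 5 / 12.
Proof. rewrite (@poly_eq _ 0 0 2 (-1)) => [|s]; [by field|by rewrite /kc; ring]. Qed.

Let h0 : `|0 : R| <= e. Proof. by rewrite normr0 ltW. Qed.
Let he : `|e| <= e. Proof. by rewrite gtr0_norm. Qed.
Let hN : `|- e| <= e. Proof. by rewrite normrN gtr0_norm. Qed.

(** The total mass of the kernel is [4 - 16/3 + 8/3 + 2/3 - 2/3 = 4/3]. *)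
Lemma Bop_diff1 L f f1 x : deriv f f1 -> wb w L f1 ->
  `|Bop e f x - 4 / 3 * f x| <= 52 * e * L * w x.
Proof.
move=> Df hL.
have l1 := Tk_diff1 cont_ka ka_le h0 he x Df hL.
have l2 := Tk_diff1 cont_kb kb_le h0 hN x Df hL.
have l3 := Tk_diff1 cont_kc kc_le he he x Df hL.
have l4 := Tk_diff1 cont_kc kc_le hN hN x Df hL.
move: l1 l2 l3 l4; rewrite /Bop /Kop ka_m0 kb_m0 kc_m0 !ler_norml.
move=> /andP[? ?] /andP[? ?] /andP[? ?] /andP[? ?]; apply/andP; split; lra_recent.
Qed.

(** The first moment is -2, from [- 35/12 - 5/4 + 13/12 + 13/12]. This term breaks the reflection
    symmetry. *)
Lemma Bop_diff2 L f f1 f2 x : deriv f f1 -> deriv f1 f2 -> wb w L f2 ->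
  `|Bop e f x - 4 / 3 * f x + 2 * e * f1 x| <= 104 * e ^+ 2 * L * w x.
Proof.
move=> Df Df1 hL.
have l1 := Tk_diff2 cont_ka ka_le h0 he x Df Df1 hL.
have l2 := Tk_diff2 cont_kb kb_le h0 hN x Df Df1 hL.
have l3 := Tk_diff2 cont_kc kc_le he he x Df Df1 hL.
have l4 := Tk_diff2 cont_kc kc_le hN hN x Df Df1 hL.
move: l1 l2 l3 l4; rewrite /Bop /Kop ka_m0 kb_m0 kc_m0 ka_m1 kb_m1 kc_m1 !ler_norml.
move=> /andP[? ?] /andP[? ?] /andP[? ?] /andP[? ?]; apply/andP; split; lra_recent.
Qed.

End Fixed.

Definition Av e f := Tk (fun=> 1) 0 e f.

Definition Qx e f g y := f (y + e) * g (y - e).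

(** The quadratic part of the scaled integrated equation, written as a bilinear form so that it can
    be polarised; it is not symmetric, and its limit at [e = 0] is [2 f g]. *)
Definition Qop e f g x :=
  Av e (fun y => (2 - 20 / 7 * e ^+ 2) * (f y * g y)) x - Av e (Qx e f g) x
  + Av (- e) (Qx e f g) x.

(** With speed [4 + e^2 (gam - 40/7)], the term [40/7 (Av f - f)] is what the shift of [beta] by
    [20/7 e^2] leaves beside [gam f]. The limit at [e = 0] is [gam f - 2 f^2]. *)
Definition Fop e gam f x := (gam - 40 / 7) * f x + 40 / 7 * Av e f x - Qop e f f x.

Lemma cont_transl1 f t : continuous f -> continuous (fun y => f (y + t)).
Proof.
move=> cf; rewrite (_ : (fun _ => _) = (fun x => f (t + 1 * x))); first exact: cont_aff.
by apply/funext => x; rewrite mul1r addrC.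
Qed.

Lemma deriv_transl f f1 t : deriv f f1 -> deriv (fun y => f (y + t)) (fun y => f1 (y + t)).
Proof.
move=> Df; have := deriv_aff t 1 Df.
rewrite (_ : (fun x => f (t + 1 * x)) = (fun y => f (y + t))); last first.
  by apply/funext => x; rewrite mul1r addrC.
by move=> D; apply: deriv_eq D _ => x; rewrite !mul1r addrC.
Qed.

Lemma bu_transl f t : bu f -> bu (fun y => f (y + t)).
Proof.
move=> bf; rewrite (_ : (fun _ => _) = (fun x => f (t + 1 * x))); first exact: bu_aff.
by apply/funext => x; rewrite mul1r addrC.
Qed.

Lemma cont_Qx e f g : continuous f -> continuous g -> continuous (Qx e f g).
Proof. by move=> cf cg; apply: contM; exact: cont_transl1. Qed.

Lemma bu_Av e f : bu f -> bu (Av e f).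
Proof.
move=> [uf [M fM]]; have k1 s : 0 <= s <= 1 -> `|1 : R| <= 1 by rewrite normr1.
split; first exact: Tk_ucont (@cont_cst _ 1) k1 uf.
by exists (1 * M) => x; apply: Tk_le (@cont_cst _ 1) k1 (ucont_cont uf) _.
Qed.

Lemma bu_Qop e f g : bu f -> bu g -> bu (Qop e f g).
Proof.
move=> bf bg; have bQ : bu (Qx e f g) by apply: buM; exact: bu_transl.
apply: buD; [apply: buB|]; apply: bu_Av => //.
by apply: buZ; exact: buM.
Qed.

Lemma bu_Fop e gam f : bu f -> bu (Fop e gam f).
Proof.
move=> bf; apply: buB; last exact: bu_Qop.
by apply: buD; apply: buZ => //; exact: bu_Av.
Qed.

Lemma AvD e f g x : continuous f -> continuous g ->
  Av e (fun y => f y + g y) x = Av e f x + Av e g x.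
Proof. by move=> cf cg; apply: TkD => //; exact: cont_cst. Qed.

Lemma AvB e f g x : continuous f -> continuous g ->
  Av e (fun y => f y - g y) x = Av e f x - Av e g x.
Proof. by move=> cf cg; apply: TkB => //; exact: cont_cst. Qed.

Lemma AvZ e a f x : continuous f -> Av e (fun y => a * f y) x = a * Av e f x.
Proof. by move=> cf; apply: TkZ => //; exact: cont_cst. Qed.

Lemma QopDl e f g h x : continuous f -> continuous g -> continuous h ->
  Qop e (fun y => f y + g y) h x = Qop e f h x + Qop e g h x.
Proof.
move=> cf cg ch; rewrite /Qop.
have E : Qx e (fun y => f y + g y) h = fun y => Qx e f h y + Qx e g h y.
  by apply/funext => y; rewrite /Qx mulrDl.
have [c1 c2] := (cont_Qx (e := e) cf ch, cont_Qx (e := e) cg ch).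
rewrite E !AvD // !AvZ; try exact: contM; last by apply: contM => //; exact: contD.
rewrite (_ : (fun y => (f y + g y) * h y) = fun y => f y * h y + g y * h y).
  by rewrite AvD; [ring|exact: contM|exact: contM].
by apply/funext => y; rewrite mulrDl.
Qed.

Lemma QopDr e f g h x : continuous f -> continuous g -> continuous h ->
  Qop e h (fun y => f y + g y) x = Qop e h f x + Qop e h g x.
Proof.
move=> cf cg ch; rewrite /Qop.
have E : Qx e h (fun y => f y + g y) = fun y => Qx e h f y + Qx e h g y.
  by apply/funext => y; rewrite /Qx mulrDr.
have [c1 c2] := (cont_Qx (e := e) ch cf, cont_Qx (e := e) ch cg).
rewrite E !AvD // !AvZ; try exact: contM; last by apply: contM => //; exact: contD.
rewrite (_ : (fun y => h y * (f y + g y)) = fun y => h y * f y + h y * g y).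
  by rewrite AvD; [ring|exact: contM|exact: contM].
by apply/funext => y; rewrite mulrDr.
Qed.

Lemma QopZl e a f h x : continuous f -> continuous h ->
  Qop e (fun y => a * f y) h x = a * Qop e f h x.
Proof.
move=> cf ch; rewrite /Qop.
have E : Qx e (fun y => a * f y) h = fun y => a * Qx e f h y.
  by apply/funext => y; rewrite /Qx mulrA.
have c1 := cont_Qx (e := e) cf ch.
rewrite E !AvZ //; [|exact: contM|by apply: contM => //; exact: contZ].
rewrite (_ : (fun y => a * f y * h y) = fun y => a * (f y * h y)).
  by rewrite AvZ; [ring|exact: contM].
by apply/funext => y; rewrite mulrA.
Qed.

Lemma QopZr e a f h x : continuous f -> continuous h ->
  Qop e h (fun y => a * f y) x = a * Qop e h f x.
Proof.
move=> cf ch; rewrite /Qop.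
have E : Qx e h (fun y => a * f y) = fun y => a * Qx e h f y.
  by apply/funext => y; rewrite /Qx mulrCA.
have c1 := cont_Qx (e := e) ch cf.
rewrite E !AvZ //; [|exact: contM|by apply: contM => //; exact: contZ].
rewrite (_ : (fun y => h y * (a * f y)) = fun y => a * (h y * f y)).
  by rewrite AvZ; [ring|exact: contM].
by apply/funext => y; rewrite mulrCA.
Qed.

Section FixedQ.
Variables (e : R) (w : R -> R).
Hypotheses (e0 : 0 < e) (e1 : e <= 1 / 100) (sw : slow 3 w).

Let w0 x : 0 < w x. Proof. by case: sw. Qed.
Let w0' x : 0 <= w x. Proof. exact: ltW. Qed.
Let h0 : `|0 : R| <= e. Proof. by rewrite normr0 ltW. Qed.
Let he : `|e| <= e. Proof. by rewrite gtr0_norm. Qed.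
Let hN : `|- e| <= e. Proof. by rewrite normrN gtr0_norm. Qed.
Let he4 : `|e| <= 4 * e. Proof. by rewrite gtr0_norm; move: e0; lra. Qed.
Let hN4 : `|- e| <= 4 * e. Proof. by rewrite normrN. Qed.
Let one01 s : 0 <= s <= 1 -> `|(1 : R)| <= 1. Proof. by rewrite normr1. Qed.
Let m0 : itg (fun _ : R => 1) 0 1 = 1. Proof. by rewrite itg_cst; ring. Qed.
Let m1 : itg (fun s : R => 1 * s) 0 1 = 1 / 2.
Proof.
have D : deriv (fun s : R => 1 / 2 * (s * s)) (fun s => 1 * s).
  by apply: deriv_eq (derivZ (1 / 2) (derivM deriv_id deriv_id)) _ => s; field.
by rewrite (itgE _ _ D); field.
Qed.

Lemma Av_wb a L f : `|a| <= e -> continuous f -> wb w L f -> wb w (2 * L) (Av a f).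
Proof.
move=> ha cf hL; have := Tk_wb e0 e1 sw (@cont_cst _ 1) one01 h0 ha cf hL.
by rewrite mul1r.
Qed.

Lemma Av_diff1 a L f f1 x : `|a| <= e -> deriv f f1 -> wb w L f1 ->
  `|Av a f x - f x| <= 4 * e * L * w x.
Proof.
move=> ha Df hL; have := Tk_diff1 e0 e1 sw (@cont_cst _ 1) one01 h0 ha x Df hL.
by rewrite m0 !mul1r.
Qed.

Lemma Av_diff2 a L f f1 f2 x : `|a| <= e -> deriv f f1 -> deriv f1 f2 -> wb w L f2 ->
  `|Av a f x - f x - a / 2 * f1 x| <= 8 * e ^+ 2 * L * w x.
Proof.
move=> ha Df Df1 hL; have := Tk_diff2 e0 e1 sw (@cont_cst _ 1) one01 h0 ha x Df Df1 hL.
by rewrite m0 m1 !mul1r mul0r add0r.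
Qed.

Let kk : `|2 - 20 / 7 * e ^+ 2| <= 2.
Proof.
have := e1; have := e0; have : e ^+ 2 <= e by rewrite expr2 ler_piMl; move: e0 e1; lra.
have : 0 <= e ^+ 2 by rewrite sqr_ge0.
by rewrite ler_norml => *; apply/andP; split; lra.
Qed.

Let Qx_wbl L M f g : wb w L f -> bnd M g -> wb w (2 * L * M) (Qx e f g).
Proof. by move=> hL hM; apply: wbMr; [exact: (wb_transl e1 sw he4 hL)|move=> x; exact: hM]. Qed.

Let Qx_wbr L M f g : bnd M f -> wb w L g -> wb w (M * (2 * L)) (Qx e f g).
Proof. by move=> hL hM; apply: wbM; [move=> x; exact: hL|exact: (wb_transl e1 sw hN4 hM)]. Qed.

Let Qop_wb0 L f g : continuous f -> continuous g -> wb w L (fun x => f x * g x) ->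
  wb w (2 * L) (Qx e f g) -> wb w (12 * L) (Qop e f g).
Proof.
move=> cf cg h1 h2 x; have cQ := cont_Qx (e := e) cf cg.
have cfg : continuous (fun y => f y * g y) by exact: contM.
have a1 := Av_wb he (@contZ _ (2 - 20 / 7 * e ^+ 2) _ cfg) (wbZ (2 - 20 / 7 * e ^+ 2) h1) x.
have a2 := Av_wb he cQ h2 x; have a3 := Av_wb hN cQ h2 x.
have L0 := mulr_ge0 (wb_ge0 w0 h1) (ltW (w0 x)).
have := ler_wpM2r L0 kk.
move: a1 a2 a3; rewrite /Qop !ler_norml => /andP[? ?] /andP[? ?] /andP[? ?] ?.
by apply/andP; split; lra_recent.
Qed.

Lemma Qop_wbl L M f g : continuous f -> continuous g -> wb w L f -> bnd M g ->
  wb w (12 * (L * M)) (Qop e f g).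
Proof.
move=> cf cg hL hM; apply: Qop_wb0 => //; first exact: wbMr.
by rewrite mulrA; exact: Qx_wbl.
Qed.

Lemma Qop_wbr L M f g : continuous f -> continuous g -> bnd M f -> wb w L g ->
  wb w (12 * (L * M)) (Qop e f g).
Proof.
move=> cf cg hM hL; apply: Qop_wb0 => //; first by rewrite mulrC; exact: wbM.
by have := Qx_wbr hM hL; rewrite mulrCA [M * L]mulrC.
Qed.

Let deriv_Qx f f1 g g1 : deriv f f1 -> deriv g g1 ->
  deriv (Qx e f g) (fun y => Qx e f1 g y + Qx e f g1 y).
Proof. by move=> Df Dg; apply: derivM; exact: deriv_transl. Qed.

(** Only one derivative of each factor is available for the correction, hence an error of first
    order in [e]. Both orders of the arguments are stated because [Qop] is not symmetric. *)
Lemma Qop_diff1 L M f f1 g g1 x : deriv f f1 -> deriv g g1 -> bnd M f -> bnd M f1 ->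
  wb w L g -> wb w L g1 ->
  `|Qop e f g x - 2 * (f x * g x)| <= 60 * e * (L * M) * w x /\
  `|Qop e g f x - 2 * (f x * g x)| <= 60 * e * (L * M) * w x.
Proof.
move=> Df Dg fM f1M gL g1L.
have [cf cg] := (deriv_cont Df, deriv_cont Dg).
have M0 := bnd_ge0 fM; have L0 := wb_ge0 w0 gL.
have LM := mulr_ge0 (mulr_ge0 L0 M0) (ltW (w0 x)).
have eLM := mulr_ge0 (ltW e0) LM.
have ee : e * e <= e / 100 by have := e1; have := e0; nra.
have eeLM : e * e * (L * M * w x) <= e / 100 * (L * M * w x) by rewrite ler_wpM2r.
have cfg : continuous (fun y => f y * g y) by exact: contM.
have Dfg : deriv (fun y => f y * g y) (fun y => f1 y * g y + f y * g1 y) by exact: derivM.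
have wfg : wb w (M * L + M * L) (fun y => f1 y * g y + f y * g1 y).
  by apply: wbD; exact: wbM.
have a1 := Av_diff1 x he Dfg wfg.
have pt : `|f x * g x| <= M * L * w x by rewrite normrM -mulrA ler_pM.
have E : (fun y => (2 - 20 / 7 * e ^+ 2) * (g y * f y)) =
    (fun y => (2 - 20 / 7 * e ^+ 2) * (f y * g y)).
  by apply/funext => y; rewrite [g y * _]mulrC.
have core h : continuous h -> (forall a, `|a| <= e -> `|Av a h x - h x| <= 16 * e * (L * M) * w x) ->
   `|Av e (fun y => (2 - 20 / 7 * e ^+ 2) * (f y * g y)) x - Av e h x + Av (- e) h x - 2 * (f x * g x)|
   <= 60 * e * (L * M) * w x.
  move=> ch H; have := H e he; have := H (- e) hN; move: a1 pt.
  rewrite AvZ // expr2; set A := Av e _ x; set B := Av e h x; set C := Av (- e) h x.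
  rewrite !ler_norml => /andP[? ?] /andP[? ?] /andP[? ?] /andP[? ?].
  have : `|e * e * A| <= e * e * (2 * (L * M * w x)).
    have ee0 : 0 <= e * e by rewrite mulr_ge0 // ltW.
    rewrite normrM (ger0_norm ee0); apply: ler_wpM2l => //; rewrite ler_norml.
    have : e * (L * M * w x) <= 1 / 100 * (L * M * w x) by rewrite ler_wpM2r.
    by move=> ?; apply/andP; split; lra_recent.
  rewrite ler_norml => /andP[? ?]; apply/andP; split; lra_recent.
have wQ1 : wb w (M * (2 * L) + M * (2 * L)) (fun y => Qx e f1 g y + Qx e f g1 y).
  by apply: wbD; exact: Qx_wbr.
have wQ2 : wb w (2 * L * M + 2 * L * M) (fun y => Qx e g1 f y + Qx e g f1 y).
  by apply: wbD; exact: Qx_wbl.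
rewrite /Qop E; split; (apply: core; first exact: cont_Qx); move=> a ha.
  apply: le_trans (_ : 4 * e * (M * (2 * L) + M * (2 * L)) * w x <= _); last lra.
  exact: Av_diff1 ha (deriv_Qx Df Dg) wQ1.
apply: le_trans (_ : 4 * e * (2 * L * M + 2 * L * M) * w x <= _); last lra.
exact: Av_diff1 ha (deriv_Qx Dg Df) wQ2.
Qed.

(** The first order terms of the three averages cancel. *)
Lemma Qop_diff2 L M f f1 f2 g g1 g2 x : deriv f f1 -> deriv f1 f2 -> deriv g g1 -> deriv g1 g2 ->
  bnd M f -> bnd M f1 -> bnd M f2 -> wb w L g -> wb w L g1 -> wb w L g2 ->
  `|Qop e f g x - 2 * (f x * g x)| <= 300 * e ^+ 2 * (L * M) * w x.
Proof.
move=> Df Df1 Dg Dg1 fM f1M f2M gL g1L g2L.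
have [cf cg] := (deriv_cont Df, deriv_cont Dg).
have M0 := bnd_ge0 fM; have L0 := wb_ge0 w0 gL.
have LM := mulr_ge0 (mulr_ge0 L0 M0) (ltW (w0 x)).
have eeLM := mulr_ge0 (mulr_ge0 (ltW e0) (ltW e0)) LM.
have cfg : continuous (fun y => f y * g y) by exact: contM.
have Dfg : deriv (fun y => f y * g y) (fun y => f1 y * g y + f y * g1 y) by exact: derivM.
have Dfg1 : deriv (fun y => f1 y * g y + f y * g1 y)
   (fun y => (f2 y * g y + f1 y * g1 y) + (f1 y * g1 y + f y * g2 y)).
  by apply: derivD; exact: derivM.
have wfg : wb w ((M * L + M * L) + (M * L + M * L))
   (fun y => (f2 y * g y + f1 y * g1 y) + (f1 y * g1 y + f y * g2 y)).
  by apply: wbD; apply: wbD; exact: wbM.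
have a1 := Av_diff2 x he Dfg Dfg1 wfg.
have DQ := deriv_Qx Df Dg.
have DQ1 : deriv (fun y => Qx e f1 g y + Qx e f g1 y)
   (fun y => (Qx e f2 g y + Qx e f1 g1 y) + (Qx e f1 g1 y + Qx e f g2 y)).
  by apply: derivD; exact: deriv_Qx.
have wQ2 : wb w ((M * (2 * L) + M * (2 * L)) + (M * (2 * L) + M * (2 * L)))
   (fun y => (Qx e f2 g y + Qx e f1 g1 y) + (Qx e f1 g1 y + Qx e f g2 y)).
  by apply: wbD; apply: wbD; exact: Qx_wbr.
have a2 := Av_diff2 x he DQ DQ1 wQ2; have a3 := Av_diff2 x hN DQ DQ1 wQ2.
have b u u1 v v1 : deriv u u1 -> deriv v v1 -> bnd M u -> bnd M u1 -> wb w L v -> wb w L v1 ->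
   `|Qx e u v x - u x * v x| <= 6 * e * (L * M) * w x.
  move=> Du Dv uM u1M vL v1L; rewrite /Qx.
  have p1 := diff1 e1 (slow_cst (ler0n _ 3)) x he4 Du (bnd_wb u1M).
  have p2 := diff1 e1 sw x hN4 Dv v1L.
  have p3 := wb_transl e1 sw hN4 vL x.
  rewrite normrN (gtr0_norm e0) in p2; rewrite (gtr0_norm e0) mulr1 in p1.
  rewrite (_ : _ - _ = (u (x + e) - u x) * v (x - e) + u x * (v (x - e) - v x)); last ring.
  apply: le_trans (ler_normD _ _) _; rewrite !normrM.
  have := ler_pM (normr_ge0 _) (normr_ge0 _) p1 p3.
  have := ler_pM (normr_ge0 _) (normr_ge0 _) (uM x) p2.
  lra_recent.
have b1 := b f1 f2 g g1 Df1 Dg f1M f2M gL g1L.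
have b2 := b f f1 g1 g2 Df Dg1 fM f1M g1L g2L.
have pt : `|f x * g x| <= M * L * w x by rewrite normrM -mulrA ler_pM.
have pt1 : `|f1 x * g x + f x * g1 x| <= (M * L + M * L) * w x.
  by apply: (@wbD w _ _ (fun x => f1 x * g x) (fun x => f x * g1 x)); exact: wbM.
have eb1 := ler_wpM2l (ltW e0) b1; have eb2 := ler_wpM2l (ltW e0) b2.
rewrite -{1}[e](gtr0_norm e0) -normrM in eb1; rewrite -{1}[e](gtr0_norm e0) -normrM in eb2.
cbv beta in a1, a2, a3, pt1, eb1, eb2.
move: a1 a2 a3 pt pt1 eb1 eb2; rewrite /Qop AvZ // !expr2.
set A := Av e _ x; set B := Av e _ x; set C := Av (- e) _ x.
set FG := f x * g x; set FG1 := f1 x * g x + f x * g1 x.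
move=> a1 a2 a3 pt pt1 eb1 eb2.
have hA : `|e * e * A| <= e * e * (3 * (L * M * w x)).
  have ee0 : 0 <= e * e by rewrite mulr_ge0 // ltW.
  rewrite normrM (ger0_norm ee0); apply: ler_wpM2l => //.
  have t1 : e * `|FG1| <= 1 / 100 * ((M * L + M * L) * w x) by apply: ler_pM => //; exact: ltW.
  have t2 : e * e * (L * M * w x) <= 1 / 100 * (L * M * w x).
    by apply: ler_wpM2r => //; have := e1; have := e0; nra.
  have t3 : `|e / 2 * FG1| = e / 2 * `|FG1| by rewrite normrM ger0_norm // divr_ge0 // ltW.
  have tA : `|A| <= `|A - FG - e / 2 * FG1| + `|FG| + `|e / 2 * FG1|.
    have := ler_normD (A - FG - e / 2 * FG1) (e / 2 * FG1); have := ler_normD (A - FG) FG.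
    by rewrite !subrK; lra_recent.
  rewrite t3 in tA; apply: le_trans tA _.
  by move: a1 pt t1 t2; lra_recent.
clear Dfg Dfg1 wfg DQ DQ1 wQ2 b1 b2 pt1; rewrite /FG1 in a1; clear FG1.
move: a1 a2 a3 eb1 eb2 hA; rewrite !ler_norml.
move=> /andP[l1 u1] /andP[l2 u2] /andP[l3 u3] /andP[l4 u4] /andP[l5 u5] /andP[l6 u6].
by apply/andP; split; move: u1 u2 u3 u4 u5 u6 l1 l2 l3 l4 l5 l6; lra_recent.
Qed.

End FixedQ.

End Consistency.

(** * The soliton and its first order solvability condition *)

Section Profile.
Context {R : realType}.
Implicit Types (x y s t : R) (k : nat).

(** The derivatives of the KdV soliton profile [2 sech^2], which solves
    [p'' = 4 p - 3 p^2]. *)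
Definition pj k : R -> R := match k with
  | 0 => fun x => 2 * sq x
  | 1 => fun x => - 4 * phi x
  | 2 => fun x => 4 * (2 * sq x) - 3 * ((2 * sq x) * (2 * sq x))
  | 3 => fun x => (4 - 6 * (2 * sq x)) * (- 4 * phi x)
  | 4 => fun x => (4 - 6 * (2 * sq x)) * (4 * (2 * sq x) - 3 * ((2 * sq x) * (2 * sq x)))
            - 6 * ((- 4 * phi x) * (- 4 * phi x))
  | _ => fun x => (4 - 6 * (2 * sq x)) * ((4 - 6 * (2 * sq x)) * (- 4 * phi x))
            - 18 * ((- 4 * phi x) * (4 * (2 * sq x) - 3 * ((2 * sq x) * (2 * sq x))))
  end.

Lemma deriv_pj0 : deriv (pj 0) (pj 1).
Proof. by apply: deriv_eq (derivZ 2 (@deriv_sq R)) _ => x; rewrite /= /phi; ring. Qed.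

Lemma deriv_pj1 : deriv (pj 1) (pj 2).
Proof.
apply: deriv_eq (derivZ (- 4) (@deriv_phi R)) _ => x; have := th2 x.
by rewrite /= /phi1 => ->; ring.
Qed.

Lemma deriv_pj2 : deriv (pj 2) (pj 3).
Proof.
by apply: deriv_eq (derivB (derivZ 4 deriv_pj0) (derivZ 3 (derivM deriv_pj0 deriv_pj0))) _ => x /=; ring.
Qed.

Lemma deriv_aff_sq : deriv (fun x : R => 4 - 6 * (2 * sq x)) (fun x => - 6 * (- 4 * phi x)).
Proof. by apply: deriv_eq (derivB (deriv_cst 4) (derivZ 6 deriv_pj0)) _ => x /=; ring. Qed.

Lemma deriv_pj3 : deriv (pj 3) (pj 4).
Proof. by apply: deriv_eq (derivM deriv_aff_sq deriv_pj1) _ => x /=; ring. Qed.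

Lemma deriv_pj4 : deriv (pj 4) (pj 5).
Proof.
by apply: deriv_eq (derivB (derivM deriv_aff_sq deriv_pj2) (derivZ 6 (derivM deriv_pj1 deriv_pj1))) _ => x /=; ring.
Qed.

Lemma deriv_pj k : (k < 5)%N -> deriv (pj k) (pj k.+1).
Proof.
case: k => [|[|[|[|[|k]]]]] k5.
- exact: deriv_pj0.
- exact: deriv_pj1.
- exact: deriv_pj2.
- exact: deriv_pj3.
- exact: deriv_pj4.
- by case: (notF k5).
Qed.

Lemma pj_le k x : `|pj k x| <= 20000 * expR (- (2 * `|x|)).
Proof.
have [s0 s1] := (sq_gt0 x, sq_le1 x); have /andP[_ sb] := sq_bounds x.
have pb := phi_le x; have e0 := expR_gt0 (- (2 * `|x|)).
set E := expR _ in sb pb e0 *.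
have p1 : `|phi x| <= 1.
  by rewrite /phi normrM (gtr0_norm s0); have := ler_pM (ltW s0) (normr_ge0 (th x)) s1 (th_le1 x); rewrite mulr1.
have a0 : `|2 * sq x| <= 8 * E by rewrite gtr0_norm; lra.
have a0' : `|2 * sq x| <= 2 by rewrite gtr0_norm; lra_local.
have a1 : `|- 4 * phi x| <= 16 * E.
  by move: pb; rewrite !ler_norml => /andP[? ?]; apply/andP; split; lra_local.
have a1' : `|- 4 * phi x| <= 4.
  by move: p1; rewrite !ler_norml => /andP[? ?]; apply/andP; split; lra_local.
have b : `|4 - 6 * (2 * sq x)| <= 16.
  by move: a0'; rewrite !ler_norml => /andP[? ?]; apply/andP; split; lra_local.
have c : `|4 * (2 * sq x) - 3 * ((2 * sq x) * (2 * sq x))| <= 80 * E.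
  have := ler_pM (normr_ge0 _) (normr_ge0 _) a0' a0; rewrite -normrM; move: a0.
  by rewrite !ler_norml => /andP[? ?] /andP[? ?]; apply/andP; split; lra_local.
have c' : `|4 * (2 * sq x) - 3 * ((2 * sq x) * (2 * sq x))| <= 20.
  have := ler_pM (normr_ge0 _) (normr_ge0 _) a0' a0'; rewrite -normrM; move: a0'.
  by rewrite !ler_norml => /andP[? ?] /andP[? ?]; apply/andP; split; lra_local.
have d : `|(4 - 6 * (2 * sq x)) * (- 4 * phi x)| <= 256 * E.
  by have := ler_pM (normr_ge0 _) (normr_ge0 _) b a1; rewrite -normrM; lra_local.
case: k => [|[|[|[|[|k]]]]] /=.
- move: a0 e0; clear; lra.
- move: a1 e0; clear; lra.
- move: c e0; clear; lra.
- move: d e0; clear; lra.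
- have := ler_pM (normr_ge0 _) (normr_ge0 _) b c; rewrite -normrM.
  have := ler_pM (normr_ge0 _) (normr_ge0 _) a1' a1; rewrite -normrM.
  set X := - 4 * phi x * _; set Y := (4 - _) * _ => hX hY.
  by have := ler_normB Y (6 * X); rewrite [`|6 * X|]normrM (ger0_norm (ler0n _ 6)); move: hX hY e0; clear; lra.
have := ler_pM (normr_ge0 _) (normr_ge0 _) b d; rewrite -normrM.
have := ler_pM (normr_ge0 _) (normr_ge0 _) a1' c; rewrite -normrM.
set X := - 4 * phi x * _; set Y := (4 - _) * _ => hX hY.
by have := ler_normB Y (18 * X); rewrite [`|18 * X|]normrM (ger0_norm (ler0n _ 18)); move: hX hY e0; clear; lra.
Qed.

(** For [k <= 5], the [k]-th derivative of the soliton [2 s^2 sech^2 (s x)]. *)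
Definition Ps s k x := s ^+ k.+2 * pj k (s * x).

Lemma deriv_Ps s k : (k < 5)%N -> deriv (Ps s k) (Ps s k.+1).
Proof.
move=> k5; have := derivZ (s ^+ k.+2) (deriv_aff 0 s (deriv_pj k5)).
rewrite (_ : (fun x => _ * pj k (0 + s * x)) = Ps s k); last first.
  by apply/funext => x; rewrite add0r.
by move=> D; apply: deriv_eq D _ => x; rewrite add0r /Ps [s ^+ k.+1.+2]exprS; ring.
Qed.

Lemma Ps2E s x : Ps s 2 x = 4 * s ^+ 2 * Ps s 0 x - 3 * Ps s 0 x ^+ 2.
Proof. by rewrite /Ps /=; ring. Qed.

(** For [s >= 3/4] the soliton decays at least like [exp (- 3/2 |x|)]; compared with the weight
    [exp (- |x|)] a factor [exp (- |x| / 2)] remains. *)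
Definition srange s := 3 / 4 <= s <= 5 / 4.

Definition exp_decay x : R := expR (- `|x|).

Lemma exp_decayE s x : srange s -> expR (- (2 * `|s * x|)) <= expR (- (1 / 2 * `|x|)) * exp_decay x.
Proof.
move=> /andP[s1 s2]; rewrite -expRD ler_expR normrM ger0_norm; last lra.
have := ler_wpM2r (normr_ge0 x) s1; lra.
Qed.

Lemma pow_le s k : srange s -> (k <= 7)%N -> `|s ^+ k| <= 2 ^+ 7.
Proof.
move=> /andP[s1 s2] k7; rewrite ger0_norm; last by rewrite exprn_ge0 //; lra.
apply: (@le_trans _ _ (2 ^+ k)); first by apply: lerXn2r; rewrite ?nnegrE; lra.
by rewrite ler_eXn2l //; lra.
Qed.

Lemma pj_bound : exists2 K, 0 < K & forall k x, `|pj k x| <= K * expR (- (2 * `|x|)).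
Proof. by exists 20000 => [|k x]; [lra_local|exact: pj_le]. Qed.

Lemma Ps_bound : exists2 C, 0 < C & forall s k x, srange s -> (k <= 5)%N ->
  `|Ps s k x| <= C * expR (- `|x|).
Proof.
have [K K0 HK] := pj_bound; exists (2 ^+ 7 * K) => [|s k x hs k5]; first by rewrite mulr_gt0 // exprn_gt0.
rewrite /Ps normrM -mulrA; apply: ler_pM => //; first exact: pow_le.
apply: le_trans (HK _ _) _; apply: ler_wpM2l; first exact: ltW.
apply: le_trans (exp_decayE x hs) _; rewrite -[X in _ <= X]mul1r.
apply: ler_wpM2r; first exact: expR_ge0.
by rewrite expR_le1 oppr_le0 mulr_ge0 // divr_ge0.
Qed.

Lemma deriv_pow n : deriv (fun t : R => t ^+ n.+1) (fun t => n.+1%:R * t ^+ n).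
Proof.
elim: n => [|n IH]; first by apply: deriv_eq deriv_id _ => t; rewrite expr0 mulr1.
apply: (deriv_ext (F := fun t : R => t * t ^+ n.+1)); first by move=> t; rewrite -exprS.
by apply: deriv_eq (derivM deriv_id IH) _ => t; rewrite -[n.+2%:R]natr1 [t ^+ n.+1]exprS; ring.
Qed.

Lemma deriv_abs_between (F f : R -> R) M a b : deriv F f ->
  (forall x, a <= x <= b \/ b <= x <= a -> `|f x| <= M) -> `|F b - F a| <= M * `|b - a|.
Proof.
move=> Ff; wlog ab : a b / a <= b => [W|] fM.
  have [ab|/ltW ba] := leP a b; first exact: W.
  by rewrite distrC [`|b - a|]distrC; apply: W => // x hx; apply: fM; tauto.
have DM := derivZ M deriv_id; have DN := derivN DM.
have fM' x : a <= x <= b -> `|f x| <= M by move=> hx; apply: fM; left.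
have H1 := deriv_le DN Ff ab; have H2 := deriv_le Ff DM ab.
rewrite (ger0_norm (_ : 0 <= b - a)) ?subr_ge0 // ler_norml; apply/andP; split.
  suff : - (M * b) - - (M * a) <= F b - F a by lra.
  by apply: H1 => x /fM'; rewrite ler_norml => /andP[]; lra.
suff : F b - F a <= M * b - M * a by lra.
by apply: H2 => x /fM'; rewrite ler_norml => /andP[]; lra.
Qed.

(** Differentiation in [s] brings out a factor [x], absorbed by the surplus decay of
    [exp_decayE]. *)
Lemma Ps_lip : exists2 C, 0 < C & forall s s' k x, srange s -> srange s' -> (k <= 4)%N ->
  `|Ps s k x - Ps s' k x| <= C * `|s - s'| * expR (- `|x|).
Proof.
have [K K0 HK] := pj_bound; exists (7 * 2 ^+ 7 * K + 2 ^+ 7 * (K * 2)).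
  by rewrite addr_gt0 // !mulr_gt0 // exprn_gt0.
move=> s s' k x hs hs' k4.
have A : `|s ^+ k.+2 - s' ^+ k.+2| <= 7 * 2 ^+ 7 * `|s - s'|.
  have D : deriv (fun t : R => t ^+ k.+2) (fun t => k.+2%:R * t ^+ k.+1).
    exact: deriv_pow.
  apply: deriv_abs_between D _ => t ht.
  have rt : srange t.
    by move: hs hs' ht; rewrite /srange => /andP[? ?] /andP[? ?] [] /andP[? ?]; apply/andP; split; lra_local.
  rewrite normrM; apply: ler_pM => //; last by apply: pow_le => //; rewrite ltnS (leq_trans k4).
  by rewrite ger0_norm // ler_nat; apply: leq_trans (k4 : (k.+2 <= 6)%N) _.
have B : `|pj k (s * x) - pj k (s' * x)| <= K * 2 * `|s - s'| * exp_decay x.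
  have D := deriv_aff 0 x (deriv_pj (leq_ltn_trans k4 (ltnSn 4))).
  have := @deriv_abs_between _ _ (K * 2 * exp_decay x) s' s D.
  rewrite !add0r ![x * _]mulrC => H; rewrite mulrAC; apply: H => t ht.
  have rt : srange t.
    by move: hs hs' ht; rewrite /srange => /andP[? ?] /andP[? ?] [] /andP[? ?]; apply/andP; split; lra_local.
  rewrite add0r [x * t]mulrC normrM.
  have h1 := le_trans (HK k.+1 (t * x)) (ler_wpM2l (ltW K0) (exp_decayE x rt)).
  apply: le_trans (ler_wpM2l (normr_ge0 x) h1) _.
  have h2 : `|x| * expR (- (1 / 2 * `|x|)) <= 2.
    have := xexp_le1 (_ : 0 <= 1 / 2 * `|x|).
    have p : 0 <= 1 / 2 * `|x| by rewrite mulr_ge0 // divr_ge0.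
    by move=> /(_ p); lra_local.
  rewrite mulrCA -[K * 2 * _]mulrA; apply: ler_wpM2l; first exact: ltW.
  by rewrite mulrA ler_wpM2r ?expR_ge0.
have C : `|pj k (s * x)| <= K * exp_decay x.
  apply: le_trans (HK _ _) _; apply: ler_wpM2l; first exact: ltW.
  apply: le_trans (exp_decayE x hs) _; rewrite -[X in _ <= X]mul1r.
  apply: ler_wpM2r; first exact: expR_ge0.
  by rewrite expR_le1 oppr_le0 mulr_ge0 // divr_ge0.
have -> : Ps s k x - Ps s' k x = (s ^+ k.+2 - s' ^+ k.+2) * pj k (s * x) +
   s' ^+ k.+2 * (pj k (s * x) - pj k (s' * x)) by rewrite /Ps; ring.
apply: le_trans (ler_normD _ _) _; rewrite normrM [X in _ + X <= _]normrM.
have P : `|s' ^+ k.+2| <= 2 ^+ 7 by apply: pow_le => //; rewrite !ltnS (leq_trans k4).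
have h1 := ler_pM (normr_ge0 _) (normr_ge0 _) A C.
have h2 := ler_pM (normr_ge0 _) (normr_ge0 _) P B.
rewrite -/(exp_decay x); move: h1 h2; lra_local.
Qed.

Lemma tends_M (F G : R -> R) a b : tends F a -> tends G b -> (forall x, `|G x| <= 1) ->
  tends (fun x => F x * G x) (a * b).
Proof.
move=> hF hG G1 e e0.
have a1 : 0 < `|a| + 1 by have := normr_ge0 a; lra.
have e2 : 0 < e / 2 by lra.
have [X HX] := hF _ e2; have [Y HY] := hG _ (divr_gt0 e2 a1).
exists (Num.max X Y) => x; rewrite ge_max => /andP[/HX h1 /HY h2].
rewrite (_ : _ - _ = (F x - a) * G x + a * (G x - b)); last ring.
apply: le_trans (ler_normD _ _) _; rewrite !normrM.
have h3 := ler_pM (normr_ge0 _) (normr_ge0 _) h1 (G1 x).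
have h4 : `|a| * `|G x - b| <= e / 2.
  apply: le_trans (ler_wpM2l (normr_ge0 a) h2) _.
  by rewrite mulrA ler_pdivrMr // mulrC ler_wpM2l //; lra_local.
lra.
Qed.

Lemma th_tends s : 0 < s -> tends (fun x => th (s * x)) 1 /\ tends (fun x => th (s * - x)) (- 1).
Proof.
move=> s0; have H : tends (fun x => th (s * x)) 1.
  apply: (@tends_dom _ _ _ (2 * s) 4); first by rewrite mulr_gt0.
  move=> x x0; have sx : 0 <= s * x by rewrite mulr_ge0 // ltW.
  have := th2 (s * x); have := th_le1 (s * x); have /andP[_] := sq_bounds (s * x).
  rewrite (ger0_norm sx) mulrA.
  have t0 : 0 <= th (s * x).
    by rewrite /th divr_ge0 ?(ltW (Ech_gt0 _)) // subr_ge0 ler_expR; lra.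
  set E := expR _; rewrite !ler_norml => h1 /andP[_ h2] h3.
  have : th (s * x) ^+ 2 <= th (s * x) by rewrite expr2 ler_piMr.
  by move=> h4; apply/andP; split; lra.
split=> //; have := tendsZ (-1) H; rewrite mulr1.
by apply: tends_eq => x _; rewrite mulrN thN mulN1r.
Qed.

(** After an integration by parts the left side is [20/7] times the integral of [P'^2] minus that of
    [P''^2]; the two scale like [s^5] and [s^7]. The simple zero at [s = 1] is what determines the
    width. *)
Lemma solvability s : 0 < s ->
  Tint (fun x => (20 / 7 * Ps s 1 x + Ps s 3 x) * Ps s 1 x) = 256 / 21 * s ^+ 5 * (1 - s ^+ 2).
Proof.
move=> s0.
pose T3 x : R := th x * th x * th x.
pose T5 x : R := T3 x * th x * th x.
pose T7 x : R := T5 x * th x * th x.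
(* An explicit primitive: as [th' = sech^2], both [phi^2] and [phi1^2] are polynomials in [th] times
   [th'], and [phi * phi1] is the boundary term of the integration by parts. *)
pose G0 (x : R) := 16 * s ^+ 5 * (20 / 7 * (1 / 3 * T3 x - 1 / 5 * T5 x) +
   s ^+ 2 * (phi x * phi1 x - (th x - 7 / 3 * T3 x + 3 * T5 x - 9 / 7 * T7 x))).
have Dt := @deriv_th R.
have D3 := derivM (derivM Dt Dt) Dt.
have D5 := derivM (derivM D3 Dt) Dt.
have D7 := derivM (derivM D5 Dt) Dt.
have DG0 := derivZ (16 * s ^+ 5) (derivD (derivZ (20 / 7) (derivB (derivZ (1 / 3) D3) (derivZ (1 / 5) D5)))
  (derivZ (s ^+ 2) (derivB (derivM (@deriv_phi R) (@deriv_phi1 R))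
    (derivB (derivD (derivB Dt (derivZ (7 / 3) D3)) (derivZ 3 D5)) (derivZ (9 / 7) D7))))).
have DG := deriv_aff 0 s DG0.
have lim l sg : l * l = 1 -> tends (fun x => th (s * (sg * x))) l -> sg = 1 \/ sg = -1 ->
    tends (fun x => G0 (0 + s * (sg * x))) (16 * s ^+ 5 * (20 / 7 * (2 / 15) - s ^+ 2 * (8 / 21)) * l).
  move=> ll hl hsg.
  have b1 x : `|th (s * (sg * x))| <= 1 by exact: th_le1.
  have l2 := tends_M hl hl b1; rewrite ll in l2.
  have l3 := tends_M l2 hl b1; rewrite mul1r in l3.
  have l4 := tends_M l3 hl b1; rewrite ll in l4.
  have l5 := tends_M l4 hl b1; rewrite mul1r in l5.
  have l6 := tends_M l5 hl b1; rewrite ll in l6.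
  have l7 := tends_M l6 hl b1; rewrite mul1r in l7.
  have lpp : tends (fun x => phi (s * (sg * x)) * phi1 (s * (sg * x))) 0.
    apply: (@tends_dom _ _ _ (2 * s) 32); first by rewrite mulr_gt0.
    move=> x x0; rewrite subr0 normrM.
    have E : `|s * (sg * x)| = s * x.
      by rewrite !normrM (gtr0_norm s0) (ger0_norm x0); case: hsg => ->; rewrite ?normrN normr1 mul1r.
    have := ler_pM (normr_ge0 _) (normr_ge0 _) (phi_le (s * (sg * x))) (phi1_le (s * (sg * x))).
    rewrite E (mulrA 2 s x) => h; apply: le_trans h _.
    have e1 : expR (- (2 * s * x)) <= 1.
      by rewrite expR_le1 oppr_le0 mulr_ge0 // mulr_ge0 // ltW.
    have e0 := expR_gt0 (- (2 * s * x)).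
    by have := ler_wpM2l (ltW e0) e1; lra_local.
  have := tendsZ (16 * s ^+ 5) (tendsD (tendsZ (20 / 7) (tendsB (tendsZ (1 / 3) l3) (tendsZ (1 / 5) l5)))
    (tendsZ (s ^+ 2) (tendsB lpp (tendsB (tendsD (tendsB hl (tendsZ (7 / 3) l3)) (tendsZ 3 l5)) (tendsZ (9 / 7) l7))))).
  rewrite (_ : 16 * s ^+ 5 * (20 / 7 * (2 / 15) - s ^+ 2 * (8 / 21)) * l =
    16 * s ^+ 5 * (20 / 7 * (1 / 3 * l - 1 / 5 * l) + s ^+ 2 * (0 - (l - 7 / 3 * l + 3 * l - 9 / 7 * l)))); last by field.
  by move=> H; apply: tends_eq H => x _; rewrite add0r /G0 /T3 /T5 /T7.
have [t1 t2] := th_tends s0.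
have t1' : tends (fun x => th (s * (1 * x))) 1 by apply: tends_eq t1 => x _; rewrite mul1r.
have t2' : tends (fun x => th (s * (-1 * x))) (-1) by apply: tends_eq t2 => x _; rewrite mulN1r.
have k1 := lim 1 1 (mulr1 1) t1' (or_introl erefl).
have kk : -1 * -1 = 1 :> R by rewrite mulrNN mulr1.
have k2 := lim (-1) (-1) kk t2' (or_intror erefl).
rewrite (@Tint_deriv _ (fun x => G0 (0 + s * x)) _
  (16 * s ^+ 5 * (20 / 7 * (2 / 15) - s ^+ 2 * (8 / 21)) * 1)
  (16 * s ^+ 5 * (20 / 7 * (2 / 15) - s ^+ 2 * (8 / 21)) * (-1))).
- by field.
- apply: deriv_eq DG _ => x; rewrite /T7 /T5 /T3 add0r /Ps /=.
  have := th2 (s * x); rewrite /phi /phi1 => t2x.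
  have -> : sq (s * x) = 1 - th (s * x) ^+ 2 by rewrite t2x; ring.
  by field.
- apply: contM; last by apply: deriv_cont (deriv_Ps s _).
  apply: contD; first by apply: contZ; exact: deriv_cont (deriv_Ps s _).
  exact: deriv_cont (deriv_Ps s _).
- by apply: tends_eq k1 => x _; rewrite mul1r.
- by apply: tends_eq k2 => x _; rewrite mulN1r.
Qed.

End Profile.

(** * Expansion of the residual and of the linearised equation *)

Section Residual.
Context {R : realType}.
Implicit Types (f h : nat -> R -> R) (V Y p w : R -> R) (x s g L M : R).

Definition jets (n : nat) f := forall k, (k < n)%N -> deriv (f k) (f k.+1).

Variables (e : R).
Hypotheses (e0 : 0 < e) (e1 : e <= 1 / 100).

Let eta := e ^+ 2 / 2.

Let ee0 : 0 <= e ^+ 2. Proof. by rewrite exprn_ge0 // ltW. Qed.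
Let eta0 : 0 <= eta. Proof. by rewrite divr_ge0. Qed.
Let ee1 : e ^+ 2 <= 1 / 10000.
Proof. by rewrite expr2; have := ler_pM (ltW e0) (ltW e0) e1 e1; lra. Qed.
Let ee2 : e ^+ 2 <= e / 100.
Proof. by rewrite expr2; have := ler_wpM2l (ltW e0) e1; lra. Qed.
Let eta1 : eta <= 1. Proof. by rewrite /eta; have := ee1; lra. Qed.

(** The first order terms of [2 F - B P'']: [80/7 * e/2 * f'] from the window average and [2 e f''']
    from the first moment of the averaging operator acting on [f'']. The quadratic part has none. *)
Definition R1op f x := 2 * (20 / 7 * f 1 x + f 3 x).

Definition remL f x :=
  40 / 7 * (2 * eta * f 2 x) +
  80 / 7 * (Av e (f 0%N) x - f 0%N x - e / 2 * f 1%N x - eta * Av e (f 2%N) x)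
  - (Bop e (f 2%N) x - 4 / 3 * f 2%N x + 2 * e * f 3%N x).

Definition remB f h x :=
  - 2 * (Qop e (f 0%N) (h 0%N) x - 2 * (f 0%N x * h 0%N x))
  + 2 * eta * (Qop e (f 0%N) (h 2%N) x + Qop e (f 2%N) (h 0%N) x)
  - 2 * eta ^+ 2 * Qop e (f 2%N) (h 2%N) x.

Lemma absD3 (a b c A B C : R) : `|a| <= A -> `|b| <= B -> `|c| <= C -> `|a + b - c| <= A + B + C.
Proof.
move=> ha hb hc; apply: le_trans (ler_normB _ _) _; apply: lerD => //.
by apply: le_trans (ler_normD _ _) _; exact: lerD.
Qed.

Lemma absM (a b A B : R) : `|a| <= A -> `|b| <= B -> `|a * b| <= A * B.
Proof. by move=> ha hb; rewrite normrM; exact: ler_pM. Qed.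

Let absE (a : R) : 0 <= a -> `|a| <= a. Proof. by move=> ?; rewrite ger0_norm. Qed.

Lemma remL_le w f L x : slow 3 w -> jets 4 f -> (forall k, (k <= 4)%N -> wb w L (f k)) ->
  `|remL f x| <= 300 * e ^+ 2 * (L * w x).
Proof.
move=> sw Jf fL; have [w0 _] := sw.
have D k : (k < 4)%N -> deriv (f k) (f k.+1) by move=> /Jf.
have L0 := mulr_ge0 (wb_ge0 w0 (fL 0%N isT)) (ltW (w0 x)).
have he : `|e| <= e by rewrite gtr0_norm.
have a := fL 2%N isT x.
have b := Av_diff2 e0 e1 sw x he (D 0%N isT) (D 1%N isT) (fL 2%N isT).
have c := Av_wb e0 e1 sw he (deriv_cont (D 2%N isT)) (fL 2%N isT) x.
have d := Bop_diff2 e0 e1 sw x (D 2%N isT) (D 3%N isT) (fL 4%N isT).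
have a' := absM (absE eta0) a; have c' := absM (absE eta0) c.
rewrite /remL; move: a' b c' d; rewrite /eta !ler_norml.
move=> /andP[? ?] /andP[? ?] /andP[? ?] /andP[? ?].
have h0 := mulr_ge0 ee0 L0; apply/andP; split; lra_recent.
Qed.

Lemma remB_le w f h L M x : slow 3 w -> jets 4 f -> jets 4 h ->
  (forall k, (k <= 4)%N -> bnd M (f k)) -> (forall k, (k <= 4)%N -> wb w L (h k)) ->
  `|remB f h x| <= 700 * e ^+ 2 * (L * M * w x).
Proof.
move=> sw Jf Jh fM hL; have [w0 _] := sw.
have D k : (k < 4)%N -> deriv (f k) (f k.+1) by move=> /Jf.
have D' k : (k < 4)%N -> deriv (h k) (h k.+1) by move=> /Jh.
have cf k : (k < 4)%N -> continuous (f k) by move=> /D/deriv_cont.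
have ch k : (k < 4)%N -> continuous (h k) by move=> /D'/deriv_cont.
have L0 := mulr_ge0 (mulr_ge0 (wb_ge0 w0 (hL 0%N isT)) (bnd_ge0 (fM 0%N isT))) (ltW (w0 x)).
have a := Qop_diff2 e0 e1 sw x (D 0%N isT) (D 1%N isT) (D' 0%N isT) (D' 1%N isT)
  (fM 0%N isT) (fM 1%N isT) (fM 2%N isT) (hL 0%N isT) (hL 1%N isT) (hL 2%N isT).
have b := Qop_wbr e0 e1 sw (cf 0%N isT) (ch 2%N isT) (fM 0%N isT) (hL 2%N isT) x.
have c := Qop_wbr e0 e1 sw (cf 2%N isT) (ch 0%N isT) (fM 2%N isT) (hL 0%N isT) x.
have d := Qop_wbr e0 e1 sw (cf 2%N isT) (ch 2%N isT) (fM 2%N isT) (hL 2%N isT) x.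
have bc : `|Qop e (f 0%N) (h 2%N) x + Qop e (f 2%N) (h 0%N) x| <= 24 * (L * M) * w x.
  by apply: le_trans (ler_normD _ _) _; move: b c; lra.
have b' := absM (absE eta0) bc.
have d' : `|eta ^+ 2 * Qop e (f 2%N) (h 2%N) x| <= eta * (12 * (L * M) * w x).
  apply: absM d; rewrite normrX ger0_norm // expr2; have := ler_wpM2l eta0 eta1; lra_recent.
rewrite /remB; move: a b' d'; rewrite /eta !ler_norml.
move=> /andP[? ?] /andP[? ?] /andP[? ?].
have h0 := mulr_ge0 ee0 L0; apply/andP; split; lra_recent.
Qed.

(** The expansion of the residual of the soliton ansatz: the terms of order 0
    cancel by the profile equation, those of order 1 form [R1op]. *)
Lemma residual_expansion f g x : jets 4 f -> (forall k, (k <= 4)%N -> bu (f k)) ->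
  4 / 3 * f 2%N x = 2 * g * f 0%N x - 4 * (f 0%N x * f 0%N x) ->
  2 * Fop e g (fun y => f 0%N y - eta * f 2%N y) x - Bop e (f 2%N) x =
  e * R1op f x + remL f x + remB f f x - 2 * eta * g * f 2%N x.
Proof.
move=> Jf bf eq0.
have c0 := bu_cont (bf 0%N isT); have c2 := bu_cont (bf 2%N isT).
have c2' : continuous (fun y => eta * f 2%N y) by exact: contZ.
have c2n : continuous (fun y => - (eta * f 2%N y)) by exact: contN.
have EN : (fun y => - (eta * f 2%N y)) = fun y => (- eta) * f 2%N y.
  by apply/funext => y; rewrite mulNr.
rewrite /Fop AvB // AvZ // QopDl //; last exact: contB.
rewrite !QopDr // EN !QopZl ?QopZr //; try exact: contZ.
rewrite /R1op /remL /remB /=; lra.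
Qed.

(** The defect between the linearised right-hand side at the preconditioned profile and [Bop]
    applied to its formal limit. Since [Bop] is close to 4/3, it is [O(e)]. [Y] is the slot of
    [V'']. *)
Definition l0op g p0 p2 V Y x :=
  let v := fun y => V y - eta * Y y in let pt := fun y => p0 y - eta * p2 y in
  2 * g * v x - 2 * (Qop e pt v x + Qop e v pt x)
  - Bop e (fun y => 3 / 4 * (2 * g * V y - 8 * (p0 y * V y))) x.

(** [Y] occurs with the factor [e^2 / 2] and is estimated by its size alone, while [V] is compared
    with its translates through one derivative. No derivative is lost in the iteration. *)
Lemma l0op_le w g p0 p1 p2 V V1 Y L M x : slow 3 w -> deriv p0 p1 -> continuous p2 ->
  deriv V V1 -> continuous V1 -> continuous p1 ->
  continuous Y -> `|g| <= M -> bnd M p0 -> bnd M p1 -> bnd M p2 ->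
  wb w L V -> wb w L V1 -> wb w L Y ->
  `|l0op g p0 p2 V Y x| <= 1200 * e * (L * M * w x).
Proof.
move=> sw Dp cp2 DV cV1 cp1 cY gM p0M p1M p2M VL V1L YL; have [w0 _] := sw.
have [cp0 cV] := (deriv_cont Dp, deriv_cont DV).
have M0 := bnd_ge0 p0M; have L0 := wb_ge0 w0 VL.
have LM0 := mulr_ge0 (mulr_ge0 L0 M0) (ltW (w0 x)).
have [q1 q2] := Qop_diff1 e0 e1 sw x Dp DV p0M p1M VL V1L.
have vL : wb w (L + `|eta| * L) (fun y => V y - eta * Y y) by apply: wbB => //; exact: wbZ.
have cv : continuous (fun y => V y - eta * Y y) by apply: contB => //; exact: contZ.
have r1 := Qop_wbr e0 e1 sw cp0 cY p0M YL x; have r2 := Qop_wbl e0 e1 sw cY cp0 YL p0M x.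
have r3 := Qop_wbr e0 e1 sw cp2 cv p2M vL x; have r4 := Qop_wbl e0 e1 sw cv cp2 vL p2M x.
rewrite (ger0_norm eta0) in r3 r4.
have EL : L + eta * L <= 2 * L by have := ler_wpM2r L0 eta1; lra_recent.
have ELM : 12 * ((L + eta * L) * M) * w x <= 24 * (L * M * w x).
  have : (L + eta * L) * (M * w x) <= 2 * L * (M * w x) by rewrite ler_wpM2r // mulr_ge0 // ltW.
  lra_recent.
have gY : `|g * Y x| <= L * M * w x.
  by rewrite (_ : L * M * w x = M * (L * w x)); [exact: absM|ring].
have df : deriv (fun y => 3 / 4 * (2 * g * V y - 8 * (p0 y * V y)))
    (fun y => 3 / 4 * (2 * g * V1 y - 8 * (p1 y * V y + p0 y * V1 y))).
  by apply: derivZ; apply: derivB; [exact: derivZ|apply: derivZ; exact: derivM].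
have fL : wb w (14 * (M * L)) (fun y => 3 / 4 * (2 * g * V1 y - 8 * (p1 y * V y + p0 y * V1 y))).
  move=> y; have h1 := absM gM (V1L y); have h2 := absM (p1M y) (VL y); have h3 := absM (p0M y) (V1L y).
  have := mulr_ge0 (mulr_ge0 M0 L0) (ltW (w0 y)).
  move: h1 h2 h3; rewrite !ler_norml => /andP[? ?] /andP[? ?] /andP[? ?] ?.
  by apply/andP; split; lra_recent.
have bf := Bop_diff1 e0 e1 sw x df fL.
have EN (u : R -> R) : (fun y => - (eta * u y)) = fun y => (- eta) * u y.
  by apply/funext => y; rewrite mulNr.
have c2n (u : R -> R) : continuous u -> continuous (fun y => - (eta * u y)).
  by move=> cu; rewrite EN; exact: contZ.
have E1 : Qop e (fun y => p0 y - eta * p2 y) (fun y => V y - eta * Y y) x =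
    Qop e p0 V x - eta * Qop e p0 Y x - eta * Qop e p2 (fun y => V y - eta * Y y) x.
  rewrite (QopDl _ _ cp0 (c2n _ cp2) cv) (QopDr _ _ cV (c2n _ cY) cp0) (EN p2) (EN Y).
  by rewrite (QopZr _ _ _ cY cp0) (QopZl _ _ _ cp2 cv); ring.
have E2 : Qop e (fun y => V y - eta * Y y) (fun y => p0 y - eta * p2 y) x =
    Qop e V p0 x - eta * Qop e Y p0 x - eta * Qop e (fun y => V y - eta * Y y) p2 x.
  rewrite (QopDr _ _ cp0 (c2n _ cp2) cv) (QopDl _ _ cV (c2n _ cY) cp0) (EN p2) (EN Y).
  by rewrite (QopZl _ _ _ cY cp0) (QopZr _ _ _ cp2 cv); ring.
rewrite /l0op E1 E2.
have et : eta * (L * M * w x) <= e / 200 * (L * M * w x).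
  by rewrite ler_wpM2r // /eta; move: ee2; lra_recent.
have eLM := mulr_ge0 (ltW e0) LM0.
have s1 := absM (absE eta0) r1; have s2 := absM (absE eta0) r2.
have s3 := absM (absE eta0) (le_trans r3 ELM); have s4 := absM (absE eta0) (le_trans r4 ELM).
have s5 := absM (absE eta0) gY.
move: q1 q2 s1 s2 s3 s4 s5 bf; rewrite !ler_norml.
move=> /andP[l1 u1] /andP[l2 u2] /andP[l3 u3] /andP[l4 u4] /andP[l5 u5] /andP[l6 u6] /andP[l7 u7] /andP[l8 u8].
apply/andP; split.
  by move: u1 u2 u3 u4 u5 u6 u7 u8 l1 l2 l3 l4 l5 l6 l7 l8 et eLM; lra_recent.
by move: u1 u2 u3 u4 u5 u6 u7 u8 l1 l2 l3 l4 l5 l6 l7 l8 et eLM; lra_recent.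
Qed.

Lemma l0opB g g' p0 p0' p2 p2' V Y x : continuous p0 -> continuous p0' -> continuous p2 ->
  continuous p2' -> continuous V -> continuous Y ->
  l0op g p0 p2 V Y x - l0op g' p0' p2' V Y x =
  l0op (g - g') (fun y => p0 y - p0' y) (fun y => p2 y - p2' y) V Y x.
Proof.
move=> c0 c0' c2 c2' cV cY; rewrite /l0op.
have cv : continuous (fun y => V y - eta * Y y) by apply: contB => //; exact: contZ.
have cp (a b : R -> R) : continuous a -> continuous b -> continuous (fun y => a y - eta * b y).
  by move=> ca cb; apply: contB => //; exact: contZ.
have cN (a : R -> R) : continuous a -> continuous (fun y => (-1) * a y) by move=> ca; exact: contZ.
have E : (fun y => p0 y - p0' y - eta * (p2 y - p2' y)) =
    fun y => (p0 y - eta * p2 y) + (-1) * (p0' y - eta * p2' y).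
  by apply/funext => y; ring.
have [cA cB] := (cp _ _ c0 c2, cp _ _ c0' c2').
rewrite E (QopDl _ _ cA (cN _ cB) cv) (QopDr _ _ cA (cN _ cB) cv) (QopZl _ _ _ cB cv) (QopZr _ _ _ cB cv).
have cf g0 (a : R -> R) : continuous a -> continuous (fun y => 3 / 4 * (2 * g0 * V y - 8 * (a y * V y))).
  by move=> ca; apply: contZ; apply: contB; apply: contZ => //; exact: contM.
have EB : (fun y => 3 / 4 * (2 * (g - g') * V y - 8 * ((p0 y - p0' y) * V y))) =
  fun y => 3 / 4 * (2 * g * V y - 8 * (p0 y * V y)) - 3 / 4 * (2 * g' * V y - 8 * (p0' y * V y)).
  by apply/funext => y; ring.
rewrite EB BopB; [ring|exact: cf|exact: cf].
Qed.

Lemma l0op_sub g p0 p2 V V' Y Y' x : continuous p0 -> continuous p2 ->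
  continuous V -> continuous V' -> continuous Y -> continuous Y' ->
  l0op g p0 p2 V Y x - l0op g p0 p2 V' Y' x =
  l0op g p0 p2 (fun y => V y - V' y) (fun y => Y y - Y' y) x.
Proof.
move=> c0 c2 cV cV' cY cY'; rewrite /l0op.
have cp (a b : R -> R) : continuous a -> continuous b -> continuous (fun y => a y - eta * b y).
  by move=> ca cb; apply: contB => //; exact: contZ.
have cN (a : R -> R) : continuous a -> continuous (fun y => (-1) * a y) by move=> ca; exact: contZ.
have E : (fun y => V y - V' y - eta * (Y y - Y' y)) =
    fun y => (V y - eta * Y y) + (-1) * (V' y - eta * Y' y).
  by apply/funext => y; ring.
have [cA [cB cpt]] := (cp _ _ cV cY, (cp _ _ cV' cY', cp _ _ c0 c2)).
rewrite E (QopDl _ _ cA (cN _ cB) cpt) (QopDr _ _ cA (cN _ cB) cpt) (QopZl _ _ _ cB cpt) (QopZr _ _ _ cB cpt).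
have cf (a : R -> R) : continuous a -> continuous (fun y => 3 / 4 * (2 * g * a y - 8 * (p0 y * a y))).
  by move=> ca; apply: contZ; apply: contB; apply: contZ => //; exact: contM.
have EB : (fun y => 3 / 4 * (2 * g * (V y - V' y) - 8 * (p0 y * (V y - V' y)))) =
  fun y => 3 / 4 * (2 * g * V y - 8 * (p0 y * V y)) - 3 / 4 * (2 * g * V' y - 8 * (p0 y * V' y)).
  by apply/funext => y; ring.
rewrite EB BopB; [ring|exact: cf|exact: cf].
Qed.

End Residual.

(** * The fixed point equation *)

Section ErrorTerm.
Context {R : realType}.
Implicit Types (f h : nat -> R -> R) (V Y w : R -> R) (x s g L M : R).

Variables (CP : R).
Hypotheses (CP1 : 1 <= CP).
Hypothesis HP1 : forall s k x, srange s -> (k <= 5)%N -> `|Ps s k x| <= CP * expR (- `|x|).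
Hypothesis HP2 : forall s s' k x, srange s -> srange s' -> (k <= 4)%N ->
  `|Ps s k x - Ps s' k x| <= CP * `|s - s'| * expR (- `|x|).

Let CP0 : 0 <= CP. Proof. by have := CP1; lra. Qed.
Let CPsq : CP <= CP * CP.
Proof. by have := ler_wpM2r CP0 CP1; rewrite mul1r. Qed.

Let w1 x : R := expR (- `|x|).

Let sw1 : slow 3 w1.
Proof.
have h : `|(-1 : R)| <= 3 by rewrite normrN1; lra.
have := slow_exp h; congr (slow _ _).
by apply/funext => x; rewrite mulN1r.
Qed.

Let w1_gt0 x : 0 < w1 x. Proof. exact: expR_gt0. Qed.
Let w1_le1 x : w1 x <= 1. Proof. by rewrite expR_le1 oppr_le0. Qed.

Let PsB s k : srange s -> (k <= 5)%N -> bnd CP (Ps s k).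
Proof.
move=> hs hk x; apply: le_trans (HP1 x hs hk) _.
by rewrite -[X in _ <= X]mulr1 ler_wpM2l ?w1_le1 //.
Qed.

Lemma Ps_jets s : jets 4 (Ps s).
Proof. by move=> k k4; apply: deriv_Ps; exact: ltnW. Qed.

Lemma Ps_bu s k : srange s -> (k <= 4)%N -> bu (Ps s k).
Proof.
move=> hs hk; split; last by exists CP; exact: PsB hs (leqW hk).
by apply: deriv_ucont (@deriv_Ps _ s k _) (PsB hs _).
Qed.

Let dP s s' k x := Ps s k x - Ps s' k x.

Let dP_jets s s' : jets 4 (dP s s').
Proof. by move=> k k4; apply: derivB; apply: deriv_Ps; exact: ltnW. Qed.

Let dP_wb s s' k : srange s -> srange s' -> (k <= 4)%N -> wb w1 (CP * `|s - s'|) (dP s s' k).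
Proof. by move=> hs hs' hk x; exact: HP2. Qed.

Let dP_bnd s s' k : srange s -> srange s' -> (k <= 4)%N -> bnd (CP * `|s - s'|) (dP s s' k).
Proof.
move=> hs hs' hk x; apply: le_trans (dP_wb hs hs' hk x) _.
by rewrite -[X in _ <= X]mulr1 ler_wpM2l ?w1_le1 // mulr_ge0 //.
Qed.

Definition gam s := 8 / 3 * s ^+ 2.

Lemma gam_le s : srange s -> `|gam s| <= 5.
Proof.
move=> /andP[s1 s2]; rewrite /gam ger0_norm; last by rewrite mulr_ge0 ?sqr_ge0.
rewrite expr2; nra.
Qed.

Lemma gam_lip s s' : srange s -> srange s' -> `|gam s - gam s'| <= 7 * `|s - s'|.
Proof.
move=> /andP[s1 s2] /andP[s3 s4].
rewrite (_ : gam s - gam s' = 8 / 3 * (s + s') * (s - s')); last by rewrite /gam; ring.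
by rewrite normrM ler_wpM2r // ger0_norm; lra.
Qed.

Variable (e : R).
Hypotheses (e0 : 0 < e) (e1 : e <= 1 / 100).
Let eta := e ^+ 2 / 2.

Let ee0 : 0 <= e ^+ 2. Proof. by rewrite exprn_ge0 // ltW. Qed.
Let eta0 : 0 <= eta. Proof. by rewrite divr_ge0. Qed.
Let ee1 : e ^+ 2 <= 1 / 10000.
Proof. by rewrite expr2; have := ler_pM (ltW e0) (ltW e0) e1 e1; lra. Qed.
Let eta1 : eta <= 1. Proof. by rewrite /eta; have := ee1; lra. Qed.
Let eta_e : eta <= e / 200.
Proof. by rewrite /eta expr2; have := ler_wpM2l (ltW e0) e1; lra. Qed.
Let e_n0 : e != 0. Proof. by rewrite gt_eqF. Qed.

Definition R1x s := R1op (Ps s).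

(** The residual of the soliton divided by [e], from which the first order term [R1x] is removed in
    the form [Bop (3/4 R1x)]: this part will be put into the correction exactly. What remains is
    [O(e)]. *)
Definition rr s x := e^-1 * (2 * Fop e (gam s) (fun y => Ps s 0 y - eta * Ps s 2 y) x
   - Bop e (Ps s 2) x) - Bop e (fun y => 3 / 4 * R1x s y) x.

Let rrE s x : srange s -> rr s x = e^-1 * (remL e (Ps s) x + remB e (Ps s) (Ps s) x
   - 2 * eta * gam s * Ps s 2 x) + (R1x s x - Bop e (fun y => 3 / 4 * R1x s y) x).
Proof.
move=> hs; rewrite /rr (@residual_expansion _ _ (Ps s) (gam s) x).
- by rewrite -/(R1x s x) /eta; set B := Bop _ _ _; field.
- exact: Ps_jets.
- by move=> k hk; exact: Ps_bu.
by rewrite Ps2E /gam; field.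
Qed.

Lemma deriv_R1op f : jets 4 f -> deriv (R1op f) (fun x => 2 * (20 / 7 * f 2%N x + f 4%N x)).
Proof.
move=> Jf; apply: derivZ; apply: derivD; last exact: (Jf 3%N).
by apply: derivZ; exact: (Jf 1%N).
Qed.

Let R1_diff f L x : jets 4 f -> (forall k, (k <= 4)%N -> wb w1 L (f k)) ->
  `|R1op f x - Bop e (fun y => 3 / 4 * R1op f y) x| <= 312 * e * L * w1 x.
Proof.
move=> Jf fL; have D := derivZ (3 / 4) (deriv_R1op Jf).
have L0 := mulr_ge0 (wb_ge0 w1_gt0 (fL 0%N isT)) (ltW (w1_gt0 x)).
have bL : wb w1 (6 * L) (fun x => 3 / 4 * (2 * (20 / 7 * f 2%N x + f 4%N x))).
  move=> y; have := fL 2%N isT y; have := fL 4%N isT y.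
  have := mulr_ge0 (wb_ge0 w1_gt0 (fL 0%N isT)) (ltW (w1_gt0 y)).
  by rewrite !ler_norml => ? /andP[? ?] /andP[? ?]; apply/andP; split; lra.
have := Bop_diff1 e0 e1 sw1 x D bL.
by rewrite !ler_norml => /andP[? ?]; apply/andP; split; lra_recent.
Qed.

Lemma remL_sub f h x : (forall k, (k <= 4)%N -> continuous (f k)) -> (forall k, (k <= 4)%N -> continuous (h k)) ->
  remL e f x - remL e h x = remL e (fun k y => f k y - h k y) x.
Proof.
move=> cf ch; rewrite /remL !AvB ?BopB; try exact: cf; try exact: ch.
by ring.
Qed.

Let cN1 (a : R -> R) : continuous a -> continuous (fun y => (-1) * a y).
Proof. exact: contZ. Qed.

Let subE (a b : R -> R) : (fun y => a y - b y) = fun y => a y + (-1) * b y.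
Proof. by apply/funext => y; ring. Qed.

Lemma Qop_subl (a b c : R -> R) x : continuous a -> continuous b -> continuous c ->
  Qop e (fun y => a y - b y) c x = Qop e a c x - Qop e b c x.
Proof.
by move=> ca cb cc; rewrite (subE a b) (QopDl _ _ ca (cN1 cb) cc) (QopZl _ _ _ cb cc); ring.
Qed.

Lemma Qop_subr (a b c : R -> R) x : continuous a -> continuous b -> continuous c ->
  Qop e c (fun y => a y - b y) x = Qop e c a x - Qop e c b x.
Proof.
by move=> ca cb cc; rewrite (subE a b) (QopDr _ _ ca (cN1 cb) cc) (QopZr _ _ _ cb cc); ring.
Qed.

Lemma remB_sub f h x : (forall k, (k <= 4)%N -> continuous (f k)) -> (forall k, (k <= 4)%N -> continuous (h k)) ->
  remB e f f x - remB e h h x =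
  remB e (fun k y => f k y - h k y) f x + remB e h (fun k y => f k y - h k y) x.
Proof.
move=> cf ch; have [f0 f2] := (cf 0%N isT, cf 2%N isT); have [h0 h2] := (ch 0%N isT, ch 2%N isT).
rewrite /remB !Qop_subl // !Qop_subr //; ring.
Qed.

Let einv a b : `|a| <= e ^+ 2 * b -> `|e^-1 * a| <= e * b.
Proof.
move=> h; rewrite normrM ger0_norm ?invr_ge0 ?(ltW e0) //.
by rewrite mulrC ler_pdivrMr // (_ : e * b * e = e ^+ 2 * b) //; ring.
Qed.

Lemma rr_le s x : srange s -> `|rr s x| <= 1400 * CP ^+ 2 * e * w1 x.
Proof.
move=> hs; have J := @Ps_jets s.
have W k : (k <= 4)%N -> wb w1 CP (Ps s k) by move=> hk y; apply: HP1 => //; exact: leqW.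
have B k : (k <= 4)%N -> bnd CP (Ps s k) by move=> hk; apply: PsB => //; exact: leqW.
have a := remL_le e0 e1 x sw1 J W; have b := remB_le e0 e1 x sw1 J J B W.
have c := absM (gam_le hs) (W 2%N isT x); have d := R1_diff x J W.
rewrite rrE //; set A := remL _ _ _ in a *; set Q := remB _ _ _ _ in b *.
set G := gam s * _ in c; set T := R1x s x - _.
have -> : A + Q - 2 * eta * gam s * Ps s 2 x = A + Q - e ^+ 2 * G by rewrite /G /eta; field.
have P0 := mulr_ge0 ee0 (ltW (w1_gt0 x)).
have P1 := mulr_ge0 ee0 (mulr_ge0 CP0 (ltW (w1_gt0 x))).
have CC : e ^+ 2 * w1 x * CP <= e ^+ 2 * w1 x * (CP * CP).
  exact: ler_wpM2l (mulr_ge0 ee0 (ltW (w1_gt0 x))) _ _ CPsq.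
have h : `|A + Q - e ^+ 2 * G| <= e ^+ 2 * (1005 * CP ^+ 2 * w1 x).
  have cG := absM (_ : `|e ^+ 2| <= e ^+ 2) c.
  have {}cG : `|e ^+ 2 * G| <= e ^+ 2 * (5 * (CP * w1 x)) by apply: cG; rewrite ger0_norm.
  apply: le_trans (absD3 a b cG) _; rewrite expr2 [CP ^+ 2]expr2 -expr2; lra_recent.
have := einv h; have := d; rewrite -/(R1x s x) -/T => dd hh.
apply: le_trans (ler_normD _ _) _; apply: le_trans (lerD hh dd) _.
have CC' : e * w1 x * CP <= e * w1 x * (CP * CP).
  by apply: ler_wpM2l; [rewrite mulr_ge0 // ltW|exact: CPsq].
have P3 : 0 <= e * w1 x * (CP * CP).
  exact: mulr_ge0 (mulr_ge0 (ltW e0) (ltW (w1_gt0 x))) (mulr_ge0 CP0 CP0).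
rewrite expr2; lra_recent.
Qed.

Lemma rr_lip s s' x : srange s -> srange s' ->
  `|rr s x - rr s' x| <= 2200 * CP ^+ 2 * e * `|s - s'| * w1 x.
Proof.
move=> hs hs'; have J := @Ps_jets s; have J' := @Ps_jets s'.
have Jd := @dP_jets s s'.
have Wd k : (k <= 4)%N -> wb w1 (CP * `|s - s'|) (dP s s' k) by exact: dP_wb.
have Bd k : (k <= 4)%N -> bnd (CP * `|s - s'|) (dP s s' k) by exact: dP_bnd.
have W k : (k <= 4)%N -> wb w1 CP (Ps s k) by move=> hk y; apply: HP1 => //; exact: leqW.
have B' k : (k <= 4)%N -> bnd CP (Ps s' k) by move=> hk; apply: PsB => //; exact: leqW.
have cf (t : R) k : (k <= 4)%N -> continuous (Ps t k) by move=> hk; apply: deriv_cont (@deriv_Ps _ t k hk).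
have a := remL_le e0 e1 x sw1 Jd Wd.
have b := remB_le e0 e1 x sw1 Jd J Bd W; have b' := remB_le e0 e1 x sw1 J' Jd B' Wd.
have c := absM (gam_lip hs hs') (W 2%N isT x); have c' := absM (gam_le hs') (Wd 2%N isT x).
have d := R1_diff x Jd Wd.
have EA := remL_sub x (cf s) (cf s'); have EB := remB_sub x (cf s) (cf s').
have ER : (R1x s x - Bop e (fun y => 3 / 4 * R1x s y) x) - (R1x s' x - Bop e (fun y => 3 / 4 * R1x s' y) x)
   = R1op (dP s s') x - Bop e (fun y => 3 / 4 * R1op (dP s s') y) x.
  have E : (fun y => 3 / 4 * R1op (dP s s') y) = fun y => 3 / 4 * R1x s y - 3 / 4 * R1x s' y.
    by apply/funext => y; rewrite /R1x /R1op /dP; ring.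
  have cR t : continuous (fun y => 3 / 4 * R1x t y).
    by apply: contZ; exact: deriv_cont (deriv_R1op (@Ps_jets t)).
  by rewrite E BopB // /R1x /R1op /dP; ring.
rewrite !rrE //.
set A := remL e (Ps s) x in EA *; set A' := remL e (Ps s') x in EA *.
set Q := remB e (Ps s) (Ps s) x in EB *; set Q' := remB e (Ps s') (Ps s') x in EB *.
set T := R1x s x - _ in ER *; set T' := R1x s' x - _ in ER *.
have -> : e^-1 * (A + Q - 2 * eta * gam s * Ps s 2 x) + T - (e^-1 * (A' + Q' - 2 * eta * gam s' * Ps s' 2 x) + T')
  = e^-1 * ((A - A') + (Q - Q') - e ^+ 2 * ((gam s - gam s') * Ps s 2 x + gam s' * dP s s' 2 x)) + (T - T').
  by rewrite /dP /eta; field.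
rewrite EA EB ER -/(dP s s').
have D0 := normr_ge0 (s - s').
set D : R := `|s - s'| in a b b' c c' d D0 *.
have wD : 0 <= D * w1 x := mulr_ge0 D0 (ltW (w1_gt0 x)).
have CC := ler_wpM2l wD CPsq.
have G : `|(gam s - gam s') * Ps s 2 x + gam s' * dP s s' 2 x| <= 12 * (D * w1 x * CP).
  by apply: le_trans (ler_normD _ _) _; move: c c'; lra_recent.
have eG := absM (_ : `|e ^+ 2| <= e ^+ 2) G.
have {}eG : `|e ^+ 2 * ((gam s - gam s') * Ps s 2 x + gam s' * dP s s' 2 x)| <= e ^+ 2 * (12 * (D * w1 x * CP)).
  by apply: eG; rewrite ger0_norm.
have bb : `|remB e (dP s s') (Ps s) x + remB e (Ps s') (dP s s') x| <= 1400 * e ^+ 2 * (D * w1 x * (CP * CP)).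
  by apply: le_trans (ler_normD _ _) _; move: b b'; lra_recent.
have h : `|remL e (dP s s') x + (remB e (dP s s') (Ps s) x + remB e (Ps s') (dP s s') x) -
    e ^+ 2 * ((gam s - gam s') * Ps s 2 x + gam s' * dP s s' 2 x)| <= e ^+ 2 * (1712 * (D * w1 x * (CP * CP))).
  apply: le_trans (absD3 a bb eG) _; have := ler_wpM2l ee0 CC; lra_recent.
have := einv h => hh; apply: le_trans (ler_normD _ _) _; apply: le_trans (lerD hh d) _.
have := ler_wpM2l (ltW e0) CC; have := mulr_ge0 (ltW e0) (mulr_ge0 wD (mulr_ge0 CP0 CP0)).
rewrite -/D expr2; lra_recent.
Qed.

(** What is left of the profile equation, divided by [e], when [P = Ps + e V] and [P''] is replaced
    by its formal value [Ps'' + e (3/4 R1x + (4 s^2 - 6 Ps) V)]; the identity is [GG_expand]. Every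
    term is [O(e)]. *)
Definition GG s V Y x := rr s x
  + 80 / 7 * (Av e (fun y => V y - eta * Y y) x - (V x - eta * Y x))
  + l0op e (gam s) (Ps s 0) (Ps s 2) V Y x
  - 2 * e * Qop e (fun y => V y - eta * Y y) (fun y => V y - eta * Y y) x.

(** [Y] stands for the second derivative of [V]; it enters [GG] only through [e^2 / 2 * Y], so its
    size and uniform continuity are what is recorded. *)
Definition adm w L V V1 Y := [/\ deriv V V1, bu V1, bu Y & [/\ wb w L V, wb w L V1 & wb w L Y]].

Variable (w : R -> R).
Hypotheses (sw : slow 3 w) (ww : forall x, w x <= 1) (w1w : forall x, w1 x <= w x).

Let w0 x : 0 < w x. Proof. by case: sw. Qed.

Let v_wb V Y L : wb w L V -> wb w L Y -> wb w (2 * L) (fun y => V y - eta * Y y).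
Proof.
move=> VL YL; have L0 := wb_ge0 w0 VL.
have := wbB VL (wbZ eta YL); apply: wbW => //.
by rewrite (ger0_norm eta0); have := ler_wpM2r L0 eta1; lra.
Qed.

Let Av_part V V1 Y L x : deriv V V1 -> continuous Y -> wb w L V1 -> wb w L Y ->
  `|80 / 7 * (Av e (fun y => V y - eta * Y y) x - (V x - eta * Y x))| <= 60 * e * (L * w x).
Proof.
move=> DV cY VL YL; have cV := deriv_cont DV.
have L0 := mulr_ge0 (wb_ge0 w0 YL) (ltW (w0 x)).
have he : `|e| <= e by rewrite gtr0_norm.
have a := Av_diff1 e0 e1 sw x he DV VL.
have b := Av_wb e0 e1 sw he cY YL x; have c := YL x.
rewrite AvB ?AvZ //; last exact: contZ.
have bc : `|eta * (Av e Y x - Y x)| <= e / 200 * (3 * (L * w x)).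
  apply: absM; first by rewrite ger0_norm.
  by apply: le_trans (ler_normB _ _) _; move: b c; lra.
have E0 := mulr_ge0 (ltW e0) L0.
by move: a bc; rewrite !ler_norml => /andP[? ?] /andP[? ?]; apply/andP; split; lra_recent.
Qed.

Let wbnd (f : R -> R) L : wb w L f -> bnd L f.
Proof.
move=> h x; apply: le_trans (h x) _; rewrite -[X in _ <= X]mulr1 ler_wpM2l //.
exact: wb_ge0 w0 h.
Qed.

Lemma bu_v V V1 Y L : adm w L V V1 Y -> bu (fun y => V y - eta * Y y).
Proof.
move=> [DV [uV1 [M hM]] bY [VL _ _]]; apply: buB; last exact: buZ.
by split; [exact: deriv_ucont DV hM|exists L; exact: wbnd].
Qed.

Lemma bu_GG s V V1 Y L : srange s -> adm w L V V1 Y -> bu (GG s V Y).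
Proof.
move=> hs aV; have bv := bu_v aV; have [DV [uV1 [M hM]] bY [VL _ _]] := aV.
have bV : bu V by split; [exact: deriv_ucont DV hM|exists L; exact: wbnd].
have bP k : (k <= 4)%N -> bu (Ps s k) by exact: Ps_bu.
have bpt : bu (fun y => Ps s 0 y - eta * Ps s 2 y) by apply: buB; [exact: bP|apply: buZ; exact: bP].
have bR : bu (fun y => 3 / 4 * R1x s y).
  by apply: buZ; apply: buZ; apply: buD; [apply: buZ|]; exact: bP.
apply: buB; [apply: buD; [apply: buD|]|].
- apply: buB; last exact: bu_Bop.
  by apply: buZ; apply: buB; [apply: buZ; exact: bu_Fop|apply: bu_Bop; exact: bP].
- by apply: buZ; apply: buB => //; exact: bu_Av.
- apply: buB; last first.
    apply: bu_Bop; apply: buZ; apply: buB; apply: buZ => //; apply: buM => //; exact: bP.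
  by apply: buB; apply: buZ => //; apply: buD; exact: bu_Qop.
by apply: buZ; exact: bu_Qop.
Qed.

(** The soliton terms decay like [exp (- |x|)] and are thus bounded in any weight above it; one
    estimate serves the decaying weight and the constant one. *)
Let up_weight (n k a : R) x : 0 <= n -> 0 <= k -> a <= n * CP ^+ 2 * e * k * w1 x ->
  a <= n * CP ^+ 2 * e * k * w x.
Proof.
move=> n0 k0 h; apply: le_trans h _; apply: ler_wpM2l; last exact: w1w.
exact: mulr_ge0 (mulr_ge0 (mulr_ge0 n0 (sqr_ge0 CP)) (ltW e0)) k0.
Qed.

Lemma GG_le s V V1 Y L x : 0 <= L -> srange s -> adm w L V V1 Y ->
  `|GG s V Y x| <= (1400 * CP ^+ 2 + 60 * L + 6000 * (L * CP) + 96 * L ^+ 2) * e * w x.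
Proof.
move=> L0 hs aV; have [DV bV1 bY [VL V1L YL]] := aV.
have cV1 := bu_cont bV1; have cY := bu_cont bY.
have wx := ltW (w0 x).
have a : `|rr s x| <= 1400 * CP ^+ 2 * e * w x.
  have h := rr_le x hs; rewrite -[_ * e]mulr1 in h *.
  by apply: (up_weight _ ler01 h); lra.
have b := Av_part x DV cY V1L YL.
have vw := v_wb VL YL; have cv := bu_cont (bu_v aV).
have c : `|l0op e (gam s) (Ps s 0) (Ps s 2) V Y x| <= 1200 * e * (L * (5 * CP) * w x).
  have CP5 : CP <= 5 * CP by have := CP1; lra_recent.
  have Bn k : (k <= 5)%N -> bnd (5 * CP) (Ps s k).
    by move=> hk y; apply: le_trans (PsB hs hk y) CP5.
  apply: l0op_le sw (@deriv_Ps _ s 0 isT) _ DV cV1 _ cY _ (Bn 0%N isT) (Bn 1%N isT) (Bn 2%N isT) VL V1L YL => //.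
  - by apply: deriv_cont (@deriv_Ps _ s 2 isT).
  - by apply: deriv_cont (@deriv_Ps _ s 1 isT).
  - by apply: le_trans (gam_le hs) _; have := CP1; lra_recent.
have d := Qop_wbl e0 e1 sw cv cv vw (wbnd vw) x.
have d' := absM (_ : `|2 * e| <= 2 * e) d.
have {}d' : `|2 * e * Qop e (fun y => V y - eta * Y y) (fun y => V y - eta * Y y) x| <=
   2 * e * (12 * (2 * L * (2 * L)) * w x) by apply: d'; rewrite ger0_norm // mulr_ge0 // ltW.
rewrite /GG; apply: le_trans (absD3 (le_trans (ler_normD _ _) (lerD a b)) c d') _.
by rewrite [L ^+ 2]expr2; lra_recent.
Qed.

Lemma GG_lip s s' V V1 Y V' V1' Y' L d x : 0 <= L -> 0 <= d -> srange s -> srange s' ->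
  adm w L V V1 Y -> adm w L V' V1' Y' ->
  adm w d (fun y => V y - V' y) (fun y => V1 y - V1' y) (fun y => Y y - Y' y) ->
  `|GG s V Y x - GG s' V' Y' x| <=
  (2200 * CP ^+ 2 * `|s - s'| + 60 * d + 8400 * (L * CP) * `|s - s'| + 6000 * CP * d + 192 * (L * d)) * e * w x.
Proof.
move=> L0 d0 hs hs' aV aV' ad.
have [DV bV1 bY [VL V1L YL]] := aV; have [DV' bV1' bY' [VL' V1L' YL']] := aV'.
have [Dd bd1 bdY [dL d1L dYL]] := ad.
have [cV [cY [cV' cY']]] := (deriv_cont DV, (bu_cont bY, (deriv_cont DV', bu_cont bY'))).
have cV1 := bu_cont bV1; have cV1d := bu_cont bd1; have cYd := bu_cont bdY.
have wx := ltW (w0 x).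
have a : `|rr s x - rr s' x| <= 2200 * CP ^+ 2 * e * `|s - s'| * w x.
  by apply: (up_weight _ (normr_ge0 _) (rr_lip x hs hs')); lra.
have b := Av_part x Dd cYd d1L dYL.
have cP (t : R) k : (k <= 4)%N -> continuous (Ps t k) by move=> hk; apply: deriv_cont (@deriv_Ps _ t k hk).
have CPp : 0 <= CP by have := CP1; lra_recent.
have c1 : `|l0op e (gam s - gam s') (dP s s' 0) (dP s s' 2) V Y x| <= 1200 * e * (L * (7 * CP * `|s - s'|) * w x).
  have E : CP * `|s - s'| <= 7 * CP * `|s - s'| by rewrite ler_wpM2r //; lra_recent.
  have Bn k : (k <= 4)%N -> bnd (7 * CP * `|s - s'|) (dP s s' k).
    by move=> hk y; apply: le_trans (dP_bnd hs hs' hk y) E.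
  apply: l0op_le sw (@dP_jets s s' 0%N isT) _ DV cV1 _ cY _ (Bn 0%N isT) (Bn 1%N isT) (Bn 2%N isT) VL V1L YL => //.
  - by apply: contB; exact: cP.
  - by apply: contB; exact: cP.
  - apply: le_trans (gam_lip hs hs') _; rewrite -mulrA ler_wpM2l //.
    by rewrite -[X in X <= _]mul1r ler_wpM2r.
have c2 : `|l0op e (gam s') (Ps s' 0) (Ps s' 2) (fun y => V y - V' y) (fun y => Y y - Y' y) x|
    <= 1200 * e * (d * (5 * CP) * w x).
  have CP5 : CP <= 5 * CP by have := CP1; lra_recent.
  have Bn k : (k <= 5)%N -> bnd (5 * CP) (Ps s' k).
    by move=> hk y; apply: le_trans (PsB hs' hk y) CP5.
  apply: l0op_le sw (@deriv_Ps _ s' 0 isT) _ Dd cV1d _ cYd _ (Bn 0%N isT) (Bn 1%N isT) (Bn 2%N isT) dL d1L dYL => //.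
  - exact: cP.
  - exact: cP.
  - by apply: le_trans (gam_le hs') _; have := CP1; lra_recent.
have vw := v_wb VL YL; have vw' := v_wb VL' YL'; have vd := v_wb dL dYL.
have cv := bu_cont (bu_v aV); have cv' := bu_cont (bu_v aV'); have cvd := bu_cont (bu_v ad).
set v := fun y => V y - eta * Y y in vw cv *; set v' := fun y => V' y - eta * Y' y in vw' cv' *.
have Ed : (fun y => V y - V' y - eta * (Y y - Y' y)) = fun y => v y - v' y.
  by apply/funext => y; rewrite /v /v'; ring.
rewrite Ed in vd cvd.
have q1 := Qop_wbl e0 e1 sw cvd cv vd (wbnd vw) x.
have q2 := Qop_wbr e0 e1 sw cv' cvd (wbnd vw') vd x.
have qE : Qop e v v x - Qop e v' v' x = Qop e (fun y => v y - v' y) v x + Qop e v' (fun y => v y - v' y) x.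
  by rewrite Qop_subl // Qop_subr //; ring.
have q : `|2 * e * (Qop e v v x - Qop e v' v' x)| <= 2 * e * (96 * (L * d) * w x).
  apply: absM; first by rewrite ger0_norm // mulr_ge0 // ltW.
  by rewrite qE; apply: le_trans (ler_normD _ _) _; move: q1 q2; lra_recent.
have lE : l0op e (gam s) (Ps s 0) (Ps s 2) V Y x - l0op e (gam s') (Ps s' 0) (Ps s' 2) V' Y' x =
    l0op e (gam s - gam s') (dP s s' 0) (dP s s' 2) V Y x +
    l0op e (gam s') (Ps s' 0) (Ps s' 2) (fun y => V y - V' y) (fun y => Y y - Y' y) x.
  rewrite -(l0op_sub e (gam s') x (cP s' 0%N isT) (cP s' 2%N isT) cV cV' cY cY').
  rewrite /dP -(l0opB e (gam s) (gam s') x (cP s 0%N isT) (cP s' 0%N isT) (cP s 2%N isT) (cP s' 2%N isT) cV cY).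
  by ring.
have vE : 80 / 7 * (Av e v x - v x) - 80 / 7 * (Av e v' x - v' x) =
    80 / 7 * (Av e (fun y => v y - v' y) x - (v x - v' x)).
  by rewrite AvB //; ring.
rewrite Ed (_ : V x - V' x - eta * (Y x - Y' x) = v x - v' x) in b; last by rewrite /v /v'; ring.
rewrite /GG -/v -/v' (_ : V x - eta * Y x = v x) // (_ : V' x - eta * Y' x = v' x) //.
have -> : rr s x + 80 / 7 * (Av e v x - v x) + l0op e (gam s) (Ps s 0) (Ps s 2) V Y x - 2 * e * Qop e v v x
  - (rr s' x + 80 / 7 * (Av e v' x - v' x) + l0op e (gam s') (Ps s' 0) (Ps s' 2) V' Y' x - 2 * e * Qop e v' v' x)
  = ((rr s x - rr s' x) + (80 / 7 * (Av e v x - v x) - 80 / 7 * (Av e v' x - v' x)))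
    + (l0op e (gam s) (Ps s 0) (Ps s 2) V Y x - l0op e (gam s') (Ps s' 0) (Ps s' 2) V' Y' x)
    - 2 * e * (Qop e v v x - Qop e v' v' x) by ring.
rewrite vE lE.
apply: le_trans (absD3 (le_trans (ler_normD _ _) (lerD a b)) (le_trans (ler_normD _ _) (lerD c1 c2)) q) _.
lra_recent.
Qed.

End ErrorTerm.

(** * Projection onto the range of the linearised operator *)

Section ProjGreen.
Context {R : realType}.
Implicit Types (f g h V : R -> R) (k x L M : R).

Lemma phi_dec k : k <= 2 -> dec k 4 (@phi R).
Proof.
move=> k2; split; first exact: cont_phi.
move=> x; apply: le_trans (phi_le x) _; apply: ler_wpM2l => //.
by rewrite ler_expR lerN2 ler_wpM2r.
Qed.

Lemma Tint_phi2 : Tint (fun x : R => phi x * phi x) = 4 / 15.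
Proof.
pose T3 (x : R) := th x * th x * th x.
pose T5 x : R := T3 x * th x * th x.
have Dt := @deriv_th R; have D3 := derivM (derivM Dt Dt) Dt; have D5 := derivM (derivM D3 Dt) Dt.
have DG := derivB (derivZ (1 / 3) D3) (derivZ (1 / 5) D5).
have [t1 t2] := th_tends (@ltr01 R).
have {}t1 : tends (@th R) 1 by apply: tends_eq t1 => x _; rewrite mul1r.
have {}t2 : tends (fun x : R => th (- x)) (-1) by apply: tends_eq t2 => x _; rewrite mul1r.
have lim l f : tends f l -> (forall x, `|f x| <= 1) ->
    tends (fun x => 1 / 3 * (f x * f x * f x) - 1 / 5 * (f x * f x * f x * f x * f x))
      (1 / 3 * (l * l * l) - 1 / 5 * (l * l * l * l * l)).
  move=> h h1; have h3 := tends_M (tends_M h h h1) h h1.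
  by apply: tendsB; apply: tendsZ => //; exact: tends_M (tends_M h3 h h1) h h1.
have b1 x : `|th (- x : R)| <= 1 by exact: th_le1.
rewrite (Tint_deriv (deriv_eq DG _) _ (lim _ _ t1 (@th_le1 R)) (lim _ _ t2 b1)).
- by field.
- move=> x; rewrite /phi; have := th2 x => t2x.
  have -> : sq x = 1 - th x ^+ 2 by rewrite t2x; ring.
  by field.
- exact: contM (@cont_phi R) (@cont_phi R).
Qed.

(** Projects [h] onto the range of the linearised operator, [phi] being a multiple
    of the derivative of the soliton. *)
Definition Pr h x := h x - Tint (fun y => phi y * h y) * (15 / 4) * phi x.

Lemma phi_dec1 k L h : 0 <= k -> dec k L h -> dec 1 (4 * L) (fun x => phi x * h x).
Proof.
move=> k0 dh; have [c b] := phi_h_dec k0 dh; split => // x.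
apply: le_trans (b x) _; apply: ler_wpM2l; first by have := dec_ge0 dh; lra.
by rewrite ler_expR lerN2 ler_wpM2r //; lra.
Qed.

Lemma phi2_dec1 : dec 1 16 (fun x : R => phi x * phi x).
Proof. by have := phi_dec1 (lexx 0) (phi_dec (ler0n R 2)); rewrite (_ : 4 * 4 = 16 :> R) //; ring. Qed.

Lemma Pr_orth k L h : 0 <= k -> dec k L h -> Tint (fun x => phi x * Pr h x) = 0.
Proof.
move=> k0 dh; have d := phi_dec1 k0 dh.
have -> : (fun x => phi x * Pr h x) =
    fun x => phi x * h x - (Tint (fun y => phi y * h y) * (15 / 4)) * (phi x * phi x).
  by apply/funext => x; rewrite /Pr; ring.
by rewrite (TintB ltr01 d (decZ _ phi2_dec1)) (TintZ _ ltr01 phi2_dec1) Tint_phi2; field.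
Qed.

(** Here [121 = 1 + 8 * 15/4 * 4]: the integral of [phi h] is at most [8 L], the normalisation is
    the inverse of [4/15], and [phi] is bounded by 4 times the weight. *)
Lemma Pr_dec k L h : 0 <= k <= 1 -> dec k L h -> dec k (121 * L) (Pr h).
Proof.
move=> /andP[k0 k1] dh; have [ch hL] := dh.
have t := Tint_le ltr01 (phi_dec1 k0 dh).
have k2 : k <= 2 by lra.
have [_ pk] := phi_dec k2.
split; first by apply: contB => //; apply: contZ; exact: cont_phi.
move=> x; have p := ler_pM (normr_ge0 _) (normr_ge0 _) t (pk x).
apply: le_trans (ler_normB _ _) _.
rewrite mulrAC normrM (ger0_norm (_ : 0 <= 15 / 4)); last lra.
rewrite normrM; have := hL x; lra.
Qed.

Lemma bu_phi : bu (@phi R).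
Proof.
have e1 x : expR (- (2 * `|x : R|)) <= 1 by rewrite expR_le1 oppr_le0 mulr_ge0.
split; last by exists 4 => x; have := phi_le x; have := e1 x; lra.
apply: (deriv_ucont (M := 8) (@deriv_phi R)) => x.
by have := phi1_le x; have := e1 x; lra.
Qed.

Lemma bu_Pr h : bu h -> bu (Pr h).
Proof. by move=> bh; apply: buB => //; apply: buZ; exact: bu_phi. Qed.

Lemma PrB k L M f g : 0 <= k -> dec k L f -> dec k M g ->
  Pr (fun x => f x - g x) = fun x => Pr f x - Pr g x.
Proof.
move=> k0 df dg; apply/funext => x; rewrite /Pr.
have -> : Tint (fun y => phi y * (f y - g y)) = Tint (fun y => phi y * f y) - Tint (fun y => phi y * g y).
  rewrite -(TintB ltr01 (phi_dec1 k0 df) (phi_dec1 k0 dg)); congr Tint.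
  by apply/funext => y; ring.
by ring.
Qed.

Lemma GrB k L M f g : 0 <= k -> dec k L f -> dec k M g ->
  [/\ Gr (fun x => f x - g x) = (fun x => Gr f x - Gr g x),
      Gr1 (fun x => f x - g x) = (fun x => Gr1 f x - Gr1 g x) &
      Gr2 (fun x => f x - g x) = (fun x => Gr2 f x - Gr2 g x)].
Proof.
move=> k0 df dg.
have [[cf _] [cg _]] := (df, dg).
have cM (p q : R -> R) : continuous p -> continuous q -> continuous (fun x => p x * q x) := @contM _ p q.
have I1 (p : R -> R) x : continuous p -> itg (fun t => p t * (f t - g t)) 0 x =
    itg (fun t => p t * f t) 0 x - itg (fun t => p t * g t) 0 x.
  move=> cp; rewrite -itgB; [|exact: cM|exact: cM].
  by apply: eq_itg => t; ring.
have G : Gc (fun x => f x - g x) = Gc f - Gc g.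
  rewrite /Gc /Ip; apply: rlimE.
  apply: tends_eq (tendsB (itg_tends ltr01 (phi_dec1 k0 df)) (itg_tends ltr01 (phi_dec1 k0 dg))) => x _.
  by rewrite -I1 //; exact: cont_phi.
have E : Gr (fun x => f x - g x) = fun x => Gr f x - Gr g x.
  by apply/funext => x; rewrite /Gr G !I1; [ring|exact: cont_psi|exact: cont_phi].
split=> //.
- by apply/funext => x; rewrite /Gr1 G !I1; [ring|exact: cont_psi|exact: cont_phi].
- by apply/funext => x; rewrite /Gr2 E; ring.
Qed.

Lemma dec_wb k L f : dec k L f -> wb (fun x => expR (- (k * `|x|))) L f.
Proof. by case. Qed.

Definition admP k L h := adm (fun x => expR (- (k * `|x|))) L (Gr (Pr h)) (Gr1 (Pr h)) (Gr2 (Pr h)).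

Lemma Pr_adm : exists2 CG : R, 1 <= CG & forall k L h, 0 <= k <= 1 -> bu h -> dec k L h ->
  admP k (CG * L) h.
Proof.
exists (20000 * 121) => [|k L h /[dup] k01 /andP[k0 k1] bh dh]; first lra_local.
have dp := Pr_dec k01 dh; have [cp _] := dp; have L0 := dec_ge0 dh.
have [dG dG1 dG2] := Gr_bounds k01 dp (Pr_orth k0 dh).
have w0 x : 0 < expR (- (k * `|x|)) by exact: expR_gt0.
have w1 x : expR (- (k * `|x|)) <= 1 by rewrite expR_le1 oppr_le0 mulr_ge0.
have bd C f : dec k C f -> bnd C f.
  move=> df x; have [_ h1] := df; apply: le_trans (h1 x) _.
  by rewrite -[X in _ <= X]mulr1; apply: ler_wpM2l (w1 x); exact: dec_ge0 df.
have bG1 : bu (Gr1 (Pr h)).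
  by split; [exact: deriv_ucont (deriv_Gr1 cp) (bd _ _ dG2)|exists (1000 * (121 * L)); exact: bd].
have bG : bu (Gr (Pr h)).
  by split; [exact: deriv_ucont (deriv_Gr cp) (bd _ _ dG1)|exists (1000 * (121 * L)); exact: bd].
split.
- exact: deriv_Gr.
- exact: bG1.
- apply: buD; first exact: bu_Pr.
  apply: buM bG; apply: buB; first exact: bu_cst.
  apply: buZ; split; last by exists 1 => x; rewrite ger0_norm ?sq_le1 // ltW // sq_gt0.
  apply: (deriv_ucont (M := 2) (@deriv_sq R)) => x.
  have H (a t : R) : 0 < a -> a <= 1 -> `|t| <= 1 -> `|- 2 * a * t| <= 2.
    move=> a0 a1 t1; rewrite !mulNr normrN !normrM (ger0_norm (ler0n _ 2)) (gtr0_norm a0).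
    by have := ler_pM (ltW a0) (normr_ge0 t) a1 t1; lra_local.
  exact: H (sq_gt0 x) (sq_le1 x) (th_le1 x).
- have le12 : 1000 * (121 * L) <= 20000 * (121 * L).
    by apply: ler_wpM2r (mulr_ge0 (ler0n _ 121) L0) _ _ _; rewrite ler_nat.
  rewrite -mulrA; split.
  + exact: wbW w0 le12 (dec_wb dG).
  + exact: wbW w0 le12 (dec_wb dG1).
  + exact: dec_wb dG2.
Qed.

Lemma adm_sub k C L M f g : 0 <= k <= 1 -> dec k L f -> dec k M g ->
  admP k C (fun x => f x - g x) -> adm (fun x => expR (- (k * `|x|))) C (fun x => Gr (Pr f) x - Gr (Pr g) x)
  (fun x => Gr1 (Pr f) x - Gr1 (Pr g) x) (fun x => Gr2 (Pr f) x - Gr2 (Pr g) x).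
Proof.
move=> /[dup] k01 /andP[k0 k1] df dg; rewrite /admP (PrB k0 df dg).
by have [-> -> ->] := GrB k0 (Pr_dec k01 df) (Pr_dec k01 dg).
Qed.

End ProjGreen.

(** * The contraction for the correction and the width *)

Section Contraction.
Context {R : realType}.
Implicit Types (f g h w V : R -> R) (x e s k A d D L M : R).

(** The unknown [h] is [V'' - (4 - 12 sech^2) V], so that [V = Gr (Pr h)] with an operator
    independent of [s]. In these terms the equation reads [V'' = 3/4 R1x + (4 s^2 - 6 Ps) V + Ed]
    with [Bop Ed = GG]; [Hn] collects everything but the linearisation at [s = 1]. *)
Definition Ed e h s := Bi e (GG e s (Gr (Pr h)) (Gr2 (Pr h))).
Definition Hn e h (sg : R) x := let s := 1 + e * sg in
  3 / 4 * R1x s x + Ed e h s x + (4 * s ^+ 2 - 4) * Gr (Pr h) x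
  - 6 * (Ps s 0 x - Ps 1 0 x) * Gr (Pr h) x.
(** Testing the equation with [Ps s 1] removes [V] and leaves [Tint (Ed * Ps s 1) = e * sg * qs s],
    by [Tint_R1] and [Tint_orth]; [Sn] solves this for [sg]. The factor [qs] is
    [3/2 * 256/21 * s^5 (1 - s^2)] divided by [1 - s]. *)
Definition qs s : R := 128 / 7 * s ^+ 5 * (1 + s).
Definition Sn e h (sg : R) := let s := 1 + e * sg in
  Tint (fun x => Ed e h s x * Ps s 1 x) / (e * qs s).

Lemma qs_bounds s s' : srange s -> srange s' -> 1 <= qs s /\ `|qs s - qs s'| <= 600 * `|s - s'|.
Proof.
move=> hs hs'; have /andP[s1 s2] := hs.
have pw n (t : R) : srange t -> (3 / 4) ^+ n <= t ^+ n <= (5 / 4) ^+ n.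
  move=> /andP[t1 t2]; apply/andP; split.
    by apply: lerXn2r => //; rewrite nnegrE; lra.
  by apply: lerXn2r => //; rewrite nnegrE; lra.
split.
  have /andP[h _] := pw 5%N s hs; rewrite /qs.
  have b1 : 1 / 5 <= s ^+ 5 by apply: le_trans h; rewrite !exprS expr0; lra.
  have b0 : 0 <= s ^+ 5 by lra.
  have t : 7 / 4 <= 1 + s by lra.
  by have := ler_wpM2l b0 t; lra.
have D := derivM (derivZ (128 / 7) (@deriv_pow R 4)) (derivD (deriv_cst 1) deriv_id).
have := @deriv_abs_between _ _ _ 600 s' s D; rewrite /qs; apply=> t ht.
have rt : srange t.
  by move: hs' ht; rewrite /srange => /andP[? ?] [] /andP[? ?]; apply/andP; split; lra_local.
have /andP[a1 a2] := pw 4%N t rt; have /andP[b1 b2] := pw 5%N t rt; have /andP[t1 t2] := rt.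
have a0 : 0 <= t ^+ 4 by apply: le_trans a1; apply: exprn_ge0; lra_local.
have b0 : 0 <= t ^+ 5 by apply: le_trans b1; apply: exprn_ge0; lra_local.
have {}a2 : t ^+ 4 <= 5 / 2 by apply: le_trans a2 _; rewrite !exprS expr0; lra_local.
have {}b2 : t ^+ 5 <= 31 / 10 by apply: le_trans b2 _; rewrite !exprS expr0; lra_local.
have c := ler_pM a0 (_ : 0 <= 1 + t) a2 (_ : 1 + t <= 9 / 4).
have {}c : t ^+ 4 * (1 + t) <= 5 / 2 * (9 / 4) by apply: c; lra_local.
have c0 : 0 <= t ^+ 4 * (1 + t) by apply: mulr_ge0 => //; lra_local.
rewrite ger0_norm; lra_local.
Qed.

Lemma dec_prod f g M C : continuous f -> continuous g -> bnd M f ->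
  (forall x, `|g x| <= C * expR (- `|x|)) -> dec 1 (M * C) (fun x => f x * g x).
Proof.
move=> cf cg fM gC; split; first exact: contM.
by move=> x; rewrite normrM mul1r -mulrA; apply: ler_pM.
Qed.

Let small e : e <= 1 / 1000 -> e <= 1 / 100 /\ 280 * e * 3 <= 1.
Proof. by move=> h; split; lra. Qed.

Let div1000 (a : R) : 0 <= a -> 0 <= a / 1000. Proof. by move=> h; lra. Qed.

Lemma leeq (a b : R) : a = b -> a <= b. Proof. by move=> ->. Qed.

Let pos4 (a b c d : R) : 0 <= a -> 0 <= b -> 0 <= c -> 0 <= d -> 0 <= 1400 * a + 60 * b + 6000 * c + 96 * d.
Proof. lra. Qed.

Let lip_const (a c K N d M : R) : 0 <= N -> 0 <= d -> 1000 * (2200 * a + 8400 * (M * c)) <= K ->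
  1000 * (60 + 6000 * c + 192 * M) <= K ->
  2200 * a * N + 60 * d + 8400 * (M * c) * N + 6000 * c * d + 192 * (M * d) <= K / 1000 * (N + d).
Proof. by move=> N0 d0 h h'; have := ler_wpM2r N0 h; have := ler_wpM2r d0 h'; lra_recent. Qed.

(** Both integrals are [O(e)], so the quotients and their differences remain bounded as [e] tends to
    0, but no factor [e] is left over. *)
Lemma quot_lip e T T' q q' X Y Z : 0 < e -> 1 <= q -> 1 <= q' -> `|T - T'| <= X * e -> `|T'| <= Y * e ->
  `|q - q'| <= Z -> `|T / (e * q) - T' / (e * q')| <= X + Y * Z.
Proof.
move=> e0 q1 q2 h1 h2 h3; have [q0 q0'] : 0 < q /\ 0 < q' by split; lra.
have qn : q != 0 by rewrite gt_eqF.
have qn' : q' != 0 by rewrite gt_eqF.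
have en : e != 0 by rewrite gt_eqF.
have i1 : `|q^-1| <= 1 by rewrite gtr0_norm ?invr_gt0 // invf_le1.
have i2 : `|q'^-1| <= 1 by rewrite gtr0_norm ?invr_gt0 // invf_le1.
have j1 : `|(T - T') / e| <= X by rewrite normrM normfV (gtr0_norm e0) ler_pdivrMr.
have j2 : `|T' / e| <= Y by rewrite normrM normfV (gtr0_norm e0) ler_pdivrMr.
have -> : T / (e * q) - T' / (e * q') = (T - T') / e * q^-1 - T' / e * (q - q') * (q^-1 * q'^-1).
  by field; rewrite qn qn' en.
apply: le_trans (ler_normB _ _) _; apply: lerD.
  by have := absM j1 i1; rewrite mulr1.
by have := absM (absM j2 h3) (absM i1 i2); rewrite !mulr1.
Qed.

Variables (CP : R).
Hypotheses (CP1 : 1 <= CP).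
Hypothesis HP1 : forall s (k : nat) x, srange s -> (k <= 5)%N -> `|Ps s k x| <= CP * expR (- `|x|).
Hypothesis HP2 : forall s s' (k : nat) x, srange s -> srange s' -> (k <= 4)%N ->
  `|Ps s k x - Ps s' k x| <= CP * `|s - s'| * expR (- `|x|).

Let CP0 : 0 <= CP. Proof. by have := CP1; lra. Qed.

Definition weight w := [/\ slow 3 w, forall x, w x <= 1 & forall x, expR (- `|x|) <= w x].

Lemma weight_exp k : 0 <= k <= 1 -> weight (fun x => expR (- (k * `|x|))).
Proof.
move=> /andP[k0 k1]; split.
- have h : `|- k| <= 3 by rewrite normrN ger0_norm; lra.
  have := slow_exp h; congr (slow _ _).
  by apply/funext => x; rewrite mulNr.
- by move=> x; rewrite expR_le1 oppr_le0 mulr_ge0.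
- by move=> x; rewrite ler_expR lerN2 ler_piMl.
Qed.

(** The constant depends on [A] and [CP] but not on the weight, so the same [K] holds for the
    weights of existence and of uniqueness. *)
Lemma Bi_GG_bounds A : 0 <= A -> exists2 K, 0 <= K &
  forall e w s V V1 Y, 0 < e -> e <= 1 / 1000 -> weight w -> srange s -> adm w A V V1 Y ->
  wb w (K * e) (Bi e (GG e s V Y)) /\
  forall s' V' V1' Y' d, srange s' -> adm w A V' V1' Y' -> 0 <= d ->
  adm w d (fun x => V x - V' x) (fun x => V1 x - V1' x) (fun x => Y x - Y' x) ->
  wb w (K * (`|s - s'| + d) * e) (fun x => Bi e (GG e s V Y) x - Bi e (GG e s' V' Y') x).
Proof.
move=> A0.
have [K K0 [Ka Kb Kc]] : exists2 K, 0 <= K &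
    [/\ 1000 * (1400 * CP ^+ 2 + 60 * A + 6000 * (A * CP) + 96 * A ^+ 2) <= K,
       1000 * (2200 * CP ^+ 2 + 8400 * (A * CP)) <= K & 1000 * (60 + 6000 * CP + 192 * A) <= K].
  have a := sqr_ge0 CP; have b := mulr_ge0 A0 CP0; have c := sqr_ge0 A; have d := CP0.
  exists (10000 * (2200 * CP ^+ 2 + 60 * A + 8400 * (A * CP) + 96 * A ^+ 2 + 60 + 6000 * CP + 192 * A)); first by move: a b c d A0; lra_recent.
  by split; move: a b c d A0; lra_recent.
exists K => // e w s V V1 Y e0 e1 [sw ww w1w] hs aV; have [w0 _] := sw.
have [e2 e3] := small e1.
have bG := bu_GG CP1 HP1 e sw ww hs aV.
split.
  have := Bi_slow e0 e3 sw bG _ (fun x => GG_le CP1 HP1 e0 e2 sw ww w1w x A0 hs aV) => H x.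
  apply: le_trans (H _ x) _.
    have a := sqr_ge0 CP; have b := mulr_ge0 A0 CP0; have c := sqr_ge0 A.
    exact: mulr_ge0 (pos4 a A0 b c) (ltW e0).
  by apply: ler_wpM2r (ltW (w0 x)) _ _ _; rewrite mulrA ler_wpM2r // ltW.
move=> s' V' V1' Y' d hs' aV' d0 ad x.
have bG' := bu_GG CP1 HP1 e sw ww hs' aV'.
rewrite -(BiB x e0 bG bG').
have N0 := normr_ge0 (s - s').
have H : forall x, `|GG e s V Y x - GG e s' V' Y' x| <= K / 1000 * (`|s - s'| + d) * e * w x.
  move=> y; apply: le_trans (GG_lip CP1 HP1 HP2 e0 e2 sw ww w1w y A0 d0 hs hs' aV aV' ad) _.
  apply: ler_wpM2r (ltW (w0 y)) _ _ _; apply: ler_wpM2r (ltW e0) _ _ _.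
  exact: lip_const N0 d0 Kb Kc.
have := Bi_slow e0 e3 sw (buB bG bG') _ H x.
rewrite (_ : 1000 * (K / 1000 * (`|s - s'| + d) * e) = K * (`|s - s'| + d) * e); last by field.
have p := div1000 K0.
by move=> /(_ (mulr_ge0 (mulr_ge0 p (addr_ge0 N0 d0)) (ltW e0))).
Qed.

Variables (CG K : R).
Hypothesis (CG1 : 1 <= CG) (K0 : 0 <= K).
Hypothesis HG : forall k L h, 0 <= k <= 1 -> bu h -> dec k L h -> admP k (CG * L) h.
(** [8 CP] bounds [3/4 R1x], the limit of [Hn] at [e = 0]; the extra 1 is room for the [O(e)] terms
    and for a margin. *)
Let L0 := 8 * CP + 1.
Let A := CG * L0.
Hypothesis HK : forall e w s V V1 Y, 0 < e -> e <= 1 / 1000 -> weight w -> srange s -> adm w A V V1 Y ->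
  wb w (K * e) (Bi e (GG e s V Y)) /\
  forall s' V' V1' Y' d, srange s' -> adm w A V' V1' Y' -> 0 <= d ->
  adm w d (fun x => V x - V' x) (fun x => V1 x - V1' x) (fun x => Y x - Y' x) ->
  wb w (K * (`|s - s'| + d) * e) (fun x => Bi e (GG e s V Y) x - Bi e (GG e s' V' Y') x).

Let CG0 : 0 <= CG. Proof. by have := CG1; lra. Qed.
Let L00 : 0 <= L0. Proof. by have := CP0; rewrite /L0; lra. Qed.
Let A0 : 0 <= A. Proof. exact: mulr_ge0. Qed.

Let Ls := 2 * K * CP + 1.
Let Ls0 : 0 <= Ls. Proof. by rewrite /Ls; have := mulr_ge0 K0 CP0; lra. Qed.

Variable (e : R).
Hypotheses (e0 : 0 < e) (e1 : e <= 1 / 1000) (e2 : e * Ls <= 1 / 4).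

Lemma shift_range (sg : R) : `|sg| <= Ls -> srange (1 + e * sg) /\ `|e * sg| <= e * Ls.
Proof.
move=> h; have h1 : `|e * sg| <= e * Ls by rewrite normrM (gtr0_norm e0) ler_wpM2l // ltW.
split=> //; have := le_trans h1 e2; rewrite ler_norml => /andP[a b].
by rewrite /srange; apply/andP; split; lra.
Qed.

Let srange1 : srange (1 : R). Proof. by rewrite /srange; apply/andP; split; lra. Qed.

Section Weighted.
Variable (k : R).
Hypothesis (k01 : 0 <= k <= 1).
Let w x := expR (- (k * `|x|)).
Let ww : weight w. Proof. exact: weight_exp. Qed.
Let w0 x : 0 < w x. Proof. exact: expR_gt0. Qed.
Let w1 x : w x <= 1. Proof. by case: ww. Qed.
Let w1w x : expR (- `|x|) <= w x. Proof. by case: ww. Qed.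

Definition ball h (sg : R) := [/\ bu h, dec k L0 h & `|sg| <= Ls].

Let V h := Gr (Pr h).
Let E h (sg : R) := Ed e h (1 + e * sg).

Let ball_adm h (sg : R) : ball h sg -> adm w A (V h) (Gr1 (Pr h)) (Gr2 (Pr h)).
Proof. by move=> [bh dh _]; exact: HG. Qed.

Let Pw s (j : nat) : srange s -> (j <= 5)%N -> wb w CP (Ps s j).
Proof.
move=> hs hj x; apply: le_trans (HP1 x hs hj) _; exact: ler_wpM2l (w1w x).
Qed.

Let bu_GGh h (sg : R) : ball h sg -> bu (GG e (1 + e * sg) (V h) (Gr2 (Pr h))).
Proof.
move=> bl; have [_ _ /shift_range[hs _]] := bl; have [sw _ _] := ww.
exact: (bu_GG CP1 HP1 e sw w1 hs (ball_adm bl)).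
Qed.

Lemma bu_Ed h (sg : R) : ball h sg -> bu (E h sg).
Proof. by move=> /bu_GGh; exact: bu_Bi. Qed.

Let E_le h (sg : R) : ball h sg -> wb w (K * e) (E h sg).
Proof.
move=> bl; have [_ _ /shift_range[hs _]] := bl.
by have [] := HK e0 e1 ww hs (ball_adm bl).
Qed.

Let diffadm f g (sf sg : R) D : ball f sf -> ball g sg -> 0 <= D -> wb w D (fun x => f x - g x) ->
  adm w (CG * D) (fun x => V f x - V g x) (fun x => Gr1 (Pr f) x - Gr1 (Pr g) x)
   (fun x => Gr2 (Pr f) x - Gr2 (Pr g) x).
Proof.
move=> [bf df _] [bg dg _] D0 fg; apply: adm_sub k01 df dg _.
by apply: HG; [exact: k01|exact: buB|split=> //; apply: contB; exact: bu_cont].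
Qed.

Let es (a b : R) : `|(1 + e * a) - (1 + e * b)| = e * `|a - b|.
Proof.
by rewrite -[X in _ = X * _](gtr0_norm e0) -normrM; congr (`|_|); ring.
Qed.

Let E_lip f g (sf sg : R) D W : ball f sf -> ball g sg -> 0 <= D -> 0 <= W ->
  wb w D (fun x => f x - g x) -> `|sf - sg| <= W * D ->
  wb w (K * (e * (W * D) + CG * D) * e) (fun x => E f sf x - E g sg x).
Proof.
move=> bf bg D0 W0 fg sfg.
have [_ _ /shift_range[hs _]] := bf; have [_ _ /shift_range[hs' _]] := bg.
have [_ H] := HK e0 e1 ww hs (ball_adm bf).
have := H _ _ _ _ _ hs' (ball_adm bg) (mulr_ge0 CG0 D0) (diffadm bf bg D0 fg).
apply: wbW => //; apply: ler_wpM2r (ltW e0) _ _ _; apply: ler_wpM2l K0 _ _ _.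
by rewrite es lerD2r; apply: ler_wpM2l (ltW e0) _ _ _.
Qed.

Let R1_le s : srange s -> wb w (8 * CP) (fun x => 3 / 4 * R1x s x).
Proof.
move=> hs x; have a := Pw hs (isT : (1 <= 5)%N) x; have b := Pw hs (isT : (3 <= 5)%N) x.
have c := mulr_ge0 CP0 (ltW (w0 x)).
by move: a b; rewrite /R1x /R1op !ler_norml => /andP[? ?] /andP[? ?]; apply/andP; split; lra.
Qed.

Let M1 := K + 9 * Ls * A + 6 * CP * Ls * A.

Let s2_le s (D' : R) : `|s - 1| <= D' -> srange s -> `|4 * s ^+ 2 - 4| <= 9 * D'.
Proof.
move=> h /andP[a b]; rewrite (_ : _ - _ = 4 * (1 + s) * (s - 1)); last by ring.
rewrite normrM; apply: ler_pM => //; rewrite ger0_norm; lra_recent.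
Qed.

Lemma Hn_le h (sg : R) : ball h sg -> wb w (8 * CP + e * M1) (Hn e h sg).
Proof.
move=> bl x; have [_ _ /[dup] hsg /shift_range[hs es1]] := bl.
have [_ _ _ [VL _ _]] := ball_adm bl.
set s := 1 + e * sg in hs *.
have sd : `|s - 1| <= e * Ls by rewrite /s addrAC subrr add0r.
have a := R1_le hs x; have b := E_le bl x.
have c := absM (s2_le sd hs) (VL x).
have p : `|Ps s 0 x - Ps 1 0 x| <= CP * (e * Ls).
  apply: le_trans (HP2 x hs srange1 (isT : (0 <= 4)%N)) _.
  have m := mulr_ge0 CP0 (normr_ge0 (s - 1)).
  apply: (@le_trans _ _ (CP * `|s - 1| * 1)); first exact: ler_wpM2l m _ _ (le_trans (w1w x) (w1 x)).
  by rewrite mulr1; exact: ler_wpM2l CP0 _ _ sd.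
have d := absM p (VL x).
rewrite /Hn -/s -/(E h sg) -/(V h).
have -> : 3 / 4 * R1x s x + E h sg x + (4 * s ^+ 2 - 4) * V h x - 6 * (Ps s 0 x - Ps 1 0 x) * V h x
  = 3 / 4 * R1x s x + E h sg x + ((4 * s ^+ 2 - 4) * V h x - 6 * ((Ps s 0 x - Ps 1 0 x) * V h x)) by ring.
apply: le_trans (ler_normD _ _) _.
apply: le_trans (lerD (le_trans (ler_normD _ _) (lerD a b)) (ler_normB _ _)) _.
rewrite [X in _ + (_ + X)]normrM (ger0_norm (_ : 0 <= 6)); last by lra.
by move: c d; rewrite /M1; lra_recent.
Qed.

Let E1 s (f : R -> R) M : srange s -> continuous f -> wb w M f ->
  `|Tint (fun x => f x * Ps s 1 x)| <= 2 * (M * CP).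
Proof.
move=> hs cf fM; have M0 := wb_ge0 w0 fM.
have fb : bnd M f by move=> x; apply: le_trans (fM x) _; rewrite -[X in _ <= X]mulr1; exact: ler_wpM2l.
have := Tint_le ltr01 (dec_prod cf (deriv_cont (deriv_Ps s (isT : (1 < 5)%N))) fb (fun x => HP1 x hs (isT : (1 <= 5)%N))).
by rewrite divr1.
Qed.

Lemma Sn_le h (sg : R) : ball h sg -> `|Sn e h sg| <= Ls - 1.
Proof.
move=> bl; have [_ _ /shift_range[hs es1]] := bl.
have [q1 _] := qs_bounds hs hs.
have t := E1 hs (bu_cont (bu_Ed bl)) (E_le bl).
have eq0 : 0 < e * qs (1 + e * sg) by apply: mulr_gt0 => //; lra.
rewrite /Sn normrM normfV (gtr0_norm eq0) ler_pdivrMr //.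
apply: le_trans t _; rewrite /Ls addrK.
have := ler_wpM2l (mulr_ge0 (mulr_ge0 K0 CP0) (ltW e0)) q1; lra.
Qed.

Let M2 (W : R) := 6 * CP * W + K * (W + CG) + 10 * W * A + 9 * Ls * CG + 6 * CP * W * A + 6 * CP * Ls * CG.

Section Lipschitz.
Variables (f g : R -> R) (sf sg D W : R).
Hypotheses (bf : ball f sf) (bg : ball g sg) (D0 : 0 <= D) (W0 : 0 <= W)
  (fg : wb w D (fun x => f x - g x)) (sfg : `|sf - sg| <= W * D).
Let s := 1 + e * sf.
Let s' := 1 + e * sg.
Let hs : srange s. Proof. by have [_ _ /shift_range[]] := bf. Qed.
Let hs' : srange s'. Proof. by have [_ _ /shift_range[]] := bg. Qed.
Let ss : `|s - s'| <= e * W * D.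
Proof. by rewrite es -mulrA; apply: ler_wpM2l (ltW e0) _ _ sfg. Qed.

Let Pd (j : nat) x : (j <= 4)%N -> `|Ps s j x - Ps s' j x| <= CP * (e * W * D) * w x.
Proof.
move=> j4; apply: le_trans (HP2 x hs hs' j4) _; apply: ler_pM => //.
- exact: mulr_ge0.
- exact: ler_wpM2l CP0 _ _ ss.
Qed.

Let EL x : `|E f sf x - E g sg x| <= K * (W + CG) * (e * D) * w x.
Proof.
apply: le_trans (E_lip bf bg D0 W0 fg sfg x) _; apply: ler_wpM2r (ltW (w0 x)) _ _ _.
have h : e * (W * D) <= W * D by rewrite ler_piMl ?mulr_ge0 //; have := e1; lra_recent.
have := ler_wpM2l (mulr_ge0 K0 (ltW e0)) h; lra.
Qed.

Lemma Hn_lip : wb w (e * M2 W * D) (fun x => Hn e f sf x - Hn e g sg x).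
Proof.
move=> x.
have [_ _ _ [VL _ _]] := ball_adm bf.
have [_ _ _ [dL _ _]] := diffadm bf bg D0 fg.
have [_ _ /shift_range[_ es2]] := bg.
have sd : `|s' - 1| <= e * Ls by rewrite /s' addrAC subrr add0r.
have a : `|3 / 4 * R1x s x - 3 / 4 * R1x s' x| <= 6 * (CP * (e * W * D) * w x).
  have a := Pd x (isT : (1 <= 4)%N); have b := Pd x (isT : (3 <= 4)%N).
  have c := le_trans (normr_ge0 _) a.
  by move: a b; rewrite /R1x /R1op !ler_norml => /andP[? ?] /andP[? ?]; apply/andP; split; lra_recent.
have b := EL x.
have c : `|4 * s ^+ 2 - 4 * s' ^+ 2| <= 10 * (e * W * D).
  rewrite (_ : _ - _ = 4 * (s + s') * (s - s')); last by ring.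
  apply: absM ss; have /andP[? ?] := hs; have /andP[? ?] := hs'.
  by rewrite ger0_norm; lra_recent.
have c1 := absM c (VL x); have c2 := absM (s2_le sd hs') (dL x).
have d1 := absM (Pd x (isT : (0 <= 4)%N)) (VL x).
have p : `|Ps s' 0 x - Ps 1 0 x| <= CP * (e * Ls).
  apply: le_trans (HP2 x hs' srange1 (isT : (0 <= 4)%N)) _.
  have m := mulr_ge0 CP0 (normr_ge0 (s' - 1)).
  apply: (@le_trans _ _ (CP * `|s' - 1| * 1)); first exact: ler_wpM2l m _ _ (le_trans (w1w x) (w1 x)).
  by rewrite mulr1; exact: ler_wpM2l CP0 _ _ sd.
have d2 := absM p (dL x).
have split5 (r r' b1 b2 a1 a2 v v' p0 p1 p2 : R) :
    3 / 4 * r + b1 + (a1 - 4) * v - 6 * (p0 - p2) * v - (3 / 4 * r' + b2 + (a2 - 4) * v' - 6 * (p1 - p2) * v') =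
    (3 / 4 * r - 3 / 4 * r') + (b1 - b2) + (a1 - a2) * v + (a2 - 4) * (v - v')
    - 6 * ((p0 - p1) * v) - 6 * ((p1 - p2) * (v - v')) by ring.
have -> : Hn e f sf x - Hn e g sg x =
  (3 / 4 * R1x s x - 3 / 4 * R1x s' x) + (E f sf x - E g sg x)
  + (4 * s ^+ 2 - 4 * s' ^+ 2) * V f x + (4 * s' ^+ 2 - 4) * (V f x - V g x)
  - 6 * ((Ps s 0 x - Ps s' 0 x) * V f x) - 6 * ((Ps s' 0 x - Ps 1 0 x) * (V f x - V g x)).
  exact: split5.
have d1' : `|(Ps s 0 x - Ps s' 0 x) * V f x| <= CP * (e * W * D) * (A * w x).
  apply: le_trans d1 _; rewrite [_ * w x * _]mulrAC -[X in X <= _]mulrA; apply: ler_wpM2l.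
    by apply: mulr_ge0 (mulr_ge0 (mulr_ge0 (ltW e0) W0) D0).
  rewrite -[X in X <= _]mulrA; apply: ler_wpM2l A0 _ _ _.
  by have := ler_wpM2r (ltW (w0 x)) (w1 x); rewrite mul1r.
have six (t T : R) : `|t| <= T -> `|6 * t| <= 6 * T.
  by apply: absM; rewrite ger0_norm.
apply: le_trans (ler_normB _ _) _.
have ab := le_trans (ler_normD _ _) (lerD a b).
have abc := le_trans (ler_normD _ _) (lerD ab c1).
apply: le_trans (lerD (absD3 abc c2 (six _ _ d1')) (six _ _ d2)) _.
by apply: leeq; rewrite /M2; ring.
Qed.

Lemma Sn_lip : `|Sn e f sf - Sn e g sg| <= 2 * K * CP * CG * D + 1204 * K * CP * e * W * D.
Proof.
have [q1 qq] := qs_bounds hs hs'; have [q2 _] := qs_bounds hs' hs.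
have cE := bu_cont (bu_Ed bf); have cE' := bu_cont (bu_Ed bg).
have bd M (p : R -> R) : wb w M p -> bnd M p.
  move=> fM x; apply: le_trans (fM x) _; rewrite -[X in _ <= X]mulr1.
  by exact: ler_wpM2l (wb_ge0 w0 fM) _ _ (w1 x).
have dE : wb w (K * (e * (W * D) + CG * D) * e) (fun x => E f sf x - E g sg x).
  exact: E_lip.
have cP (t : R) : continuous (Ps t 1) by apply: deriv_cont (deriv_Ps t (isT : (1 < 5)%N)).
have dec1 := dec_prod cE (cP s) (bd _ _ (E_le bf)) (fun x => HP1 x hs (isT : (1 <= 5)%N)).
have dec2 := dec_prod cE' (cP s') (bd _ _ (E_le bg)) (fun x => HP1 x hs' (isT : (1 <= 5)%N)).
have dec3 := dec_prod (contB cE cE') (cP s) (bd _ _ dE) (fun x => HP1 x hs (isT : (1 <= 5)%N)).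
have P4 x : `|Ps s 1 x - Ps s' 1 x| <= CP * (e * W * D) * expR (- `|x|).
  apply: le_trans (HP2 x hs hs' (isT : (1 <= 4)%N)) _.
  by apply: ler_wpM2r; [exact: expR_ge0|exact: ler_wpM2l CP0 _ _ ss].
have dec4 := dec_prod cE' (contB (cP s) (cP s')) (bd _ _ (E_le bg)) P4.
have TE : Tint (fun x => E f sf x * Ps s 1 x) - Tint (fun x => E g sg x * Ps s' 1 x) =
   Tint (fun x => (E f sf x - E g sg x) * Ps s 1 x) + Tint (fun x => E g sg x * (Ps s 1 x - Ps s' 1 x)).
  rewrite -(TintB ltr01 dec1 dec2) -(TintD ltr01 dec3 dec4); congr Tint.
  have hp (a b c d : R) : a * c - b * d = (a - b) * c + b * (c - d) by ring.
  by apply/funext => x; exact: hp.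
have t1 := Tint_le ltr01 dec3; have t2 := Tint_le ltr01 dec4.
have t3 := Tint_le ltr01 dec2.
rewrite divr1 in t1; rewrite divr1 in t2; rewrite divr1 in t3.
have qq' : `|qs s - qs s'| <= 600 * (e * W * D) by apply: le_trans qq _; exact: ler_wpM2l (ler0n _ 600) _ _ ss.
have t12 : `|Tint (fun x => E f sf x * Ps s 1 x) - Tint (fun x => E g sg x * Ps s' 1 x)| <=
   (2 * K * (e * W * D + CG * D) * CP + 2 * K * CP * (e * W * D)) * e.
  rewrite TE; apply: le_trans (ler_normD _ _) _; apply: le_trans (lerD t1 t2) _.
  by apply: leeq; ring.
have t3' : `|Tint (fun x => E g sg x * Ps s' 1 x)| <= 2 * K * CP * e.
  by apply: le_trans t3 _; apply: leeq; ring.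
rewrite /Sn -/s -/s' -/(E f sf) -/(E g sg).
by apply: le_trans (quot_lip e0 q1 q2 t12 t3' qq') _; apply: leeq; ring.
Qed.

End Lipschitz.

(** [Sn] is Lipschitz in [h] with constant [2 K CP CG], which is not small. Measured relative to the
    weight [W], the scalar component changes by at most half the distance; the components of [Hn]
    stay small because [sg] enters them only through [e * sg]. *)
Let W := 4 * K * CP * CG + 1.
Let W1 : 1 <= W.
Proof. by rewrite /W; have := mulr_ge0 (mulr_ge0 K0 CP0) CG0; lra. Qed.
Let W0 : 0 <= W. Proof. exact: le_trans ler01 W1. Qed.
Hypotheses (eM1 : e * M1 <= 1 / 2) (eM2 : e * M2 W <= 1 / 2) (eM3 : 1204 * K * CP * e <= 1 / 4).

(** A pair [(h, sg)] is packed into one function on [option R], the scalar sitting at [None]. *)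
Let hof (F : option R -> R) x := F (Some x).
Let Phi (F : option R -> R) o := match o with
  | Some x => Hn e (hof F) (F None) x
  | None => Sn e (hof F) (F None) end.
Let wo o := match o with Some x => w x | None => W end.
Let wo0 o : 0 <= wo o. Proof. by case: o => [x|] /=; [exact: ltW|exact: W0]. Qed.
Let S (F : option R -> R) := ball (hof F) (F None).

Let Hn_bound h (sg : R) : ball h sg -> wb w (L0 - 1 / 2) (Hn e h sg).
Proof. by move=> /Hn_le; apply: wbW => //; rewrite /L0; have := eM1; lra. Qed.

Lemma bu_Hn h (sg : R) : ball h sg -> bu (Hn e h sg).
Proof.
move=> bl; have [_ _ /shift_range[hs _]] := bl.
have [DV [uV1 [M hM]] _ [VL _ _]] := ball_adm bl.
have bV : bu (V h).
  split; first exact: deriv_ucont DV hM.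
  exists A => x; apply: le_trans (VL x) _.
  by rewrite -[X in _ <= X]mulr1; exact: ler_wpM2l.
have bP (t : R) (j : nat) : srange t -> (j <= 4)%N -> bu (Ps t j) by move=> ht hj; exact: (Ps_bu CP1 HP1 ht hj).
apply: buB; first apply: buD.
- apply: buD; last exact: bu_Ed.
  by apply: buZ; apply: buZ; apply: buD; [apply: buZ|]; exact: bP.
- exact: buZ.
- by apply: buM bV; apply: buZ; apply: buB; exact: bP.
Qed.

Let S_Phi F : S F -> S (Phi F).
Proof.
move=> SF; have bH := bu_Hn SF; split=> //.
- split; first exact: bu_cont.
  move=> x; apply: le_trans (Hn_bound SF x) _; apply: ler_wpM2r (ltW (w0 x)) _ _ _.
  by have := L00; lra.
- by apply: le_trans (Sn_le SF) _; have := Ls0; lra.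
Qed.

Let Phi_lip F G D : S F -> S G -> 0 <= D -> (forall o, `|F o - G o| <= D * wo o) ->
  forall o, `|Phi F o - Phi G o| <= 3 / 4 * D * wo o.
Proof.
move=> SF SG D0 FG.
have fg : wb w D (fun x => hof F x - hof G x) by move=> x; exact: (FG (Some x)).
have sfg : `|F None - G None| <= W * D by rewrite mulrC; exact: (FG None).
case=> [x|] /=.
- apply: le_trans (Hn_lip SF SG D0 W0 fg sfg x) _; apply: ler_wpM2r (ltW (w0 x)) _ _ _.
  by apply: ler_wpM2r D0 _ _ _; apply: le_trans eM2 _; lra.
- apply: le_trans (Sn_lip SF SG D0 W0 fg sfg) _.
  have h := ler_wpM2r (mulr_ge0 W0 D0) eM3.
  have h1 : 2 * K * CP * CG * D <= 1 / 2 * D * W.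
    have -> : 2 * K * CP * CG * D = 1 / 2 * D * (4 * K * CP * CG) by field.
    by apply: ler_wpM2l; [lra|rewrite /W; lra].
  by move: h h1; rewrite /=; lra.
Qed.

(** The fixed point lies inside the ball with margins 1/2 and 1; this is what later places every
    nearby solution in the ball, where uniqueness applies. *)
Lemma fixed_exists : exists h (sg : R), [/\ bu h, dec k (L0 - 1 / 2) h, `|sg| <= Ls - 1,
  Hn e h sg = h & Sn e h sg = sg].
Proof.
have S0 : S (fun=> 0).
  split; [exact: bu_cst| |by rewrite normr0; exact: Ls0].
  by split; [exact: cont_cst|move=> x; rewrite normr0 mulr_ge0 // ltW].
have th : 0 <= (3 / 4 : R) < 1 by apply/andP; split; lra.
have D0 : 0 <= L0 + Ls by exact: addr_ge0 L00 Ls0.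
have first o : `|Phi (fun=> 0) o - 0| <= (L0 + Ls) * wo o.
  rewrite subr0; case: o => [x|] /=.
    apply: le_trans (Hn_bound S0 x) _; apply: ler_wpM2r (ltW (w0 x)) _ _ _.
    by have := Ls0; lra.
  apply: le_trans (Sn_le S0) _; have := L00; have := Ls0; have := ler_wpM2l D0 W1; lra.
have cl (u : nat -> option R -> R) (F : option R -> R) : (forall n, S (u n)) ->
    (forall r, 0 < r -> exists n, forall o, `|u n o - F o| <= r * wo o) -> S F.
  move=> Su H.
  have uc : ucont (hof F).
    apply: (@ucont_lim _ _ (fun n => hof (u n))) => [n|r r0].
      by case: (Su n) => [[]].
    have [n Hn] := H r r0; exists n => x; apply: le_trans (Hn (Some x)) _.
    by rewrite -[X in _ <= X]mulr1; exact: ler_wpM2l (ltW r0) _ _ (w1 x).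
  have FL x : `|hof F x| <= L0 * w x.
    apply/ler_addgt0Pr => r r0; have [n Hn] := H r r0; have [_ [_ /(_ x) b] _] := Su n.
    have := Hn (Some x); have := ler_wpM2l (ltW r0) (w1 x); move: b; rewrite /hof /= -/(w x) !ler_norml.
    by move=> /andP[? ?] ? /andP[? ?]; apply/andP; split; lra.
  split.
  - split=> //; exists L0 => x; apply: le_trans (FL x) _.
    by rewrite -[X in _ <= X]mulr1; exact: ler_wpM2l L00 _ _ (w1 x).
  - by split=> //; exact: ucont_cont.
  - apply/ler_addgt0Pr => r r0; have W2 : 0 < W by have := W1; lra.
    have [n Hn] := H _ (divr_gt0 r0 W2); have [_ _ b] := Su n.
    have := Hn None; rewrite /= divfK ?gt_eqF //; move: b; rewrite !ler_norml.
    by move=> /andP[? ?] /andP[? ?]; apply/andP; split; lra.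
have [F SF FE] := contraction_fixpoint th wo0 S0 S_Phi Phi_lip D0 first cl.
have H1 : Hn e (hof F) (F None) = hof F by apply/funext => x; exact: (FE (Some x)).
have H2 : Sn e (hof F) (F None) = F None by exact: (FE None).
exists (hof F), (F None); split=> //.
- by case: SF.
- by split; [case: SF => _ []|rewrite -H1; exact: Hn_bound].
- by rewrite -H2; exact: Sn_le.
Qed.

(** Both fixed points are iterated: their weighted distance is multiplied by 3/4 at each step. With
    [k = 0] the ball asks for boundedness and no decay. *)
Lemma fixed_unique h h' (sg sg' : R) : ball h sg -> ball h' sg' ->
  Hn e h sg = h -> Sn e h sg = sg -> Hn e h' sg' = h' -> Sn e h' sg' = sg' -> h = h' /\ sg = sg'.
Proof.
move=> bl bl' H1 H2 H1' H2'.
pose F o := match o with Some x => h x | None => sg end.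
pose F' o := match o with Some x => h' x | None => sg' end.
have PF : Phi F = F by apply/funext => -[x|] /=; [rewrite -[in RHS]H1|rewrite -[in RHS]H2].
have PF' : Phi F' = F' by apply/funext => -[x|] /=; [rewrite -[in RHS]H1'|rewrite -[in RHS]H2'].
pose D := 2 * L0 + 2 * Ls.
have D0 : 0 <= D by have := L00; have := Ls0; rewrite /D; lra.
have key (n : nat) o : `|F o - F' o| <= (3 / 4) ^+ n * D * wo o.
  elim: n o => [|n IH] o.
    rewrite expr0 mul1r; case: o => [x|] /=.
      have [_ [_ /(_ x) a] _] := bl; have [_ [_ /(_ x) b] _] := bl'.
      apply: le_trans (ler_normB _ _) _; apply: le_trans (lerD a b) _.
      rewrite -mulrDl; apply: ler_wpM2r (ltW (w0 x)) _ _ _; rewrite /D; have := Ls0; lra.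
    have [_ _ a] := bl; have [_ _ b] := bl'.
    apply: le_trans (ler_normB _ _) _; apply: le_trans (lerD a b) _.
    by have := ler_wpM2l D0 W1; have := L00; rewrite /D; lra.
  have Dn : 0 <= (3 / 4) ^+ n * D by apply: mulr_ge0 D0; apply: exprn_ge0; lra.
  by have := Phi_lip bl bl' Dn IH o; rewrite PF PF' exprS !mulrA.
have FF o : F o = F' o.
  apply/eqP; rewrite -subr_eq0 -normr_le0; apply/ler_addgt0Pr => r r0; rewrite add0r.
  have : (3 / 4) ^+ n @[n --> \oo] --> (0 : R) by apply: cvg_expr; rewrite ger0_norm; lra.
  have X1 : 0 < D * wo o + 1 by have := mulr_ge0 D0 (wo0 o); lra.
  move=> /cvgrPdist_le /(_ _ (divr_gt0 r0 X1)) [n _ /(_ n (leqnn n))] /=.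
  have p : 0 <= (3 / 4 : R) ^+ n by apply: exprn_ge0; lra.
  rewrite sub0r normrN (ger0_norm p) => h1; apply: le_trans (key n o) _.
  have := ler_wpM2r (ltW X1) h1; rewrite divfK ?gt_eqF //; lra.
split; last exact: (FF None).
by apply/funext => x; exact: (FF (Some x)).
Qed.

End Weighted.

End Contraction.

(** * Fixed points and solutions of the profile equation *)

Section SolitonEquation.
Context {R : realType}.
Implicit Types (f g h w V : R -> R) (x e s k L M : R).

Lemma dec_tends G C : (forall x, `|G x| <= C * expR (- `|x : R|)) ->
  tends G 0 /\ tends (fun x => G (- x)) 0.
Proof.
move=> h; split; apply: (@tends_dom _ _ _ 1 C ltr01) => x x0; rewrite subr0 mul1r.
  by have := h x; rewrite (ger0_norm x0).
by have := h (- x); rewrite normrN (ger0_norm x0).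
Qed.

Lemma Ps3E s x : Ps s 3 x = (4 * s ^+ 2 - 6 * Ps s 0 x) * Ps s 1 x.
Proof. by rewrite /Ps /=; ring. Qed.

(** The Wronskians with [phi] and [psi] are constant. The one with [phi] tends to 0, which gives
    [D0 0 = 0]; then both vanish, and their independence forces [D0 = 0]. *)
Lemma bounded_kernel (D0 D1 : R -> R) M : deriv D0 D1 ->
  deriv D1 (fun x => (4 - 12 * sq x) * D0 x) -> bnd M D0 -> bnd M D1 -> D1 0 = 0 -> D0 =1 (fun=> 0).
Proof.
move=> d0 d1 b0 b1 z.
have const (p p1 : R -> R) : deriv p p1 -> deriv p1 (fun x => (4 - 12 * sq x) * p x) ->
    forall x, D1 x * p x - D0 x * p1 x = D1 0 * p 0 - D0 0 * p1 0.
  move=> dp dp1 x.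
  apply: (deriv0_cst (F := fun x => D1 x * p x - D0 x * p1 x)).
  by apply: deriv_eq (derivB (derivM d1 dp) (derivM d0 dp1)) _ => y; ring.
have P := const _ _ (@deriv_phi R) (@deriv_phi1 R).
have Q := const _ _ (@deriv_psi R) (@deriv_psi1 R).
have a : D0 0 = 0.
  have [t _] : tends (fun x => D1 x * phi x - D0 x * phi1 x) 0 /\ True.
    split=> //; apply: (@tends_dom _ _ _ 2 (12 * M)) => // x x0; rewrite subr0.
    apply: le_trans (ler_normB _ _) _.
    have := absM (b1 x) (phi_le x); have := absM (b0 x) (phi1_le x); rewrite (ger0_norm x0); lra.
  have t' : tends (fun x => D1 x * phi x - D0 x * phi1 x) (D1 0 * phi 0 - D0 0 * phi1 0).
    by apply: tends_eq (tends_cst _) => x _; rewrite P.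
  by have := tends_uniq t t'; rewrite z phi_0 phi1_0; lra.
move=> x; have := P x; have := Q x; rewrite z a => q p.
have := wronskian x => W.
have : D0 x * 4 = 0 by rewrite -W; have := congr1 (fun y => y * phi x) q; have := congr1 (fun y => y * psi x) p; lra.
lra.
Qed.

(** For a bounded solution the orthogonality of [h] to [phi] is automatic: [phi h] is the derivative
    of [V' phi - V phi1], which decays on both sides. *)
Lemma Gr_unique V V' h M : deriv V V' -> deriv V' (fun x => h x + (4 - 12 * sq x) * V x) ->
  bnd M V -> bnd M V' -> V' 0 = 0 -> dec 0 M h ->
  Tint (fun x => phi x * h x) = 0 /\ [/\ V = Gr h, V' = Gr1 h & (fun x => h x + (4 - 12 * sq x) * V x) = Gr2 h].
Proof.
move=> d0 d1 b0 b1 z dh; have [ch _] := dh.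
have T0 : Tint (fun x => phi x * h x) = 0.
  have e2 x : expR (- (2 * `|x : R|)) <= expR (- `|x|).
    by rewrite ler_expR lerN2 ler_peMl // ler1n.
  have M0 := bnd_ge0 b0.
  have G x : `|V' x * phi x - V x * phi1 x| <= 12 * M * expR (- `|x|).
    apply: le_trans (ler_normB _ _) _.
    have := absM (b1 x) (phi_le x); have := absM (b0 x) (phi1_le x); have := ler_wpM2l M0 (e2 x); lra.
  have [t1 t2] := dec_tends G.
  rewrite (Tint_deriv (deriv_eq (derivB (derivM d1 (@deriv_phi R)) (derivM d0 (@deriv_phi1 R))) _) _ t1 t2); first lra.
    by move=> x; ring.
  exact: contM (@cont_phi R) ch.
have k01 : 0 <= (0 : R) <= 1 by rewrite lexx ler01.
have [dG dG1 _] := Gr_bounds k01 dh T0.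
have bd C (f : R -> R) : dec 0 C f -> bnd C f.
  by move=> [_ h1] x; have := h1 x; rewrite mul0r oppr0 expR0 mulr1.
have M0 := bnd_ge0 b0.
have bB (f f' : R -> R) : bnd M f -> bnd (1000 * M) f' -> bnd (2000 * M) (fun x => f x - f' x).
  move=> h1 h2 x; apply: le_trans (ler_normB _ _) _; have := h1 x; have := h2 x; lra_local.
have dD := derivB d0 (deriv_Gr ch).
have dD1 : deriv (fun x => V' x - Gr1 h x) (fun x => (4 - 12 * sq x) * (V x - Gr h x)).
  by apply: deriv_eq (derivB d1 (deriv_Gr1 ch)) _ => x; rewrite /Gr2; ring.
have E := bounded_kernel dD dD1 (bB _ _ b0 (bd _ _ dG)) (bB _ _ b1 (bd _ _ dG1)) _.
have EV : V = Gr h by apply/funext => x; apply/eqP; rewrite -subr_eq0; apply/eqP; apply: E; rewrite z Gr1_0 subrr.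
split=> //; split=> //.
- apply/funext => x; have := d0 x; rewrite EV => a; have b := deriv_Gr ch x.
  by rewrite -(@derive_val _ _ _ _ _ _ _ a) -(@derive_val _ _ _ _ _ _ _ b).
- by rewrite EV.
Qed.

Lemma Fop_expand e (g : R) f (v : R -> R) x : continuous f -> continuous v ->
  2 * Fop e g (fun y => f y + e * v y) x = 2 * Fop e g f x
  + e * (2 * g * v x + 80 / 7 * (Av e v x - v x) - 2 * (Qop e f v x + Qop e v f x) - 2 * e * Qop e v v x).
Proof.
move=> cf cv; have cz : continuous (fun y => e * v y) by exact: contZ.
have cs : continuous (fun y => f y + e * v y) by exact: contD.
rewrite /Fop AvD // AvZ // (QopDl _ _ cf cz cs) (QopDr _ _ cf cz cf) (QopDr _ _ cf cz cz).
rewrite !(QopZl _ _ _ cv cf) !(QopZr _ _ _ cv cf) (QopZl _ _ _ cv cz) (QopZr _ _ _ cv cv).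
by ring.
Qed.

Lemma GG_expand e s V (Y : R -> R) x : e != 0 -> continuous V -> continuous Y ->
  e * GG e s V Y x = 2 * Fop e (gam s) (fun y => Ps s 0 y + e * V y - e ^+ 2 / 2 * (Ps s 2 y + e * Y y)) x
    - Bop e (fun y => Ps s 2 y + e * (3 / 4 * R1x s y + (4 * s ^+ 2 - 6 * Ps s 0 y) * V y)) x.
Proof.
move=> en cV cY.
have cP (k : nat) : (k < 5)%N -> continuous (Ps s k) by move=> k5; exact: deriv_cont (deriv_Ps s k5).
have cf : continuous (fun y => Ps s 0 y - e ^+ 2 / 2 * Ps s 2 y).
  by apply: contB; [|apply: contZ]; exact: cP.
have cv : continuous (fun y => V y - e ^+ 2 / 2 * Y y) by apply: contB => //; exact: contZ.
have -> : (fun y => Ps s 0 y + e * V y - e ^+ 2 / 2 * (Ps s 2 y + e * Y y)) =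
  fun y => (Ps s 0 y - e ^+ 2 / 2 * Ps s 2 y) + e * (V y - e ^+ 2 / 2 * Y y).
  by apply/funext => y; ring.
rewrite (Fop_expand _ _ _ cf cv).
have cR : continuous (fun y => 3 / 4 * R1x s y).
  by apply: contZ; apply: contZ; apply: contD; [apply: contZ|]; exact: cP.
have cL : continuous (fun y => 3 / 4 * (2 * gam s * V y - 8 * (Ps s 0 y * V y))).
  by apply: contZ; apply: contB; apply: contZ => //; apply: contM => //; exact: cP.
have -> : (fun y => Ps s 2 y + e * (3 / 4 * R1x s y + (4 * s ^+ 2 - 6 * Ps s 0 y) * V y)) =
  fun y => Ps s 2 y + e * (3 / 4 * R1x s y + 3 / 4 * (2 * gam s * V y - 8 * (Ps s 0 y * V y))).
  by apply/funext => y; rewrite /gam; field.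
have cRL := contD cR cL.
rewrite (BopD _ _ (cP 2%N isT) (@contZ _ e _ cRL)) (BopZ _ _ _ cRL) (BopD _ _ cR cL).
rewrite /GG /rr /l0op.
by field.
Qed.

Section Conversion.
Variables (CP : R).
Hypotheses (CP1 : 1 <= CP).
Hypothesis HP1 : forall s (k : nat) x, srange s -> (k <= 5)%N -> `|Ps s k x| <= CP * expR (- `|x|).
Hypothesis HP2 : forall s s' (k : nat) x, srange s -> srange s' -> (k <= 4)%N ->
  `|Ps s k x - Ps s' k x| <= CP * `|s - s'| * expR (- `|x|).

Let CP0 : 0 <= CP. Proof. by have := CP1; lra. Qed.

Variables (e s sg : R).
Hypotheses (e0 : 0 < e) (hs : srange s) (sE : s = 1 + e * sg).

Let s0 : 0 < s. Proof. by have /andP[? ?] := hs; lra. Qed.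
Let cP (k : nat) : (k < 5)%N -> continuous (Ps s k).
Proof. by move=> k5; exact: deriv_cont (deriv_Ps s k5). Qed.
Let Pw (k : nat) x : (k <= 5)%N -> `|Ps s k x| <= CP * expR (- `|x|).
Proof. by move=> k5; exact: HP1. Qed.
Let cR : continuous (R1x s).
Proof. by apply: contZ; apply: contD; [apply: contZ|]; exact: cP. Qed.

Let ex1 x : expR (- `|x : R|) <= 1. Proof. by rewrite expR_le1 oppr_le0. Qed.

Let R1b : bnd (8 * CP) (fun x => 3 / 4 * R1x s x).
Proof.
move=> x; have a := Pw x (isT : (1 <= 5)%N); have b := Pw x (isT : (3 <= 5)%N).
have c := ler_wpM2l CP0 (ex1 x).
by move: a b c; rewrite /R1x /R1op !ler_norml => /andP[? ?] /andP[? ?] ?; apply/andP; split; lra_recent.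
Qed.

Let decP1 f M : continuous f -> bnd M f -> dec 1 (M * CP) (fun x => f x * Ps s 1 x).
Proof. by move=> cf fM; exact: (dec_prod cf (cP (isT : (1 < 5)%N)) fM (fun x => Pw x (isT : (1 <= 5)%N))). Qed.

Lemma Tint_R1 : Tint (fun x => 3 / 4 * R1x s x * Ps s 1 x) = - (sg * (e * qs s)).
Proof.
have H := solvability s0.
have -> : (fun x => 3 / 4 * R1x s x * Ps s 1 x) =
  fun x => 3 / 2 * ((20 / 7 * Ps s 1 x + Ps s 3 x) * Ps s 1 x).
  by apply/funext => x; rewrite /R1x /R1op; field.
have c : continuous (fun x => 20 / 7 * Ps s 1 x + Ps s 3 x).
  by apply: contD; [apply: contZ|]; exact: cP.
have b : bnd (4 * CP) (fun x => 20 / 7 * Ps s 1 x + Ps s 3 x).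
  move=> x; have a := Pw x (isT : (1 <= 5)%N); have b := Pw x (isT : (3 <= 5)%N).
  have d := ler_wpM2l CP0 (ex1 x).
  by move: a b d; rewrite !ler_norml => /andP[? ?] /andP[? ?] ?; apply/andP; split; lra_recent.
rewrite (TintZ _ ltr01 (decP1 c b)) H /qs.
have -> : 1 - s ^+ 2 = - (e * sg) * (1 + s) by rewrite sE; ring.
by field.
Qed.

(** By [Ps3E] the derivative of the soliton solves the linearised equation at the same [s], so the
    integrand is the derivative of [V' * Ps s 1 - V * Ps s 2]. *)
Lemma Tint_orth V V' Y M : deriv V V' -> deriv V' Y -> continuous Y -> bnd M V -> bnd M V' ->
  Tint (fun x => (Y x - (4 * s ^+ 2 - 6 * Ps s 0 x) * V x) * Ps s 1 x) = 0.
Proof.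
move=> d0 d1 cY b0 b1.
have G x : `|V' x * Ps s 1 x - V x * Ps s 2 x| <= 2 * M * CP * expR (- `|x|).
  apply: le_trans (ler_normB _ _) _.
  have a := absM (b1 x) (Pw x (isT : (1 <= 5)%N)); have b := absM (b0 x) (Pw x (isT : (2 <= 5)%N)).
  by apply: le_trans (lerD a b) _; apply: leeq; ring.
have [t1 t2] := dec_tends G.
have cV := deriv_cont d0.
have D := derivB (derivM d1 (deriv_Ps s (isT : (1 < 5)%N))) (derivM d0 (deriv_Ps s (isT : (2 < 5)%N))).
rewrite (Tint_deriv (deriv_eq D _) _ t1 t2) ?subrr //.
  by move=> x /=; rewrite Ps3E; ring.
apply: contM; last exact: cP.
apply: contB => //; apply: contM => //; apply: contB; first exact: cont_cst.
by apply: contZ; exact: cP.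
Qed.

(** At a fixed point the projection is inactive. It removes a multiple [mu] of [phi], the kernel at
    [s = 1], while [Sn] enforces the solvability condition at the actual [s]; testing with [Ps s 1]
    leaves [mu] times the integral of [phi * Ps s 1], and that integral is not 0. *)
Lemma fixed_equation h : bu h -> Hn e h sg = h -> Sn e h sg = sg ->
  8 * CP * `|s - 1| < 1 ->
  (exists C, dec 1 C h) -> (exists M, [/\ bnd M (Gr (Pr h)), bnd M (Gr1 (Pr h)) & bu (Ed e h s)]) ->
  Bop e (Ed e h s) =1 GG e s (Gr (Pr h)) (Gr2 (Pr h)) ->
  Pr h = h /\ forall x, Bop e (fun y => Ps s 2 y + e * Gr2 h y) x =
     2 * Fop e (gam s) (fun y => Ps s 0 y + e * Gr h y - e ^+ 2 / 2 * (Ps s 2 y + e * Gr2 h y)) x.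
Proof.
move=> bh Hh Sh small [C dh] [M [bV bV1 bE]] EG.
have ch := bu_cont bh; have cE := bu_cont bE; have [_ [ME EM]] := bE.
have cPr : continuous (Pr h) by apply: contB => //; apply: contZ; exact: cont_phi.
have cG2 : continuous (Gr2 (Pr h)).
  apply: contD => //; apply: contM; last exact: deriv_cont (deriv_Gr cPr).
  by apply: contB; [exact: cont_cst|apply: contZ; exact: cont_sqch].
set mu := Tint (fun y => phi y * h y) * (15 / 4).
have Y x : Gr2 (Pr h) x - (4 * s ^+ 2 - 6 * Ps s 0 x) * Gr (Pr h) x =
    3 / 4 * R1x s x + Ed e h s x - mu * phi x.
  have p : Ps 1 0 x = 2 * sq x by rewrite /Ps /= expr1n !mul1r.
  have -> : Gr2 (Pr h) x = h x - mu * phi x + (4 - 12 * sq x) * Gr (Pr h) x by [].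
  have := congr1 (fun f => f x) Hh; rewrite /Hn -sE p => {1}<-.
  by move: (Ed e h s x) (Gr (Pr h) x) (R1x s x) (Ps s 0 x) mu => a b c d m; ring.
have qs1 : 1 <= qs s by have [] := qs_bounds hs hs.
have eq0 : e * qs s != 0 by rewrite gt_eqF // mulr_gt0 //; lra.
have TE : Tint (fun x => Ed e h s x * Ps s 1 x) = sg * (e * qs s).
  by rewrite -[in RHS]Sh /Sn -sE divfK.
have Z := Tint_orth (deriv_Gr cPr) (deriv_Gr1 cPr) cG2 bV bV1.
have bphi : bnd 4 (@phi R).
  have e2 x : expR (- (2 * `|x : R|)) <= 1 by rewrite expR_le1 oppr_le0 mulr_ge0.
  by move=> x; have := phi_le x; have := e2 x; lra.
have dphi := decP1 (@cont_phi R) bphi.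
have mu0 : mu = 0.
  have Z2 : Tint (fun x => (3 / 4 * R1x s x * Ps s 1 x + Ed e h s x * Ps s 1 x) - mu * (phi x * Ps s 1 x)) = 0.
    by rewrite -Z; congr Tint; apply/funext => x; rewrite Y; ring.
  have d1 := decP1 (@contZ _ (3 / 4) _ cR) R1b; have d2 := decP1 cE EM.
  move: Z2; rewrite (TintB ltr01 (decD d1 d2) (decZ mu dphi)) (TintD ltr01 d1 d2) (TintZ _ ltr01 dphi).
  rewrite Tint_R1 TE addNr sub0r => /eqP; rewrite oppr_eq0 mulf_eq0 => /orP[/eqP //|/eqP T0].
  (* At [s = 1] the integral is [- 16/15]; replacing [s] by 1 changes it by at most
     [8 CP |s - 1| < 1], so it cannot vanish. *)
  have Pd x : `|Ps s 1 x - Ps 1 1 x| <= CP * `|s - 1| * expR (- `|x|).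
    by apply: HP2 => //; rewrite /srange; apply/andP; split; lra_recent.
  have c1 : continuous (Ps 1 1 : R -> R) := deriv_cont (deriv_Ps 1 (isT : (1 < 5)%N)).
  have d3 := dec_prod (@cont_phi R) (contB (cP (isT : (1 < 5)%N)) c1) bphi Pd.
  have pp : (fun x : R => phi x * Ps 1 1 x) = fun x => (- 4) * (phi x * phi x).
    by apply/funext => x; rewrite /Ps /= expr1n !mul1r; ring.
  have dpp : dec 1 16 (fun x : R => phi x * phi x).
    split; first exact: contM (@cont_phi R) (@cont_phi R).
    move=> x; have := absM (bphi x) (phi_le x); rewrite mul1r => h1; apply: le_trans h1 _.
    have : expR (- (2 * `|x|)) <= expR (- `|x|) by rewrite ler_expR lerN2 ler_peMl // ler1n.
    lra_recent.
  have d4 : dec 1 (`|-4| * 16) (fun x : R => phi x * Ps 1 1 x) by rewrite pp; exact: decZ.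
  have := Tint_le ltr01 d3.
  have -> : (fun x => phi x * (Ps s 1 x - Ps 1 1 x)) = fun x => phi x * Ps s 1 x - phi x * Ps 1 1 x.
    by apply/funext => x; ring.
  rewrite (TintB ltr01 dphi d4) T0 pp (TintZ _ ltr01 dpp) Tint_phi2 divr1.
  rewrite sub0r mulNr opprK ger0_norm; last lra.
  by move: small; lra.
have Prh : Pr h = h by apply/funext => x; rewrite /Pr -/mu mu0 mul0r subr0.
split=> // x; rewrite Prh in EG Y cG2.
have en : e != 0 by rewrite gt_eqF.
have cG : continuous (Gr h) by exact: deriv_cont (deriv_Gr ch).
have := GG_expand s x en cG cG2.
have cX : continuous (fun y => 3 / 4 * R1x s y + (4 * s ^+ 2 - 6 * Ps s 0 y) * Gr h y).
  apply: contD; first exact: contZ.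
  by apply: contM => //; apply: contB; [exact: cont_cst|apply: contZ; exact: cP].
have -> : (fun y => Ps s 2 y + e * Gr2 h y) =
  fun y => (Ps s 2 y + e * (3 / 4 * R1x s y + (4 * s ^+ 2 - 6 * Ps s 0 y) * Gr h y)) + e * Ed e h s y.
  apply/funext => y; have := Y y; rewrite mu0 mul0r subr0 => /eqP.
  by rewrite subr_eq => /eqP ->; ring.
rewrite (BopD _ _ (contD (cP (isT : (2 < 5)%N)) (@contZ _ e _ cX)) (@contZ _ e _ cE)) (BopZ _ _ _ cE) EG.
move=> ->; ring.
Qed.

(** The converse of [fixed_equation]. It asks for bounds on the correction and no decay, so that it
    applies to competitors known only to be uniformly close. *)
Lemma solution_fixed V V' Y M : deriv V V' -> deriv V' Y -> bu Y -> bnd M V -> bnd M V' -> V' 0 = 0 ->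
  (forall x, Bop e (fun y => Ps s 2 y + e * Y y) x =
     2 * Fop e (gam s) (fun y => Ps s 0 y + e * V y - e ^+ 2 / 2 * (Ps s 2 y + e * Y y)) x) ->
  let h := fun x => Y x - (4 - 12 * sq x) * V x in
  [/\ bu h, V = Gr h, Hn e h sg = h & Sn e h sg = sg].
Proof.
move=> d0 d1 bY b0 b1 z eqn h.
have cY := bu_cont bY; have cV := deriv_cont d0; have cV' := deriv_cont d1.
have bV : bu V by split; [exact: deriv_ucont d0 b1|exists M].
have bsq : bu (@sq R).
  split; last by exists 1 => x; rewrite ger0_norm ?sq_le1 // ltW // sq_gt0.
  apply: (deriv_ucont (M := 2) (@deriv_sq R)) => x.
  have H (a t : R) : 0 < a -> a <= 1 -> `|t| <= 1 -> `|- 2 * a * t| <= 2.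
    by move=> a0 a1; rewrite !ler_norml => /andP[? ?]; apply/andP; split; nra.
  exact: H (sq_gt0 x) (sq_le1 x) (th_le1 x).
have bh : bu h by apply: buB => //; apply: buM bV; apply: buB; [exact: bu_cst|exact: buZ].
have [_ [N hN]] := bh.
have dh : dec 0 (M + N) h.
  split; first exact: bu_cont.
  by move=> x; rewrite mul0r oppr0 expR0 mulr1; have := hN x; have := bnd_ge0 b0; lra.
have M0 := bnd_ge0 b0; have N0 := bnd_ge0 hN.
have up f : bnd M f -> bnd (M + N) f by move=> fM x; have := fM x; lra.
have d1' : deriv V' (fun x => h x + (4 - 12 * sq x) * V x).
  by apply: deriv_eq d1 _ => x; rewrite /h subrK.
have [T0 [VE V'E YE]] := Gr_unique d0 d1' (up _ b0) (up _ b1) z dh.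
have Prh : Pr h = h by apply/funext => x; rewrite /Pr T0 !mul0r subr0.
have YE' : Gr2 h = Y by rewrite -YE; apply/funext => x; rewrite /h subrK.
have en : e != 0 by rewrite gt_eqF.
have bP (k : nat) : (k <= 4)%N -> bu (Ps s k) by move=> hk; exact: (Ps_bu CP1 HP1 hs hk).
pose Z x := Y x - (3 / 4 * R1x s x + (4 * s ^+ 2 - 6 * Ps s 0 x) * V x).
have bX : bu (fun x => 3 / 4 * R1x s x + (4 * s ^+ 2 - 6 * Ps s 0 x) * V x).
  apply: buD.
    by apply: buZ; apply: buZ; apply: buD; [apply: buZ|]; exact: bP.
  by apply: buM bV; apply: buB; [exact: bu_cst|apply: buZ; exact: bP].
have bZ : bu Z by exact: buB.
have GE : GG e s V Y = Bop e Z.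
  apply/funext => x; apply: (mulfI en); rewrite (GG_expand s x en cV cY) -eqn.
  rewrite (BopD _ _ (bu_cont (bP 2%N isT)) (@contZ _ e _ cY)).
  rewrite (BopD _ _ (bu_cont (bP 2%N isT)) (@contZ _ e _ (bu_cont bX))).
  by rewrite (BopZ _ _ _ cY) (BopZ _ _ _ (bu_cont bX)) (BopB _ _ cY (bu_cont bX)); ring.
have EE : Ed e h s = Z.
  by apply/funext => x; rewrite /Ed Prh YE' -VE GE; exact: BopK.
split=> //.
- apply/funext => x; rewrite /Hn -sE Prh -VE EE /Z /h.
  have -> : Ps 1 0 x = 2 * sq x by rewrite /Ps /= expr1n !mul1r.
  by move: (R1x s x) (Ps s 0 x) (V x) (Y x) (sq x) => a b c d m; ring.
- have qs1 : 1 <= qs s by have [] := qs_bounds hs hs.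
  have eq0 : e * qs s != 0 by rewrite gt_eqF // mulr_gt0 //; lra.
  rewrite /Sn -sE EE; apply: (canLR (mulfK eq0)).
  have [_ [ML HL]] : bu (fun x => Y x - (4 * s ^+ 2 - 6 * Ps s 0 x) * V x).
    by apply: buB => //; apply: buM bV; apply: buB; [exact: bu_cst|apply: buZ; exact: bP].
  have cL : continuous (fun x => Y x - (4 * s ^+ 2 - 6 * Ps s 0 x) * V x).
    apply: bu_cont; apply: buB => //; apply: buM bV; apply: buB; first exact: bu_cst.
    by apply: buZ; exact: bP.
  have -> : (fun x => Z x * Ps s 1 x) = fun x =>
     (Y x - (4 * s ^+ 2 - 6 * Ps s 0 x) * V x) * Ps s 1 x - 3 / 4 * R1x s x * Ps s 1 x.
    by apply/funext => x; rewrite /Z; ring.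
  rewrite (TintB ltr01 (decP1 cL HL) (decP1 (@contZ _ (3 / 4) _ cR) R1b)).
  by rewrite (Tint_orth d0 d1 cY b0 b1) Tint_R1; ring.
Qed.

End Conversion.

End SolitonEquation.

(** * The branch of profiles *)

Section Branch.
Context {R : realType}.
Implicit Types (P V : R -> R) (x e s C r : R).

Definition profile e s P P1 P2 := [/\ deriv P P1, deriv P1 P2, bu P2 &
  forall x, Bop e P2 x = 2 * Fop e (gam s) (fun y => P y - e ^+ 2 / 2 * P2 y) x].

Lemma small_scale (X : R) : 0 <= X -> exists2 e0 : R, 0 < e0 & forall e, 0 < e -> e <= e0 -> e * X <= 1.
Proof.
move=> X0; exists (1 / (1 + X)) => [|e e0]; first by apply: divr_gt0 => //; lra.
by rewrite ler_pdivlMr; lra.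
Qed.

Lemma scale5 (a b c d f e : R) : 0 <= a -> 0 <= b -> 0 <= c -> 0 <= d -> 0 <= f -> 0 < e ->
  e * (1000 + 4 * a + 2 * b + 2 * c + 4816 * d + 16 * f) <= 1 ->
  [/\ e * a <= 1 / 4, e * b <= 1 / 2, e * c <= 1 / 2, 1204 * d * e <= 1 / 4 & 8 * (f * e) < 1].
Proof.
move=> a0 b0 c0 d0 f0 e0; have e0' := ltW e0.
have part (x y : R) : 0 <= x -> 0 <= y -> e * (x + y) <= 1 -> e * x <= 1 /\ e * y <= 1.
  by move=> x0 y0 h; split; apply: le_trans h; apply: ler_wpM2l e0' _ _ _; rewrite ?lerDl ?lerDr.
have n k (x : R) : 0 <= x -> 0 <= k%:R * x by exact: mulr_ge0 (ler0n _ k).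
have p1 := addr_ge0 (ler0n R 1000) (n 4 _ a0); have p2 := addr_ge0 p1 (n 2 _ b0).
have p3 := addr_ge0 p2 (n 2 _ c0); have p4 := addr_ge0 p3 (n 4816 _ d0).
move=> /(part _ _ p4 (n 16 _ f0))[/(part _ _ p3 (n 4816 _ d0))[h d1] f1].
have [/(part _ _ p1 (n 2 _ b0))[/(part _ _ (ler0n R 1000) (n 4 _ a0))[_ a1] b1] c1] := part _ _ p2 (n 2 _ c0) h.
by split; [move: a1|move: b1|move: c1|move: d1|move: f1]; clear; lra.
Qed.

(** All constants are fixed before [e]. Existence uses the decay rate [k = 1], uniqueness the rate
    [k = 0], for the same [h]: the decaying fixed point is unique even among merely bounded ones. *)
Lemma soliton_setting : exists CP Ls L0 A e0 : R,
  [/\ 1 <= CP, 1 <= Ls, 1 <= L0, 0 <= A & 0 < e0 /\ e0 <= 1 / 1000] /\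
  (forall s (k : nat) x, srange s -> (k <= 5)%N -> `|Ps s k x| <= CP * expR (- `|x|)) /\
  (forall s s' (k : nat) x, srange s -> srange s' -> (k <= 4)%N ->
    `|Ps s k x - Ps s' k x| <= CP * `|s - s'| * expR (- `|x|)) /\
  forall e, 0 < e -> e <= e0 -> [/\ e * Ls <= 1 / 4, 8 * (CP * Ls * e) < 1 & exists h (sg : R),
  let s := 1 + e * sg in
  [/\ [/\ bu h, dec 1 (L0 - 1 / 2) h & `|sg| <= Ls - 1], Hn e h sg = h /\ Sn e h sg = sg, admP 1 A h,
    bu (Ed e h s) /\ bu (GG e s (Gr (Pr h)) (Gr2 (Pr h))) &
    forall h' sg', bu h' -> bnd L0 h' -> `|sg'| <= Ls -> Hn e h' sg' = h' -> Sn e h' sg' = sg' ->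
      h = h' /\ sg = sg']].
Proof.
have q1000 : 0 < 1 / 1000 :> R by lra.
have [C1 C10 HC1] := @Ps_bound R; have [C2 C20 HC2] := @Ps_lip R.
pose CP := 1 + C1 + C2.
have CP1 : 1 <= CP by rewrite /CP; lra.
have HP1 s (k : nat) x : srange s -> (k <= 5)%N -> `|Ps s k x| <= CP * expR (- `|x|).
  move=> hs hk; apply: le_trans (HC1 s k x hs hk) _; apply: ler_wpM2r (expR_ge0 _) _ _ _.
  by rewrite /CP; lra.
have HP2 s s' (k : nat) x : srange s -> srange s' -> (k <= 4)%N ->
    `|Ps s k x - Ps s' k x| <= CP * `|s - s'| * expR (- `|x|).
  move=> hs hs' hk; apply: le_trans (HC2 s s' k x hs hs' hk) _; apply: ler_wpM2r (expR_ge0 _) _ _ _.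
  by apply: ler_wpM2r (normr_ge0 _) _ _ _; rewrite /CP; lra.
have CP0 : 0 <= CP by lra.
move: CP1 HP1 HP2 CP0; move: (CP) => {C1 C10 HC1 C2 C20 HC2 CP} CP CP1 HP1 HP2 CP0.
have [CG CG1 HG] := @Pr_adm R.
have CG0 : 0 <= CG by lra.
pose L0 := 8 * CP + 1; have L01 : 1 <= L0 by rewrite /L0; lra.
have L00 : 0 <= L0 by exact: le_trans ler01 L01.
pose A := CG * L0; have A0 : 0 <= A by exact: mulr_ge0.
have [K K0 HK] := Bi_GG_bounds CP1 HP1 HP2 A0.
pose Ls := 2 * K * CP + 1; have Ls1 : 1 <= Ls by rewrite /Ls; have := mulr_ge0 K0 CP0; lra_local.
pose M1 := K + 9 * Ls * A + 6 * CP * Ls * A.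
pose W := 4 * K * CP * CG + 1.
pose M2 := 6 * CP * W + K * (W + CG) + 10 * W * A + 9 * Ls * CG + 6 * CP * W * A + 6 * CP * Ls * CG.
have Ls0 : 0 <= Ls by lra_local.
have W0 : 0 <= W by rewrite /W; have := mulr_ge0 (mulr_ge0 K0 CP0) CG0; lra_local.
have p1 := mulr_ge0 Ls0 A0; have p2 := mulr_ge0 CP0 p1.
have M10 : 0 <= M1 by rewrite /M1; move: p1 p2 K0; lra_local.
have q1 := mulr_ge0 CP0 W0; have q2 := mulr_ge0 K0 (addr_ge0 W0 CG0); have q3 := mulr_ge0 W0 A0.
have q4 := mulr_ge0 Ls0 CG0; have q5 := mulr_ge0 q1 A0; have q6 := mulr_ge0 (mulr_ge0 CP0 Ls0) CG0.
have M20 : 0 <= M2.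
  have hp (a b c d f g : R) : 0 <= a -> 0 <= b -> 0 <= c -> 0 <= d -> 0 <= f -> 0 <= g ->
     0 <= 6 * a + b + 10 * c + 9 * d + 6 * f + 6 * g by lra_local.
  by have := hp _ _ _ _ _ _ q1 q2 q3 q4 q5 q6; rewrite /M2 !mulrA.
have KC := mulr_ge0 K0 CP0; have CL := mulr_ge0 CP0 Ls0.
(* A single number whose product with [e] being at most 1 contains all the smallness conditions,
   separated by [scale5]. *)
pose X := 1000 + 4 * Ls + 2 * M1 + 2 * M2 + 4816 * (K * CP) + 16 * (CP * Ls).
have X0 : 0 <= X by rewrite /X; move: Ls0 M10 M20 KC CL; lra_local.
have [e0 e00 He0] := small_scale X0.
exists CP, Ls, L0, A, (Num.min e0 (1 / 1000)).
split; first split; [exact: CP1|exact: Ls1|exact: L01|exact: A0| |].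
  split; first by rewrite lt_min e00; apply/andP; split; [by []|exact: q1000].
  by rewrite ge_min lexx orbT.
split; first exact: HP1.
split; first exact: HP2.
move=> e ep; rewrite le_min => /andP[ee0 e1].
have [e2 eM1 eM2 eM3 eM4] := scale5 Ls0 M10 M20 KC CL ep (He0 e ep ee0).
rewrite mulrA in eM3.
have k1 : 0 <= (1 : R) <= 1 by rewrite ler01 lexx.
have k0 : 0 <= (0 : R) <= 1 by rewrite ler01 lexx.
split; [exact: e2|exact: eM4|].
have [h [sg [bh dh sgL Hh Sh]]] := fixed_exists CP1 HP1 HP2 CG1 K0 HG HK ep e1 e2 k1 eM1 eM2 eM3.
have lt1 (a : R) : a - 1 <= a by rewrite gerBl ler01.
have sgL' : `|sg| <= Ls by exact: le_trans sgL (lt1 _).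
have [hs es] := shift_range ep e2 sgL'.
have lt2 (a : R) : a - 1 / 2 <= a by rewrite gerBl divr_ge0.
have dh1 : dec 1 L0 h.
  have [c b] := dh; split=> // x; apply: le_trans (b x) _; apply: ler_wpM2r (expR_ge0 _) _ _ _; exact: lt2.
have adm1 := HG 1 L0 h k1 bh dh1.
have bl1 : ball CP K 1 h sg by [].
exists h, sg; split; [by []|by []|exact: adm1| |].
  split; first exact: (bu_Ed CP1 HP1 HG ep e2 k1 bl1).
  have [sw ww _] := weight_exp k1.
  exact: (bu_GG CP1 HP1 e sw ww hs adm1).
move=> h' sg' bh' bd' sg'L Hh' Sh'.
have ex1 x : expR (- (1 * `|x : R|)) <= 1 by rewrite expR_le1 oppr_le0 mul1r.
have d0 (f : R -> R) : bu f -> bnd L0 f -> dec 0 L0 f.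
  by move=> bf fL; split=> [|x]; [exact: bu_cont|rewrite mul0r oppr0 expR0 mulr1].
have dh0 : dec 0 L0 h.
  apply: d0 => // x; have [_ b] := dh1; apply: le_trans (b x) _.
  by rewrite -[X in _ <= X]mulr1; exact: ler_wpM2l L00 _ _ (ex1 x).
exact: (fixed_unique CP1 HP1 HP2 CG1 K0 HG HK ep e1 e2 k0 eM2 eM3
    (And3 bh dh0 sgL') (And3 bh' (d0 _ bh' bd') sg'L) Hh Sh Hh' Sh').
Qed.

Theorem soliton_branch : exists C e0 : R, [/\ 0 < C, 0 < e0, e0 <= 1 / 1000 &
  forall e, 0 < e -> e <= e0 -> exists s P P1 P2,
  [/\ profile e s P P1 P2, P1 0 = 0, `|s - 1| <= C * e,
    (forall x, `|P x - Ps 1 0 x| <= C * e * expR (- `|x|) /\ `|P1 x - Ps 1 1 x| <= C * e * expR (- `|x|) /\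
      `|P2 x - Ps 1 2 x| <= C * e * expR (- `|x|)) &
    exists2 r, 0 < r & forall s' P' P1' P2', profile e s' P' P1' P2' -> P1' 0 = 0 -> `|s' - s| <= r ->
      bnd r (fun x => P' x - P x) -> bnd r (fun x => P1' x - P1 x) -> bnd r (fun x => P2' x - P2 x) ->
      s' = s /\ P' = P]].
Proof.
have [CP [Ls [L0 [A [e0 [[CP1 Ls1 L01 A0 [e00 e01]] [HP1 [HP2 H]]]]]]]] := soliton_setting.
have CP0 : 0 <= CP by lra.
have Ls0 : 0 <= Ls by lra_local.
have L00 : 0 <= L0 by lra_local.
have CL := mulr_ge0 CP0 Ls0.
pose C := Ls + CP * Ls + A + 1.
have C0 : 0 < C by rewrite /C; lra_local.
exists C, e0; split; [exact: C0|exact: e00|exact: e01|].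
move=> e ep ee0; have [e2 eM4 [h [sg [[bh dh sgL] [Hh Sh] adm1 [bE bGG] uniq]]]] := H e ep ee0.
rewrite /admP in adm1.
have sgL' : `|sg| <= Ls by lra_local.
have sr (sg' : R) : `|sg'| <= Ls -> srange (1 + e * sg') /\ `|e * sg'| <= e * Ls.
  move=> h1; have h2 : `|e * sg'| <= e * Ls by rewrite normrM (gtr0_norm ep) ler_wpM2l // ltW.
  split=> //; have := le_trans h2 e2; rewrite ler_norml => /andP[a b].
  by rewrite /srange; apply/andP; split; lra_local.
have dh1 : dec 1 L0 h.
  have [c b] := dh; split=> // x; apply: le_trans (b x) _; apply: ler_wpM2r (expR_ge0 _) _ _ _; lra_local.
have [hs es] := sr _ sgL'.
set s := 1 + e * sg in hs.
have s1 : `|s - 1| <= e * Ls by rewrite /s addrAC subrr add0r.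
have [DV bV1 bY [VL V1L YL]] := adm1.
have ex1 x : expR (- (1 * `|x : R|)) <= 1 by rewrite expR_le1 oppr_le0 mul1r.
have bd M (f : R -> R) : 0 <= M -> wb (fun x => expR (- (1 * `|x|))) M f -> bnd M f.
  move=> M0 fM x; apply: le_trans (fM x) _; rewrite -[X in _ <= X]mulr1; exact: ler_wpM2l M0 _ _ (ex1 x).
have [Prh eqn] : Pr h = h /\ forall x, Bop e (fun y => Ps s 2 y + e * Gr2 h y) x =
     2 * Fop e (gam s) (fun y => Ps s 0 y + e * Gr h y - e ^+ 2 / 2 * (Ps s 2 y + e * Gr2 h y)) x.
  apply: (fixed_equation CP1 HP1 HP2 ep hs erefl bh Hh Sh).
  - apply: le_lt_trans eM4; rewrite -[8 * CP * _]mulrA; apply: ler_wpM2l; first lra_local.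
    by rewrite -[CP * Ls * e]mulrA; apply: ler_wpM2l CP0 _ _ _; rewrite mulrC.
  - by exists L0.
  - by exists A; split; [exact: bd VL|exact: bd V1L|exact: bE].
  - exact: BiK.
rewrite Prh in DV bV1 bY VL V1L YL.
have cV1 := bu_cont bV1; have ch := bu_cont bh.
have cl (k : nat) (V : R -> R) x : (k <= 4)%N -> wb (fun x => expR (- (1 * `|x|))) A V ->
    `|Ps s k x + e * V x - Ps 1 k x| <= C * e * expR (- `|x|).
  move=> k4 VA; have r1 : srange (1 : R) by rewrite /srange; apply/andP; split; lra_local.
  rewrite addrAC; apply: le_trans (ler_normD _ _) _.
  have a := HP2 s 1 k x hs r1 k4; have b := VA x; rewrite mul1r in b.
  rewrite normrM (gtr0_norm ep).
  have c : `|Ps s k x - Ps 1 k x| <= CP * (e * Ls) * expR (- `|x|).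
    apply: le_trans a _; apply: ler_wpM2r (expR_ge0 _) _ _ _; exact: ler_wpM2l CP0 _ _ s1.
  apply: le_trans (lerD c (ler_wpM2l (ltW ep) b)) _.
  have -> : CP * (e * Ls) * expR (- `|x|) + e * (A * expR (- `|x|)) = (CP * Ls + A) * e * expR (- `|x|) by ring.
  apply: ler_wpM2r (expR_ge0 _) _ _ _; apply: ler_wpM2r (ltW ep) _ _ _.
  by rewrite /C; move: Ls0; lra_local.
have bP (k : nat) : (k <= 4)%N -> bu (Ps s k) by move=> hk; exact: (Ps_bu CP1 HP1 hs hk).
have z1 (t : R) : Ps t 1 0 = 0 by rewrite /Ps /= mulr0 phi_0 !mulr0.
exists s, (fun x => Ps s 0 x + e * Gr h x), (fun x => Ps s 1 x + e * Gr1 h x),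
  (fun x => Ps s 2 x + e * Gr2 h x); split.
- split.
  + apply: derivD; first exact: (deriv_Ps s (isT : (0 < 5)%N)).
    by apply: derivZ; exact: deriv_Gr.
  + apply: derivD; first exact: (deriv_Ps s (isT : (1 < 5)%N)).
    by apply: derivZ; exact: deriv_Gr1.
  + by apply: buD; [exact: bP|exact: buZ].
  + exact: eqn.
- by rewrite z1 Gr1_0; ring.
- apply: le_trans s1 _; rewrite mulrC; apply: ler_wpM2r (ltW ep) _ _ _.
  by rewrite /C; move: CL A0; lra_local.
- by move=> x; split; [exact: cl|split; exact: cl].
- have CPp : 0 < 18 * (1 + CP) by move: CP0; lra_local.
  (* This radius brings the rescaled corrections within 1/18 of each other, hence the unknowns [h]
     within [1/18 + 8 * 1/18 = 1/2], the margin left by [fixed_exists]. *)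
  exists (e / (18 * (1 + CP))); first exact: divr_gt0.
  set r := e / _.
  have re : (1 + CP) * r / e = 1 / 18.
    by rewrite /r; field; rewrite !gt_eqF //; move: CP0; lra_local.
  have r0 : 0 <= r by rewrite /r divr_ge0 // ltW.
  have rle : r / e <= 1.
    by rewrite ler_pdivrMr // mul1r /r ler_pdivrMr // ler_peMr ?ltW //; move: CP0; lra_local.
  move=> s' P' P1' P2' [dP dP1 bP2 eqn'] z' ss PP PP1 PP2.
  have en : e != 0 by rewrite gt_eqF.
  pose sg' := e^-1 * (s' - 1).
  have s'E : s' = 1 + e * sg' by rewrite /sg' mulrA divff // mul1r addrC subrK.
  have sg'L : `|sg'| <= Ls.
    have : `|sg' - sg| <= 1.
      have -> : sg' - sg = e^-1 * (s' - s) by rewrite /sg' /s; field.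
      rewrite normrM normfV (gtr0_norm ep) mulrC; apply: le_trans rle.
      by apply: ler_wpM2r ss; rewrite invr_ge0 ltW.
    have := ler_normD (sg' - sg) sg; rewrite subrK => a b; apply: le_trans a _.
    by apply: le_trans (lerD b sgL) _; lra_local.
  have [hs' _] := sr _ sg'L; rewrite -s'E in hs'.
  pose q (k : nat) (p : R -> R) x := e^-1 * (p x - Ps s' k x).
  have qE k p x : Ps s' k x + e * q k p x = p x by rewrite /q mulrA divff // mul1r addrC subrK.
  have qd (k : nat) (p V : R -> R) x : (k <= 4)%N -> `|p x - (Ps s k x + e * V x)| <= r ->
      `|q k p x - V x| <= 1 / 18.
    move=> k4 h1.
    have -> : q k p x - V x = e^-1 * ((p x - (Ps s k x + e * V x)) - (Ps s' k x - Ps s k x)).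
      by rewrite /q; field.
    have h2 := HP2 s' s k x hs' hs k4.
    have h3 : `|Ps s' k x - Ps s k x| <= CP * r.
      apply: le_trans h2 _; apply: le_trans (_ : CP * `|s' - s| * 1 <= _); last first.
        by rewrite mulr1; exact: ler_wpM2l CP0 _ _ ss.
      apply: ler_wpM2l; first exact: mulr_ge0.
      by rewrite expR_le1 oppr_le0.
    rewrite normrM normfV (gtr0_norm ep) -re mulrC; apply: ler_wpM2r; first by rewrite invr_ge0 ltW.
    by apply: le_trans (ler_normB _ _) _; apply: le_trans (lerD h1 h3) _; apply: leeq; ring.
  have Vd x := qd 0%N P' (Gr h) x isT (PP x).
  have V1d x := qd 1%N P1' (Gr1 h) x isT (PP1 x).
  have Yd x := qd 2%N P2' (Gr2 h) x isT (PP2 x).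
  have bdV : bnd (A + 1 / 18) (q 0%N P').
    move=> x; have := ler_normD (q 0%N P' x - Gr h x) (Gr h x); rewrite subrK => a; apply: le_trans a _.
    by rewrite addrC; exact: lerD (bd _ _ A0 VL x) (Vd x).
  have bdV1 : bnd (A + 1 / 18) (q 1%N P1').
    move=> x; have := ler_normD (q 1%N P1' x - Gr1 h x) (Gr1 h x); rewrite subrK => a; apply: le_trans a _.
    by rewrite addrC; exact: lerD (bd _ _ A0 V1L x) (V1d x).
  have dq0 : deriv (q 0%N P') (q 1%N P1').
    exact: (derivZ _ (derivB dP (deriv_Ps s' (isT : (0 < 5)%N)))).
  have dq1 : deriv (q 1%N P1') (q 2%N P2').
    exact: (derivZ _ (derivB dP1 (deriv_Ps s' (isT : (1 < 5)%N)))).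
  have bq2 : bu (q 2%N P2').
    exact: (buZ _ (buB bP2 (Ps_bu CP1 HP1 hs' (isT : (2 <= 4)%N)))).
  have qz : q 1%N P1' 0 = 0 by rewrite /q z' z1 subrr mulr0.
  have EE (k : nat) p : (fun y => Ps s' k y + e * q k p y) = p by apply/funext => y; exact: qE.
  have eqn2 x : Bop e (fun y => Ps s' 2 y + e * q 2%N P2' y) x = 2 * Fop e (gam s')
      (fun y => Ps s' 0 y + e * q 0%N P' y - e ^+ 2 / 2 * (Ps s' 2 y + e * q 2%N P2' y)) x.
    rewrite EE eqn'; congr (2 * Fop _ _ _ _).
    by apply/funext => y; rewrite !qE.
  have [bh' VE' Hh' Sh'] := solution_fixed CP1 HP1 ep hs' s'E dq0 dq1 bq2 bdV bdV1 qz eqn2.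
  set h' := (fun x => _) in bh' VE' Hh' Sh'.
  have dh' : bnd L0 h'.
    move=> x.
    have hE : h x = Gr2 h x - (4 - 12 * sq x) * Gr h x by rewrite /Gr2 addrK.
    have a : `|4 - 12 * sq x| <= 8.
      by have := sq_gt0 x; have := sq_le1 x; rewrite ler_norml => lo hi; apply/andP; split; clear -lo hi; lra.
    have b := absM a (Vd x).
    have c : `|h' x - h x| <= 1 / 2.
      have -> : h' x - h x = (q 2%N P2' x - Gr2 h x) - (4 - 12 * sq x) * (q 0%N P' x - Gr h x).
        by rewrite hE /h'; ring.
      by apply: le_trans (ler_normB _ _) _; apply: le_trans (lerD (Yd x) b) _; clear; lra.
    have [_ d] := dh; have := ler_normD (h' x - h x) (h x); rewrite subrK => f; apply: le_trans f _.
    have g : `|h x| <= L0 - 1 / 2.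
      apply: le_trans (d x) _; rewrite -/L0 -[X in _ <= X]mulr1; apply: ler_wpM2l (ex1 x).
      by move: L01; clear; lra.
    by apply: le_trans (lerD c g) _; clear; lra.
  have [hh sgsg] := uniq _ _ bh' dh' sg'L Hh' Sh'.
  have ssE : s' = s by rewrite s'E -sgsg.
  split=> //; apply/funext => x.
  by rewrite -(qE 0%N P' x) VE' -hh ssE.
Qed.

End Branch.

(** * From the profile equation to the delay equation *)

Section IntegratedEquation.
Context {R : realType}.
Implicit Types (f p q h U u k : R -> R) (x e c d xi : R).

Lemma Tk_parts k k' P P1 P2 d c x (k2 : R) : deriv k k' -> deriv k' (fun=> k2) ->
  deriv P P1 -> deriv P1 P2 -> continuous P2 ->
  c ^+ 2 * Tk k d c P2 x = c * k 1 * P1 (x + (d + c)) - c * k 0 * P1 (x + d)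
    - k' 1 * P (x + (d + c)) + k' 0 * P (x + d) + k2 * Tk (fun=> 1) d c P x.
Proof.
move=> dk dk' dP dP1 c2.
have A f f' : deriv f f' -> deriv (fun s => f (x + (d + c * s))) (fun s => c * f' (x + (d + c * s))).
  move=> df; have := deriv_aff (x + d) c df.
  rewrite (_ : (fun s => f (x + d + c * s)) = (fun s => f (x + (d + c * s)))); last first.
    by apply/funext => s; rewrite addrA.
  by move=> D; apply: deriv_eq D _ => s; rewrite addrA.
have cP := deriv_cont dP.
have ct f : continuous f -> continuous (fun s => f (x + (d + c * s))) by exact: cont_transl.
pose F s := c * k s * P1 (x + (d + c * s)) - k' s * P (x + (d + c * s)).
have D : deriv F (fun s => c ^+ 2 * (k s * P2 (x + (d + c * s))) - k2 * (1 * P (x + (d + c * s)))).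
  by apply: deriv_eq (derivB (derivM (derivZ c dk) (A _ _ dP1)) (derivM dk' (A _ _ dP))) _ => s; ring.
have c1 : continuous (fun s => k s * P2 (x + (d + c * s))).
  by apply: contM; [exact: deriv_cont dk|exact: ct].
have c3 : continuous (fun s => 1 * P (x + (d + c * s))) by apply: contZ; exact: ct.
have := itgE 0 1 D; rewrite (itgB _ _ (@contZ _ (c ^+ 2) _ c1) (@contZ _ k2 _ c3)) (itgZ _ _ _ c1) (itgZ _ _ _ c3).
rewrite -/(Tk k d c P2 x) -/(Tk (fun=> 1) d c P x) /F mulr1 mulr0 addr0.
lra.
Qed.

(** The linear part of the integrated equation at speed 4 and [beta = 2], after scaling. The
    coefficient 5 is [2 beta] plus 1, as one window of [hop] coincides with that of the [beta]
    term. *)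
Definition Mop e f x := 4 * f x - 5 * Tk (fun=> 1) 0 e f x + Tk (fun=> 1) e e f x
  + Tk (fun=> 1) 0 (- e) f x - Tk (fun=> 1) (- e) (- e) f x.

(** The idea behind the preconditioner [P - e ^+ 2 / 2 * P'']: two integrations by
    parts turn the second difference [Mop] into an average of the second derivative. *)
Lemma Mop_precond e P P1 P2 x : deriv P P1 -> deriv P1 P2 -> continuous P2 ->
  Mop e (fun y => P y - e ^+ 2 / 2 * P2 y) x = - (e ^+ 2 / 2) * Bop e P2 x.
Proof.
move=> dP dP1 c2; have cP := deriv_cont dP.
have c1 : continuous (fun _ : R => 1 : R) by exact: cont_cst.
have cz : continuous (fun y => e ^+ 2 / 2 * P2 y) by exact: contZ.
rewrite /Mop !(TkB _ _ _ c1 cP cz) !(TkZ _ _ _ _ c1 c2).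
have d1 : deriv (fun _ : R => 1 : R) (fun=> 0) := deriv_cst 1.
have ds : deriv (fun s : R => s * s) (fun s => 2 * s).
  by apply: deriv_eq (derivM deriv_id deriv_id) _ => s; ring.
have d2 a : deriv (fun s : R => a + 2 * s) (fun=> 2).
  by apply: deriv_eq (derivD (deriv_cst a) (derivZ 2 deriv_id)) _ => s; ring.
have dka : deriv (@ka R) (fun s => - 8 + 10 * s).
  apply: deriv_eq (derivD (derivB (deriv_cst (-3)) (derivZ 8 deriv_id)) (derivZ 5 ds)) _ => s; ring.
have dka' : deriv (fun s : R => - 8 + 10 * s) (fun=> 10).
  by apply: deriv_eq (derivD (deriv_cst _) (derivZ 10 deriv_id)) _ => s; ring.
have dkb : deriv (@kb R) (fun s => - 2 * s).
  apply: deriv_eq (derivB (deriv_cst 3) ds) _ => s; ring.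
have dkb' : deriv (fun s : R => - 2 * s) (fun=> -2).
  by apply: deriv_eq (derivZ (-2) deriv_id) _ => s; ring.
have dkc : deriv (@kc R) (fun s => 2 - 2 * s).
  apply: deriv_eq (derivB (derivZ 2 deriv_id) ds) _ => s; ring.
have dkc' : deriv (fun s : R => 2 - 2 * s) (fun=> -2).
  by apply: deriv_eq (derivB (deriv_cst 2) (derivZ 2 deriv_id)) _ => s; ring.
have E1 := Tk_parts 0 e x d1 (deriv_cst 0) dP dP1 c2.
have E2 := Tk_parts e e x d1 (deriv_cst 0) dP dP1 c2.
have E3 := Tk_parts 0 (- e) x d1 (deriv_cst 0) dP dP1 c2.
have E4 := Tk_parts (- e) (- e) x d1 (deriv_cst 0) dP dP1 c2.
have A1 := Tk_parts 0 e x dka dka' dP dP1 c2.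
have A2 := Tk_parts e e x dkc dkc' dP dP1 c2.
have A3 := Tk_parts 0 (- e) x dkb dkb' dP dP1 c2.
have A4 := Tk_parts (- e) (- e) x dkc dkc' dP dP1 c2.
rewrite /Bop /Kop.
have sq2 : (- e) ^+ 2 = e ^+ 2 by rewrite sqrrN.
rewrite sq2 in E3 E4 A3 A4.
rewrite ?add0r ?addr0 in E1 E3 A1 A3.
move: E1 E2 E3 E4 A1 A2 A3 A4; rewrite /ka /kb /kc.
set a1 := Tk _ _ _ P2 x; set a2 := Tk _ _ _ P2 x; set a3 := Tk _ _ _ P2 x; set a4 := Tk _ _ _ P2 x.
set b1 := Tk _ _ _ P2 x; set b2 := Tk _ _ _ P2 x; set b3 := Tk _ _ _ P2 x; set b4 := Tk _ _ _ P2 x.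
move: a1 a2 a3 a4 b1 b2 b3 b4 => a1 a2 a3 a4 b1 b2 b3 b4.
move: (e ^+ 2) => e2 E1 E2 E3 E4 A1 A2 A3 A4.
lra_local.
Qed.

Lemma profile_Mop e g P P1 P2 x : e != 0 -> deriv P P1 -> deriv P1 P2 -> continuous P2 ->
  let U := fun y => P y - e ^+ 2 / 2 * P2 y in
  Bop e P2 x = 2 * Fop e g U x <-> Mop e U x + e ^+ 2 * Fop e g U x = 0.
Proof.
move=> en dP dP1 c2 U; rewrite /U (Mop_precond _ _ dP dP1 c2) -/U.
have -> : - (e ^+ 2 / 2) * Bop e P2 x + e ^+ 2 * Fop e g U x =
  - (e ^+ 2 / 2) * (Bop e P2 x - 2 * Fop e g U x) by field.
split=> [->|/eqP]; first by rewrite subrr mulr0.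
have h : - (e ^+ 2 / 2) != 0 by rewrite oppr_eq0 mulf_neq0 ?expf_neq0 // invr_eq0 pnatr_eq0.
by rewrite mulf_eq0 (negPf h) /= subr_eq0 => /eqP.
Qed.

(** For [Q = m (1 + u)] the product [Q(y-1) Q(y+1)] is [m^2 (1 + hop u y)]. *)
Definition hop u y := u (y - 1) + u (y + 1) + u (y - 1) * u (y + 1).

(** The first integral of the delay equation for [Q = m (1 + u)] at speed [m c]: a difference is the
    derivative of a window integral. The integration constant is 0 for [u] tending to 0. *)
Definition int_res (beta c : R) u xi := c * u xi - beta * itg (fun y => 2 * u y + u y ^+ 2) xi (xi + 1)
  + itg (hop u) xi (xi + 1) - itg (hop u) (xi - 1) xi.

Lemma itg_Av e f xi : continuous f ->
  itg (fun y => f (e * y)) xi (xi + 1) = Av e f (e * xi) /\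
  itg (fun y => f (e * y)) (xi - 1) xi = Av (- e) f (e * xi).
Proof.
move=> cf; have ce : continuous (fun y => f (e * y)).
  rewrite (_ : (fun y => _) = (fun y => f (0 + e * y))); first exact: cont_aff.
  by apply/funext => y; rewrite add0r.
split.
- have := itg_aff xi 1 0 1 ce; rewrite mulr1 mulr0 mul1r addr0 => <-.
  by apply: eq_itg => s; rewrite !mul1r add0r mulrDr.
- have := itg_aff xi (-1) 0 1 ce; rewrite mulrN1 mulr1 mulr0 addr0 => E.
  rewrite itg_swap -E opprK; apply: eq_itg => s.
  by rewrite !mul1r add0r; congr f; ring.
Qed.

Lemma Tk_rev e f x : continuous f -> Tk (fun=> 1) (- e) e f x = Tk (fun=> 1) 0 (- e) f x.
Proof.
move=> cf; have c : continuous (fun s => 1 * f (x + (0 + - e * s))).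
  by apply: contZ; exact: cont_transl.
have := itg_aff 1 (-1) 0 1 c; rewrite mulr0 addr0 !mulN1r subrr => E.
rewrite /Tk -[RHS]opprK -itg_swap -E mulrN1 opprK.
by apply: eq_itg => s; rewrite !mul1r; congr f; ring.
Qed.

Lemma int_scaled e g U xi : continuous U ->
  int_res (2 - 20 / 7 * e ^+ 2) (4 + e ^+ 2 * (g - 40 / 7)) (fun y => e ^+ 2 * U (e * y)) xi =
  e ^+ 2 * (Mop e U (e * xi) + e ^+ 2 * Fop e g U (e * xi)).
Proof.
move=> cU.
have cp : continuous (fun y => U (y + e)) by exact: cont_transl1.
have cm : continuous (fun y => U (y - e)) by exact: cont_transl1.
have cQ : continuous (Qx e U U) by exact: cont_Qx.
have cz a f : continuous f -> continuous (fun y : R => a * f y) by exact: contZ.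
have cUU : continuous (fun y => U y * U y) by exact: contM.
rewrite /int_res.
have -> : (fun y => 2 * (e ^+ 2 * U (e * y)) + (e ^+ 2 * U (e * y)) ^+ 2) =
   fun y => (fun z => 2 * e ^+ 2 * U z + e ^+ 4 * (U z * U z)) (e * y).
  by apply/funext => y; ring.
have -> : hop (fun y => e ^+ 2 * U (e * y)) =
   fun y => (fun z => e ^+ 2 * U (z - e) + e ^+ 2 * U (z + e) + e ^+ 4 * Qx e U U z) (e * y).
  by apply/funext => y; rewrite /hop /Qx mulrBr mulrDr mulr1; ring.
have c1 : continuous (fun z => 2 * e ^+ 2 * U z + e ^+ 4 * (U z * U z)) by apply: contD; exact: cz.
have c2' : continuous (fun z => e ^+ 2 * U (z - e) + e ^+ 2 * U (z + e)) by apply: contD; exact: cz.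
have c2 : continuous (fun z => e ^+ 2 * U (z - e) + e ^+ 2 * U (z + e) + e ^+ 4 * Qx e U U z).
  by apply: contD => //; exact: cz.
have [-> _] := itg_Av e xi c1; have [-> ->] := itg_Av e xi c2.
rewrite (AvD _ _ (cz _ _ cU) (cz _ _ cUU)) (AvZ _ _ _ cU) (AvZ _ _ _ cUU).
have AE d : Av d (fun z => e ^+ 2 * U (z - e) + e ^+ 2 * U (z + e) + e ^+ 4 * Qx e U U z) (e * xi) =
   e ^+ 2 * Av d (fun z => U (z - e)) (e * xi) + e ^+ 2 * Av d (fun z => U (z + e)) (e * xi)
   + e ^+ 4 * Av d (Qx e U U) (e * xi).
  by rewrite (AvD _ _ c2' (cz _ _ cQ)) (AvD _ _ (cz _ _ cm) (cz _ _ cp)) !AvZ.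
rewrite !AE.
have TE d t : Av d (fun z => U (z + t)) (e * xi) = Tk (fun=> 1) t d U (e * xi).
  by apply: eq_itg => s; rewrite !mul1r; congr U; ring.
have r2 := Tk_rev (- e) (e * xi) cU; rewrite opprK in r2.
rewrite !TE (Tk_rev e (e * xi) cU) r2.
rewrite /Fop /Qop (AvZ _ _ _ cUU) /Mop /Av.
by ring.
Qed.

End IntegratedEquation.

(** * The delay equation, its integrated form and the lattice *)

Section Delay.
Context {R : realType}.
Implicit Types (f h Q u : R -> R) (x e m xi eps beta c : R).

Lemma deriv_derive1 Q Q' x : deriv Q Q' -> derive1 Q x = Q' x.
Proof. by move=> D; rewrite derive1E; have := D x => ?; exact: derive_val. Qed.

Lemma derivable_deriv Q : (forall x, derivable Q x 1) -> deriv Q (derive1 Q).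
Proof. by move=> D x; rewrite derive1E; exact: derivableP. Qed.

Lemma deriv_window f : continuous f ->
  deriv (fun xi => itg f xi (xi + 1)) (fun xi => f (xi + 1) - f xi) /\
  deriv (fun xi => itg f (xi - 1) xi) (fun xi => f xi - f (xi - 1)).
Proof.
move=> cf; have D := itg_deriv 0 cf.
split.
- apply: deriv_ext (derivB (deriv_transl 1 D) D) => xi.
  by rewrite -(itg_cat f 0 xi (xi + 1)); ring.
- apply: deriv_ext (derivB D (deriv_transl (- 1) D)) => xi.
  by rewrite -(itg_cat f 0 (xi - 1) xi); ring.
Qed.

Definition delay_rhs beta u xi := beta * (2 * u (xi + 1) + u (xi + 1) ^+ 2 - (2 * u xi + u xi ^+ 2))
  - (hop u (xi + 1) - hop u xi) + (hop u xi - hop u (xi - 1)).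

Lemma cont_hop u : continuous u -> continuous (hop u).
Proof.
move=> cu; apply: contD; [apply: contD|apply: contM]; exact: cont_transl1.
Qed.

Lemma cont2 u : continuous u -> continuous (fun y => 2 * u y + u y ^+ 2).
Proof.
by move=> cu; apply: contD; [exact: contZ|exact: contM].
Qed.

Lemma int_res_deriv beta c u u' : deriv u u' ->
  deriv (int_res beta c u) (fun xi => c * u' xi - delay_rhs beta u xi).
Proof.
move=> du; have cu := deriv_cont du.
have [a _] := deriv_window (cont2 cu); have [b b'] := deriv_window (cont_hop cu).
by apply: deriv_eq (derivB (derivD (derivB (derivZ c du) (derivZ beta a)) b) b') _ => xi; rewrite /delay_rhs; ring.
Qed.

(** Window integrals of continuous functions are differentiable, so a solution that is only known to
    be continuous gains a derivative. *)
Lemma int_deriv beta c u : c != 0 -> continuous u -> (forall xi, int_res beta c u xi = 0) ->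
  deriv u (fun xi => c^-1 * delay_rhs beta u xi).
Proof.
move=> c0 cu E; have [a _] := deriv_window (cont2 cu); have [b b'] := deriv_window (cont_hop cu).
have D := derivZ (c^-1) (derivD (derivB (derivZ beta a) b) b').
apply: deriv_ext (deriv_eq D _) => xi.
  have := E xi; rewrite /int_res => H.
  by apply: (mulfI c0); rewrite mulrA divff // mul1r; move: H; lra.
by rewrite /delay_rhs; ring.
Qed.

Lemma delayE beta m c u u' : m != 0 -> deriv u u' ->
  delay_solution beta (fun xi => m * (1 + u xi)) (m * c) <->
  forall xi, c * u' xi = delay_rhs beta u xi.
Proof.
move=> m0 du; have D : deriv (fun xi => m * (1 + u xi)) (fun xi => m * u' xi).
  by apply: deriv_eq (derivZ m (derivD (deriv_cst 1) du)) _ => xi; ring.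
have m2 : m ^+ 2 != 0 by rewrite expf_neq0.
have E xi : - (m * c) * derive1 (fun xi => m * (1 + u xi)) xi
    + 2 * (m * (1 + u (xi - 1))) * (m * (1 + u (xi + 1)))
    - m * (1 + u xi) * (m * (1 + u (xi - 2)) + m * (1 + u (xi + 2)))
    + beta * ((m * (1 + u (xi + 1))) ^+ 2 - (m * (1 + u xi)) ^+ 2)
   = m ^+ 2 * (delay_rhs beta u xi - c * u' xi).
  rewrite (deriv_derive1 _ D) /delay_rhs /hop.
  have -> : xi - 1 - 1 = xi - 2 by ring.
  have -> : xi + 1 + 1 = xi + 2 by ring.
  by rewrite addrK subrK; ring.
split.
- move=> [_ H] xi; have := H xi; rewrite E => /esym/eqP.
  by rewrite mulf_eq0 (negPf m2) /= subr_eq0 => /eqP.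
- move=> H; split=> [xi|xi]; last by rewrite E H subrr mulr0.
  by have [] := D xi.
Qed.

(** The residual has derivative 0, and far to the right it is at most [B * eps] because both windows
    see only small values of [u]. *)
Lemma delay_int beta m c u : m != 0 -> (forall xi, derivable u xi 1) ->
  delay_solution beta (fun xi => m * (1 + u xi)) (m * c) -> tends u 0 ->
  forall xi, int_res beta c u xi = 0.
Proof.
move=> m0 /derivable_deriv du /(delayE _ _ m0 du) H t.
have K : deriv (int_res beta c u) (fun=> 0).
  by apply: deriv_eq (int_res_deriv beta c du) _ => xi; rewrite H subrr.
have cu := deriv_cont du.
move=> xi; apply/eqP; rewrite -normr_le0.
pose B := `|c| + `|beta| * 3 + 6.
have B0 : 0 < B by rewrite /B; have := normr_ge0 c; have := normr_ge0 beta; lra.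
have key eps : 0 < eps -> eps <= 1 -> `|int_res beta c u xi| <= B * eps.
  move=> e0 e1; have [X HX] := t eps e0.
  pose y := X + 2; rewrite (deriv0_cst K xi y).
  have ub z : X <= z -> `|u z| <= eps by move=> /HX; rewrite subr0.
  have ee : eps * eps <= eps by rewrite ler_piMl // ltW.
  have uu z z' : X <= z -> X <= z' -> `|u z * u z'| <= eps.
    by move=> hz hz'; apply: le_trans (absM (ub _ hz) (ub _ hz')) ee.
  have i1 : `|itg (fun y => 2 * u y + u y ^+ 2) y (y + 1)| <= 3 * eps.
    have := @itg_bound _ (fun y => 2 * u y + u y ^+ 2) (3 * eps) y (y + 1) (cont2 cu).
    rewrite (_ : y + 1 - y = 1) ?mulr1; last by ring.
    apply; first by rewrite lerDl.
    move=> z /andP[z1 z2]; have Xz : X <= z by move: z1; rewrite /y; lra.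
    have := ub _ Xz; have := uu _ _ Xz Xz; rewrite -expr2 !ler_norml => /andP[? ?] /andP[? ?].
    by apply/andP; split; lra_local.
  have hb z : X + 1 <= z -> `|hop u z| <= 3 * eps.
    move=> hz; have Xz : X <= z - 1 by lra.
    have Xz' : X <= z + 1 by lra.
    have := ub _ Xz; have := ub _ Xz'; have := uu _ _ Xz Xz'; rewrite /hop !ler_norml.
    by move=> /andP[? ?] /andP[? ?] /andP[? ?]; apply/andP; split; lra_local.
  have i2 : `|itg (hop u) y (y + 1)| <= 3 * eps.
    have := @itg_bound _ (hop u) (3 * eps) y (y + 1) (cont_hop cu).
    rewrite (_ : y + 1 - y = 1) ?mulr1; last by ring.
    apply; first by rewrite lerDl.
    by move=> z /andP[z1 z2]; apply: hb; move: z1; rewrite /y; lra.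
  have i3 : `|itg (hop u) (y - 1) y| <= 3 * eps.
    have := @itg_bound _ (hop u) (3 * eps) (y - 1) y (cont_hop cu).
    rewrite (_ : y - (y - 1) = 1) ?mulr1; last by ring.
    apply; first by rewrite gerBl.
    by move=> z /andP[z1 z2]; apply: hb; move: z1; rewrite /y; lra_local.
  have i0 : `|u y| <= eps by apply: ub; rewrite /y; lra_local.
  have j0 := absM (lexx `|c|) i0; have j1 := absM (lexx `|beta|) i1.
  rewrite /int_res; apply: le_trans (absD3 (le_trans (ler_normB _ _) (lerD j0 j1)) i2 i3) _.
  by apply: leeq; rewrite /B; ring.
apply/ler_addgt0Pr => r r0; rewrite add0r.
have [|r1] := leP (r / B) 1.
  by move=> /(key _ (divr_gt0 r0 B0)); rewrite mulrC divfK // gt_eqF.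
apply: le_trans (key 1 ltr01 (lexx _)) _; rewrite mulr1.
by move: r1; rewrite ltr_pdivlMr // mul1r => /ltW.
Qed.

(** For [c != 0] the row [n = 0] runs through all arguments of [Q] as [t] varies, so that row alone
    recovers the delay equation. *)
Lemma lattice_delay beta Q c : c != 0 ->
  lattice_solution beta (traveling_wave Q c) <-> delay_solution beta Q c.
Proof.
move=> c0; split.
- move=> H.
  pose rhs t := 2 * traveling_wave Q c (0 + 1) t * traveling_wave Q c (0 - 1) t
    - traveling_wave Q c 0 t * (traveling_wave Q c (0 + 2) t + traveling_wave Q c (0 - 2) t)
    + beta * (traveling_wave Q c (0 + 1) t ^+ 2 - traveling_wave Q c 0 t ^+ 2).
  have D : deriv (traveling_wave Q c 0) rhs by move=> t; exact: H.
  have E x : traveling_wave Q c 0 (c^-1 * x) = Q x.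
    by rewrite /traveling_wave mulr0z add0r mulrA divff // mul1r.
  have DQ : deriv Q (fun x => c^-1 * rhs (0 + c^-1 * x)).
    by apply: deriv_ext (deriv_aff 0 (c^-1) D) => x; rewrite add0r.
  split=> xi; first by have [] := DQ xi.
  rewrite (deriv_derive1 _ DQ) mulNr mulrA divff // mul1r add0r /rhs.
  have F (n : int) (a : R) : n%:~R = a -> traveling_wave Q c n (c^-1 * xi) = Q (xi + a).
    by rewrite /traveling_wave => ->; rewrite mulrA divff // mul1r addrC.
  rewrite E (F (0 + 1) 1) ?(F (0 - 1) (-1)) ?(F (0 + 2) 2) ?(F (0 - 2) (-2)) ?add0r ?mulrNz //; ring.
- move=> [dQ H] n t; have D := derivable_deriv dQ.
  have DW : deriv (traveling_wave Q c n) (fun t => c * derive1 Q (n%:~R + c * t)) by exact: deriv_aff.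
  have := DW t; congr (is_derive _ _ _ _).
  have := H (n%:~R + c * t); rewrite /traveling_wave !intrD !rmorphN /=.
  set x := n%:~R + c * t.
  have s a : n%:~R + a + c * t = x + a by rewrite /x; ring.
  by rewrite !s; lra.
Qed.

End Delay.

(** * Positivity *)

Section LocalEstimate.
Context {R : realType}.
Implicit Types (f w : R -> R) (x : R).

(** The self-improving bound is applied to the supremum of [|f| / w]. The lower bound [d] of the
    weight makes this supremum finite and does not enter the conclusion, which allows weights
    proportional to arbitrarily small values of the solution. *)
Lemma weighted_contract f w K B (d : R) : (forall x, 0 < w x) -> 0 < d -> (forall x, d <= w x) ->
  bnd B f -> 0 <= K -> (forall L, 0 <= L -> wb w L f -> wb w (K + L / 2) f) -> wb w (2 * K) f.
Proof.
move=> w0 d0 dw fB K0 H.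
pose S := [set y | exists x, y = `|f x| / w x].
have ubS : has_ubound S.
  exists (B / d) => _ [x ->]; rewrite ler_pdivrMr //; apply: le_trans (fB x) _.
  rewrite mulrAC ler_pdivlMr //; apply: ler_wpM2l (bnd_ge0 fB) _ _ (dw x).
have Sx x : `|f x| / w x <= sup S by apply: ub_le_sup => //; exists x.
have S0 : 0 <= sup S by apply: le_trans (Sx 0); rewrite divr_ge0 // ltW.
have wS : wb w (sup S) f by move=> x; rewrite -ler_pdivrMr.
have H1 := H _ S0 wS.
have : sup S <= K + sup S / 2.
  apply: ge_sup; first by exists (`|f 0| / w 0); exists 0.
  by move=> _ [x ->]; rewrite ler_pdivrMr.
by move=> h; apply: wbW wS => //; lra.
Qed.

Definition K1 (B : R) := 46 + 48 * B.
Definition K2 (B : R) := 2 * (1000 * K1 B).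
Definition K3 (B C : R) := 2 * (5 * K2 B + 6 * C + 24 + 18 * K2 B + 60 * B + 36 * (K2 B * B)).
Definition Kloc (B C : R) := 1000 * (K3 B C + 39 * (6 + 8 * B)).

Variables (e B C s : R) (P P1 P2 w : R -> R) (d : R).
Hypotheses (e0 : 0 < e) (e1 : e <= 1 / 1000) (B1 : 1 <= B) (C0 : 0 <= C).
Hypotheses (PB : bnd B P) (P1B : bnd B P1) (P2B : bnd B P2) (prof : profile e s P P1 P2).
Hypotheses (hs : srange s) (sC : `|s - 1| <= C * e) (sw : slow 3 w) (d0 : 0 < d) (dw : forall x, d <= w x).
Hypotheses (Pw : wb w 1 P) (P1w : wb w 1 P1) (eK : 1000 * K1 B * (e ^+ 2 / 2) <= 1 / 2).

Let eta := e ^+ 2 / 2.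
Let U y := P y - eta * P2 y.
Let w0 x : 0 < w x. Proof. by case: sw. Qed.
Let B0 : 0 <= B. Proof. by have := B1; lra. Qed.
Let e2 : e <= 1 / 100. Proof. by have := e1; lra. Qed.
Let eta0 : 0 <= eta. Proof. by rewrite /eta divr_ge0 // exprn_ge0 // ltW. Qed.
Let etae : eta <= e.
Proof. by rewrite /eta expr2; have := ler_wpM2l (ltW e0) e1; have := e0; lra. Qed.
Let eta1 : eta <= 1. Proof. by have := etae; have := e1; lra. Qed.

Let dP : deriv P P1. Proof. by case: prof. Qed.
Let dP1 : deriv P1 P2. Proof. by case: prof. Qed.
Let bP2 : bu P2. Proof. by case: prof. Qed.
Let bP : bu P. Proof. by split; [exact: deriv_ucont dP P1B|exists B]. Qed.
Let bU : bu U. Proof. by apply: buB bP _; exact: buZ. Qed.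
Let cP := bu_cont bP. Let c2 := bu_cont bP2. Let cU := bu_cont bU.

Let UB : bnd (2 * B) U.
Proof.
move=> x; apply: le_trans (ler_normB _ _) _; rewrite normrM (ger0_norm eta0).
by have := ler_pM eta0 (normr_ge0 _) eta1 (P2B x); have := PB x; lra.
Qed.

Let wU L : wb w L P2 -> wb w (1 + eta * L) U.
Proof. by move=> h; have := wbB Pw (wbZ eta h); rewrite (ger0_norm eta0). Qed.

Let K10 : 0 <= 1000 * K1 B. Proof. by rewrite /K1; have := B0; lra. Qed.

Let FopE x : 2 * Fop e (gam s) U x =
  2 * (gam s * U x + 40 / 7 * (Av e U x - U x) - Qop e U U x).
Proof. by rewrite /Fop; field. Qed.

Let ee : `|e| <= e. Proof. by rewrite gtr0_norm. Qed.

(** [P''] occurs on the right of its own equation with the factor [e^2 / 2], small enough to be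
    absorbed. *)
Lemma second_bound : wb w (K2 B) P2.
Proof.
apply: (weighted_contract w0 d0 dw P2B K10) => L L0 P2L x.
have L2 := wU P2L; have [_ _ _ eqn] := prof.
have l0 : 0 <= 1 + eta * L by rewrite addr_ge0 // mulr_ge0.
have G : forall x, `|Bop e P2 x| <= K1 B * (1 + eta * L) * w x.
  move=> y; rewrite eqn -/eta -/U FopE.
  have a := absM (gam_le hs) (L2 y).
  have b := Av_wb e0 e2 sw ee cU L2 y.
  have c := Qop_wbl e0 e2 sw cU cU L2 UB y.
  have n := L2 y; set q := (1 + eta * L) * w y in a n.
  have b' : `|Av e U y - U y| <= 3 * q.
    apply: le_trans (ler_normB _ _) _; apply: le_trans (lerD b n) _.
    by apply: leeq; rewrite /q; ring.
  have q0 : 0 <= q by rewrite mulr_ge0 // ltW.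
  have b2 := absM (lexx `|40 / 7 : R|) b'.
  have c' : `|Qop e U U y| <= 24 * B * q by apply: le_trans c _; apply: leeq; rewrite /q; ring.
  have h := absM (lexx `|2 : R|) (absD3 a b2 c').
  rewrite (ger0_norm (_ : 0 <= 2)) // (ger0_norm (_ : 0 <= 40 / 7)) in h; last by rewrite divr_ge0.
  apply: le_trans h _; rewrite -[X in _ <= X]mulrA -/q /K1; lra_recent.
have e3 : 280 * e * 3 <= 1 by have := e1; lra.
have := Bi_slow e0 e3 sw (bu_Bop e bP2) (mulr_ge0 _ l0) G x; rewrite BopK // => h.
apply: le_trans (h _) _; first by rewrite /K1; have := B0; lra_recent.
apply: ler_wpM2r (ltW (w0 x)) _ _ _.
have := ler_wpM2r L0 eK; rewrite -/eta; lra_recent.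
Qed.

Let P2w := second_bound.
Let K20 : 0 <= K2 B. Proof. by rewrite /K2; have := K10; lra. Qed.

Let gam_near : `|gam s - 8 / 3| <= 6 * C * e.
Proof.
rewrite (_ : gam s - 8 / 3 = 8 / 3 * (s + 1) * (s - 1)); last by rewrite /gam; field.
have h : `|8 / 3 * (s + 1)| <= 6 by have /andP[? ?] := hs; rewrite ger0_norm; lra.
by apply: le_trans (absM h sC) _; apply: leeq; ring.
Qed.

Let G0 x := 16 / 3 * P x - 4 * (P x * P x).

Let near_G0 x : `|2 * Fop e (gam s) U x - G0 x| <= K3 B C * e * w x.
Proof.
have wx := ltW (w0 x).
have up t X : 0 <= X -> `|t| <= X -> `|eta * t| <= e * X.
  move=> X0 h; rewrite normrM (ger0_norm eta0); exact: ler_pM.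
have Z := P2w x; have KW : 0 <= K2 B * w x by exact: mulr_ge0.
have a1 := absM (gam_le hs) (up _ _ KW Z).
have a2 := absM gam_near (Pw x).
have a3 := Av_diff1 e0 e2 sw x ee dP P1w.
have a4 : `|eta * (Av e P2 x - P2 x)| <= e * (3 * (K2 B * w x)).
  apply: up; first by rewrite mulr_ge0.
  apply: le_trans (ler_normB _ _) _; apply: le_trans (lerD (Av_wb e0 e2 sw ee c2 P2w x) Z) _.
  by apply: leeq; ring.
have [a5 _] := Qop_diff1 e0 e2 sw x dP dP PB P1B Pw P1w.
have QP : 0 <= 12 * (K2 B * B) * w x by rewrite mulr_ge0 // mulr_ge0 // mulr_ge0.
have a6 := up _ _ QP (Qop_wbr e0 e2 sw cP c2 PB P2w x).
have QP2 : 0 <= 12 * (K2 B * (2 * B)) * w x by rewrite mulr_ge0 // mulr_ge0 // mulr_ge0 // mulr_ge0.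
have a7 := up _ _ QP2 (Qop_wbl e0 e2 sw c2 cU P2w UB x).
have cz : continuous (fun y => (- eta) * P2 y) by exact: contZ.
have UE : U = fun y => P y + (- eta) * P2 y by apply/funext => y; rewrite /U mulNr.
have QE : Qop e U U x = Qop e P P x - eta * Qop e P P2 x - eta * Qop e P2 U x.
  rewrite [X in Qop e X U]UE (QopDl _ _ cP cz cU) (QopZl _ _ _ c2 cU).
  rewrite [X in Qop e P X]UE (QopDr _ _ cP cz cP) (QopZr _ _ _ c2 cP); ring.
have AE : Av e U x = Av e P x - eta * Av e P2 x.
  by rewrite UE (AvD _ _ cP cz) (AvZ _ _ _ c2); ring.
have -> : 2 * Fop e (gam s) U x - G0 x =
  2 * ((- (gam s * (eta * P2 x)) + (gam s - 8 / 3) * P x)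
   + (40 / 7 * ((Av e P x - P x) - eta * (Av e P2 x - P2 x)))
   - ((Qop e P P x - 2 * (P x * P x)) + (- (eta * Qop e P P2 x)) - eta * Qop e P2 U x)).
  by rewrite FopE QE AE /U /G0; field.
have b1 := le_trans (ler_normD (- (gam s * (eta * P2 x))) ((gam s - 8 / 3) * P x)) (lerD (_ : _ <= _) a2).
rewrite normrN in b1; have {}b1 := b1 _ a1.
have b2 := absM (lexx `|40 / 7 : R|) (le_trans (ler_normB _ _) (lerD a3 a4)).
have a6' : `|- (eta * Qop e P P2 x)| <= e * (12 * (K2 B * B) * w x) by rewrite normrN.
have b3 := absD3 a5 a6' a7.
have h := absM (lexx `|2 : R|) (absD3 b1 b2 b3).
rewrite (ger0_norm (_ : 0 <= 2)) // (ger0_norm (_ : 0 <= 40 / 7)) in h; last by rewrite divr_ge0.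
apply: le_trans h _; rewrite /K3.
have ew := mulr_ge0 (ltW e0) wx; have eKw := mulr_ge0 (ltW e0) KW.
move: ew eKw; move: (K2 B) => K; lra_recent.
Qed.

(** The profile equation is compared with its limit relative to any slow weight that dominates [P]
    and [P']. An absolute error [O(e)] would be useless for the sign in the tails, where [P] itself
    is exponentially small. *)
Theorem local_estimate x : `|P2 x - (4 * P x - 3 * (P x * P x))| <= Kloc B C * e * w x.
Proof.
have [_ _ _ eqn] := prof.
have dG : deriv G0 (fun x => 16 / 3 * P1 x - 4 * (P1 x * P x + P x * P1 x)).
  exact: (derivB (derivZ _ dP) (derivZ _ (derivM dP dP))).
have G1 : wb w (6 + 8 * B) (fun x => 16 / 3 * P1 x - 4 * (P1 x * P x + P x * P1 x)).
  move=> y; have a := P1w y; have b := absM (P1w y) (PB y); have c := ltW (w0 y).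
  rewrite mul1r in a; rewrite mul1r in b.
  have -> : 16 / 3 * P1 y - 4 * (P1 y * P y + P y * P1 y) = 16 / 3 * P1 y - 8 * (P1 y * P y) by ring.
  by move: a b; rewrite !ler_norml => /andP[? ?] /andP[? ?]; apply/andP; split; lra.
have bG0 : bu G0 by apply: buB; apply: buZ => //; exact: buM.
have cG0 := bu_cont bG0.
have bG34 : bu (fun y => 3 / 4 * G0 y) by exact: buZ.
have -> : P2 x - (4 * P x - 3 * (P x * P x)) = Bi e (fun y => Bop e P2 y - Bop e (fun y => 3 / 4 * G0 y) y) x.
  by rewrite (BiB _ e0 (bu_Bop _ bP2) (bu_Bop _ bG34)) !BopK // /G0; field.
have e3 : 280 * e * 3 <= 1 by have := e1; lra.
have K30 : 0 <= K3 B C.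
  rewrite /K3; have := K20; have := B0; have := C0; have := mulr_ge0 K20 B0.
  by move: (K2 B) => K; lra.
have H : forall y, `|Bop e P2 y - Bop e (fun y => 3 / 4 * G0 y) y| <=
    (K3 B C + 39 * (6 + 8 * B)) * e * w y.
  move=> y; rewrite (BopZ _ _ _ cG0) eqn.
  have -> : 2 * Fop e (gam s) (fun y => P y - e ^+ 2 / 2 * P2 y) y - 3 / 4 * Bop e G0 y =
    (2 * Fop e (gam s) U y - G0 y) - 3 / 4 * (Bop e G0 y - 4 / 3 * G0 y) by rewrite -/U; field.
  have a := near_G0 y; have b := absM (lexx `|3 / 4 : R|) (Bop_diff1 e0 e2 sw y dG G1).
  rewrite (ger0_norm (_ : 0 <= 3 / 4)) in b; last by rewrite divr_ge0.
  apply: le_trans (ler_normB _ _) _; apply: le_trans (lerD a b) _.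
  by apply: leeq; field.
have p : 0 <= (K3 B C + 39 * (6 + 8 * B)) * e.
  by apply: mulr_ge0 (ltW e0); rewrite addr_ge0 // mulr_ge0 // addr_ge0 // mulr_ge0.
apply: le_trans (Bi_slow e0 e3 sw (buB (bu_Bop _ bP2) (bu_Bop _ bG34)) p H x) _.
by apply: leeq; rewrite /Kloc; ring.
Qed.

End LocalEstimate.

(** * Propagation of positivity along the tail *)

Section Tail.
Context {R : realType}.
Implicit Types (f w : R -> R) (x y X M L : R).

Lemma deriv_abs_le2 (F G f g : R -> R) a b : deriv F f -> deriv G g -> a <= b ->
  (forall x, a <= x <= b -> `|f x| <= g x) -> `|F b - F a| <= G b - G a.
Proof.
move=> dF dG ab h; rewrite ler_norml; apply/andP; split.
- have H : - G b - - G a <= F b - F a.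
    by apply: deriv_le (derivN dG) dF ab _ => x /h; rewrite ler_norml => /andP[].
  lra.
- by apply: deriv_le dF dG ab _ => x /h; rewrite ler_norml => /andP[].
Qed.

(** Solutions of [W' = 2 W] grow, so a bounded [W] is governed by the defect to its right: the
    derivative of [exp (- 2 x) W] is integrated from [x] to far away. *)
Lemma unstable_bound (W W1 : R -> R) X G N : deriv W W1 -> (forall x, X <= x -> `|W x| <= N) ->
  (forall x, X <= x -> `|W1 x - 2 * W x| <= G) -> forall x, X <= x -> `|W x| <= G / 2.
Proof.
move=> dW WN Wg x Xx.
have N0 : 0 <= N by apply: le_trans (WN _ Xx).
have key y : x <= y -> `|W x| <= N * expR (- (2 * (y - x))) + G / 2.
  move=> xy; have d1 := derivM (@deriv_expZ R (-2)) dW.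
  have d2 := derivZ (- (G / 2)) (@deriv_expZ R (-2)).
  have := deriv_abs_le2 d1 d2 xy => H.
  have {}H : `|expR (-2 * y) * W y - expR (-2 * x) * W x| <= - (G / 2) * expR (-2 * y) - - (G / 2) * expR (-2 * x).
    apply: H => z /andP[xz _]; have Xz := le_trans Xx xz; have E0 := expR_gt0 (-2 * z).
    rewrite (_ : _ + _ = expR (-2 * z) * (W1 z - 2 * W z)); last by ring.
    by rewrite normrM (gtr0_norm E0); have := ler_wpM2l (ltW E0) (Wg z Xz); lra.
  have Ex := expR_gt0 (-2 * x).
  have E : expR (-2 * y) = expR (-2 * x) * expR (- (2 * (y - x))) by rewrite -expRD; congr expR; ring.
  have Wy := WN y (le_trans Xx xy); have G0 : 0 <= G by apply: le_trans (Wg _ Xx).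
  have t := expR_gt0 (- (2 * (y - x))); rewrite E in H; move: (expR (- (2 * (y - x)))) t H => t t0 H.
  have h1 : expR (-2 * x) * `|W x| <= expR (-2 * x) * (N * t + G / 2).
    have a : expR (-2 * x) * `|W x| = `|expR (-2 * x) * W x| by rewrite normrM (gtr0_norm Ex).
    have b : `|expR (-2 * x) * t * W y| <= expR (-2 * x) * (t * N).
      rewrite normrM (gtr0_norm (mulr_gt0 Ex t0)) -mulrA.
      by apply: ler_wpM2l (ltW Ex) _ _ _; exact: ler_wpM2l (ltW t0) _ _ Wy.
    have c := ler_normD (expR (-2 * x) * W x - expR (-2 * x) * t * W y) (expR (-2 * x) * t * W y).
    rewrite subrK distrC in c; have q := mulr_ge0 (mulr_ge0 (ltW Ex) (ltW t0)) G0.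
    by rewrite a; move: H b c q; lra_local.
  by rewrite ler_pM2l in h1.
apply/ler_addgt0Pr => r r0; rewrite addrC.
have [Z Z0 HZ] := exp_small N (ltr0Sn R 1) r0.
have := key (x + Z); rewrite addrAC subrr add0r => /(_ _)/le_trans; apply; first by rewrite lerDl.
by rewrite lerD2r; exact: HZ.
Qed.

Lemma expR_pow (t : R) n : expR t ^+ n = expR (n%:R * t).
Proof. by elim: n => [|n IH]; rewrite ?expr0 ?mul0r ?expR0 // exprS IH -expRD mulrSr mulrDl mul1r addrC. Qed.

Lemma expR_m2 : 1 / 10 <= expR (- 2 : R).
Proof.
have h : 3 / 4 <= expR (- (1 / 4) : R) by apply: le_trans (expR_ge1Dx _); lra.
have -> : expR (- 2 : R) = expR (- (1 / 4)) ^+ 8 by rewrite expR_pow; congr expR; field.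
have : (3 / 4) ^+ 8 <= expR (- (1 / 4) : R) ^+ 8 by apply: lerXn2r => //; rewrite nnegrE ?expR_ge0 //; lra.
by apply: le_trans; rewrite !exprS expr0; lra.
Qed.

Lemma expR_3 : 11 <= expR (3 : R).
Proof.
have h : 3 / 2 <= expR (1 / 2 : R) by apply: le_trans (expR_ge1Dx _); lra.
have -> : expR (3 : R) = expR (1 / 2) ^+ 6 by rewrite expR_pow; congr expR; field.
have : (3 / 2) ^+ 6 <= expR (1 / 2 : R) ^+ 6 by apply: lerXn2r => //; rewrite nnegrE ?expR_ge0 //; lra.
by apply: le_trans; rewrite !exprS expr0; lra.
Qed.

Variables (P P1 P2 : R -> R) (B kap Lam X0 : R).
Hypotheses (dP : deriv P P1) (dP1 : deriv P1 P2) (PB : bnd B P) (P1B : bnd B P1).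
Hypothesis local : forall w d, slow 3 w -> 0 < d -> (forall x, d <= w x) -> wb w 1 P -> wb w 1 P1 ->
  forall x, `|P2 x - (4 * P x - 3 * (P x * P x))| <= kap * w x.
Hypotheses (kap0 : 0 <= kap) (Lam1 : 33 <= Lam) (kapLam : kap * Lam <= 1 / 1000).
Hypothesis small : forall x, X0 <= x -> `|P x| <= 1 / 1000.

(** The invariant of the induction: everything to the left of [X] is bounded in terms of [P X], with
    a wall of rate 3, steeper than the decay rate 2 of [P] and still a slow weight. *)
Definition controlled X := 0 < P X /\
  forall y, y <= X -> `|P y| <= Lam * P X * expR (3 * (X - y)) /\ `|P1 y| <= Lam * P X * expR (3 * (X - y)).

Lemma slow_wall X M : 0 < M -> slow 3 (fun y => M * (1 + expR (3 * (X - y)))).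
Proof.
move=> M0; split=> [x|x y].
  by rewrite mulr_gt0 // addr_gt0 // expR_gt0.
rewrite [X in _ <= X]mulrCA; apply: ler_wpM2l (ltW M0) _ _ _.
rewrite [X in _ <= X]mulrDr mulr1; apply: lerD.
  by rewrite -[X in X <= _]expR0 ler_expR mulr_ge0.
rewrite -expRD ler_expR -mulrDr ler_wpM2l //.
by have := ler_norm (x - y); rewrite distrC; lra.
Qed.

(** Over one unit [P] keeps at least 1/11 of its value, because [exp (- 2) >= 1/10], while the wall
    gains the factor [exp 3 >= 11]; hence the constant [Lam] reproduces itself. To the right of [X]
    it reproduces since [m <= 3 P X <= 33 P (X + 1)]. *)
Lemma tail_step X : X0 <= X -> controlled X -> controlled (X + 1) /\
  forall x, X <= x <= X + 1 -> P X / 11 <= P x /\ `|P2 x - 4 * P x| <= P X / 50.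
Proof.
move=> XX [p0 ctl]; set p := P X in p0 ctl *.
pose S := [set z | exists2 x, X <= x & z = Num.max `|P x| `|P1 x|].
have hS : has_ubound S by exists B => _ [x _ ->]; rewrite ge_max PB P1B.
pose m := sup S.
have mx x : X <= x -> `|P x| <= m /\ `|P1 x| <= m.
  move=> Xx; have : Num.max `|P x| `|P1 x| <= m by apply: ub_le_sup => //; exists x.
  by rewrite ge_max => /andP[].
have m0 : 0 <= m by have [h _] := mx X (lexx X); apply: le_trans h.
have mle k : (forall x, X <= x -> `|P x| <= k /\ `|P1 x| <= k) -> m <= k.
  move=> h; apply: ge_sup; first by exists (Num.max `|P X| `|P1 X|); exists X.
  by move=> _ [x Xx ->]; have [? ?] := h x Xx; rewrite ge_max; apply/andP.
have L0 : 0 <= Lam by have := Lam1; lra.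
have Lp : 0 <= Lam * p by rewrite mulr_ge0 // ltW.
pose M := Lam * p + m.
have M0 : 0 < M by rewrite /M; have := mulr_gt0 (_ : 0 < Lam) p0; have := Lam1; have := m0; nra.
have sw := slow_wall X M0.
have dw x : M <= M * (1 + expR (3 * (X - x))).
  by have := mulr_ge0 (ltW M0) (expR_ge0 (3 * (X - x))); lra_recent.
have wP f : (forall y, y <= X -> `|f y| <= Lam * p * expR (3 * (X - y))) -> (forall x, X <= x -> `|f x| <= m) ->
    wb (fun y => M * (1 + expR (3 * (X - y)))) 1 f.
  move=> h1 h2 y; rewrite mul1r; have E0 := expR_ge0 (3 * (X - y)).
  have [yX|/ltW Xy] := leP y X.
    apply: le_trans (h1 y yX) _; rewrite /M; have := mulr_ge0 m0 E0; have := mulr_ge0 Lp E0; lra_recent.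
  apply: le_trans (h2 y Xy) _; rewrite /M; have := mulr_ge0 m0 E0; have := mulr_ge0 Lp E0; lra_recent.
have loc := local sw M0 dw (wP _ (fun y h => (ctl y h).1) (fun x h => (mx x h).1))
  (wP _ (fun y h => (ctl y h).2) (fun x h => (mx x h).2)).
(* To the right of [X] the weight is at most [2 M], which contributes [p / 500 + m / 500]; the
   quadratic term contributes [3 / 1000 * m]. *)
pose G := p / 500 + m / 200.
have kap1 : kap <= 1 / 1000 by have := kapLam; have := ler_wpM2l kap0 Lam1; have := kap0; lra_recent.
have g x : X <= x -> `|P2 x - 4 * P x| <= G.
  move=> Xx; have [Pm _] := mx x Xx; have sm := small (le_trans XX Xx).
  have e1 : expR (3 * (X - x)) <= 1 by rewrite -[X in _ <= X]expR0 ler_expR; lra_recent.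
  have a : `|P2 x - (4 * P x - 3 * (P x * P x))| <= kap * (2 * M).
    apply: le_trans (loc x) _; apply: ler_wpM2l kap0 _ _ _.
    by have := ler_wpM2l (ltW M0) e1; lra_recent.
  have b := absM sm Pm.
  have c := ler_wpM2r (ltW p0) kapLam; have d := ler_wpM2r m0 kap1.
  move: a b; rewrite !ler_norml /M /G => /andP[a1 a2] /andP[b1 b2].
  by apply/andP; split; move: a1 a2 b1 b2 c d p0 m0; lra_recent.
(* Factorisation of [P'' - 4 P] into [(d/dx - 2)(d/dx + 2) P]: the unstable factor is solved from
   the right, the stable one from [X]. *)
pose W x := P1 x + 2 * P x.
have dW : deriv W (fun x => P2 x + 2 * P1 x) := derivD dP1 (derivZ 2 dP).
have Wb x : X <= x -> `|W x| <= 3 * m.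
  by move=> /mx[]; rewrite /W !ler_norml => /andP[? ?] /andP[? ?]; apply/andP; split; lra_recent.
have Wg x : X <= x -> `|P2 x + 2 * P1 x - 2 * W x| <= G.
  by move=> /g; rewrite (_ : P2 x + 2 * P1 x - 2 * W x = P2 x - 4 * P x) // /W; ring.
have W2 := unstable_bound dW Wb Wg.
have G0 : 0 <= G by apply: le_trans (g X (lexx X)).
have Pe x : X <= x -> `|P x - expR (- (2 * (x - X))) * p| <= G / 4.
  move=> Xx; have d1 := derivM (@deriv_expZ R 2) dP.
  have d2 := derivZ (G / 4) (@deriv_expZ R 2).
  have H : `|expR (2 * x) * P x - expR (2 * X) * P X| <= G / 4 * expR (2 * x) - G / 4 * expR (2 * X).
    apply: (deriv_abs_le2 d1 d2 Xx) => z /andP[Xz _]; have E0 := expR_gt0 (2 * z).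
    rewrite (_ : _ + _ = expR (2 * z) * W z); last by rewrite /W; ring.
    by rewrite normrM (gtr0_norm E0); have := ler_wpM2l (ltW E0) (W2 z Xz); lra_recent.
  have Ex := expR_gt0 (2 * x).
  have E : expR (2 * X) = expR (2 * x) * expR (- (2 * (x - X))) by rewrite -expRD; congr expR; ring.
  have t0 := expR_gt0 (- (2 * (x - X))).
  have : expR (2 * x) * `|P x - expR (- (2 * (x - X))) * p| <= expR (2 * x) * (G / 4).
    have EE : expR (2 * x) * (P x - expR (- (2 * (x - X))) * p) = expR (2 * x) * P x - expR (2 * X) * P X.
      by rewrite E -/p; ring.
    rewrite -[X in X * `|_|](gtr0_norm Ex) -normrM EE.
    by apply: le_trans H _; have := mulr_ge0 G0 (expR_ge0 (2 * X)); lra_recent.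
  by rewrite ler_pM2l.
have Pup x : X <= x -> `|P x| <= p + G / 4.
  move=> Xx; have t1 : expR (- (2 * (x - X))) <= 1 by rewrite expR_le1; lra_recent.
  have := ler_wpM2r (ltW p0) t1; have := mulr_ge0 (expR_ge0 (- (2 * (x - X)))) (ltW p0).
  by have := Pe x Xx; rewrite !ler_norml => /andP[? ?] ? ?; apply/andP; split; lra_recent.
(* The supremum [m] of the future values has been used to bound the defect [G]; here the loop is
   closed. *)
have m3 : m <= 3 * p.
  have : m <= 2 * p + G.
    apply: mle => x Xx; have := Pup x Xx; have := W2 x Xx.
    have := p0; have := G0; rewrite /W !ler_norml => ? ? /andP[? ?] /andP[? ?].
    by split; apply/andP; split; lra_recent.
  by have := p0; rewrite /G; lra_recent.
have Gp : G <= p / 50 by rewrite /G; have := p0; lra_recent.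
have low x : X <= x <= X + 1 -> p / 11 <= P x.
  move=> /andP[Xx xX]; have t1 : 1 / 10 <= expR (- (2 * (x - X))).
    by apply: le_trans expR_m2 _; rewrite ler_expR; lra_recent.
  have := ler_wpM2r (ltW p0) t1; have := Pe x Xx; rewrite ler_norml => /andP[? ?] ?.
  have := p0; lra_recent.
split; last first.
  move=> x hx; split; first exact: low.
  by have /andP[Xx _] := hx; apply: le_trans (g x Xx) Gp.
have p1 : p / 11 <= P (X + 1) by apply: low; rewrite lerDl ler01 lexx.
have pp0 : 0 < P (X + 1) by have := p0; lra_recent.
split=> // y yX.
have fin f : (forall y, y <= X -> `|f y| <= Lam * p * expR (3 * (X - y))) -> (forall x, X <= x -> `|f x| <= m) ->
    `|f y| <= Lam * P (X + 1) * expR (3 * (X + 1 - y)).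
  move=> h1 h2; have [yX'|/ltW Xy] := leP y X.
    apply: le_trans (h1 y yX') _.
    have -> : 3 * (X + 1 - y) = 3 + 3 * (X - y) by ring.
    rewrite expRD mulrA; apply: ler_wpM2r (expR_ge0 _) _ _ _.
    have := ler_wpM2l (mulr_ge0 L0 (ltW pp0)) expR_3; have := ler_wpM2l L0 p1; lra_recent.
  apply: le_trans (h2 y Xy) _.
  have E1 : 1 <= expR (3 * (X + 1 - y)) by rewrite -[X in X <= _]expR0 ler_expR; lra_recent.
  have := ler_wpM2l (mulr_ge0 L0 (ltW pp0)) E1; have := ler_wpM2r (ltW pp0) Lam1; lra_recent.
split; apply: fin.
- by move=> z hz; have [] := ctl z hz.
- by move=> x /mx[].
- by move=> z hz; have [] := ctl z hz.
- by move=> x /mx[].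
Qed.

Lemma tail_positive eta x : 0 <= eta <= 1 / 100 -> controlled X0 -> X0 <= x -> 0 < P x - eta * P2 x.
Proof.
move=> /andP[h0 h1] c0.
have cn n : controlled (X0 + n%:R).
  elim: n => [|n IH]; first by rewrite addr0.
  have [] := tail_step (X := X0 + n%:R) _ IH; first by rewrite lerDl.
  by rewrite -addrA natr1.
have good n y : X0 + n%:R <= y <= X0 + n%:R + 1 -> 0 < P y - eta * P2 y.
  move=> hy; have Xn : X0 <= X0 + n%:R by rewrite lerDl.
  have [_ /(_ y hy) [a b]] := tail_step Xn (cn n); have [p0 _] := cn n.
  have c := absM (_ : `|eta| <= 1 / 100) b.
  have {}c := c _; rewrite (ger0_norm h0) in c; have {}c := c h1.
  have d : eta * P y <= 1 / 100 * P y by apply: ler_wpM2r h1; lra.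
  by move: c; rewrite ler_norml => /andP[? ?]; lra_recent.
have all n y : X0 <= y <= X0 + n%:R -> 0 < P y - eta * P2 y.
  elim: n => [|n IH] /andP[h2 h3].
    by apply: (good 0%N); rewrite addr0 in h3 *; apply/andP; split; lra.
  have [yn|/ltW ny] := leP y (X0 + n%:R); first by apply: IH; apply/andP.
  by apply: (good n); apply/andP; split=> //; rewrite -addrA natr1.
move=> Xx; have [n hn] := nat_ge (x - X0).
by apply: (all n); apply/andP; split=> //; lra.
Qed.

End Tail.

(** * Global positivity of the wave *)

Section Positivity.
Context {R : realType}.
Implicit Types (x e s C : R).

Lemma slow_opp (k : R) (w : R -> R) : slow k w -> slow k (fun x => w (- x)).
Proof.
move=> [w0 wk]; split=> // x y; apply: le_trans (wk (- x) (- y)) _.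
by rewrite -opprD normrN.
Qed.

Lemma deriv_opp (F f : R -> R) : deriv F f -> deriv (fun x => F (- x)) (fun x => - f (- x)).
Proof. by move=> dF; apply: deriv_eq (deriv_comp dF (derivN deriv_id)) _ => x; rewrite mulrN1. Qed.

Lemma scale_split e (a b : R) : 0 < e -> 0 <= a -> 0 <= b -> e * (a + b) <= 1 -> e * a <= 1 /\ e * b <= 1.
Proof. by move=> e0 a0 b0; have := mulr_ge0 (ltW e0) a0; have := mulr_ge0 (ltW e0) b0; split; lra. Qed.

Lemma ratio (e a q : R) : 0 < q -> e * (a / q) <= 1 -> e * a <= q.
Proof. by move=> q0; rewrite mulrA ler_pdivrMr // mul1r. Qed.

Lemma small_constants (C B q kl k1 : R) : 0 <= C -> 1 <= B -> 0 < q -> 0 <= kl -> 0 <= k1 ->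
  let Lam := 33 + B / q in
  exists2 e0 : R, 0 < e0 & forall e, 0 < e -> e <= e0 ->
  [/\ C * e <= 1 / 2000, C * e <= q, 2 * (e * B) <= q, kl * e * Lam <= 1 / 1000 & 2000 * (k1 * e) <= 1].
Proof.
move=> C0 B1 q0 kl0 k10 Lam.
have B0 : 0 <= B by lra.
have Lam0 : 0 <= Lam by rewrite /Lam; have := divr_ge0 B0 (ltW q0); lra.
have n1 : 0 <= 2000 * C by lra.
have n2 : 0 <= C / q by rewrite divr_ge0 // ltW.
have n3 : 0 <= 1000 * (kl * Lam) by have := mulr_ge0 kl0 Lam0; lra_local.
have n4 : 0 <= 2000 * k1 by lra_local.
have n5 : 0 <= (2 * B) / q by apply: divr_ge0; [exact: mulr_ge0 (ler0n _ 2) B0|exact: ltW].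
have n45 := addr_ge0 n4 n5; have n345 := addr_ge0 n3 n45; have n2345 := addr_ge0 n2 n345.
have [e2 e20 He2] := small_scale (addr_ge0 n1 n2345).
exists e2; first exact: e20.
move=> e ep ee2.
have [m1 h1] := scale_split ep n1 n2345 (He2 e ep ee2).
have [m2 h2] := scale_split ep n2 n345 h1.
have [m3 h3] := scale_split ep n3 n45 h2.
have [m4 m5] := scale_split ep n4 n5 h3.
have r2 := ratio q0 m2; have r5 := ratio q0 m5.
by split; [move: m1|move: r2|move: r5|move: m3|move: m4]; clear; lra.
Qed.

Theorem soliton_props : exists C e0 : R, [/\ 0 < C, 0 < e0, e0 <= 1 / 1000 &
  forall e, 0 < e -> e <= e0 -> exists s (P P1 P2 : R -> R),
  [/\ profile e s P P1 P2 /\ P1 0 = 0 /\ P2 0 <= - 2, `|s - 1| <= C * e /\ srange s,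
    (forall x, [/\ `|P x| <= C * expR (- `|x|), `|P1 x| <= C * expR (- `|x|) & `|P2 x| <= C * expR (- `|x|)]),
    (forall x, `|P x - e ^+ 2 / 2 * P2 x - 2 * sq x| <= C * e /\ 0 < P x - e ^+ 2 / 2 * P2 x) &
    exists2 r, 0 < r & forall s' (P' P1' P2' : R -> R), profile e s' P' P1' P2' -> P1' 0 = 0 -> `|s' - s| <= r ->
      bnd r (fun x => P' x - P x) -> bnd r (fun x => P1' x - P1 x) -> bnd r (fun x => P2' x - P2 x) ->
      s' = s /\ P' = P]].
Proof.
have [C [e0 [C0 e00 e01 H]]] := @soliton_branch R.
have [CP CP0 HCP] := @Ps_bound R.
have r1 : srange (1 : R) by rewrite /srange; apply/andP; split; lra_local.
pose B := CP + C + 1.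
have B1 : 1 <= B by rewrite /B; lra.
have B0 : 0 <= B by exact: le_trans ler01 B1.
have [q2000 two0] : 0 < 1 / 2000 :> R /\ 0 < 2 :> R by rewrite ltr0n divr_gt0 ?ltr0n.
(* Beyond [X0] the soliton is below 1/2000, and the correction [C * e] as well, as the tail argument
   asks. *)
have [X0 X00 HX0] := exp_small 8 two0 q2000.
pose q0 := expR (- (2 * X0)).
have q00 : 0 < q0 by exact: expR_gt0.
have k10 : 0 <= K1 B by rewrite /K1; move: B0; lra_local.
have kl0 : 0 <= Kloc B C.
  have k20 : 0 <= K2 B by rewrite /K2; move: B0; lra_local.
  have k30 : 0 <= K3 B C by rewrite /K3; have := mulr_ge0 k20 B0; move: (K2 B) k20 B0 C0 => K; lra_local.
  by rewrite /Kloc; move: k20 k30; lra_local.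
have [e2 e20 He2] := small_constants (ltW C0) B1 q00 kl0 k10.
(* The summand [B / q0] starts the induction: on [-X0, X0] the profile is at least [q0], so the
   global bound [B] is at most [Lam] times its value at [X0]. *)
pose Lam := 33 + B / q0.
have Lam1 : 33 <= Lam by rewrite /Lam lerDl divr_ge0 // ltW.
have Lam0 : 0 <= Lam by exact: le_trans (ler0n _ 33) Lam1.
have CB : C + B <= 2 * B by rewrite /B; move: CP0; lra_local.
have BB : 0 < 2 * B by move: B1; lra_local.
exists (2 * B), (Num.min e0 e2).
split; [exact: BB|by rewrite lt_min e00|by rewrite ge_min e01|].
move=> e ep; rewrite le_min => /andP[ee0 ee2].
have [eC eCq eBq kL eK] := He2 e ep ee2; rewrite -/Lam in kL.
have e1 := le_trans ee0 e01.
have {He2 e20 ee2 q2000} _ := tt.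
have [s [P [P1 [P2 [prof z1 sC close uniq]]]]] := H e ep ee0.
have hs : srange s.
  by rewrite /srange; move: sC; rewrite ler_norml => /andP[p1 p2]; apply/andP; split; clear -eC p1 p2; lra.
have ex0 x : 0 <= expR (- `|x : R|) by exact: expR_ge0.
have ex1 x : expR (- `|x : R|) <= 1 by rewrite expR_le1 oppr_le0.
have wB (k : nat) (f : R -> R) x : (k <= 5)%N -> `|f x - Ps 1 k x| <= C * e * expR (- `|x|) -> `|f x| <= B * expR (- `|x|).
  move=> k5 h; have := HCP 1 k x r1 k5 => h'.
  have := ler_normD (f x - Ps 1 k x) (Ps 1 k x); rewrite subrK => h''; apply: le_trans h'' _.
  have h3 : C * e * expR (- `|x|) <= 1 * expR (- `|x|) by apply: ler_wpM2r => //; clear -eC; lra.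
  apply: le_trans (lerD h h') _; rewrite /B.
  have := mulr_ge0 (ltW C0) (ex0 x); clear -h3; lra.
have PB x : [/\ `|P x| <= B * expR (- `|x|), `|P1 x| <= B * expR (- `|x|) & `|P2 x| <= B * expR (- `|x|)].
  by have [a [b c]] := close x; split; [exact: wB (isT : (0 <= 5)%N) a|exact: wB (isT : (1 <= 5)%N) b|exact: wB (isT : (2 <= 5)%N) c].
have bd (f : R -> R) x : `|f x| <= B * expR (- `|x|) -> `|f x| <= B.
  by move=> h; apply: le_trans h _; have := ler_wpM2l B0 (ex1 x); rewrite mulr1.
have bP : bnd B P by move=> x; apply: bd; have [] := PB x.
have bP1 : bnd B P1 by move=> x; apply: bd; have [] := PB x.
have bP2 : bnd B P2 by move=> x; apply: bd; have [] := PB x.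
have eta0 : 0 <= e ^+ 2 / 2 by rewrite divr_ge0 // exprn_ge0 // ltW.
have etae : e ^+ 2 / 2 <= e by rewrite expr2; have := ler_wpM2l (ltW ep) e1; clear -ep; lra.
have eta1 : e ^+ 2 / 2 <= 1 / 100 by clear -etae e1; lra.
have P0 x : `|P x - 2 * sq x| <= C * e.
  have [a _] := close x; have p : Ps 1 0 x = 2 * sq x by rewrite /Ps /= expr1n !mul1r.
  rewrite p in a; apply: le_trans a _; have Ce := mulr_ge0 (ltW C0) (ltW ep).
  by have := ler_wpM2l Ce (ex1 x); rewrite mulr1.
have eB2 x : `|e ^+ 2 / 2 * P2 x| <= e * B.
  by apply: le_trans (absM (_ : _ <= e) (bP2 x)) _ => //; rewrite ger0_norm.
have [dP dP1 buP2 eqn] := prof.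
have loc (w : R -> R) d : slow 3 w -> 0 < d -> (forall x, d <= w x) -> wb w 1 P -> wb w 1 P1 ->
    forall x, `|P2 x - (4 * P x - 3 * (P x * P x))| <= Kloc B C * e * w x.
  move=> sw d0 dw h1 h2 x.
  apply: (local_estimate ep e1 B1 (ltW C0) bP bP1 bP2 prof hs sC sw d0 dw h1 h2 _ x).
  have := ler_wpM2l k10 etae; move: eK; move: (K1 B) => k; clear; lra.
have kap0 : 0 <= Kloc B C * e by rewrite mulr_ge0 // ltW.
have smallX x : X0 <= `|x| -> `|P x| <= 1 / 1000.
  move=> hx; have /andP[s1 s2] := sq_bounds x; have := P0 x.
  have := HX0 `|x| hx; have := sq_gt0 x.
  by rewrite !ler_norml => p1 p2 /andP[p3 p4]; apply/andP; split; clear -p1 p2 p3 p4 s1 s2 eC; lra.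
have low x : `|x| <= X0 -> q0 <= P x.
  move=> hx; have /andP[s1 s2] := sq_bounds x; have := P0 x.
  have : q0 <= expR (- (2 * `|x|)) by rewrite ler_expR lerN2 ler_wpM2l.
  by rewrite ler_norml => p0 /andP[p1 p2]; move: (q0) p0 eCq => q p0 p3; clear -p0 p1 p2 p3 s1; lra.
have BL p (y : R) E : q0 <= p -> 1 <= E -> `|y| <= B -> `|y| <= Lam * p * E.
  move=> qp e1' yB; apply: le_trans yB _.
  have h1 : B <= Lam * q0 by rewrite /Lam mulrDl divfK ?gt_eqF // lerDr mulr_ge0 // ltW.
  have h2 := ler_wpM2l Lam0 qp; have h3 : 0 <= Lam * p by apply: le_trans (le_trans B0 h1) h2.
  by have := ler_wpM2l h3 e1'; move: (Lam) (q0) h1 h2 => l q h1 h2; clear -h1 h2; lra.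
have X0n : `|X0| = X0 by rewrite ger0_norm.
have pos x : 0 < P x - e ^+ 2 / 2 * P2 x.
  have [hx|/ltW hx] := leP `|x| X0.
    by have := low x hx; have := eB2 x; rewrite ler_norml => /andP[p1 p2] p3; move: (q0) q00 p3 eBq => q q1 p3 p4; clear -p1 p2 p3 q1 p4; lra.
  have [x0|x0] := leP 0 x.
    rewrite ger0_norm // in hx.
    apply: (tail_positive dP dP1 bP bP1 loc kap0 Lam1 kL (X0 := X0)) => //.
    - by move=> y hy; apply: smallX; apply: le_trans hy (ler_norm y).
    - by apply/andP.
    - have q := low X0; rewrite X0n in q; have {}q := q (lexx _).
      split; first exact: lt_le_trans q00 q.
      move=> y yX; have E1 : 1 <= expR (3 * (X0 - y)) by rewrite -[X in X <= _]expR0 ler_expR mulr_ge0 // subr_ge0.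
      by split; apply: BL.
  have dQ := deriv_opp dP.
  have dQ1 : deriv (fun x => - P1 (- x)) (fun x => P2 (- x)).
    by apply: deriv_eq (derivN (deriv_opp dP1)) _ => y; rewrite opprK.
  (* The left tail is the right tail of the reflected profile. The profile equation is not invariant
     under reflection, but the local estimate is, provided the weight is reflected too. *)
  have locQ (w : R -> R) d : slow 3 w -> 0 < d -> (forall x, d <= w x) -> wb w 1 (fun x => P (- x)) ->
      wb w 1 (fun x => - P1 (- x)) ->
      forall x, `|P2 (- x) - (4 * P (- x) - 3 * (P (- x) * P (- x)))| <= Kloc B C * e * w x.
    move=> sw d0 dw h1 h2 y.
    have := loc _ d (slow_opp sw) d0 (fun x => dw (- x)) _ _ (- y); rewrite opprK; apply.
      by move=> z; have := h1 (- z); rewrite opprK.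
    by move=> z; have := h2 (- z); rewrite opprK normrN.
  rewrite ltr0_norm // in hx.
  have := tail_positive dQ dQ1 (fun y => bP (- y)) (_ : bnd B _) locQ kap0 Lam1 kL (X0 := X0) _ (x := - x) (eta := e ^+ 2 / 2).
  rewrite opprK; apply=> //.
  - by move=> y; rewrite normrN.
  - by move=> y hy; apply: smallX; rewrite normrN; apply: le_trans hy (ler_norm y).
  - by apply/andP.
  - have q := low (- X0); rewrite normrN X0n in q; have {}q := q (lexx _).
    split; first exact: lt_le_trans q00 q.
    move=> y yX; have E1 : 1 <= expR (3 * (X0 - y)) by rewrite -[X in X <= _]expR0 ler_expR mulr_ge0 // subr_ge0.
    by split; apply: BL => //; rewrite normrN.
exists s, P, P1, P2; split=> //.
- split=> //; split; first exact: z1.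
  have [_ [_ a]] := close 0; have p : Ps 1 2 0 = - 4 :> R.
    by rewrite Ps2E /Ps /= expr1n !mul1r sq0; ring.
  have b : C * e * expR (- `|0 : R|) <= 1 / 2000 by rewrite normr0 oppr0 expR0 mulr1.
  by move: a b; rewrite p ler_norml => /andP[_ p2] p3; clear -p2 p3; lra.
- split=> //; apply: le_trans sC _; apply: ler_wpM2r (ltW ep) _ _ _; clear -CB B0; lra.
- move=> x; have [a b c] := PB x; have k : B * expR (- `|x|) <= 2 * B * expR (- `|x|).
    by apply: ler_wpM2r => //; clear -B0; lra.
  by split; [exact: le_trans a k|exact: le_trans b k|exact: le_trans c k].
- move=> x; split=> //; have a := P0 x; have b := eB2 x.
  rewrite addrAC; apply: le_trans (ler_normB _ _) _; apply: le_trans (lerD a b) _.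
  by have := ler_wpM2l (ltW ep) CB; clear; lra.
Qed.

End Positivity.

(** * Uniqueness *)

Section Resolvent.
Context {R : realType}.
Implicit Types (f g z w : R -> R) (x y a e t M : R).

(** The function [exp (a x)] times the integral of [exp (- a t) f t] over [[x, +oo[]: the only
    bounded solution of [B' = a B - f]. *)
Lemma half_resolvent a M f : 0 < a -> continuous f -> bnd M f ->
  exists2 B : R -> R, deriv B (fun x => a * B x - f x) & bnd (M / a) B.
Proof.
move=> a0 cf fM; have M0 := bnd_ge0 fM.
have dE := @deriv_expZ R (- a).
pose g x := expR (- a * x) * f x.
have cg : continuous g by apply: contM => //; exact: deriv_cont dE.
have gM x : `|g x| <= M * expR (- (a * x)).
  by rewrite /g normrM ger0_norm ?expR_ge0 // mulNr mulrC ler_wpM2r ?expR_ge0.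
have [l Hl] := prim_limit a0 cg (fun x _ => gM x).
exists (fun x => expR (a * x) * (l - itg g 0 x)).
  apply: deriv_eq (derivM (@deriv_expZ R a) (derivB (deriv_cst l) (itg_deriv 0 cg))) _ => x.
  have EE : expR (a * x) * expR (- a * x) = 1 by rewrite -expRD mulNr subrr expR0.
  rewrite /g; move: (expR (a * x)) (expR (- a * x)) (itg _ 0 x) EE => X Y I EE.
  by transitivity (a * X * (l - I) - (X * Y) * f x); [ring|rewrite EE; ring].
move=> x; rewrite normrM ger0_norm ?expR_ge0 //.
have E0 := expR_gt0 (a * x).
suff h : `|l - itg g 0 x| <= M / a * expR (- (a * x)).
  apply: le_trans (ler_wpM2l (ltW E0) h) _.
  by rewrite mulrCA -expRD subrr expR0 mulr1.
have [x0|/ltW x0] := leP 0 x; first by rewrite distrC; exact: Hl.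
(* For [x <= 0] the estimate of the tail at 0 is completed by the integral from [x] to 0. *)
have l0 := Hl 0 (lexx 0); rewrite itg_xx sub0r normrN mulr0 oppr0 expR0 mulr1 in l0.
have dG := derivZ (- (M / a)) (@deriv_expZ R (- a)).
have i0 : `|itg g 0 0 - itg g 0 x| <= - (M / a) * expR (- a * 0) - - (M / a) * expR (- a * x).
  apply: (deriv_abs_le2 (itg_deriv 0 cg) dG x0) => y _.
  apply: le_trans (gM y) _; apply: leeq; rewrite (mulNr a y).
  by field; rewrite gt_eqF.
rewrite itg_xx sub0r normrN mulr0 expR0 (mulNr a x) in i0.
apply: le_trans (ler_normB _ _) _; apply: le_trans (lerD l0 i0) _.
lra.
Qed.

(** With [a^2 = 2 / e^2] this solves [z - e^2 / 2 z'' = f], inverting the preconditioner: closeness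
    in [u] becomes closeness of profiles and of their first two derivatives. *)
Lemma resolvent a M f : 0 < a -> continuous f -> bnd M f ->
  exists z z1 : R -> R, [/\ deriv z z1, deriv z1 (fun x => a ^+ 2 * (z x - f x)), bnd M z & bnd (a * M) z1].
Proof.
move=> a0 cf fM; have [B dB bB] := half_resolvent a0 cf fM.
have cf' : continuous (fun x => f (- x)) by apply: cont_comp => //; exact: contN cont_id.
have [A' dA' bA'] := half_resolvent a0 cf' (fun x => fM (- x)).
pose A x := A' (- x).
have dA : deriv A (fun x => - (a * A x) + f x).
  by apply: deriv_eq (deriv_opp dA') _ => x; rewrite /A opprK; ring.
have an : a != 0 by rewrite gt_eqF.
exists (fun x => a / 2 * (A x + B x)), (fun x => a ^+ 2 / 2 * (B x - A x)); split.
- by apply: deriv_eq (derivZ (a / 2) (derivD dA dB)) _ => x; field.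
- by apply: deriv_eq (derivZ (a ^+ 2 / 2) (derivB dB dA)) _ => x; field.
- move=> x; rewrite normrM ger0_norm; last by rewrite divr_ge0 // ltW.
  have h := le_trans (ler_normD (A x) (B x)) (lerD (bA' (- x)) (bB x)).
  have h2 := ler_wpM2l (_ : 0 <= a / 2) h; apply: le_trans (h2 _) _; first by rewrite divr_ge0 // ltW.
  by apply: leeq; field.
- move=> x; rewrite normrM ger0_norm; last by rewrite divr_ge0 // exprn_ge0 // ltW.
  have h := le_trans (ler_normB (B x) (A x)) (lerD (bB x) (bA' (- x))).
  have h2 := ler_wpM2l (_ : 0 <= a ^+ 2 / 2) h; apply: le_trans (h2 _) _; first by rewrite divr_ge0 // exprn_ge0 // ltW.
  by apply: leeq; field.
Qed.

Lemma Tk_transl k d c t f x : Tk k d c (fun y => f (y + t)) x = Tk k d c f (x + t).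
Proof. by apply: eq_itg => s; congr (_ * f _); ring. Qed.

Lemma profile_transl e s t P P1 P2 : profile e s P P1 P2 ->
  profile e s (fun x => P (x + t)) (fun x => P1 (x + t)) (fun x => P2 (x + t)).
Proof.
move=> [dP dP1 bP2 eqn]; split; [exact: deriv_transl|exact: deriv_transl|exact: bu_transl|].
move=> x; have -> : Bop e (fun x => P2 (x + t)) x = Bop e P2 (x + t).
  by rewrite /Bop /Kop !Tk_transl.
rewrite eqn; congr (2 * _).
rewrite /Fop /Qop /Av.
have E (d : R) : Tk (fun=> 1) 0 d (Qx e (fun y => P (y + t) - e ^+ 2 / 2 * P2 (y + t))
    (fun y => P (y + t) - e ^+ 2 / 2 * P2 (y + t))) x =
  Tk (fun=> 1) 0 d (Qx e (fun y => P y - e ^+ 2 / 2 * P2 y) (fun y => P y - e ^+ 2 / 2 * P2 y)) (x + t).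
  rewrite -Tk_transl; congr (Tk _ _ _ _ _); apply/funext => y; rewrite /Qx.
  have -> : y + t + e = y + e + t by ring.
  by have -> : y + t - e = y - e + t by ring.
rewrite !E -(Tk_transl _ _ _ t (fun y => P y - e ^+ 2 / 2 * P2 y)).
by rewrite -(Tk_transl _ _ _ t (fun y => (2 - 20 / 7 * e ^+ 2) * _)).
Qed.

End Resolvent.

(** * Uniqueness among uniformly close solutions *)

Section SupUniqueness.
Context {R : realType}.
Implicit Types (f g u : R -> R) (x y e s t M : R).

Lemma delay_rhs_bnd beta N u : bnd N u -> bnd (`|beta| * (2 * (2 * N + N ^+ 2)) + 4 * (2 * N + N ^+ 2)) (delay_rhs beta u).
Proof.
move=> uN x; have N0 := bnd_ge0 uN.
have h y z : `|u y * u z| <= N ^+ 2 by rewrite expr2; exact: absM.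
have q y : `|2 * u y + u y ^+ 2| <= 2 * N + N ^+ 2.
  rewrite (expr2 (u y)); have := h y y; have := uN y; rewrite !ler_norml => /andP[? ?] /andP[? ?].
  by apply/andP; split; lra.
have p y : `|hop u y| <= 2 * N + N ^+ 2.
  have := h (y - 1) (y + 1); have := uN (y - 1); have := uN (y + 1); rewrite /hop !ler_norml.
  by move=> /andP[? ?] /andP[? ?] /andP[? ?]; apply/andP; split; lra.
rewrite /delay_rhs.
have a := le_trans (ler_normB _ _) (lerD (q (x + 1)) (q x)).
have b := absM (lexx `|beta|) a.
have c := le_trans (ler_normB _ _) (lerD (p (x + 1)) (p x)).
have d := le_trans (ler_normB _ _) (lerD (p x) (p (x - 1))).
apply: le_trans (ler_normD _ _) _; apply: le_trans (lerD (le_trans (ler_normB _ _) (lerD b c)) d) _.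
by apply: leeq; ring.
Qed.

(** A competitor [u] is turned into a profile by the resolvent, then translated so that its
    derivative vanishes at 0. The condition [P2 0 <= - 2] keeps the required translation small, so
    the uniqueness of normalised profiles applies. *)
Lemma sup_unique e s (P P1 P2 : R -> R) (B r : R) : 0 < e -> e <= 1 / 1000 -> srange s ->
  profile e s P P1 P2 -> P1 0 = 0 -> P2 0 <= - 2 -> bnd B P -> bnd B P1 -> bnd B P2 -> 0 < r ->
  (forall s' (P' P1' P2' : R -> R), profile e s' P' P1' P2' -> P1' 0 = 0 -> `|s' - s| <= r ->
      bnd r (fun x => P' x - P x) -> bnd r (fun x => P1' x - P1 x) -> bnd r (fun x => P2' x - P2 x) ->
      s' = s /\ P' = P) ->
  let c0 := 4 + e ^+ 2 * (gam s - 40 / 7) in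
  let u0 := fun x => e ^+ 2 * (P (e * x) - e ^+ 2 / 2 * P2 (e * x)) in
  exists2 del : R, 0 < del & forall u (du : R -> R) c1, deriv u du ->
    (forall x, int_res (2 - 20 / 7 * e ^+ 2) c1 u x = 0) -> `|c1 - c0| <= del -> bnd del (fun x => u x - u0 x) ->
    c1 = c0 /\ exists tau, forall x, u x = u0 (x + tau).
Proof.
move=> e0 e1 hs prof z1 P20 bP bP1 bP2 r0 uniq c0 u0.
have [dP dP1 buP2 eqn] := prof; have [uP2 _] := buP2.
have B0 := bnd_ge0 bP.
have ee : 0 < e ^+ 2 by exact: exprn_gt0.
have en : e != 0 by rewrite gt_eqF.
pose a := Num.sqrt (2 / e ^+ 2).
have a2 : a ^+ 2 = 2 / e ^+ 2 by rewrite sqr_sqrtr // divr_ge0 // ltW.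
have a0 : 0 < a by rewrite sqrtr_gt0 divr_gt0.
pose mu := Num.min 1 (r / 2).
have mu0 : 0 < mu by rewrite lt_min ltr01 divr_gt0.
have [rho rho0 Hrho] := uP2 mu mu0.
(* Translations by at most [t] move [P], [P1] and [P2] by at most [r / 2], and on [-t, t] the second
   derivative stays below -1. *)
pose t := Num.min (rho / 2) (r / (2 * (B + 1))).
have BB : 0 < 2 * (B + 1) by lra_local.
have t0 : 0 < t by rewrite lt_min !divr_gt0.
have trho : t < rho.
  have : t <= rho / 2 by rewrite ge_min lexx.
  by move=> h; apply: le_lt_trans h _; clear -rho0; lra.
have tB : t * B <= r / 2.
  have : t <= r / (2 * (B + 1)) by rewrite ge_min lexx orbT.
  rewrite ler_pdivlMr // => h; have := t0; clear -h t0; lra.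
(* The resolvent multiplies a sup bound by 1, [a] and [2 a^2] for the function and its first and
   second derivatives. *)
pose q := 1 + a + 2 * a ^+ 2.
have q0 : 0 < q by rewrite /q; have := exprn_gt0 2 a0; lra_local.
pose m := Num.min (r / 2) t.
have m0 : 0 < m by rewrite lt_min t0 divr_gt0.
pose kap := Num.min 1 (m / q).
have kap0 : 0 < kap by rewrite lt_min ltr01 divr_gt0.
have kap1 : kap <= 1 by rewrite ge_min lexx.
have kapq : kap * q <= m by rewrite -ler_pdivlMr // ge_min lexx orbT.
have mr : m <= r / 2 by rewrite ge_min lexx.
have mt : m <= t by rewrite ge_min lexx orbT.
have ak0 := mulr_ge0 (ltW a0) (ltW kap0); have ak2 := mulr_ge0 (sqr_ge0 a) (ltW kap0).
have kE : kap * q = kap + a * kap + a ^+ 2 * (2 * kap) by rewrite /q; ring.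
have k_1 : kap <= m by apply: le_trans kapq; rewrite kE; clear -ak0 ak2; lra.
have k_2 : a * kap <= m by apply: le_trans kapq; rewrite kE; clear -ak0 ak2 kap0; lra.
have k_3 : a ^+ 2 * (2 * kap) <= m by apply: le_trans kapq; rewrite kE; clear -ak0 ak2 kap0; lra.
exists (e ^+ 2 * kap); first exact: mulr_gt0.
move=> u du c1 dU int cc uu.
have e21 : e ^+ 2 <= 1 / 1000 by rewrite expr2; have := ler_pM (ltW e0) (ltW e0) e1 e1; clear; lra.
pose g' := 40 / 7 + (c1 - 4) / e ^+ 2.
have gg : g' - gam s = (c1 - c0) / e ^+ 2 by rewrite /g' /c0; field.
have ggk : `|g' - gam s| <= kap.
  by rewrite gg normrM normfV (gtr0_norm ee) ler_pdivrMr // mulrC.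
have /andP[s1 s2] := hs.
have g0 : 0 <= 3 / 8 * g'.
  have : 9 / 16 <= s ^+ 2 by rewrite expr2; have := ler_pM (_ : 0 <= 3 / 4) (_ : 0 <= 3 / 4) s1 s1; clear -s1; move=> h; nra.
  move: ggk kap1; rewrite /gam ler_norml => /andP[h1 h2] h3 h4; clear -h1 h3 h4; lra.
(* The width whose soliton speed is the speed [c1] of the competitor: [gam s' = g']. *)
pose s' := Num.sqrt (3 / 8 * g').
have s'0 : 0 <= s' by exact: sqrtr_ge0.
have gs' : gam s' = g' by rewrite /gam sqr_sqrtr //; field.
have c1E : c1 = 4 + e ^+ 2 * (gam s' - 40 / 7) by rewrite gs' /g'; field.
have ss : `|s' - s| <= r.
  have h : (s' - s) * (s' + s) = 3 / 8 * (g' - gam s) by rewrite -gs' /gam; field.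
  have h1 : `|s' - s| * (s' + s) <= 3 / 8 * kap.
    have sp : 0 <= s' + s by clear -s'0 s1; lra.
    rewrite -[X in _ * X](ger0_norm sp) -normrM h normrM ger0_norm; last by clear; lra.
    by apply: ler_wpM2l ggk; clear; lra.
  have h2 := ler_wpM2l (normr_ge0 (s' - s)) (_ : 3 / 4 <= s' + s).
  have {}h2 := h2 (ltac:(clear -s'0 s1; lra)).
  clear -h1 h2 k_1 mr kap0 r0; lra.
pose U x := P x - e ^+ 2 / 2 * P2 x.
pose U' x := (e ^+ 2)^-1 * u (0 + e^-1 * x).
have uE x : u x = e ^+ 2 * U' (e * x).
  by rewrite /U' add0r !mulrA mulVf // divff ?mul1r // gt_eqF.
have ubd : exists N, bnd N u.
  exists (e ^+ 2 * kap + e ^+ 2 * (B + e ^+ 2 / 2 * B)) => x.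
  have a1 := uu x; have h2 := absM (lexx `|e ^+ 2 / 2|) (bP2 (e * x)).
  have h3 := absM (lexx `|e ^+ 2|) (le_trans (ler_normB _ _) (lerD (bP (e * x)) h2)).
  have e22 : 0 <= e ^+ 2 / 2 by clear -ee; lra.
  rewrite (gtr0_norm ee) (ger0_norm e22) in h3.
  by have := ler_normD (u x - u0 x) (u0 x); rewrite subrK => h; apply: le_trans h _; exact: lerD.
have [N uN] := ubd.
have cu := deriv_cont dU.
have c1n : c1 != 0.
  rewrite gt_eqF //; move: cc; rewrite /c0 ler_norml => /andP[h1 _].
  have gp : 0 <= e ^+ 2 * gam s by rewrite /gam; apply: mulr_ge0 (ltW ee) (mulr_ge0 _ (sqr_ge0 s)); clear; lra.
  have : e ^+ 2 * kap <= e ^+ 2 * 1 by exact: ler_wpM2l (ltW ee) _ _ kap1.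
  move: h1 gp e21; clear => *; lra.
have dU2 := int_deriv c1n cu int.
have bU' : bu U'.
  have M1 := delay_rhs_bnd (2 - 20 / 7 * e ^+ 2) uN; set M := _ + _ in M1.
  have bdu : bnd (`|c1^-1| * M) (fun x => c1^-1 * delay_rhs (2 - 20 / 7 * e ^+ 2) u x).
    by move=> x; exact: absM.
  by apply: buZ; apply: bu_aff; split; [exact: deriv_ucont dU2 bdu|exists N].
have buP : bu P by split; [exact: deriv_ucont dP bP1|exists B].
have bU : bu U by apply: buB buP _; exact: buZ.
have buz : bu (fun x => U' x - U x) by exact: buB.
have eK x : e * (e^-1 * x) = x by rewrite mulrA divff // mul1r.
have zk : bnd kap (fun x => U' x - U x).
  move=> x; have := uu (e^-1 * x); rewrite uE /u0 eK -mulrBr normrM (gtr0_norm ee).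
  by rewrite ler_pM2l.
have [z [zd [dz dz1 bz bz1]]] := resolvent a0 (bu_cont buz) zk.
set zdd := (fun x => _) in dz1.
pose P' x := P x + z x; pose P1' x := P1 x + zd x; pose P2' x := P2 x + zdd x.
have dP' : deriv P' P1' := derivD dP dz.
have dP1' : deriv P1' P2' := derivD dP1 dz1.
have bzdd : bu zdd.
  apply: buZ; apply: buB buz; split; first exact: deriv_ucont dz bz1.
  by exists kap.
have bP2' : bu P2' := buD buP2 bzdd.
have UE : (fun y => P' y - e ^+ 2 / 2 * P2' y) = U'.
  by apply/funext => x; rewrite /P' /P2' /zdd a2 /U; field.
have prof' : profile e s' P' P1' P2'.
  split=> // x; apply/(profile_Mop (gam s') x en dP' dP1' (bu_cont bP2')); rewrite UE.
  have := int_scaled e (gam s') (e^-1 * x) (bu_cont bU').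
  rewrite -c1E -(funext uE) int eK => /esym/eqP.
  by rewrite mulf_eq0 (gt_eqF ee) => /eqP.
have zdB x : `|zd x| <= m by apply: le_trans (bz1 x) k_2.
have zddB x : `|zdd x| <= m.
  apply: le_trans k_3; rewrite /zdd normrM ger0_norm ?sqr_ge0 //; apply: ler_wpM2l (sqr_ge0 a) _ _ _.
  by apply: le_trans (ler_normB _ _) _; have := lerD (bz x) (zk x); clear; lra.
have zB x : `|z x| <= m by apply: le_trans (bz x) k_1.
have P2neg y : `|y| <= t -> P2 y <= - 1.
  move=> yt; have := Hrho y 0; rewrite subr0 => /(_ (le_lt_trans yt trho)).
  have : mu <= 1 by rewrite ge_min lexx.
  by rewrite ler_norml => h1 /andP[h2 h3]; clear -h1 h3 P20; lra.
have dl : deriv (fun x : R => - 1 * x) (fun=> - 1) by apply: deriv_eq (derivZ (-1) deriv_id) _ => y; rewrite mulr1.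
have Pt : P1 t <= - t.
  have := deriv_le dP1 dl (ltW t0); rewrite z1 => h.
  have {}h : P1 t - 0 <= - 1 * t - - 1 * 0.
    by apply: h => y /andP[y0 yt]; apply: P2neg; rewrite ger0_norm.
  clear -h; lra.
have tm : - t <= 0 by clear -t0; lra.
have Pmt : t <= P1 (- t).
  have := deriv_le dP1 dl tm; rewrite z1 => h.
  have {}h : 0 - P1 (- t) <= - 1 * 0 - - 1 * (- t).
    by apply: h => y /andP[y0 yt]; apply: P2neg; rewrite ler0_norm // lerNl.
  clear -h; lra.
have tt : - t <= t by clear -t0; lra.
(* [P1 (- t) >= t] and [P1 t <= - t], and the perturbation is at most [m <= t], so the perturbed
   derivative still changes sign on [-t, t]. *)
have [tau taut tau0] : exists2 tau, - t <= tau <= t & P1' tau = 0.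
  have h1 : 0 <= P1' (- t).
    by have := zdB (- t); rewrite /P1' ler_norml => /andP[h1 _]; clear -h1 Pmt mt; lra.
  have h2 : P1' t <= 0.
    by have := zdB t; rewrite /P1' ler_norml => /andP[_ h2]; clear -h2 Pt mt; lra.
  have := @IVT R P1' (- t) t 0 tt (deriv_within dP1').
  case; first by rewrite ge_min le_max h1 h2 orbT.
  by move=> tau; rewrite in_itv /=; exists tau.
have tauB : `|tau| <= t by rewrite ler_norml.
have sh (f : R -> R) x : bnd B f -> forall F, deriv F f -> `|F (x + tau) - F x| <= r / 2.
  move=> fB F dF; apply: le_trans (deriv_lip dF fB _ _) _.
  rewrite addrAC subrr add0r; apply: le_trans tB; rewrite mulrC.
  by apply: ler_wpM2r.
have rr : r / 2 + r / 2 = r by clear; lra.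
have mr' x (f g : R -> R) : `|g (x + tau)| <= m -> `|f (x + tau) - f x| <= r / 2 ->
    `|f (x + tau) + g (x + tau) - f x| <= r.
  move=> h1 h2; rewrite addrAC -rr; apply: le_trans (ler_normD _ _) _; apply: lerD h2 _.
  exact: le_trans h1 mr.
have [ssE PE] : s' = s /\ (fun x => P' (x + tau)) = P.
  apply: (uniq _ _ _ _ (profile_transl tau prof')).
  - by rewrite add0r.
  - exact: ss.
  - by move=> x; apply: mr' (zB _) _; exact: sh bP1 _ dP.
  - by move=> x; apply: mr' (zdB _) _; exact: sh bP2 _ dP1.
  - move=> x; apply: mr' (zddB _) _; apply: le_trans (Hrho _ _ _) _; last by rewrite ge_min lexx orbT.
    by rewrite addrAC subrr add0r; apply: le_lt_trans trho.
split; first by rewrite c1E ssE.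
have du1 (F f f' : R -> R) : deriv F f -> deriv F f' -> f = f'.
  move=> h1 h2; apply/funext => x; have h3 := h1 x; have h4 := h2 x.
  by rewrite -(@derive_val _ _ _ _ _ _ _ h3) -(@derive_val _ _ _ _ _ _ _ h4).
have P1E : (fun x => P1' (x + tau)) = P1.
  by have := deriv_transl tau dP'; rewrite PE => h; exact: du1 h dP.
have P2E : (fun x => P2' (x + tau)) = P2.
  by have := deriv_transl tau dP1'; rewrite P1E => h; exact: du1 h dP1.
exists (- (e^-1 * tau)) => x.
have et : e * (x + - (e^-1 * tau)) = e * x - tau by rewrite mulrDr mulrN eK.
rewrite uE -UE /u0 et.
have := congr1 (fun f => f (e * x - tau)) PE; have := congr1 (fun f => f (e * x - tau)) P2E.
by rewrite /= subrK => -> ->.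
Qed.

End SupUniqueness.

(** * The topology of H^2 *)

Section Measure.
Context {R : realType}.
Implicit Types (f g u v : R -> R) (x a b k C M : R).
Local Notation mu := (@lebesgue_measure R).

Lemma cvg_at_rl (F : R -> R) x : continuous F -> F @ x^'+ --> F x /\ F @ x^'- --> F x.
Proof. by move=> cF; split; [exact: cvg_at_right_filter (cF x)|exact: cvg_at_left_filter (cF x)]. Qed.

Lemma integral_itg f a b : continuous f -> a < b ->
  (\int[mu]_(x in `[a, b]) (f x)%:E = (itg f a b)%:E)%E.
Proof.
move=> cf ab; have D := prim_cont cf; have cp := deriv_cont D.
rewrite (@continuous_FTC2 _ f (prim f) a b ab) /itg ?EFinB //.
- exact: continuous_subspaceT.
- split; [by move=> x _; have [] := D x|exact: (cvg_at_rl a cp).1|exact: (cvg_at_rl b cp).2].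
- by move=> x _; exact: deriv_derive1.
Qed.

Lemma measurable_cont f : continuous f -> measurable_fun (setT : set (measurableTypeR R)) f.
Proof. exact: continuous_measurable_fun. Qed.

Lemma L2_sq f : L2 f -> (\int[mu]_x (f x ^+ 2)%:E = (L2norm f ^+ 2)%:E)%E.
Proof.
move=> /andP[_ lf]; have fin : ('N[mu]_2%:E[EFin \o f] < +oo)%E := set_mem lf.
have n0 := @Lnorm_ge0 _ _ _ mu 2%:E (EFin \o f).
have E : ('N[mu]_2%:E[EFin \o f] = (L2norm f)%:E)%E.
  by rewrite /L2norm fineK // ge0_fin_numE.
have t0 : (2 : R) != 0 by [].
have := @poweR_Lnorm _ _ _ mu (EFin \o f) _ t0; rewrite E poweR_EFin powR_mulrn; last first.
  by rewrite -lee_fin -E.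
move=> ->; apply: eq_integral => x _ /=.
by rewrite powR_mulrn // -normrX ger0_norm ?sqr_ge0.
Qed.

Lemma L2_local f a b : continuous f -> a < b -> L2 f -> itg (fun x => f x ^+ 2) a b <= L2norm f ^+ 2.
Proof.
move=> cf ab lf; have c2 : continuous (fun x => f x ^+ 2) by exact: contM.
rewrite -lee_fin -L2_sq // -integral_itg //.
apply: ge0_subset_integral => //.
- by apply/measurable_EFinP; apply: measurable_funS (measurable_cont c2).
- by move=> x _; rewrite lee_fin sqr_ge0.
Qed.

(** Monotone convergence along growing intervals, on each of which the Lebesgue integral of the
    square is an increment of a primitive. *)
Lemma L2_dec f k C : 0 < k -> dec k C f -> L2 f.
Proof.
move=> k0 [cf fC]; have C0 := dec_ge0 (conj cf fC).
have c2 : continuous (fun x => f x ^+ 2) by exact: contM.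
(* The successor keeps the first interval nondegenerate, as [integral_itg] asks for [a < b]. *)
pose F (n : nat) := `[- (n.+1%:R : R), n.+1%:R]%classic : set R.
pose M := C ^+ 2 * (2 * (2 * k)^-1).
have k2 : 0 < (2 * k)^-1 by rewrite invr_gt0 mulr_gt0.
have IF n : (\int[mu]_(x in F n) (f x ^+ 2)%:E <= M%:E)%E.
  have n0 : 0 < n.+1%:R :> R by rewrite ltr0n.
  have nn : - n.+1%:R < n.+1%:R :> R by apply: lt_trans n0; rewrite oppr_lt0.
  rewrite /F (integral_itg c2 nn) lee_fin.
  have cE : continuous (fun x : R => expR (- (`|x| / (2 * k)^-1))).
    have c : continuous (fun x : R => - (`|x| / (2 * k)^-1)).
      have -> : (fun x : R => - (`|x| / (2 * k)^-1)) = fun x => (- (2 * k)) * `|x|.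
        by apply/funext => x; rewrite invrK mulNr mulrC.
      by apply: contZ => x; exact: norm_continuous.
    exact: (cont_comp (deriv_cont (@deriv_exp R)) c).
  apply: le_trans (ler_wpM2l (sqr_ge0 C) (itg_exp_abs k2 (ltW n0))).
  rewrite -itgZ //; apply: itg_le => //; [exact: contZ|exact: ltW|].
  move=> x _; have := absM (fC x) (fC x); rewrite -expr2 ger0_norm ?sqr_ge0 // => h.
  apply: le_trans h _; apply: leeq; rewrite mulrACA -expRD -expr2 invrK; congr (_ * expR _); ring.
have ndF : nondecreasing_seq F.
  move=> i j ij; rewrite subsetEset => x; rewrite /F /= !in_itv /= => /andP[a b].
  have h : i.+1%:R <= j.+1%:R :> R by rewrite ler_nat ltnS.
  by apply/andP; split; [apply: le_trans a; rewrite lerN2|exact: le_trans b h].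
have mf2 : measurable_fun (setT : set (measurableTypeR R)) (fun x => f x ^+ 2) by exact: measurable_cont.
have cv := @ge0_nondecreasing_set_cvg_integral _ (measurableTypeR R) R F (fun x => (f x ^+ 2)%:E) mu ndF.
have UF : \bigcup_i F i = setT.
  apply/seteqP; split=> // x _; have [n hn] := nat_ge `|x|.
  exists n => //; rewrite /F /= in_itv /= -ler_norml; apply: le_trans hn _.
  by rewrite ler_nat.
have I : (\int[mu]_x (f x ^+ 2)%:E <= M%:E)%E.
  have {}cv : (\int[mu]_(x in F i) (f x ^+ 2)%:E @[i --> \oo] --> \int[mu]_x (f x ^+ 2)%:E)%E.
    rewrite -UF; apply: cv.
    - by move=> i; exact: measurable_itv.
    - by move=> i; apply/measurable_EFinP; exact: measurable_funTS.
    - by move=> i x _; rewrite lee_fin sqr_ge0.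
  rewrite -(cvg_lim _ cv) //; apply: lime_le; first by apply/cvg_ex; eexists; exact: cv.
  by apply: nearW => n; exact: IF.
apply/andP; split; rewrite inE /=; first exact: (measurable_cont cf).
rewrite /finite_norm unlock /Lnorm; apply: poweR_lty.
apply: le_lt_trans (ltry M); apply: le_trans I; apply: ge0_le_integral => //.
- by move=> x _; rewrite poweR_ge0.
- apply/measurable_EFinP => /=.
  have -> : (fun x => `|f x| `^ 2) = fun x => f x ^+ 2.
    by apply/funext => x; rewrite powR_mulrn // -normrX ger0_norm ?sqr_ge0.
  exact: mf2.
- by apply/measurable_EFinP; exact: mf2.
- move=> x _ /=; rewrite lee_fin.
  by rewrite powR_mulrn // -normrX ger0_norm ?sqr_ge0.
Qed.

Lemma Rintegral_support f N : 0 < N -> continuous f -> (forall x, N < `|x| -> f x = 0) ->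
  (\int[mu]_x f x)%R = itg f (- N) N.
Proof.
move=> N0 cf f0; have NN : - N < N by lra.
rewrite /Rintegral -[RHS]/(fine (itg f (- N) N)%:E) -(integral_itg cf NN); congr fine.
rewrite [in RHS]integral_mkcond; apply: eq_integral => x _.
rewrite patchE; case: ifPn => //; rewrite notin_setE /= in_itv /= => /negP.
by rewrite -ler_norml -ltNge => /f0 ->.
Qed.

Lemma weak_deriv u v : deriv u v -> continuous v -> weak_derivative u v.
Proof.
move=> duv cv phi [dphi cphi]; have cu := deriv_cont duv.
have d1 : deriv phi (derive1 phi) by apply: derivable_deriv; exact: dphi 0%N.
have c1 : continuous (derive1 phi).
  by apply: (deriv_cont (f := derive1 (derive1 phi))); apply: derivable_deriv; exact: dphi 1%N.
have [N N0 HN] : exists2 N, 0 < N & forall x, N < `|x| -> phi x = 0.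
  have := compact_bounded cphi => -[N [Nr HN]].
  have N1 : N < `|N| + 1 by have := ler_norm N; lra.
  exists (`|N| + 1) => [|x Nx]; first by have := normr_ge0 N; lra.
  apply: contrapT => /eqP nz; have : closure [set x | phi x != 0] x by exact: subset_closure.
  by move=> cx; have /= h := HN _ N1 _ cx; move: Nx; rewrite ltNge h.
have HN1 x : N < `|x| -> derive1 phi x = 0.
  move=> Nx; have e : \near x, phi x = cst 0 x.
    have : \forall y \near x, N < `|y|.
      have c : continuous (fun y : R => `|y|) by move=> y; exact: norm_continuous.
      by have := c x; move=> /cvgr_gt; apply.
    by apply: filterS => y /HN.
  by rewrite derive1E (near_eq_derive _ e) derive_cst.
have cu1 : continuous (fun x => u x * derive1 phi x) by exact: contM.
have cvp : continuous (fun x => v x * phi x) by apply: contM => //; exact: deriv_cont d1.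
rewrite (Rintegral_support N0 cu1); last by move=> x /HN1 ->; rewrite mulr0.
rewrite (Rintegral_support N0 cvp); last by move=> x /HN ->; rewrite mulr0.
apply/eqP; rewrite -subr_eq0 opprK addrC -itgD //.
rewrite (itgE _ _ (derivM duv d1)).
(* The support is only known to avoid [|x| > N]; the boundary terms at [|x| = N] vanish by
   continuity. *)
have z : forall x, N <= `|x| -> u x * phi x = 0.
  move=> x; rewrite le_eqVlt => /orP[/eqP Nx|/HN ->]; last by rewrite mulr0.
  have cup : continuous (fun y => u y * phi y) by apply: contM => //; exact: deriv_cont d1.
  apply/eqP; rewrite -normr_le0; apply/ler_addgt0Pr => e e0; rewrite add0r.
  have [r r0 Hr] := (contP (fun y => u y * phi y) x).1 (cup x) e e0.
  pose y := x + (if 0 <= x then r / 2 else - (r / 2)).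
  have yx : `|y - x| < r.
    by rewrite /y addrAC subrr add0r; case: ifP => _; rewrite ?normrN ger0_norm; lra_local.
  have Ny : N < `|y|.
    rewrite Nx /y; have [x0|x0] := leP 0 x.
      by rewrite !ger0_norm; lra_local.
    by rewrite !ltr0_norm; lra_local.
  by have := Hr y yx; rewrite (HN y Ny) mulr0 sub0r normrN.
by rewrite !z ?subrr // ?normrN ger0_norm ?lexx // ltW.
Qed.

End Measure.

(** * Regularity of decaying solutions and uniform closeness *)

Section Regularity.
Context {R : realType}.
Implicit Types (f g u : R -> R) (x y k C M : R).

Definition edec k f := exists C, dec k C f.

Lemma edec_cont k f : edec k f -> continuous f.
Proof. by move=> [C []]. Qed.

Lemma edecD k f g : edec k f -> edec k g -> edec k (fun x => f x + g x).
Proof. by move=> [C df] [M dg]; exists (C + M); exact: decD. Qed.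

Lemma edecZ k a f : edec k f -> edec k (fun x => a * f x).
Proof. by move=> [C df]; exists (`|a| * C); exact: decZ. Qed.

Lemma edecB k f g : edec k f -> edec k g -> edec k (fun x => f x - g x).
Proof.
move=> df dg; have := edecD df (edecZ (-1) dg); congr edec.
by apply/funext => x; rewrite mulN1r.
Qed.

Lemma edecM k f g : 0 <= k -> edec k f -> edec k g -> edec k (fun x => f x * g x).
Proof.
move=> k0 [C df] [M dg]; have [C0 M0] := (dec_ge0 df, dec_ge0 dg).
have [cf hf] := df; have [cg hg] := dg.
exists (C * M); split; first exact: contM.
move=> x; apply: le_trans (absM (hf x) (hg x)) _.
have E0 := expR_ge0 (- (k * `|x|)).
have E1 : expR (- (k * `|x|)) <= 1 by rewrite expR_le1 oppr_le0 mulr_ge0.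
by have := ler_wpM2l (mulr_ge0 (mulr_ge0 C0 M0) E0) E1; lra.
Qed.

Lemma edec_shift k f (t : R) : 0 <= k -> edec k f -> edec k (fun x => f (x + t)).
Proof.
move=> k0 [C df]; have C0 := dec_ge0 df; have [cf hf] := df.
exists (C * expR (k * `|t|)); split; first exact: cont_transl1.
move=> x; apply: le_trans (hf _) _; rewrite -mulrA -expRD; apply: ler_wpM2l C0 _ _ _.
rewrite ler_expR; have := ler_normB (x + t) t; rewrite addrK => h.
by have := ler_wpM2l k0 h; lra.
Qed.

Lemma edec_hop k u : 0 <= k -> edec k u -> edec k (hop u).
Proof.
move=> k0 du; apply: edecD; first apply: edecD; try exact: edec_shift.
by apply: edecM => //; exact: edec_shift.
Qed.

Lemma edec_rhs k beta u : 0 <= k -> edec k u -> edec k (delay_rhs beta u).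
Proof.
move=> k0 du.
have dq : edec k (fun y => 2 * u y + u y ^+ 2) by apply: edecD; [exact: edecZ|exact: edecM].
have dh := edec_hop k0 du.
apply: edecD; first apply: edecB.
- by apply: edecZ; apply: edecB => //; exact: (edec_shift 1 k0 dq).
- by apply: edecB => //; exact: edec_shift.
- by apply: edecB => //; exact: edec_shift.
Qed.

Definition hop1 u (d : R -> R) y := d (y - 1) + d (y + 1) + (d (y - 1) * u (y + 1) + u (y - 1) * d (y + 1)).

Lemma deriv_hop u (d : R -> R) : deriv u d -> deriv (hop u) (hop1 u d).
Proof.
move=> du; apply: derivD; first apply: derivD; try exact: deriv_transl.
by apply: derivM; exact: deriv_transl.
Qed.

Definition rhs1 beta u (d : R -> R) y :=
  beta * (2 * d (y + 1) + 2 * (u (y + 1) * d (y + 1)) - (2 * d y + 2 * (u y * d y)))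
  - (hop1 u d (y + 1) - hop1 u d y) + (hop1 u d y - hop1 u d (y - 1)).

Lemma deriv_rhs beta u (d : R -> R) : deriv u d -> deriv (delay_rhs beta u) (rhs1 beta u d).
Proof.
move=> du; have dh := deriv_hop du.
have dq : deriv (fun y => 2 * u y + u y ^+ 2) (fun y => 2 * d y + 2 * (u y * d y)).
  by apply: deriv_eq (derivD (derivZ 2 du) (derivM du du)) _ => y; ring.
apply: derivD; first apply: derivB.
- by apply: derivZ; apply: derivB => //; exact: (deriv_transl 1 dq).
- by apply: derivB => //; exact: deriv_transl.
- by apply: derivB => //; exact: deriv_transl.
Qed.

Lemma edec_rhs1 k beta u (d : R -> R) : 0 <= k -> edec k u -> edec k d -> edec k (rhs1 beta u d).
Proof.
move=> k0 du dd.
have dh : edec k (hop1 u d).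
  apply: edecD; first by apply: edecD; exact: edec_shift.
  by apply: edecD; apply: edecM => //; exact: edec_shift.
have dq : edec k (fun y => 2 * d y + 2 * (u y * d y)).
  by apply: edecD; apply: edecZ => //; exact: edecM.
apply: edecD; first apply: edecB.
- by apply: edecZ; apply: edecB => //; exact: (edec_shift 1 k0 dq).
- by apply: edecB => //; exact: edec_shift.
- by apply: edecB => //; exact: edec_shift.
Qed.

(** The integrated equation expresses [u'] through translates of [u], hence [u''] through translates
    of [u] and [u']; both inherit the exponential decay. *)
Lemma solution_H2 k beta c u m : 0 < k -> c != 0 -> edec k u -> (forall x, int_res beta c u x = 0) ->
  H2 (fun x => m * u x).
Proof.
move=> k0 c0 eu int; have k0' := ltW k0.
have d1 := int_deriv c0 (edec_cont eu) int.
have e1 : edec k (fun x => c^-1 * delay_rhs beta u x) by apply: edecZ; exact: edec_rhs.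
have d2 := derivZ c^-1 (deriv_rhs beta d1).
have e2 : edec k (fun x => c^-1 * rhs1 beta u (fun x => c^-1 * delay_rhs beta u x) x).
  by apply: edecZ; exact: edec_rhs1.
have L f : edec k f -> L2 (fun x => m * f x).
  by move=> ef; have [C dC] := edecZ m ef; exact: L2_dec k0 dC.
exists (fun x => m * (c^-1 * delay_rhs beta u x)),
  (fun x => m * (c^-1 * rhs1 beta u (fun x => c^-1 * delay_rhs beta u x) x)); split.
- exact: L.
- exact: L.
- exact: L.
- by apply: weak_deriv; [exact: derivZ|apply: contZ; exact: edec_cont e1].
- by apply: weak_deriv; [exact: derivZ|apply: contZ; exact: edec_cont e2].
Qed.

Lemma edec_tends k u : 0 < k -> edec k u -> tends u 0 /\ tends (fun x => u (- x)) 0.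
Proof.
move=> k0 [C [cu h]]; split; apply: (@tends_dom _ _ _ k C k0) => x x0; rewrite subr0.
  by have := h x; rewrite (ger0_norm x0).
by have := h (- x); rewrite normrN (ger0_norm x0).
Qed.

(** At the scale [del] this trades an integral of [|a|] for one of [a^2]: a mean square of size
    [del^2] gives a mean of size [del]. *)
Lemma amgm (a del : R) : 0 < del -> `|a| <= (del + a ^+ 2 / del) / 2.
Proof.
move=> d0; have dn : del != 0 by rewrite gt_eqF.
have : 0 <= (`|a| - del) ^+ 2 / del by rewrite divr_ge0 ?sqr_ge0 // ltW.
have -> : (`|a| - del) ^+ 2 / del = `|a| ^+ 2 / del - 2 * `|a| + del by field.
by rewrite -normrX ger0_norm ?sqr_ge0 //; lra.
Qed.

(** Local L^2 closeness is upgraded to uniform closeness by the integrated equation. *)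
Lemma L2_to_sup beta c c0 u u0 M del : 0 < del -> del <= 1 -> 1 <= c -> `|beta| <= 2 -> continuous u -> continuous u0 ->
  bnd M u0 -> (forall x, int_res beta c u x = 0) -> (forall x, int_res beta c0 u0 x = 0) ->
  `|c - c0| <= del -> (forall a, itg (fun x => (u x - u0 x) ^+ 2) a (a + 1) <= del ^+ 2) ->
  bnd ((12 + 9 * M) * del) (fun x => u x - u0 x).
Proof.
move=> d0 d1 c1 b2 cu cu0 bM int int0 cc loc x; have M0 := bnd_ge0 bM.
pose d y := u y - u0 y; have cd : continuous d by exact: contB.
pose s y := d y ^+ 2; have cs : continuous s by exact: contM.
have dn : del != 0 by rewrite gt_eqF.
have dd : del ^+ 2 <= del by rewrite expr2; have := ler_wpM2l (ltW d0) d1; lra.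
have Is a : itg s a (a + 1) <= del ^+ 2 := loc a.
have am a := amgm (d a) d0.
have cz a f : continuous f -> continuous (fun y : R => a * f y) by exact: contZ.
have W1 a : `|itg (fun y => 2 * u y + u y ^+ 2) a (a + 1) - itg (fun y => 2 * u0 y + u0 y ^+ 2) a (a + 1)|
    <= (3 + 2 * M) * del.
  have cq (v : R -> R) : continuous v -> continuous (fun y => 2 * v y + v y ^+ 2).
    by move=> cv; apply: contD; [exact: cz|exact: contM].
  rewrite -(itgB _ _ (cq u cu) (cq u0 cu0)).
  have ct : continuous (fun y => (1 + M) * del + ((1 + M) / del + 1) * s y).
    by apply: contD; [exact: cont_cst|exact: cz].
  apply: le_trans (itg_abs_le (g := fun y => (1 + M) * del + ((1 + M) / del + 1) * s y) _ ct _ _) _.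
  - exact: contB (cq u cu) (cq u0 cu0).
  - by rewrite lerDl.
  - move=> y _.
    have -> : 2 * u y + u y ^+ 2 - (2 * u0 y + u0 y ^+ 2) = 2 * (1 + u0 y) * d y + s y by rewrite /s /d; ring.
    have h : `|2 * (1 + u0 y)| <= 2 * (1 + M).
      by have := bM y; rewrite !ler_norml => /andP[? ?]; apply/andP; split; lra_local.
    apply: le_trans (ler_normD _ _) _; apply: le_trans (lerD (absM h (am y)) (lexx _)) _.
    rewrite (ger0_norm (sqr_ge0 (d y))) -/(s y); apply: leeq; field.
    by [].
  - rewrite (itgD _ _ (@cont_cst R _) (cz _ _ cs)) itg_cst (itgZ _ _ _ cs) (_ : a + 1 - a = 1); last by ring.
    have k0 : 0 <= (1 + M) / del + 1 by rewrite addr_ge0 // divr_ge0 ?addr_ge0 // ltW.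
    have := ler_wpM2l k0 (Is a).
    have -> : ((1 + M) / del + 1) * del ^+ 2 = (1 + M) * del + del ^+ 2 by field.
    by move: dd; lra_local.
have W2 a : `|itg (hop u) a (a + 1) - itg (hop u0) a (a + 1)| <= (3 + 2 * M) * del.
  have ch := cont_hop cu; have ch0 := cont_hop cu0.
  rewrite -(itgB _ _ ch ch0).
  have cp : continuous (fun y => s (y + 1)) by exact: cont_transl1.
  have cm : continuous (fun y => s (y - 1)) by exact: cont_transl1.
  pose B := (1 + M) / (2 * del) + 1 / 2.
  have ct : continuous (fun y => (1 + M) * del + B * (s (y - 1) + s (y + 1))).
    by apply: contD; [exact: cont_cst|apply: cz; exact: contD].
  apply: le_trans (itg_abs_le (g := fun y => (1 + M) * del + B * (s (y - 1) + s (y + 1))) _ ct _ _) _.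
  - exact: contB ch ch0.
  - by rewrite lerDl.
  - move=> y _.
    have -> : hop u y - hop u0 y = (1 + u0 (y + 1)) * d (y - 1) + (1 + u0 (y - 1)) * d (y + 1) + d (y - 1) * d (y + 1).
      by rewrite /hop /d; ring.
    have h z : `|1 + u0 z| <= 1 + M.
      by have := bM z; rewrite !ler_norml => /andP[? ?]; apply/andP; split; lra_local.
    have p1 := absM (h (y + 1)) (am (y - 1)); have p2 := absM (h (y - 1)) (am (y + 1)).
    have p3 : `|d (y - 1) * d (y + 1)| <= (s (y - 1) + s (y + 1)) / 2.
      rewrite normrM; have := sqr_ge0 (`|d (y - 1)| - `|d (y + 1)|).
      have e1 : s (y - 1) = `|d (y - 1)| ^+ 2 by rewrite -normrX ger0_norm ?sqr_ge0.
      have e2 : s (y + 1) = `|d (y + 1)| ^+ 2 by rewrite -normrX ger0_norm ?sqr_ge0.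
      by rewrite e1 e2; move: (`|d (y - 1)|) (`|d (y + 1)|) => p q; rewrite expr2; lra_local.
    apply: le_trans (ler_normD _ _) _.
    apply: le_trans (lerD (le_trans (ler_normD _ _) (lerD p1 p2)) p3) _.
    by apply: leeq; rewrite -/(s (y - 1)) -/(s (y + 1)) /B; field.
  - rewrite (itgD _ _ (@cont_cst R _) (cz _ _ (contD cm cp))) itg_cst (itgZ _ _ _ (contD cm cp)) (itgD _ _ cm cp).
    rewrite (itg_shift 1 _ _ cs) (itg_shift (- 1) _ _ cs) (_ : a + 1 - a = 1); last by ring.
    rewrite (_ : a + 1 + - 1 = a + - 1 + 1); last by ring.
    have B0 : 0 <= B.
      by rewrite /B addr_ge0 // divr_ge0 ?addr_ge0 // mulr_ge0 // ltW.
    have := ler_wpM2l B0 (lerD (Is (a + - 1)) (Is (a + 1))).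
    have -> : B * (del ^+ 2 + del ^+ 2) = (1 + M) * del + del ^+ 2 by rewrite /B; field.
    by move: dd; lra_local.
(* The difference of the two integrated equations, solved for the pointwise difference; the sum of
   the bounds is [M + 2 (3 + 2 M) + 2 (3 + 2 M) = 12 + 9 M] times [del]. *)
have E : c * d x = (c0 - c) * u0 x
   + beta * (itg (fun y => 2 * u y + u y ^+ 2) x (x + 1) - itg (fun y => 2 * u0 y + u0 y ^+ 2) x (x + 1))
   - (itg (hop u) x (x + 1) - itg (hop u0) x (x + 1))
   + (itg (hop u) (x - 1) x - itg (hop u0) (x - 1) x).
  by have := int x; have := int0 x; rewrite /int_res /d; lra_local.
have cc' : `|c0 - c| <= del by rewrite distrC.
have q1 := absM cc' (bM x); have q2 := absM b2 (W1 x).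
have q3 := W2 x; have q4 := W2 (x - 1); rewrite subrK in q4.
have q := le_trans (ler_normD _ _) (lerD (absD3 q1 q2 q3) q4); rewrite -E in q.
have : 1 * `|d x| <= `|c * d x|.
  by rewrite normrM; apply: ler_wpM2r (normr_ge0 _) _ _ _; exact: le_trans c1 (ler_norm c).
by rewrite -/(d x); move: q; have := mulr_ge0 M0 (ltW d0); lra_local.
Qed.

End Regularity.

(** * The wave *)

Section Wave.
Context {R : realType}.
Implicit Types (f g u q Q : R -> R) (x xi e m beta c C del : R).

(** All that the theorem uses about the wave of parameter [e], for [Q = m (1 + u)] and speed [m c],
    so that the scale [m] enters only at the end. *)
Definition wave C e c u := let beta := 2 - 20 / 7 * e ^+ 2 in
  [/\ edec e u /\ (forall x, int_res beta c u x = 0),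
      (forall x, 0 < u x) /\ bnd 1 u,
      2 <= c /\ 2 * beta < c,
      (forall x, `|u x - 2 * e ^+ 2 * sq (e * x)| <= C * e ^+ 3) /\ `|c - (4 - 64 / 21 * e ^+ 2)| <= C * e ^+ 3 &
      exists2 del : R, 0 < del & forall v (dv : R -> R) c1, deriv v dv ->
        (forall x, int_res beta c1 v x = 0) -> `|c1 - c| <= del -> bnd del (fun x => v x - u x) ->
        c1 = c /\ exists tau, forall x, v x = u (x + tau)].

Lemma wave_exists : exists C e0 : R, [/\ 0 < C, 0 < e0, e0 <= 1 &
  forall e, 0 < e -> e <= e0 -> exists c u, wave C e c u].
Proof.
have [C [e0 [C0 e00 e01 H]]] := @soliton_props R.
have C2 : 0 <= 2 * C by lra_local.
have [e2 e20 He2] := small_scale C2.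
have C6 : 0 < 6 * C by lra_local.
have CC : C <= 6 * C by lra_local.
exists (6 * C), (Num.min e0 e2); split; [exact: C6|by rewrite lt_min e00| |].
  by rewrite ge_min; apply/orP; left; lra_local.
move=> e ep; rewrite le_min => /andP[ee0 ee2]; have eC := He2 e ep ee2.
have e1 := le_trans ee0 e01.
have [s [P [P1 [P2 [[prof [z1 P20]] [sC hs] PB near uniq]]]]] := H e ep ee0.
have {H He2 e20 ee2 C2 CC C6} _ := tt.
have en : e != 0 by rewrite gt_eqF.
have ee : 0 < e ^+ 2 by exact: exprn_gt0.
have e21 : e ^+ 2 <= 1 / 1000 by rewrite expr2; have := ler_pM (ltW ep) (ltW ep) e1 e1; clear; lra.
have [dP dP1 buP2 eqn] := prof.
have C0' := ltW C0.
have ex1 x : expR (- `|x : R|) <= 1 by rewrite expR_le1 oppr_le0.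
have bd (f : R -> R) x : `|f x| <= C * expR (- `|x|) -> `|f x| <= C.
  by move=> h; apply: le_trans h _; have := ler_wpM2l C0' (ex1 x); rewrite mulr1.
have bP : bnd C P by move=> x; apply: bd; have [] := PB x.
have bP1 : bnd C P1 by move=> x; apply: bd; have [] := PB x.
have bP2 : bnd C P2 by move=> x; apply: bd; have [] := PB x.
pose U x := P x - e ^+ 2 / 2 * P2 x.
have buU : bu U.
  apply: buB; last exact: buZ.
  by split; [exact: deriv_ucont dP bP1|exists C].
have UB x : `|U x| <= 2 * C * expR (- `|x|).
  have [a _ c] := PB x.
  have h : `|e ^+ 2 / 2| <= 1 by rewrite ger0_norm; move: ee e21; clear; lra.
  apply: le_trans (ler_normB _ _) _; apply: le_trans (lerD a (absM h c)) _.
  by apply: leeq; ring.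
pose u x := e ^+ 2 * U (e * x).
pose c := 4 + e ^+ 2 * (gam s - 40 / 7).
have g0 : 0 < gam s by have /andP[? ?] := hs; rewrite /gam mulr_gt0 // exprn_gt0; lra_local.
have eg : 0 < e ^+ 2 * gam s by exact: mulr_gt0.
have int x : int_res (2 - 20 / 7 * e ^+ 2) c u x = 0.
  have cP2 := bu_cont buP2.
  have /(profile_Mop (gam s) (e * x) en dP dP1 cP2) h := eqn (e * x).
  by rewrite (int_scaled e (gam s) x (bu_cont buU)) h mulr0.
exists c, u; split.
- split; last exact: int.
  exists (e ^+ 2 * (2 * C)); split.
    apply: contZ; rewrite (_ : (fun x => _) = (fun x => U (0 + e * x))); first exact: cont_aff (bu_cont buU).
    by apply/funext => x; rewrite add0r.
  move=> x; rewrite /u normrM (gtr0_norm ee) -mulrA; apply: ler_wpM2l (ltW ee) _ _ _.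
  by apply: le_trans (UB _) _; rewrite normrM (gtr0_norm ep).
- split=> x; first by rewrite /u mulr_gt0 //; have [] := near (e * x).
  rewrite /u normrM (gtr0_norm ee).
  have h1 : e * (2 * C) <= 1 := eC.
  have h2 : `|U (e * x)| <= 2 * C.
    by apply: le_trans (UB _) _; have := ler_wpM2l (ltW C0) (ex1 (e * x)); clear; lra.
  apply: le_trans (ler_wpM2l (ltW ee) h2) _.
  have h3 : e * (e * (2 * C)) <= e * 1 := ler_wpM2l (ltW ep) h1.
  by rewrite expr2 -mulrA; apply: le_trans h3 _; move: e1; clear; lra.
(* [c - 2 beta] is exactly [e^2 * gam s], since the two terms [40/7 e^2] cancel. *)
- by rewrite /c; split; move: eg e21; clear; lra.
- split=> [x|].
    have [h _] := near (e * x).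
    have -> : u x - 2 * e ^+ 2 * sq (e * x) = e ^+ 2 * (P (e * x) - e ^+ 2 / 2 * P2 (e * x) - 2 * sq (e * x)).
      by rewrite /u /U; ring.
    rewrite normrM (gtr0_norm ee); apply: le_trans (ler_wpM2l (ltW ee) h) _.
    have -> : 6 * C * e ^+ 3 = 6 * (e ^+ 2 * (C * e)) by ring.
    by have := mulr_ge0 (ltW ee) (mulr_ge0 (ltW C0) (ltW ep)); clear; lra.
  have -> : c - (4 - 64 / 21 * e ^+ 2) = e ^+ 2 * (8 / 3 * (s + 1) * (s - 1)) by rewrite /c /gam; field.
  rewrite normrM (gtr0_norm ee).
  have h : `|8 / 3 * (s + 1)| <= 6 by have /andP[a b] := hs; rewrite ger0_norm; move: a b; clear; lra.
  apply: le_trans (ler_wpM2l (ltW ee) (absM h sC)) _.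
  by apply: leeq; ring.
- have [r r0 Hr] := uniq.
  exact: (sup_unique ep e1 hs prof z1 P20 bP bP1 bP2 r0 Hr).
Qed.

End Wave.

(** * Limits at infinity *)

Section Limits.
Context {R : realType}.
Implicit Types (Q u : R -> R) (m x : R).

Lemma cvg_of_tends Q m : tends Q m -> tends (fun x => Q (- x)) m -> limit_at_infinity Q m.
Proof.
move=> h h'; split; apply/cvgrPdist_le => e e0.
- have [X HX] := h e e0; near=> x; rewrite distrC; apply: HX; near: x; exact: nbhs_pinfty_ge (num_real X).
- have [X HX] := h' e e0; near=> x; rewrite distrC -[x]opprK; apply: HX; rewrite lerNr.
  by near: x; exact: nbhs_ninfty_le (num_real _).
Unshelve. all: by end_near. Qed.

Lemma tends_of_cvg Q m : limit_at_infinity Q m -> tends Q m.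
Proof.
move=> [/cvgrPdist_le h _] e e0; have [X [_ HX]] := h e e0.
exists (X + 1) => x Xx; rewrite distrC; apply: HX; lra.
Qed.

Lemma sqrt_cube (d : R) : 0 <= d -> Num.sqrt d ^+ 3 = d `^ (3 / 2).
Proof.
move=> d0; have -> : (3 / 2 : R) = 2^-1 * 3%:R by field.
by rewrite powRrM powR12_sqrt // powR_mulrn // sqrtr_ge0.
Qed.

End Limits.

(** * Local uniqueness in H^2 and the homoclinic property *)

Section Uniqueness.
Context {R : realType}.
Implicit Types (Q u : R -> R) (m c x : R).

Lemma L2norm_H2_ball u del v : H2_ball u del v -> L2 (v \- u) /\ L2norm (v \- u) < del.
Proof.
move=> [w1 [w2 [[L _ _ _ _] h]]]; split=> //; apply: le_lt_trans h.
have n0 : 0 <= L2norm (v \- u) by apply: fine_ge0; exact: Lnorm_ge0.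
rewrite -[leLHS](ger0_norm n0) -sqrtr_sqr; apply: ler_wsqrtr.
have := sqr_ge0 (L2norm w1); have := sqr_ge0 (L2norm w2); clear; lra.
Qed.

(** [sol] is a parameter so that the delay equation and the lattice equation are treated at once;
    near the positive speed [m c] the competing speed is nonzero, where either one gives the delay
    equation. *)
Lemma wave_unique C e m c u (sol : (R -> R) -> R -> Prop) : let beta := 2 - 20 / 7 * e ^+ 2 in
  0 < m -> 0 < e -> e <= 1 -> wave C e c u ->
  (forall Q c', c' != 0 -> sol Q c' -> delay_solution beta Q c') ->
  locally_unique sol m (fun x => m * (1 + u x)) (m * c).
Proof.
move=> beta m0 e0 e1 [[eu int] [u0 b1] [c2 _] _ [del del0 uniq]] Hsol.
have mn : m != 0 by rewrite gt_eqF.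
have cn : c != 0 by rewrite gt_eqF //; apply: lt_le_trans c2; rewrite ltr0n.
have cu := edec_cont eu.
have Eq : (fun x => m * (1 + u x) - m) = (fun x => m * u x) by apply/funext => x; ring.
split; first by rewrite Eq; exact: solution_H2 e0 cn eu int.
(* The 21 is the constant [12 + 9 M] of [L2_to_sup] for a wave bounded by [M = 1]. *)
pose d := Num.min 1 (del / 21).
have d0 : 0 < d by rewrite lt_min ltr01 /= divr_gt0.
have d1 : d <= 1 by rewrite ge_min lexx.
have dd : d <= del / 21 by rewrite ge_min lexx orbT.
exists (m * d); first exact: mulr_gt0.
move=> Q c' _ ball hc hs lim; rewrite Eq in ball.
pose v x := m^-1 * Q x - 1.
have EQ : Q = (fun x => m * (1 + v x)) by apply/funext => x; rewrite /v; field.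
have hc1 : `|m^-1 * c' - c| < d.
  have -> : m^-1 * c' - c = m^-1 * (c' - m * c) by field.
  by rewrite normrM gtr0_norm ?invr_gt0 // ltr_pdivrMl.
have c1 : 1 <= m^-1 * c' by move: hc1; rewrite ltr_norml => /andP[a _]; move: a d1 c2; clear; lra.
have Ec : c' = m * (m^-1 * c') by rewrite mulVKf.
have cn' : c' != 0.
  by apply/eqP => z; move: c1; rewrite z mulr0; clear; lra.
have ds := Hsol _ _ cn' hs.
have dv : deriv v (fun x => m^-1 * derive1 Q x).
  apply: deriv_eq (derivB (derivZ m^-1 (derivable_deriv ds.1)) (deriv_cst 1)) _ => x.
  by rewrite subr0.
have tv : tends v 0.
  have := tendsB (tendsZ m^-1 (tends_of_cvg lim)) (tends_cst 1).
  by rewrite mulVf // subrr.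
have cv := deriv_cont dv.
have intv : forall x, int_res beta (m^-1 * c') v x = 0.
  apply: (delay_int mn) tv; first by move=> x; have := dv x => ?; exact: ex_derive.
  by rewrite -EQ -Ec.
have [L Ln] := L2norm_H2_ball ball.
have b2 : `|beta| <= 2.
  have e2 : e ^+ 2 <= 1 by rewrite expr_le1 // ltW.
  have := sqr_ge0 e; rewrite ler_norml /beta => h; move: h e2; clear; lra.
have En : (fun x => Q x - m) \- (fun x => m * u x) = (fun x => m * (v x - u x)).
  by apply/funext => x /=; rewrite /v; field.
rewrite En in L Ln.
have loc a : itg (fun x => (v x - u x) ^+ 2) a (a + 1) <= d ^+ 2.
  have cw : continuous (fun x => m * (v x - u x)) by apply: (@contZ _ m _ (contB cv cu)).
  have aa : a < a + 1 by rewrite ltrDl ltr01.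
  have h := L2_local cw aa L.
  have n0 : 0 <= L2norm (fun x => m * (v x - u x)) by apply: fine_ge0; exact: Lnorm_ge0.
  have cd2 : continuous (fun x => (v x - u x) ^+ 2) by apply: contM; exact: contB.
  have m2 : 0 < m ^+ 2 by exact: exprn_gt0.
  rewrite -(ler_pM2l m2) -itgZ // -exprMn.
  have -> : (fun x => m ^+ 2 * (v x - u x) ^+ 2) = (fun x => (m * (v x - u x)) ^+ 2).
    by apply/funext => x; rewrite exprMn.
  by apply: le_trans h _; apply: lerXn2r; rewrite ?nnegrE // ltW // mulr_gt0.
have bd := L2_to_sup d0 d1 c1 b2 cv cu b1 intv int (ltW hc1) loc.
have cl : `|m^-1 * c' - c| <= del.
  by apply: le_trans (ltW hc1) _; move: dd del0; clear; lra.
have bl : bnd del (fun x => v x - u x).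
  by move=> x; apply: le_trans (bd x) _; move: dd; clear; lra.
have [E1 [tau E2]] := uniq v _ _ dv intv cl bl.
split; first by rewrite -E1.
by exists tau => x; rewrite -E2 EQ.
Qed.

Lemma wave_homoclinic C e m c u : let beta := 2 - 20 / 7 * e ^+ 2 in
  0 < m -> 0 < e -> wave C e c u -> homoclinic_solution beta m (fun x => m * (1 + u x)) (m * c).
Proof.
move=> beta m0 e0 [[eu int] [u0 b1] [c2 _] _ _].
have mn : m != 0 by rewrite gt_eqF.
have cn : c != 0 by rewrite gt_eqF //; apply: lt_le_trans c2; rewrite ltr0n.
have [t t'] := edec_tends e0 eu.
have lim g : tends g 0 -> tends (fun x => m * (1 + g x)) m.
  move=> h; have := tendsZ m (tendsD (tends_cst 1) h).
  by rewrite addr0 mulr1.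
split.
- apply/(delayE _ _ mn (int_deriv cn (edec_cont eu) int)) => x.
  by rewrite mulrA divff // mul1r.
- have h0 : 0 < u 0 / 2 by rewrite divr_gt0 // ltr0n.
  have [X HX] := t _ h0; exists X, 0; apply/eqP => /(mulfI mn) /addrI E.
  have := HX X (lexx X); rewrite subr0 E gtr0_norm //.
  by move: (u0 0); clear; lra.
- exact: cvg_of_tends (lim _ t) (lim _ t').
Qed.

End Uniqueness.

Theorem theorem1 (R : realType) (m : R) (hm : 0 < m) :
  exists2 beta_star : R, 0 < beta_star &
  exists (c : R -> R) (q : R -> R -> R),
    (forall beta : R, 2 - beta_star < beta < 2 ->
      [/\ homoclinic_solution beta m (q beta) (c beta)
          /\ locally_unique (delay_solution beta) m (q beta) (c beta),
          lattice_solution beta (traveling_wave (q beta) (c beta))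
          /\ locally_unique
               (fun Q c' => lattice_solution beta (traveling_wave Q c'))
               m (q beta) (c beta),
          forall xi : R, m < q beta xi
        & 2 * m * beta < c beta])
    /\ (exists K : R, \forall beta \near (2 : R)^'-, forall xi : R,
          `|q beta xi
            - m * (1 + 7 * (2 - beta) / 10
                       * sech (Num.sqrt (7 * (2 - beta) / 20) * xi) ^+ 2)|
          <= K * (2 - beta) `^ (3 / 2))
    /\ (exists K : R, \forall beta \near (2 : R)^'-,
          `|c beta - m * (4 - 16 / 15 * (2 - beta))|
          <= K * (2 - beta) `^ (3 / 2)).
Proof.
have [C [e0 [C0 e00 e01 W]]] := @wave_exists R.
pose bs := 20 / 7 * e0 ^+ 2.
have bs0 : 0 < bs by have := exprn_gt0 2 e00; rewrite /bs; clear; lra.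
have [f Hf] : exists f : R -> R * (R -> R), forall e, 0 < e -> e <= e0 -> wave C e (f e).1 (f e).2.
  have H (e : R) : exists p : R * (R -> R), 0 < e -> e <= e0 -> wave C e p.1 p.2.
    have [/andP[a b]|h] := boolP ((0 < e) && (e <= e0)).
      by have [c [u h]] := W e a b; exists (c, u).
    by exists (0, fun=> 0) => a b; rewrite a b in h.
  by have [f Hf] := choice H; exists f.
(* The solution of [beta = 2 - 20/7 e^2]; consequently [2 e^2 = 7 (2 - beta) / 10] and
   [64/21 e^2 = 16/15 (2 - beta)]. *)
pose ep (beta : R) := Num.sqrt (7 * (2 - beta) / 20).
have ep2 beta : beta < 2 -> ep beta ^+ 2 = 7 * (2 - beta) / 20.
  by move=> b; rewrite sqr_sqrtr //; move: b; clear; lra.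
have epp beta : beta < 2 -> 0 < ep beta by move=> b; rewrite sqrtr_gt0; move: b; clear; lra.
have epe beta : beta < 2 -> 2 - 20 / 7 * ep beta ^+ 2 = beta by move=> b; rewrite ep2 //; field.
have epl beta : beta < 2 -> 2 - bs < beta -> ep beta <= e0.
  move=> b b'; rewrite -(@ler_pXn2r _ 2) // ?nnegrE; [|exact: ltW (epp _ b)|exact: ltW e00].
  by rewrite ep2 //; move: b'; rewrite /bs; clear; lra.
(* The cube of [e] is below the required power because 7/20 is at most 1. *)
have ep3 beta : beta < 2 -> ep beta ^+ 3 <= (2 - beta) `^ (3 / 2).
  move=> b; have d0 : 0 <= 2 - beta by move: b; clear; lra.
  rewrite -sqrt_cube //; apply: lerXn2r; rewrite ?nnegrE ?sqrtr_ge0 //.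
  by apply: ler_wsqrtr; move: d0; clear; lra.
have wv beta : beta < 2 -> 2 - bs < beta -> wave C (ep beta) (f (ep beta)).1 (f (ep beta)).2.
  by move=> b b'; apply: Hf; [exact: epp|exact: epl].
have mC : 0 <= m * C by rewrite mulr_ge0 // ltW.
exists bs => //; exists (fun beta => m * (f (ep beta)).1), (fun beta x => m * (1 + (f (ep beta)).2 x)).
split; last split.
- move=> beta /andP[b' b]; have w := wv _ b b'; have p := epp _ b; have E := epe _ b.
  have p1 := le_trans (epl _ b b') e01.
  have hom := wave_homoclinic hm p w; rewrite E in hom.
  have [_ [u0 _] [c2 c2b] _ _] := w; rewrite E in c2b.
  have cn : m * (f (ep beta)).1 != 0.
    by rewrite gt_eqF // mulr_gt0 //; apply: lt_le_trans c2; rewrite ltr0n.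
  have un := wave_unique hm p p1 w; rewrite /= E in un.
  split; [split|split| |].
  + exact: hom.
  + by apply: un.
  + by apply/(lattice_delay _ _ cn); case: hom.
  + by apply: un => Q c' c0 /(lattice_delay _ _ c0).
  + by move=> xi; rewrite ltr_pMr // ltrDl.
  + by rewrite (mulrC 2) -mulrA ltr_pM2l.
- exists (m * C); near=> beta => xi.
  have b : beta < 2 by near: beta; exact: nbhs_left_lt.
  have b' : 2 - bs < beta by near: beta; apply: nbhs_left_gt; rewrite ltrBlDr ltrDl.
  have [_ _ _ [h _] _] := wv _ b b'.
  rewrite -/(ep beta).
  have -> : m * (1 + (f (ep beta)).2 xi) - m * (1 + 7 * (2 - beta) / 10 * sech (ep beta * xi) ^+ 2)
      = m * ((f (ep beta)).2 xi - 2 * ep beta ^+ 2 * sq (ep beta * xi)).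
    by rewrite ep2 // /sq; field.
  rewrite normrM gtr0_norm //; apply: le_trans (ler_wpM2l (ltW hm) (h xi)) _.
  by rewrite mulrA; exact: ler_wpM2l mC _ _ (ep3 _ b).
- exists (m * C); near=> beta.
  have b : beta < 2 by near: beta; exact: nbhs_left_lt.
  have b' : 2 - bs < beta by near: beta; apply: nbhs_left_gt; rewrite ltrBlDr ltrDl.
  have [_ _ _ [_ h] _] := wv _ b b'.
  have -> : m * (f (ep beta)).1 - m * (4 - 16 / 15 * (2 - beta))
      = m * ((f (ep beta)).1 - (4 - 64 / 21 * ep beta ^+ 2)).
    by rewrite ep2 //; field.
  rewrite normrM gtr0_norm //; apply: le_trans (ler_wpM2l (ltW hm) h) _.
  by rewrite mulrA; exact: ler_wpM2l mC _ _ (ep3 _ b).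
Unshelve. all: by end_near. Qed.
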